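(* Let $\lambda\in\mathbb{R}$, $\lambda\neq0$. The planar vector field $$X_p=\left(-\tfrac13x^2-y^2+\lambda x^3,\ \tfrac23xy\right)$$ is precisely $C^{1+1/3}$-regularisable (at the origin): its block map is of class $C^{4/3}$ and not of class $C^{\alpha}$ for any non-integer $\alpha>4/3$.
   Context: Regularisability: let $\varphi$ be the flow of $X_p$ and $I$ the origin. For a compact smooth 2-dimensional submanifold with boundary $N$, $n=\partial N$, put $n^+=\{p\in n:\exists t>0,\varphi(p,(-t,0))\cap N=\emptyset\}$, $n^-=\{p\in n:\exists t>0,\varphi(p,(0,t))\cap N=\emptyset\}$, $\tau=\{p\in n: X_p\text{ tangent to }n\text{ at }p\}$, $a^+=\{p\in n^+:\varphi(p,t)\in N\ \forall t\ge0\}$, $a^-=\{p\in n^-:\varphi(p,t)\in N\ \forall t\le0\}$. $N$ is an isolating block for $I$ if $I$ is the maximal invariant set in $N$, $n^+\cap n^-=\tau$ and $\tau$ is a smooth codimension-one submanifold of $n$. Let $\pi:n^+\setminus a^+\to n^-\setminus a^-$ send $p$ to the exit point of its forward orbit from $N$. The vector field is $C^k$-regularisable if $\pi$ has a unique $C^k$ extension $\overline\pi:n^+\to n^-$ (the block map), and similarly for the classes below. With exactly one ingoing and one outgoing asymptotic orbit at the origin (orbits tending to the origin in forward, resp. backward, time), the differentiability of $\overline\pi$ is studied as the germ, at the point of the ingoing asymptotic orbit, of the transition map from a smooth section transverse to the ingoing asymptotic orbit to a smooth section transverse to the outgoing one (extended by sending the point of the ingoing orbit to that of the outgoing orbit);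 the result does not depend on the choice of sections. Classes: $f\in C^{0,\alpha}$, $\alpha\in[0,1]$, if (locally) $|f(x)-f(y)|\le C|x-y|^\alpha$ for some constant $C$; $f\in C^{k,\alpha}$ if $f^{(k)}\in C^{0,\alpha}$; $C^\alpha:=C^{\lfloor\alpha\rfloor,\alpha-\lfloor\alpha\rfloor}$ for $\alpha\in\mathbb{R}\setminus\mathbb{N}$. *)

(* Defs.v *)
From Stdlib Require Import Reals ZArith List.
From Coquelicot Require Import Coquelicot.
Open Scope R_scope.

Definition plane : Type := (R * R)%type.
Definition origin : plane := (0, 0).

Definition Xp (lam : R) (p : plane) : plane :=
  let (x, y) := p in
  (- (1 / 3) * x ^ 2 - y ^ 2 + lam * x ^ 3, 2 / 3 * x * y).

Definition solves_at (X : plane -> plane) (u : R -> plane) (t : R) : Prop :=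
  is_derive (fun s => fst (u s)) t (fst (X (u t))) /\
  is_derive (fun s => snd (u s)) t (snd (X (u t))).

(* The graph of the local flow: "phi (p, t) is defined and equals q".  The
   flow need not be complete, so it is kept as a relation.  Derivatives are
   two-sided at the end points as well: maximal solutions have open domains. *)
Definition flow (X : plane -> plane) (p : plane) (t : R) (q : plane) : Prop :=
  exists u : R -> plane,
    u 0 = p /\ u t = q /\
    forall s, Rmin 0 t <= s <= Rmax 0 t -> solves_at X u s.

Definition invariant (X : plane -> plane) (S : plane -> Prop) : Prop :=
  forall p, S p -> forall t, exists q, flow X p t q /\ S q.

Definition maximal_invariant_in
    (X : plane -> plane) (N I : plane -> Prop) : Prop :=
  (forall p, I p -> N p) /\ invariant X I /\
  forall S : plane -> Prop,
    (forall p, S p -> N p) -> invariant X S -> forall p, S p -> I p.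

Definition compact_set (N : plane -> Prop) : Prop :=
  forall F : (plane -> Prop) -> Prop,
    (forall U, F U -> open U) ->
    (forall p, N p -> exists U, F U /\ U p) ->
    exists l : list (plane -> Prop),
      (forall U, In U l -> F U) /\
      forall p, N p -> exists U, In U l /\ U p.

Definition smooth_at (f : R -> R) (x : R) : Prop :=
  locally x (fun y => forall k : nat, ex_derive_n f k y).

Definition flip (b : bool) (p : plane) : plane :=
  if b then (snd p, fst p) else p.

(* Near p, up to exchanging the coordinates, N is the set of points lying on
   one side (chosen by the sign of e) of the graph of a smooth function h. *)
Definition smooth_boundary_at (N : plane -> Prop) (p : plane) : Prop :=
  exists (b : bool) (h : R -> R) (e : R),
    e <> 0 /\
    smooth_at h (fst (flip b p)) /\
    snd (flip b p) = h (fst (flip b p)) /\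
    locally p (fun q : plane =>
      N q <-> e * (snd (flip b q) - h (fst (flip b q))) <= 0).

Definition smooth_domain (N : plane -> Prop) : Prop :=
  compact_set N /\
  forall p, N p -> locally p N \/ smooth_boundary_at N p.

(* In codimension zero the manifold boundary is N minus its interior. *)
Definition bd (N : plane -> Prop) (p : plane) : Prop :=
  N p /\ ~ locally p N.

Definition smooth_curve_in
    (n : plane -> Prop) (p : plane) (c : R -> plane) : Prop :=
  c 0 = p /\
  smooth_at (fun s => fst (c s)) 0 /\
  smooth_at (fun s => snd (c s)) 0 /\
  locally 0 (fun s => n (c s)).

Definition velocity0 (c : R -> plane) : plane :=
  (Derive (fun s => fst (c s)) 0, Derive (fun s => snd (c s)) 0).

Definition tangent_to (n : plane -> Prop) (p v : plane) : Prop :=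
  exists c : R -> plane, smooth_curve_in n p c /\ velocity0 c = v.

(* A regular smooth curve in a 1-manifold n is a local parametrisation. *)
Definition local_param
    (n : plane -> Prop) (p : plane) (c : R -> plane) : Prop :=
  smooth_curve_in n p c /\ velocity0 c <> (0, 0).

Definition nplus (X : plane -> plane) (N : plane -> Prop) (p : plane) : Prop :=
  bd N p /\
  exists t, 0 < t /\ forall s q, - t < s < 0 -> flow X p s q -> ~ N q.

Definition nminus (X : plane -> plane) (N : plane -> Prop) (p : plane) : Prop :=
  bd N p /\
  exists t, 0 < t /\ forall s q, 0 < s < t -> flow X p s q -> ~ N q.

Definition tau (X : plane -> plane) (N : plane -> Prop) (p : plane) : Prop :=
  bd N p /\ tangent_to (bd N) p (X p).

Definition aplus (X : plane -> plane) (N : plane -> Prop) (p : plane) : Prop :=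
  nplus X N p /\ forall t, 0 <= t -> exists q, flow X p t q /\ N q.

(* A codimension-one submanifold of the 1-manifold bd N is a 0-dimensional
   one, that is, a set all of whose points are isolated. *)
Definition zero_dim_submanifold (T : plane -> Prop) : Prop :=
  forall p, T p -> locally p (fun q : plane => T q -> q = p).

Definition isolating_block
    (X : plane -> plane) (I N : plane -> Prop) : Prop :=
  smooth_domain N /\
  maximal_invariant_in X N I /\
  (forall p, nplus X N p /\ nminus X N p <-> tau X N p) /\
  zero_dim_submanifold (tau X N).

(* q is the exit point from N of the forward orbit of p: the orbit is at q at
   the last time t up to which it has stayed in N. *)
Definition exit_point
    (X : plane -> plane) (N : plane -> Prop) (p q : plane) : Prop :=
  exists t, 0 <= t /\ flow X p t q /\
    (forall s r, 0 <= s <= t -> flow X p s r -> N r) /\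
    forall e, 0 < e -> exists s r, t < s < t + e /\ flow X p s r /\ ~ N r.

(* g restricts to a map n^+ -> n^- extending pi : n^+ \ a^+ -> n^- \ a^-;
   its values outside n^+ are irrelevant. *)
Definition extends_pi
    (X : plane -> plane) (N : plane -> Prop) (g : plane -> plane) : Prop :=
  (forall p, nplus X N p -> nminus X N (g p)) /\
  forall p, nplus X N p -> ~ aplus X N p -> exit_point X N p (g p).

(* Germ at x0 of the class C^{k,b}.  Derivatives of all orders j <= k are
   required because [ex_derive_n f k] says nothing about lower orders.
   [Rpower 0 b = 1] is harmless: for y = z the left-hand side is 0. *)
Definition C_holder (k : nat) (b : R) (f : R -> R) (x0 : R) : Prop :=
  exists eps C : R, 0 < eps /\
    (forall (j : nat) y, (j <= k)%nat -> Rabs (y - x0) < eps ->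
       ex_derive_n f j y) /\
    forall y z, Rabs (y - x0) < eps -> Rabs (z - x0) < eps ->
      Rabs (Derive_n f k y - Derive_n f k z) <= C * Rpower (Rabs (y - z)) b.

(* C^a for non-integer a > 0; [Int_part] and [frac_part] are the floor and
   the fractional part. *)
Definition C_class (a : R) (f : R -> R) (x0 : R) : Prop :=
  C_holder (Z.to_nat (Int_part a)) (frac_part a) f x0.

(* The germ of g along n^+ at the points of a^+ is of class C^a, read in a
   smooth local parametrisation of the source; the target n^- is an embedded
   submanifold, so the map is tested componentwise in the plane. *)
Definition class_at_aplus
    (X : plane -> plane) (N : plane -> Prop) (a : R) (g : plane -> plane)
    : Prop :=
  forall p c, aplus X N p -> local_param (bd N) p c ->
    C_class a (fun s => fst (g (c s))) 0 /\
    C_class a (fun s => snd (g (c s))) 0.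

(* g is the unique (as a map on n^+) extension of pi of class C^a. *)
Definition is_block_map
    (X : plane -> plane) (N : plane -> Prop) (a : R) (g : plane -> plane)
    : Prop :=
  extends_pi X N g /\ class_at_aplus X N a g /\
  forall g', extends_pi X N g' -> class_at_aplus X N a g' ->
    forall p, nplus X N p -> g' p = g p.

(* Main.v *)
Require Import Defs.
From Stdlib Require Import Reals Lra Lia ClassicalEpsilon List ZArith.
From Coquelicot Require Import Coquelicot.
Open Scope R_scope.

(* Off the x-axis, where [x' < 0] near the origin, the orbits are graphs [y = Y x] over the
   x-axis.  For [lam = 0] the function [y (x^2 + y^2)] is a first integral; for general [lam]
   it is still comparable along an orbit, so an orbit entering at distance [s] from the x-axis
   crosses the line [x = 0] at a height [a = Y 0] with [|a|^3] of the order of [|s|].  Solving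
   the linearised equation along [Y] explicitly, the derivative at [s] of the map to the exit
   point is a Lipschitz function of the end points times [exp (-3 lam E)], where
   [E = int Y^2 / ((1/3 - lam x) |x'|) dx] is taken over the orbit.  The integrand is
   concentrated on [|x| <= |a|], where it has size 1, so [E] is of the order of
   [|a| ~ |s|^(1/3)]; it is 1/3-Hoelder in [s] and no better, which gives [C^(4/3)] precisely
   when [lam <> 0].  In an arbitrary isolating block the only asymptotic points on the boundary
   are the two ends of the x-axis, where the field is transverse to the boundary; a small disc
   is an isolating block. *)

(** * Calculus on the line *)

Ltac derive_rw h :=
  match type of h with is_derive ?f ?x ?l =>
    repeat match goal with |- context [Derive ?g x] =>
      replace (Derive g x) with l by (symmetry; exact (is_derive_unique _ _ _ h)) end end.

Ltac side_derive :=
  repeat match goal with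
  | |- _ /\ _ => split
  | |- True => exact I
  | |- ex_derive _ _ => eexists; eassumption
  end.

Lemma is_derive_cont (f : R -> R) (x l : R) : is_derive f x l -> continuous f x.
Proof. intros H. apply (@ex_derive_continuous R_AbsRing R_NormedModule). now exists l. Qed.

Lemma is_derive_cont_pt (f : R -> R) (x l : R) : is_derive f x l -> continuity_pt f x.
Proof.
  intros H. apply continuity_pt_filterlim. exact (is_derive_cont _ _ _ H).
Qed.

Lemma MVT_le (f df : R -> R) (a b : R) : a <= b ->
  (forall x, a <= x <= b -> is_derive f x (df x)) ->
  exists c, a <= c <= b /\ f b - f a = df c * (b - a).
Proof.
  intros Hab Hd.
  destruct (MVT_gen f a b df) as [c [Hc E]].
  - rewrite Rmin_left, Rmax_right by lra. intros x Hx. apply Hd. lra.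
  - rewrite Rmin_left, Rmax_right by lra. intros x Hx.
    apply (is_derive_cont_pt _ _ (df x)). now apply Hd.
  - rewrite Rmin_left, Rmax_right in Hc by lra. now exists c.
Qed.

Lemma MVT_any (f df : R -> R) (a b : R) :
  (forall x, Rmin a b <= x <= Rmax a b -> is_derive f x (df x)) ->
  exists c, Rmin a b <= c <= Rmax a b /\ f b - f a = df c * (b - a).
Proof.
  intros Hd.
  destruct (MVT_gen f a b df) as [c [Hc E]].
  - intros x Hx. apply Hd. lra.
  - intros x Hx. apply (is_derive_cont_pt _ _ (df x)). now apply Hd.
  - now exists c.
Qed.

Lemma deriv_nonneg_le (f df : R -> R) (a b : R) : a <= b ->
  (forall x, a <= x <= b -> is_derive f x (df x) /\ 0 <= df x) -> f a <= f b.
Proof.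
  intros Hab H. destruct (MVT_le f df a b Hab) as [c [Hc E]].
  - intros x Hx. now apply H.
  - assert (0 <= df c) by now apply H. nra.
Qed.

Lemma deriv_pos_lt (f df : R -> R) (a b : R) : a < b ->
  (forall x, a <= x <= b -> is_derive f x (df x) /\ 0 < df x) -> f a < f b.
Proof.
  intros Hab H. destruct (MVT_le f df a b) as [c [Hc E]]; [lra| |].
  - intros x Hx. now apply H.
  - assert (0 < df c) by now apply H. nra.
Qed.

Lemma deriv_compare (f df g dg : R -> R) (a b : R) : a <= b ->
  (forall x, a <= x <= b ->
     is_derive f x (df x) /\ is_derive g x (dg x) /\ Rabs (df x) <= dg x) ->
  Rabs (f b - f a) <= g b - g a.
Proof.
  intros Hab H.
  assert (Hm : g a - f a <= g b - f b).
  { apply (deriv_nonneg_le (fun x => g x - f x) (fun x => dg x - df x)); [lra|].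
    intros x Hx. destruct (H x Hx) as [h1 [h2 h3]]. split.
    - exact (is_derive_minus _ _ _ _ _ h2 h1).
    - generalize (Rle_abs (df x)); lra. }
  assert (Hp : g a + f a <= g b + f b).
  { apply (deriv_nonneg_le (fun x => g x + f x) (fun x => dg x + df x)); [lra|].
    intros x Hx. destruct (H x Hx) as [h1 [h2 h3]]. split.
    - exact (is_derive_plus _ _ _ _ _ h2 h1).
    - generalize (Rle_abs (- df x)); rewrite Rabs_Ropp; lra. }
  apply Rabs_le; lra.
Qed.

Lemma deriv_lip (f df : R -> R) (M a b : R) :
  (forall x, Rmin a b <= x <= Rmax a b -> is_derive f x (df x) /\ Rabs (df x) <= M) ->
  Rabs (f b - f a) <= M * Rabs (b - a).
Proof.
  intros H. destruct (MVT_any f df a b) as [c [Hc E]].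
  - intros x Hx. now apply H.
  - rewrite E, Rabs_mult. apply Rmult_le_compat_r; [apply Rabs_pos|]. now apply H.
Qed.

(** The products of f with exp (k (t - a)) and with exp (- k (t - a)) are respectively nondecreasing
    and nonincreasing, which gives the bound in both directions of time. *)
Lemma gronwall_right (f df : R -> R) (k a b : R) : a <= b ->
  (forall x, a <= x <= b -> is_derive f x (df x) /\ Rabs (df x) <= k * f x) ->
  f b <= f a * exp (k * (b - a)) /\ f a <= f b * exp (k * (b - a)).
Proof.
  intros Hab H.
  assert (Hd : forall s x, a <= x <= b ->
     is_derive (fun t => f t * exp (s * (t - a))) x ((df x + s * f x) * exp (s * (x - a)))).
  { intros s x Hx. destruct (H x Hx) as [h1 _].
    assert (h2 : is_derive (fun t => exp (s * (t - a))) x (s * exp (s * (x - a)))).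
    { auto_derive; [exact I|]. unfold Rminus; ring. }
    generalize (is_derive_mult f (fun t => exp (s * (t - a))) x _ _ h1 h2 Rmult_comm).
    intros h. replace ((df x + s * f x) * exp (s * (x - a))) with
      (plus (mult (df x) (exp (s * (x - a)))) (mult (f x) (s * exp (s * (x - a))))).
    exact h. unfold plus, mult; simpl; ring. }
  assert (E0 : forall s, f a * exp (s * (a - a)) = f a).
  { intros s. replace (s * (a - a)) with 0 by ring. rewrite exp_0; ring. }
  assert (P := fun x => exp_pos x).
  assert (h1 : f a <= f b * exp (k * (b - a))).
  { rewrite <- (E0 k).
    apply (deriv_nonneg_le (fun t => f t * exp (k * (t - a)))
      (fun x => (df x + k * f x) * exp (k * (x - a))) a b Hab).
    intros x Hx. split; [exact (Hd k x Hx)|]. destruct (H x Hx) as [_ h3].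
    generalize (Rle_abs (- df x)) (P (k * (x - a))); rewrite Rabs_Ropp; intros; nra. }
  assert (h2 : f b * exp (- k * (b - a)) <= f a).
  { assert (hh : - (f a * exp (- k * (a - a))) <= - (f b * exp (- k * (b - a)))).
    { apply (deriv_nonneg_le (fun t => - (f t * exp (- k * (t - a))))
        (fun x => - ((df x + - k * f x) * exp (- k * (x - a)))) a b Hab).
      intros x Hx. split.
      - exact (is_derive_opp _ _ _ (Hd (- k) x Hx)).
      - destruct (H x Hx) as [_ h3]. generalize (Rle_abs (df x)) (P (- k * (x - a))).
        intros; nra. }
    rewrite E0 in hh. lra. }
  split; [|exact h1].
  replace (f b) with ((f b * exp (- k * (b - a))) * exp (k * (b - a))).
  - apply Rmult_le_compat_r; [left; apply P | exact h2].
  - rewrite Rmult_assoc, <- exp_plus.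
    replace (- k * (b - a) + k * (b - a)) with 0 by ring. rewrite exp_0; ring.
Qed.

Lemma gronwall (f df : R -> R) (k a b x y : R) :
  (forall x, a <= x <= b -> is_derive f x (df x) /\ Rabs (df x) <= k * f x) ->
  a <= x <= b -> a <= y <= b -> f x <= f y * exp (k * Rabs (x - y)).
Proof.
  intros H Hx Hy. destruct (Rle_or_lt x y) as [h|h].
  - rewrite Rabs_minus_sym, Rabs_pos_eq by lra.
    apply (gronwall_right f df k x y h). intros t Ht. apply H. lra.
  - rewrite Rabs_pos_eq by lra.
    apply (gronwall_right f df k y x); [lra|]. intros t Ht. apply H. lra.
Qed.

Lemma gronwall_abs (f df : R -> R) (k a b x y : R) :
  (forall x, a <= x <= b -> is_derive f x (df x) /\ Rabs (df x) <= k * Rabs (f x)) ->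
  a <= x <= b -> a <= y <= b -> Rabs (f x) <= Rabs (f y) * exp (k * Rabs (x - y)).
Proof.
  intros H Hx Hy.
  (* |f| need not be differentiable at a zero of f; its square is, with the doubled constant. *)
  assert (h : f x ^ 2 <= f y ^ 2 * exp (2 * k * Rabs (x - y))).
  { apply (gronwall (fun t => f t ^ 2) (fun t => 2 * f t * df t) (2 * k) a b); auto.
    intros t Ht. destruct (H t Ht) as [h1 h2]. split.
    - auto_derive; [now exists (df t)|]. derive_rw h1. ring.
    - rewrite 2!Rabs_mult, (Rabs_pos_eq 2) by lra. rewrite <- (pow2_abs (f t)).
      generalize (Rabs_pos (f t)); nra. }
  apply Rsqr_incr_0_var.
  - rewrite Rsqr_mult, <- !Rsqr_abs. unfold Rsqr at 3. rewrite <- exp_plus.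
    replace (k * Rabs (x - y) + k * Rabs (x - y)) with (2 * k * Rabs (x - y)) by ring.
    unfold Rsqr. simpl in h. lra.
  - apply Rmult_le_pos; [apply Rabs_pos | left; apply exp_pos].
Qed.

Lemma gronwall_zero (f df : R -> R) (k a b x y : R) :
  (forall x, a <= x <= b -> is_derive f x (df x) /\ Rabs (df x) <= k * Rabs (f x)) ->
  a <= x <= b -> a <= y <= b -> f y = 0 -> f x = 0.
Proof.
  intros H Hx Hy E. generalize (gronwall_abs f df k a b x y H Hx Hy).
  rewrite E, Rabs_R0, Rmult_0_l. intros h.
  destruct (Req_dec (f x) 0) as [e|e]; auto. apply Rabs_pos_lt in e. lra.
Qed.

Lemma IVT_le (f : R -> R) (a b v : R) : a <= b ->
  (forall x, a <= x <= b -> continuous f x) ->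
  (f a <= v <= f b \/ f b <= v <= f a) -> exists x, a <= x <= b /\ f x = v.
Proof.
  intros Hab Hc Hv.
  (* Composing with the retraction onto [a, b] makes the function continuous on the whole line, as
     [IVT_gen] asks. *)
  set (cl := fun x => Rmax a (Rmin b x)).
  assert (Hcl : forall x, a <= cl x <= b).
  { intros x. unfold cl, Rmax, Rmin. repeat destruct Rle_dec; lra. }
  assert (Hclc : forall x y, Rabs (cl y - cl x) <= Rabs (y - x)).
  { intros x y. unfold cl, Rmax, Rmin. repeat destruct Rle_dec; unfold Rabs; repeat destruct Rcase_abs; lra. }
  assert (Ea : cl a = a). { unfold cl, Rmax, Rmin; repeat destruct Rle_dec; lra. }
  assert (Eb : cl b = b). { unfold cl, Rmax, Rmin; repeat destruct Rle_dec; lra. }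
  destruct (IVT_gen (fun x => f (cl x)) a b v) as [x [Hx E]].
  - intros x. apply continuity_pt_filterlim.
    apply (continuous_comp cl f).
    + intros P [e He]. exists e. intros y Hy. apply He.
      unfold ball in *; simpl in *; unfold AbsRing_ball, abs, minus, plus, opp in *; simpl in *.
      eapply Rle_lt_trans; [apply Hclc|exact Hy].
    + now apply Hc.
  - rewrite Ea, Eb. unfold Rmin, Rmax; repeat destruct Rle_dec; lra.
  - exists (cl x). split; auto.
Qed.

(** A change of sign would produce a zero by the intermediate value theorem, and a zero of f
    propagates to the whole interval. *)
Lemma gronwall_sign (f df : R -> R) (k a b x y : R) :
  (forall x, a <= x <= b -> is_derive f x (df x) /\ Rabs (df x) <= k * Rabs (f x)) ->
  a <= x <= b -> a <= y <= b -> 0 < f y -> 0 < f x.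
Proof.
  intros H Hx Hy P. destruct (Rlt_or_le 0 (f x)) as [h|h]; auto. exfalso.
  assert (Hc : forall t, a <= t <= b -> continuous f t).
  { intros t Ht. apply (is_derive_cont _ _ (df t)). now apply H. }
  assert (exists z, a <= z <= b /\ f z = 0) as [z [Hz E]].
  { destruct (Rle_or_lt x y) as [l|l].
    - destruct (IVT_le f x y 0 l) as [z [Hz E]]; [intros; apply Hc; lra | lra |].
      exists z; split; [lra|auto].
    - destruct (IVT_le f y x 0) as [z [Hz E]]; [lra | intros; apply Hc; lra | lra |].
      exists z; split; [lra|auto]. }
  rewrite (gronwall_zero f df k a b y z) in P; auto. lra.
Qed.

(** T is the supremum of the times up to which P holds without interruption. Openness of the failure
    set puts T among them, and maximality gives failures arbitrarily soon after T. Exit times and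
    the ends of stays in a region are extracted in this form. *)
Lemma last_time (P : R -> Prop) (t1 : R) : 0 <= t1 -> P 0 -> ~ P t1 ->
  (forall t, ~ P t -> locally t (fun s => ~ P s)) ->
  exists T, 0 <= T < t1 /\ (forall s, 0 <= s <= T -> P s) /\
    forall e, 0 < e -> exists s, T < s < T + e /\ ~ P s.
Proof.
  intros Ht1 P0 Pt1 Hcl.
  set (E := fun t => 0 <= t /\ forall s, 0 <= s <= t -> P s).
  assert (Hb : forall t, E t -> t <= t1).
  { intros t [Ht Hs]. destruct (Rle_or_lt t t1); auto. exfalso. apply Pt1, Hs. lra. }
  assert (E0 : E 0). { split; [lra|]. intros s Hs. replace s with 0 by lra. exact P0. }
  destruct (completeness E) as [T [HT1 HT2]].
  - exists t1. intros t Ht. now apply Hb.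
  - now exists 0.
  - assert (T0 : 0 <= T) by now apply HT1.
    assert (Hlt : forall s, 0 <= s < T -> P s).
    { intros s Hs. destruct (classic (P s)) as [h|h]; auto. exfalso.
      assert (T <= s); [|lra]. apply HT2. intros t [Ht1' Ht2].
      destruct (Rle_or_lt t s); auto. exfalso; apply h, Ht2; lra. }
    assert (PT : P T).
    { destruct (classic (P T)) as [h|h]; auto. exfalso. destruct (Hcl T h) as [e He].
      destruct T0 as [T0|T0]; [|now subst].
      set (s := Rmax 0 (T - e / 2)).
      assert (0 <= s < T /\ Rabs (s - T) < e).
      { unfold s, Rmax; generalize (cond_pos e); intros. destruct Rle_dec; unfold Rabs; destruct Rcase_abs; split; try lra. }
      apply (He s); [|now apply Hlt]. apply H. }
    assert (Hle : forall s, 0 <= s <= T -> P s).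
    { intros s [h1 [h2|h2]]; [now apply Hlt | now subst]. }
    exists T. split; [|split]; auto.
    + split; auto. assert (T <= t1) by now apply HT2.
      destruct H as [H|H]; auto. subst; tauto.
    + intros e He. destruct (classic (exists s, T < s < T + e /\ ~ P s)) as [h|h]; auto.
      exfalso. assert (T + e / 2 <= T); [|lra]. apply HT1. split; [lra|].
      intros s Hs. destruct (Rle_or_lt s T); [apply Hle; lra|].
      destruct (classic (P s)) as [g|g]; auto. exfalso; apply h. exists s; split; [lra|auto].
Qed.

Lemma deriv_neg_local (f : R -> R) (t l : R) : is_derive f t l -> l < 0 ->
  exists e, 0 < e /\ (forall s, t < s < t + e -> f s < f t) /\
    (forall s, t - e < s < t -> f t < f s).
Proof.
  intros Hd Hl. apply is_derive_Reals in Hd.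
  destruct (Hd (- l / 2)) as [e He]; [lra|].
  assert (K : forall s, s <> t -> Rabs (s - t) < e -> (f s - f t) / (s - t) < l / 2).
  { intros s Hs Hse. specialize (He (s - t)). replace (t + (s - t)) with s in He by ring.
    assert (h : Rabs ((f s - f t) / (s - t) - l) < - l / 2) by (apply He; [lra|auto]).
    apply Rabs_def2 in h. lra. }
  exists e. split; [apply cond_pos|]. split; intros s Hs.
  - assert (h := K s ltac:(lra) ltac:(rewrite Rabs_pos_eq; lra)).
    apply (Rmult_lt_compat_r (s - t)) in h; [|lra].
    unfold Rdiv in h at 1. rewrite Rmult_assoc, Rinv_l in h by lra. nra.
  - assert (h := K s ltac:(lra) ltac:(rewrite Rabs_left; lra)).
    apply (Rmult_lt_compat_r (t - s)) in h; [|lra].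
    replace ((f s - f t) / (s - t) * (t - s)) with (f t - f s) in h by (field; lra). nra.
Qed.

Lemma deriv_pos_local (f : R -> R) (t l : R) : is_derive f t l -> 0 < l ->
  exists e, 0 < e /\ (forall s, t < s < t + e -> f t < f s) /\
    (forall s, t - e < s < t -> f s < f t).
Proof.
  intros Hd Hl. destruct (deriv_neg_local (fun s => - f s) t (- l)) as [e [He [h1 h2]]].
  - exact (is_derive_opp _ _ _ Hd).
  - lra.
  - exists e. split; auto. split; intros s Hs; [specialize (h1 s Hs)|specialize (h2 s Hs)]; lra.
Qed.

Lemma half_pow_pos (n : nat) : 0 < (1 / 2) ^ n.
Proof. apply pow_lt; lra. Qed.

Lemma le_half_pow (z w C : R) : (forall n, z <= w + C * (1 / 2) ^ n) -> z <= w.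
Proof.
  intros H. apply (is_lim_seq_le (fun _ => z) (fun n => w + C * (1 / 2) ^ n) z w H).
  - apply is_lim_seq_const.
  - replace (Finite w) with (Finite (w + C * 0)) by (f_equal; ring).
    apply is_lim_seq_plus'; [apply is_lim_seq_const|].
    apply (is_lim_seq_scal_l _ C 0). apply is_lim_seq_geom. rewrite Rabs_pos_eq; lra.
Qed.

Lemma geometric_limit (u : nat -> R) (K : R) :
  (forall n, Rabs (u (S n) - u n) <= K * (1 / 2) ^ n) ->
  exists l, forall n, Rabs (u n - l) <= 2 * K * (1 / 2) ^ n.
Proof.
  intros H.
  assert (K0 : 0 <= K). { generalize (H O) (Rabs_pos (u 1%nat - u O)). simpl; lra. }
  assert (Hp : forall n p, Rabs (u (n + p)%nat - u n) <= 2 * K * (1 / 2) ^ n).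
  { intros n p.
    assert (Rabs (u (n + p)%nat - u n) <= 2 * K * (1 / 2) ^ n * (1 - (1 / 2) ^ p)).
    { induction p as [|p IH].
      - rewrite Nat.add_0_r, Rminus_diag, Rabs_R0. simpl; lra.
      - replace (u (n + S p)%nat - u n) with ((u (S (n + p)) - u (n + p)%nat) + (u (n + p)%nat - u n))
          by (rewrite Nat.add_succ_r; ring).
        eapply Rle_trans; [apply Rabs_triang|]. generalize (H (n + p)%nat).
        rewrite pow_add. simpl. lra. }
    eapply Rle_trans; [exact H0|].
    rewrite <- (Rmult_1_r (2 * K * (1 / 2) ^ n)) at 2.
    apply Rmult_le_compat_l.
    - generalize (half_pow_pos n); nra.
    - generalize (half_pow_pos p); lra. }
  assert (Hc : ex_finite_lim_seq u).
  { apply ex_lim_seq_cauchy_corr. intros e.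
    assert (exists N, 2 * K * (1 / 2) ^ N < e / 2) as [N HN].
    { destruct (Rlt_or_le 0 K) as [k|k].
      - destruct (pow_lt_1_zero (1 / 2) ltac:(rewrite Rabs_pos_eq; lra) (e / (4 * K))) as [N HN].
        + apply Rdiv_lt_0_compat; [apply cond_pos|lra].
        + exists N. generalize (HN N ltac:(lia)). rewrite Rabs_pos_eq by (left; apply half_pow_pos).
          intros h. apply (Rmult_lt_compat_l (2 * K)) in h; [|lra].
          replace (2 * K * (e / (4 * K))) with (e / 2) in h by (field; lra). exact h.
      - exists O. replace K with 0 by lra. generalize (cond_pos e); simpl; lra. }
    exists N. intros n m Hn Hm.
    replace n with (N + (n - N))%nat by lia. replace m with (N + (m - N))%nat by lia.
    generalize (Hp N (n - N)%nat) (Hp N (m - N)%nat).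
    set (a := u (N + (n - N))%nat). set (b := u (N + (m - N))%nat). intros h1 h2.
    replace (a - b) with ((a - u N) - (b - u N)) by ring.
    unfold Rminus at 1. eapply Rle_lt_trans; [apply Rabs_triang|]. rewrite Rabs_Ropp. lra. }
  destruct Hc as [l Hl]. exists l. intros n.
  rewrite Rabs_minus_sym.
  apply (is_lim_seq_le (fun p => Rabs (u (p + n)%nat - u n)) (fun _ => 2 * K * (1 / 2) ^ n)
    (Rabs (l - u n)) (2 * K * (1 / 2) ^ n)).
  - intros p. rewrite Nat.add_comm. apply Hp.
  - apply (is_lim_seq_abs _ (l - u n)). apply is_lim_seq_minus'; [|apply is_lim_seq_const].
    now apply is_lim_seq_incr_n.
  - apply is_lim_seq_const.
Qed.

Definition prim (f : R -> R) (t : R) : R := RInt f 0 t.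

Lemma prim_0 (f : R -> R) : prim f 0 = 0.
Proof. unfold prim. now rewrite RInt_point. Qed.

Lemma prim_derive (f : R -> R) (t : R) :
  (forall s, continuous f s) -> is_derive (prim f) t (f t).
Proof.
  intros Hf. apply (is_derive_RInt f (prim f) 0 t); [|apply Hf].
  apply filter_forall. intros x. unfold prim. apply (@RInt_correct R_CompleteNormedModule).
  apply (@ex_RInt_continuous R_CompleteNormedModule). intros z _. apply Hf.
Qed.

(** Integrating the weight exp (k |s|) gains a factor 1/k on both half-lines; this gain is what
    makes the Picard operator a contraction in the weighted norm. *)
Lemma exp_weight_bound (f df : R -> R) (c k t : R) : 0 < k ->
  (forall s, is_derive f s (df s) /\ Rabs (df s) <= c * k * exp (k * Rabs s)) ->
  f 0 = 0 -> Rabs (f t) <= c * (exp (k * Rabs t) - 1).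
Proof.
  intros Hk H f0. destruct (Rle_or_lt 0 t) as [h|h].
  - replace (f t) with (f t - f 0) by (rewrite f0; ring).
    replace (c * (exp (k * Rabs t) - 1)) with (c * exp (k * t) - c * exp (k * 0)).
    + apply (deriv_compare f df (fun s => c * exp (k * s)) (fun s => c * k * exp (k * s)) 0 t h).
      intros x Hx. destruct (H x) as [h1 h2]. split; [exact h1|split].
      * auto_derive; auto; ring.
      * rewrite (Rabs_pos_eq x) in h2 by lra. exact h2.
    + rewrite (Rabs_pos_eq t), Rmult_0_r, exp_0 by lra. ring.
  - replace (f t) with (- (f 0 - f t)) by (rewrite f0; ring). rewrite Rabs_Ropp.
    replace (c * (exp (k * Rabs t) - 1)) with (- c * exp (- k * 0) - (- c * exp (- k * t))).
    + apply (deriv_compare f df (fun s => - c * exp (- k * s)) (fun s => c * k * exp (- k * s)) t 0); [lra|].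
      intros x Hx. destruct (H x) as [h1 h2]. split; [exact h1|split].
      * auto_derive; auto; ring.
      * rewrite (Rabs_left1 x) in h2 by lra. replace (k * - x) with (- k * x) in h2 by ring. exact h2.
    + rewrite (Rabs_left t), Rmult_0_r, exp_0 by lra. replace (- k * t) with (k * - t) by ring. ring.
Qed.

(** * Existence and uniqueness of solutions *)
Section Picard.
Variables F G : R -> R -> R -> R.
Variables L M x0 y0 : R.
Hypothesis HF : forall x y t, (forall s, continuous x s) -> (forall s, continuous y s) ->
  continuous (fun s => F s (x s) (y s)) t /\ continuous (fun s => G s (x s) (y s)) t.
Hypothesis HL0 : 0 < L.
Hypothesis HL : forall t x y x' y',
  Rabs (F t x y - F t x' y') <= L * (Rabs (x - x') + Rabs (y - y')) /\
  Rabs (G t x y - G t x' y') <= L * (Rabs (x - x') + Rabs (y - y')).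
Hypothesis HM : forall t x y, Rabs (F t x y) <= M /\ Rabs (G t x y) <= M.

(** Bielecki's weight: relative to [E], integrating a function bounded by L times the distance gains
    1/(4 L), so each component of the Picard operator has Lipschitz constant 1/4 and the sum of the
    two 1/2. One contraction thus serves the whole time line. *)
Let k : R := 4 * L.
Let E (t : R) : R := exp (k * Rabs t).

Lemma picard_E1 t : 1 <= E t.
Proof.
  unfold E, k. rewrite <- exp_0. generalize (Rabs_pos t). intros h.
  assert (0 <= 4 * L * Rabs t) by nra. destruct H as [H|H].
  - left; now apply exp_increasing.
  - rewrite <- H. lra.
Qed.

Let P (z : (R -> R) * (R -> R)) : (R -> R) * (R -> R) :=
  (fun t => x0 + prim (fun s => F s (fst z s) (snd z s)) t,
   fun t => y0 + prim (fun s => G s (fst z s) (snd z s)) t).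

Let cont (z : (R -> R) * (R -> R)) :=
  (forall s, continuous (fst z) s) /\ (forall s, continuous (snd z) s).

Lemma picard_P_derive z : cont z -> forall t,
  is_derive (fst (P z)) t (F t (fst z t) (snd z t)) /\
  is_derive (snd (P z)) t (G t (fst z t) (snd z t)).
Proof.
  intros [h1 h2] t. unfold P; simpl. split.
  - replace (F t (fst z t) (snd z t)) with (0 + F t (fst z t) (snd z t)) by ring.
    apply (is_derive_plus (fun _ => x0)); [apply (is_derive_const x0)|].
    apply (prim_derive (fun s => F s (fst z s) (snd z s))). intros s. now apply (HF (fst z) (snd z) s).
  - replace (G t (fst z t) (snd z t)) with (0 + G t (fst z t) (snd z t)) by ring.
    apply (is_derive_plus (fun _ => y0)); [apply (is_derive_const y0)|].
    apply (prim_derive (fun s => G s (fst z s) (snd z s))). intros s. now apply (HF (fst z) (snd z) s).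
Qed.

Lemma picard_P_cont z : cont z -> cont (P z).
Proof.
  intros h. split; intros t.
  - exact (is_derive_cont _ _ _ (proj1 (picard_P_derive z h t))).
  - exact (is_derive_cont _ _ _ (proj2 (picard_P_derive z h t))).
Qed.

Lemma picard_P_contract z z' c : cont z -> cont z' ->
  (forall t, Rabs (fst z t - fst z' t) + Rabs (snd z t - snd z' t) <= c * E t) ->
  forall t, Rabs (fst (P z) t - fst (P z') t) + Rabs (snd (P z) t - snd (P z') t) <= c / 2 * E t.
Proof.
  intros h h' H t.
  assert (K0 : 0 < k) by (unfold k; lra).
  assert (c0 : 0 <= c).
  { generalize (H t) (picard_E1 t) (Rabs_pos (fst z t - fst z' t)) (Rabs_pos (snd z t - snd z' t)). nra. }
  assert (A1 : Rabs (fst (P z) t - fst (P z') t) <= c / 4 * (E t - 1)).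
  { apply (exp_weight_bound (fun t => fst (P z) t - fst (P z') t)
      (fun t => F t (fst z t) (snd z t) - F t (fst z' t) (snd z' t)) (c / 4) k t K0).
    - intros s. split.
      + exact (is_derive_minus _ _ _ _ _ (proj1 (picard_P_derive z h s)) (proj1 (picard_P_derive z' h' s))).
      + eapply Rle_trans; [apply HL|]. generalize (H s). unfold E, k. intros; nra.
    - unfold P; simpl. rewrite !prim_0. ring. }
  assert (A2 : Rabs (snd (P z) t - snd (P z') t) <= c / 4 * (E t - 1)).
  { apply (exp_weight_bound (fun t => snd (P z) t - snd (P z') t)
      (fun t => G t (fst z t) (snd z t) - G t (fst z' t) (snd z' t)) (c / 4) k t K0).
    - intros s. split.
      + exact (is_derive_minus _ _ _ _ _ (proj2 (picard_P_derive z h s)) (proj2 (picard_P_derive z' h' s))).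
      + eapply Rle_trans; [apply HL|]. generalize (H s). unfold E, k. intros; nra.
    - unfold P; simpl. rewrite !prim_0. ring. }
  lra.
Qed.

Let it (n : nat) := Nat.iter n P (fun _ => x0, fun _ => y0).

Lemma picard_it_cont n : cont (it n).
Proof.
  induction n as [|n IH]; [split; intros s; apply continuous_const|].
  apply (picard_P_cont _ IH).
Qed.

Lemma picard_it_step : exists K, forall n t,
  Rabs (fst (it (S n)) t - fst (it n) t) + Rabs (snd (it (S n)) t - snd (it n) t)
    <= K * (1 / 2) ^ n * E t.
Proof.
  assert (M0 : 0 <= M). { generalize (proj1 (HM 0 0 0)) (Rabs_pos (F 0 0 0)). lra. }
  assert (K0 : 0 < k) by (unfold k; lra).
  exists (2 * (M / k)). intros n. induction n as [|n IH]; intros t.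
  - assert (h := picard_it_cont O).
    assert (Mk : M / k * k = M) by (field; lra).
    assert (ME : forall s, M <= M / k * k * exp (k * Rabs s)).
    { intros s. rewrite Mk. generalize (picard_E1 s). unfold E. nra. }
    assert (Mk0 : 0 <= M / k) by (apply Rdiv_le_0_compat; lra).
    assert (A1 : Rabs (fst (it 1) t - x0) <= M / k * (E t - 1)).
    { apply (exp_weight_bound (fun t => fst (it 1) t - x0) (fun t => F t x0 y0) (M / k) k t K0).
      - intros s. split.
        + replace (F s x0 y0) with (F s x0 y0 - 0) by ring.
          exact (is_derive_minus _ _ _ _ _ (proj1 (picard_P_derive _ h s)) (is_derive_const x0 s)).
        + eapply Rle_trans; [apply HM|apply ME].
      - unfold it, P; simpl. rewrite prim_0. ring. }
    assert (A2 : Rabs (snd (it 1) t - y0) <= M / k * (E t - 1)).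
    { apply (exp_weight_bound (fun t => snd (it 1) t - y0) (fun t => G t x0 y0) (M / k) k t K0).
      - intros s. split.
        + replace (G s x0 y0) with (G s x0 y0 - 0) by ring.
          exact (is_derive_minus _ _ _ _ _ (proj2 (picard_P_derive _ h s)) (is_derive_const y0 s)).
        + eapply Rle_trans; [apply HM|apply ME].
      - unfold it, P; simpl. rewrite prim_0. ring. }
    change (Rabs (fst (it 1) t - x0) + Rabs (snd (it 1) t - y0) <= 2 * (M / k) * 1 * E t). lra.
  - replace (2 * (M / k) * (1 / 2) ^ S n) with (2 * (M / k) * (1 / 2) ^ n / 2) by (simpl; field; lra).
    apply (picard_P_contract (it (S n)) (it n)); auto using picard_it_cont.
Qed.

Lemma picard_existence : exists x y : R -> R, x 0 = x0 /\ y 0 = y0 /\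
  forall t, is_derive x t (F t (x t) (y t)) /\ is_derive y t (G t (x t) (y t)).
Proof.
  destruct picard_it_step as [K HK].
  assert (HX : forall t, exists l, forall n, Rabs (fst (it n) t - l) <= 2 * (K * E t) * (1 / 2) ^ n).
  { intros t. apply geometric_limit. intros n. generalize (HK n t) (Rabs_pos (snd (it (S n)) t - snd (it n) t)). lra. }
  assert (HY : forall t, exists l, forall n, Rabs (snd (it n) t - l) <= 2 * (K * E t) * (1 / 2) ^ n).
  { intros t. apply geometric_limit. intros n. generalize (HK n t) (Rabs_pos (fst (it (S n)) t - fst (it n) t)). lra. }
  set (x := fun t => proj1_sig (constructive_indefinite_description _ (HX t))).
  set (y := fun t => proj1_sig (constructive_indefinite_description _ (HY t))).
  assert (Hx : forall t n, Rabs (fst (it n) t - x t) <= 2 * (K * E t) * (1 / 2) ^ n).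
  { intros t. exact (proj2_sig (constructive_indefinite_description _ (HX t))). }
  assert (Hy : forall t n, Rabs (snd (it n) t - y t) <= 2 * (K * E t) * (1 / 2) ^ n).
  { intros t. exact (proj2_sig (constructive_indefinite_description _ (HY t))). }
  clearbody x y.
  assert (M0 : 0 <= M). { generalize (proj1 (HM 0 0 0)) (Rabs_pos (F 0 0 0)). lra. }
  (* Every iterate is M-Lipschitz, hence so is the pointwise limit; its continuity is obtained from
     this instead of from locally uniform convergence. *)
  assert (lip : forall n s t, Rabs (fst (it n) t - fst (it n) s) <= M * Rabs (t - s) /\
     Rabs (snd (it n) t - snd (it n) s) <= M * Rabs (t - s)).
  { intros [|n] s t.
    - simpl. rewrite !Rminus_diag, Rabs_R0. generalize (Rabs_pos (t - s)); split; nra.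
    - split.
      + apply (deriv_lip _ (fun r => F r (fst (it n) r) (snd (it n) r))). intros r _. split; [|apply HM].
        exact (proj1 (picard_P_derive (it n) (picard_it_cont n) r)).
      + apply (deriv_lip _ (fun r => G r (fst (it n) r) (snd (it n) r))). intros r _. split; [|apply HM].
        exact (proj2 (picard_P_derive (it n) (picard_it_cont n) r)). }
  assert (cl : forall (u : nat -> R -> R) (v : R -> R),
     (forall t n, Rabs (u n t - v t) <= 2 * (K * E t) * (1 / 2) ^ n) ->
     (forall n s t, Rabs (u n t - u n s) <= M * Rabs (t - s)) -> forall s, continuous v s).
  { intros u v Hu Hl s P' [e He].
    assert (lv : forall t, Rabs (v t - v s) <= M * Rabs (t - s)).
    { intros t. apply (le_half_pow _ _ (2 * (K * E t) + 2 * (K * E s))). intros n.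
      replace (v t - v s) with (- (u n t - v t) + (u n t - u n s) + (u n s - v s)) by ring.
      eapply Rle_trans; [apply Rabs_triang|].
      generalize (Rabs_triang (- (u n t - v t)) (u n t - u n s)). rewrite Rabs_Ropp.
      generalize (Hu t n) (Hu s n) (Hl n s t). lra. }
    assert (d0 : 0 < e / (M + 1)) by (apply Rdiv_lt_0_compat; [apply cond_pos|lra]).
    exists (mkposreal _ d0). intros t Ht. apply He.
    unfold ball in *; simpl in *; unfold AbsRing_ball, abs, minus, plus, opp in *; simpl in *.
    change (Rabs (v t - v s) < e). change (Rabs (t - s) < e / (M + 1)) in Ht.
    apply (Rmult_lt_compat_r (M + 1)) in Ht; [|lra].
    unfold Rdiv in Ht. rewrite Rmult_assoc, Rinv_l, Rmult_1_r in Ht by lra.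
    generalize (lv t) (Rabs_pos (t - s)). nra. }
  assert (cz : cont (x, y)).
  { split; simpl.
    - apply (cl (fun n => fst (it n)) x); auto. intros; apply lip.
    - apply (cl (fun n => snd (it n)) y); auto. intros; apply lip. }
  assert (fp : forall t, Rabs (x t - fst (P (x, y)) t) + Rabs (y t - snd (P (x, y)) t) <= 0).
  { intros t. apply (le_half_pow _ _ (4 * (K * E t))). intros n.
    assert (A : Rabs (fst (it (S n)) t - fst (P (x, y)) t) + Rabs (snd (it (S n)) t - snd (P (x, y)) t)
      <= 4 * K * (1 / 2) ^ n / 2 * E t).
    { apply (picard_P_contract (it n) (x, y)); auto using picard_it_cont.
      intros s. generalize (Hx s n) (Hy s n). simpl fst; simpl snd; lra. }
    generalize (Hx t (S n)) (Hy t (S n)).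
    change ((1 / 2) ^ S n) with (1 / 2 * (1 / 2) ^ n). intros B1 B2.
    generalize (Rabs_triang (- (fst (it (S n)) t - x t)) (fst (it (S n)) t - fst (P (x, y)) t))
      (Rabs_triang (- (snd (it (S n)) t - y t)) (snd (it (S n)) t - snd (P (x, y)) t)).
    rewrite !Rabs_Ropp.
    replace (- (fst (it (S n)) t - x t) + (fst (it (S n)) t - fst (P (x, y)) t))
      with (x t - fst (P (x, y)) t) by ring.
    replace (- (snd (it (S n)) t - y t) + (snd (it (S n)) t - snd (P (x, y)) t))
      with (y t - snd (P (x, y)) t) by ring.
    intros. lra. }
  assert (ex : forall t, x t = fst (P (x, y)) t /\ y t = snd (P (x, y)) t).
  { intros t. generalize (fp t) (Rabs_pos (x t - fst (P (x, y)) t)) (Rabs_pos (y t - snd (P (x, y)) t)).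
    intros h1 h2 h3. split; apply Rminus_diag_uniq; destruct (Req_dec (x t - fst (P (x, y)) t) 0) as [e|e];
      destruct (Req_dec (y t - snd (P (x, y)) t) 0) as [e'|e']; auto;
      try (apply Rabs_pos_lt in e; lra); try (apply Rabs_pos_lt in e'; lra). }
  exists x, y. split; [|split; [|intros t; split]].
  - rewrite (proj1 (ex 0)). unfold P; simpl. rewrite prim_0. ring.
  - rewrite (proj2 (ex 0)). unfold P; simpl. rewrite prim_0. ring.
  - apply (is_derive_ext (fst (P (x, y)))); [intros s; symmetry; apply ex|].
    exact (proj1 (picard_P_derive (x, y) cz t)).
  - apply (is_derive_ext (snd (P (x, y)))); [intros s; symmetry; apply ex|].
    exact (proj2 (picard_P_derive (x, y) cz t)).
Qed.
End Picard.

(* With [d] a power of a distance this also covers Hoelder functions. *)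
Definition bounded_lip {T : Type} (S : T -> Prop) (d : T -> T -> R) (g : T -> R) : Prop :=
  exists M, 0 <= M /\ (forall p, S p -> Rabs (g p) <= M) /\
    forall p q, S p -> S q -> Rabs (g p - g q) <= M * d p q.

Section BoundedLip.
Context {T : Type} (S : T -> Prop) (d : T -> T -> R).
Hypothesis d_pos : forall p q, 0 <= d p q.

Lemma bl_const c : bounded_lip S d (fun _ => c).
Proof.
  exists (Rabs c). split; [apply Rabs_pos|split].
  - intros; lra.
  - intros p q _ _. rewrite Rminus_diag, Rabs_R0. apply Rmult_le_pos; [apply Rabs_pos|auto].
Qed.

Lemma bl_ext f g : (forall p, S p -> f p = g p) -> bounded_lip S d f -> bounded_lip S d g.
Proof.
  intros E [M [H1 [H2 H3]]]. exists M. split; [auto|split].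
  - intros p hp. rewrite <- E; auto.
  - intros p q hp hq. rewrite <- !E; auto.
Qed.

Lemma bl_plus f g : bounded_lip S d f -> bounded_lip S d g -> bounded_lip S d (fun p => f p + g p).
Proof.
  intros [M [H1 [H2 H3]]] [N [K1 [K2 K3]]]. exists (M + N). split; [lra|split].
  - intros p hp. eapply Rle_trans; [apply Rabs_triang|]. generalize (H2 p hp) (K2 p hp); lra.
  - intros p q hp hq. replace (f p + g p - (f q + g q)) with ((f p - f q) + (g p - g q)) by ring.
    eapply Rle_trans; [apply Rabs_triang|]. generalize (H3 p q hp hq) (K3 p q hp hq); lra.
Qed.

Lemma bl_opp f : bounded_lip S d f -> bounded_lip S d (fun p => - f p).
Proof.
  intros [M [H1 [H2 H3]]]. exists M. split; [lra|split].
  - intros p hp. rewrite Rabs_Ropp; auto.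
  - intros p q hp hq. replace (- f p - - f q) with (- (f p - f q)) by ring. rewrite Rabs_Ropp; auto.
Qed.

Lemma bl_minus f g : bounded_lip S d f -> bounded_lip S d g -> bounded_lip S d (fun p => f p - g p).
Proof. intros. apply bl_plus; auto. now apply bl_opp. Qed.

Lemma bl_mult f g : bounded_lip S d f -> bounded_lip S d g -> bounded_lip S d (fun p => f p * g p).
Proof.
  intros [M [H1 [H2 H3]]] [N [K1 [K2 K3]]]. exists (M * N + M * N + M * N).
  assert (0 <= M * N) by nra. split; [lra|split].
  - intros p hp. rewrite Rabs_mult. generalize (H2 p hp) (K2 p hp) (Rabs_pos (f p)) (Rabs_pos (g p)). nra.
  - intros p q hp hq. replace (f p * g p - f q * g q) with (f p * (g p - g q) + (f p - f q) * g q) by ring.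
    eapply Rle_trans; [apply Rabs_triang|]. rewrite !Rabs_mult.
    assert (A : Rabs (f p) * Rabs (g p - g q) <= M * (N * d p q)).
    { apply Rmult_le_compat; auto using Rabs_pos. }
    assert (B : Rabs (f p - f q) * Rabs (g q) <= (M * d p q) * N).
    { apply Rmult_le_compat; auto using Rabs_pos. }
    generalize (d_pos p q). nra.
Qed.

Lemma bl_inv f m : 0 < m -> (forall p, S p -> m <= Rabs (f p)) ->
  bounded_lip S d f -> bounded_lip S d (fun p => / f p).
Proof.
  intros hm hf [M [H1 [H2 H3]]].
  assert (nz : forall p, S p -> f p <> 0).
  { intros p hp e. generalize (hf p hp). rewrite e, Rabs_R0. lra. }
  assert (I : forall p, S p -> Rabs (/ f p) <= / m).
  { intros p hp. rewrite Rabs_inv. apply Rinv_le_contravar; auto. }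
  assert (0 < / m) by now apply Rinv_0_lt_compat.
  exists (/ m + M * (/ m * / m)). assert (0 <= M * (/ m * / m)) by (apply Rmult_le_pos; nra).
  split; [lra|split].
  - intros p hp. generalize (I p hp). lra.
  - intros p q hp hq.
    replace (/ f p - / f q) with (- (f p - f q) * (/ f p * / f q)) by (field; auto).
    rewrite Rabs_mult, Rabs_Ropp, Rabs_mult.
    apply Rle_trans with (M * d p q * (/ m * / m)).
    + apply Rmult_le_compat; auto using Rabs_pos.
      * apply Rmult_le_pos; apply Rabs_pos.
      * apply Rmult_le_compat; auto using Rabs_pos.
    + generalize (d_pos p q). nra.
Qed.

Lemma bl_exp f : bounded_lip S d f -> bounded_lip S d (fun p => exp (f p)).
Proof.
  intros [M [H1 [H2 H3]]].
  assert (X : forall p, S p -> exp (f p) <= exp M).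
  { intros p hp. generalize (H2 p hp) (Rle_abs (f p)). intros a b.
    destruct (Rle_lt_or_eq_dec (f p) M) as [h|h]; [lra| |rewrite h; lra]. left; now apply exp_increasing. }
  exists (exp M * (1 + M)). generalize (exp_pos M). intros eM. split; [nra|split].
  - intros p hp. rewrite Rabs_pos_eq by (left; apply exp_pos). generalize (X p hp). nra.
  - intros p q hp hq.
    apply Rle_trans with (exp M * Rabs (f p - f q)).
    + apply (deriv_lip exp exp). intros x hx. split.
      * apply is_derive_Reals. apply derivable_pt_lim_exp.
      * rewrite Rabs_pos_eq by (left; apply exp_pos).
        assert (x <= M).
        { generalize (H2 p hp) (H2 q hq) (Rle_abs (f p)) (Rle_abs (f q)). revert hx.
          unfold Rmax; destruct Rle_dec; lra. }
        destruct H as [h|h]; [left; now apply exp_increasing | rewrite h; lra].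
    + generalize (H3 p q hp hq) (d_pos p q) (Rabs_pos (f p - f q)). intros. nra.
Qed.

Lemma bl_pow f n : bounded_lip S d f -> bounded_lip S d (fun p => f p ^ n).
Proof.
  intros h. induction n as [|n IH]; simpl; [apply (bl_const 1)|now apply bl_mult].
Qed.
End BoundedLip.

Lemma bl_dist_le {T} (S : T -> Prop) d d' (C : R) f : 0 <= C ->
  (forall p q, S p -> S q -> d p q <= C * d' p q) -> (forall p q, 0 <= d' p q) ->
  bounded_lip S d f -> bounded_lip S d' f.
Proof.
  intros hC h hd' [M [H1 [H2 H3]]]. exists (M + M * C). split; [nra|split].
  - intros p hp. generalize (H2 p hp). nra.
  - intros p q hp hq. generalize (H3 p q hp hq) (h p q hp hq) (hd' p q). nra.
Qed.

Lemma bl_subset {T} (S S' : T -> Prop) d f :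
  (forall p, S' p -> S p) -> bounded_lip S d f -> bounded_lip S' d f.
Proof.
  intros h [M [H1 [H2 H3]]]. exists M. split; [auto|split]; auto.
Qed.

(** * The clamped vector field, its complete flow, and uniqueness *)

Definition clamp (B z : R) : R := Rmax (- B) (Rmin B z).

Lemma clamp_bound B z : 0 <= B -> - B <= clamp B z <= B.
Proof. intros h. unfold clamp, Rmax, Rmin. repeat destruct Rle_dec; lra. Qed.

Lemma clamp_id B z : - B <= z <= B -> clamp B z = z.
Proof. intros h. unfold clamp, Rmax, Rmin. repeat destruct Rle_dec; lra. Qed.

Lemma clamp_lip B z z' : 0 <= B -> Rabs (clamp B z - clamp B z') <= Rabs (z - z').
Proof.
  intros h. unfold clamp, Rmax, Rmin. repeat destruct Rle_dec; unfold Rabs; repeat destruct Rcase_abs; lra.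
Qed.

Definition dist1 (p q : plane) : R := Rabs (fst p - fst q) + Rabs (snd p - snd q).

Lemma dist1_pos p q : 0 <= dist1 p q.
Proof. unfold dist1. generalize (Rabs_pos (fst p - fst q)) (Rabs_pos (snd p - snd q)). lra. Qed.

(* Clamping makes the field globally Lipschitz, so that its flow is complete. *)
Definition Xc (lam B : R) (p : plane) : plane := Xp lam (clamp B (fst p), clamp B (snd p)).

Definition in_box (B : R) (p : plane) : Prop := - B <= fst p <= B /\ - B <= snd p <= B.

Lemma Xc_in_box lam B p : in_box B p -> Xc lam B p = Xp lam p.
Proof. intros [h1 h2]. unfold Xc. rewrite !clamp_id by auto. now destruct p. Qed.

Lemma solves_Xc lam B u t : in_box B (u t) -> solves_at (Xc lam B) u t <-> solves_at (Xp lam) u t.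
Proof. intros h. unfold solves_at. now rewrite Xc_in_box. Qed.

Lemma Xc_bl lam B : 0 <= B ->
  bounded_lip (fun _ => True) dist1 (fun p => fst (Xc lam B p)) /\
  bounded_lip (fun _ => True) dist1 (fun p => snd (Xc lam B p)).
Proof.
  intros hB.
  assert (h1 : bounded_lip (fun _ => True) dist1 (fun p => clamp B (fst p))).
  { exists (B + 1). split; [lra|split].
    - intros p _. apply Rabs_le. generalize (clamp_bound B (fst p) hB). lra.
    - intros p q _ _. eapply Rle_trans; [apply clamp_lip; auto|]. unfold dist1.
      generalize (Rabs_pos (fst p - fst q)) (Rabs_pos (snd p - snd q)). nra. }
  assert (h2 : bounded_lip (fun _ => True) dist1 (fun p => clamp B (snd p))).
  { exists (B + 1). split; [lra|split].
    - intros p _. apply Rabs_le. generalize (clamp_bound B (snd p) hB). lra.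
    - intros p q _ _. eapply Rle_trans; [apply clamp_lip; auto|]. unfold dist1.
      generalize (Rabs_pos (fst p - fst q)) (Rabs_pos (snd p - snd q)). nra. }
  assert (D := dist1_pos).
  split; unfold Xc, Xp; simpl fst; simpl snd.
  - apply bl_plus; [apply bl_minus|]; auto.
    + apply bl_mult; auto. apply bl_const; auto. apply (bl_pow _ _ D (fun p => clamp B (fst p)) 2 h1).
    + apply (bl_pow _ _ D (fun p => clamp B (snd p)) 2 h2).
    + apply bl_mult; auto. apply bl_const; auto. apply (bl_pow _ _ D (fun p => clamp B (fst p)) 3 h1).
  - repeat apply bl_mult; auto. all: apply bl_const; auto.
Qed.

Lemma lip_continuous (f : R -> R) (M t : R) : 
  (forall s, Rabs (f s - f t) <= M * Rabs (s - t)) -> continuous f t.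
Proof.
  intros lv P' [e He].
  assert (M0 : 0 <= M). { generalize (lv (t + 1)) (Rabs_pos (f (t + 1) - f t)).
    replace (t + 1 - t) with 1 by ring. rewrite Rabs_R1. lra. }
  assert (d0 : 0 < e / (M + 1)) by (apply Rdiv_lt_0_compat; [apply cond_pos|lra]).
  exists (mkposreal _ d0). intros s Hs. apply He.
  change (Rabs (f s - f t) < e). change (Rabs (s - t) < e / (M + 1)) in Hs.
  apply (Rmult_lt_compat_r (M + 1)) in Hs; [|lra].
  unfold Rdiv in Hs. rewrite Rmult_assoc, Rinv_l, Rmult_1_r in Hs by lra.
  generalize (lv s) (Rabs_pos (s - t)). nra.
Qed.

Lemma continuous_eps (f : R -> R) (t : R) :
  continuous f t <-> forall e, 0 < e -> exists d, 0 < d /\ forall s, Rabs (s - t) < d -> Rabs (f s - f t) < e.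
Proof.
  split.
  - intros h e he. destruct (h (fun z => Rabs (z - f t) < e)) as [d Hd].
    + exists (mkposreal e he). auto.
    + exists d. split; [apply cond_pos|]. intros s hs. now apply Hd.
  - intros h P [e He]. destruct (h e (cond_pos e)) as [d [hd Hd]].
    exists (mkposreal d hd). intros s hs. apply He. now apply Hd.
Qed.

Lemma bl_continuous (g : plane -> R) (x y : R -> R) t :
  bounded_lip (fun _ => True) dist1 g ->
  continuous x t -> continuous y t -> continuous (fun s => g (x s, y s)) t.
Proof.
  intros [M [H1 [_ H3]]] hx hy. apply continuous_eps. intros e he.
  set (e' := e / (2 * (M + 1))).
  assert (0 < e') by (apply Rdiv_lt_0_compat; lra).
  destruct (proj1 (continuous_eps x t) hx e' H) as [d1 [p1 q1]].
  destruct (proj1 (continuous_eps y t) hy e' H) as [d2 [p2 q2]].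
  exists (Rmin d1 d2). split; [now apply Rmin_glb_lt|]. intros s hs.
  eapply Rle_lt_trans; [apply H3; auto|]. unfold dist1; simpl.
  specialize (q1 s (Rlt_le_trans _ _ _ hs (Rmin_l _ _))).
  specialize (q2 s (Rlt_le_trans _ _ _ hs (Rmin_r _ _))).
  assert (e = (M + 1) * (e' + e')) by (unfold e'; field; lra).
  rewrite H0. generalize (Rabs_pos (x s - x t)) (Rabs_pos (y s - y t)). nra.
Qed.

Lemma complete_flow_exists lam B : 0 <= B ->
  exists Phi : plane -> R -> plane, (forall p, Phi p 0 = p) /\
    forall p t, solves_at (Xc lam B) (Phi p) t.
Proof.
  intros hB. destruct (Xc_bl lam B hB) as [b1 b2].
  assert (H : forall p, exists u : R -> plane, u 0 = p /\ forall t, solves_at (Xc lam B) u t).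
  { intros p. assert (b1' := b1). assert (b2' := b2).
    destruct b1' as [M [m0 [m1 m2]]]. destruct b2' as [N [n0 [n1 n2]]].
    destruct (picard_existence (fun _ x y => fst (Xc lam B (x, y))) (fun _ x y => snd (Xc lam B (x, y)))
      (M + N + 1) (M + N) (fst p) (snd p)) as [x [y [hx [hy hd]]]].
    - intros x y t cx cy. split.
      + apply (bl_continuous (fun q => fst (Xc lam B q)) x y t b1 (cx t) (cy t)).
      + apply (bl_continuous (fun q => snd (Xc lam B q)) x y t b2 (cx t) (cy t)).
    - lra.
    - intros t x y x' y'. generalize (m2 (x, y) (x', y') I I) (n2 (x, y) (x', y') I I).
      unfold dist1; simpl. generalize (Rabs_pos (x - x')) (Rabs_pos (y - y')). intros; split; nra.
    - intros t x y. generalize (m1 (x, y) I) (n1 (x, y) I). intros; split; lra.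
    - exists (fun t => (x t, y t)). split.
      + rewrite hx, hy. now destruct p.
      + intros t. destruct (hd t). split; simpl; auto. }
  exists (fun p => proj1_sig (constructive_indefinite_description _ (H p))).
  split; intros p; [|intros t]; apply (proj2_sig (constructive_indefinite_description _ (H p))).
Qed.

Definition sq_dist (p q : plane) : R := (fst p - fst q) ^ 2 + (snd p - snd q) ^ 2.

Lemma is_derive_sq_diff (f g : R -> R) t df dg : is_derive f t df -> is_derive g t dg ->
  is_derive (fun s => (f s - g s) ^ 2) t (2 * (f t - g t) * (df - dg)).
Proof.
  intros hf hg. auto_derive.
  - split; [now exists df|split; [now exists dg|exact I]].
  - derive_rw hf. derive_rw hg. ring.
Qed.

Lemma Xc_gronwall lam B : 0 <= B -> exists k, 0 <= k /\ forall u v a b s r,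
  (forall t, a <= t <= b -> solves_at (Xc lam B) u t /\ solves_at (Xc lam B) v t) ->
  a <= s <= b -> a <= r <= b -> sq_dist (u s) (v s) <= sq_dist (u r) (v r) * exp (k * Rabs (s - r)).
Proof.
  intros hB. destruct (Xc_bl lam B hB) as [[M [m0 [m1 m2]]] [N [n0 [n1 n2]]]].
  (* With x and y the absolute coordinate differences, the squared distance has derivative at most 2
     (M x + N y)(x + y), and both x (x + y) and y (x + y) are at most 2 (x^2 + y^2). *)
  exists (4 * (M + N)). split; [lra|]. intros u v a b s r H hs hr.
  apply (gronwall (fun t => sq_dist (u t) (v t))
    (fun t => 2 * (fst (u t) - fst (v t)) * (fst (Xc lam B (u t)) - fst (Xc lam B (v t)))
      + 2 * (snd (u t) - snd (v t)) * (snd (Xc lam B (u t)) - snd (Xc lam B (v t)))) (4 * (M + N)) a b); auto.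
  intros t ht. destruct (H t ht) as [[u1 u2] [v1 v2]]. split.
  - exact (is_derive_plus _ _ _ _ _ (is_derive_sq_diff _ _ _ _ _ u1 v1) (is_derive_sq_diff _ _ _ _ _ u2 v2)).
  - generalize (m2 (u t) (v t) I I) (n2 (u t) (v t) I I). unfold dist1, sq_dist.
    set (d1 := fst (u t) - fst (v t)). set (d2 := snd (u t) - snd (v t)).
    set (e1 := fst (Xc lam B (u t)) - _). set (e2 := snd (Xc lam B (u t)) - _). intros h1 h2.
    eapply Rle_trans; [apply Rabs_triang|]. rewrite !Rabs_mult, !(Rabs_pos_eq 2) by lra.
    rewrite <- (pow2_abs d1), <- (pow2_abs d2).
    revert h1 h2. generalize (Rabs_pos d1) (Rabs_pos d2) (Rabs_pos e1) (Rabs_pos e2).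
    generalize (Rabs d1) (Rabs d2) (Rabs e1) (Rabs e2). clear - m0 n0. intros x y e f hx hy he hf h1 h2.
    assert (x * e <= x * (M * (x + y))) by (apply Rmult_le_compat_l; auto).
    assert (y * f <= y * (N * (x + y))) by (apply Rmult_le_compat_l; auto).
    assert (h3 : x * (x + y) <= 2 * (x ^ 2 + y ^ 2)) by nra.
    assert (h4 : y * (x + y) <= 2 * (x ^ 2 + y ^ 2)) by nra.
    assert (M * (x * (x + y)) <= M * (2 * (x ^ 2 + y ^ 2))) by (apply Rmult_le_compat_l; auto).
    assert (N * (y * (x + y)) <= N * (2 * (x ^ 2 + y ^ 2))) by (apply Rmult_le_compat_l; auto).
    nra.
Qed.

Lemma sq_dist_0 p q : sq_dist p q <= 0 -> p = q.
Proof.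
  unfold sq_dist. intros h. destruct p as [a b], q as [c d]; simpl in *.
  assert (h1 : (a - c) * (a - c) = 0) by (generalize (pow2_ge_0 (b - d)) (pow2_ge_0 (a - c)); simpl; lra).
  assert (h2 : (b - d) * (b - d) = 0) by (generalize (pow2_ge_0 (b - d)) (pow2_ge_0 (a - c)); simpl; lra).
  apply Rmult_integral in h1. apply Rmult_integral in h2. f_equal; destruct h1, h2; lra.
Qed.

Lemma sq_dist_refl p : sq_dist p p = 0.
Proof. unfold sq_dist. ring. Qed.

Lemma Xc_unique lam B u v a b r : 0 <= B ->
  (forall t, a <= t <= b -> solves_at (Xc lam B) u t /\ solves_at (Xc lam B) v t) ->
  a <= r <= b -> u r = v r -> forall s, a <= s <= b -> u s = v s.
Proof.
  intros hB H hr E s hs. destruct (Xc_gronwall lam B hB) as [k [_ hk]].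
  apply sq_dist_0. eapply Rle_trans; [apply (hk u v a b s r); auto|].
  rewrite E, sq_dist_refl. lra.
Qed.

Lemma cont_bounded (f : R -> R) a b : (forall x, a <= x <= b -> continuous f x) ->
  exists M, 0 <= M /\ forall x, a <= x <= b -> Rabs (f x) <= M.
Proof.
  intros H. destruct (Rle_or_lt a b) as [h|h].
  - destruct (continuity_ab_maj (fun x => Rabs (f x)) a b h) as [m [Hm hm]].
    + intros x hx. apply continuity_pt_filterlim.
      apply (continuous_comp f Rabs); [now apply H|]. apply continuous_Rabs.
    + exists (Rabs (f m)). split; [apply Rabs_pos|auto].
  - exists 0. split; [lra|]. intros; lra.
Qed.

Lemma solves_cont X u t : solves_at X u t ->
  continuous (fun s => fst (u s)) t /\ continuous (fun s => snd (u s)) t.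
Proof. intros [h1 h2]. split; eapply is_derive_cont; eassumption. Qed.

(** On a compact interval both solutions are bounded, so they also solve the equation clamped to a
    large enough box, where the field is globally Lipschitz. *)
Lemma Xp_unique lam u v a b r :
  (forall t, a <= t <= b -> solves_at (Xp lam) u t /\ solves_at (Xp lam) v t) ->
  a <= r <= b -> u r = v r -> forall s, a <= s <= b -> u s = v s.
Proof.
  intros H hr E s hs.
  destruct (cont_bounded (fun s => fst (u s)) a b) as [B1 [p1 q1]]; [intros x hx; eapply solves_cont; now apply H|].
  destruct (cont_bounded (fun s => snd (u s)) a b) as [B2 [p2 q2]]; [intros x hx; eapply solves_cont; now apply H|].
  destruct (cont_bounded (fun s => fst (v s)) a b) as [B3 [p3 q3]]; [intros x hx; eapply solves_cont; now apply H|].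
  destruct (cont_bounded (fun s => snd (v s)) a b) as [B4 [p4 q4]]; [intros x hx; eapply solves_cont; now apply H|].
  apply (Xc_unique lam (B1 + B2 + B3 + B4) u v a b r); auto; [lra|].
  intros t ht. destruct (H t ht).
  specialize (q1 t ht). specialize (q2 t ht). specialize (q3 t ht). specialize (q4 t ht).
  apply Rabs_le_between in q1. apply Rabs_le_between in q2.
  apply Rabs_le_between in q3. apply Rabs_le_between in q4.
  split; apply solves_Xc; auto; split; lra.
Qed.

Lemma flow_unique_along lam u p t q : flow (Xp lam) p t q -> u 0 = p ->
  (forall s, Rmin 0 t <= s <= Rmax 0 t -> solves_at (Xp lam) u s) -> q = u t.
Proof.
  intros [v [v0 [vt hv]]] u0 hu. rewrite <- vt.
  apply (Xp_unique lam v u (Rmin 0 t) (Rmax 0 t) 0).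
  - intros s hs. split; auto.
  - split; [apply Rmin_l|apply Rmax_l].
  - congruence.
  - split; [apply Rmin_r|apply Rmax_r].
Qed.

Lemma flow_of_solution lam u t : 
  (forall s, Rmin 0 t <= s <= Rmax 0 t -> solves_at (Xp lam) u s) -> flow (Xp lam) (u 0) t (u t).
Proof. intros h. now exists u. Qed.

Lemma flow_functional lam p t q q' : flow (Xp lam) p t q -> flow (Xp lam) p t q' -> q = q'.
Proof.
  intros h [v [v0 [vt hv]]]. rewrite <- vt. now apply (flow_unique_along lam v p).
Qed.

(** The exit time is determined: the orbit leaves N arbitrarily soon after the smaller of two
    candidate times, yet would still be in N up to the larger one. *)
Lemma exit_point_unique lam N p q q' :
  exit_point (Xp lam) N p q -> exit_point (Xp lam) N p q' -> q = q'.
Proof.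
  assert (K : forall q q' t t', 0 <= t -> t < t' -> 
    (forall e, 0 < e -> exists s r, t < s < t + e /\ flow (Xp lam) p s r /\ ~ N r) ->
    (forall s r, 0 <= s <= t' -> flow (Xp lam) p s r -> N r) -> q = q' :> plane).
  { intros r r' t t' h0 h1 h2 h3. exfalso. destruct (h2 (t' - t)) as [s [z [h4 [h5 h6]]]]; [lra|].
    apply h6, (h3 s); auto. lra. }
  intros [t [a1 [a2 [a3 a4]]]] [t' [b1 [b2 [b3 b4]]]].
  destruct (Rtotal_order t t') as [h|[h|h]].
  - now apply (K q q' t t').
  - subst t'. now apply (flow_functional lam p t).
  - symmetry. now apply (K q' q t' t).
Qed.

(** * Orbits as graphs over the x-axis *)

(* [x' = - AA lam x y], and [FF] is the slope [dy / dx] of the orbits. *)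
Definition rr (lam x : R) : R := 1 / 3 - lam * x.
Definition AA (lam x y : R) : R := rr lam x * x ^ 2 + y ^ 2.
Definition FF (lam x y : R) : R := - (2 / 3) * x * y / AA lam x y.

Definition graph (lam xl xr : R) (Y : R -> R) : Prop :=
  forall x, xl <= x <= xr -> Y x <> 0 /\ is_derive Y x (FF lam x (Y x)).

Lemma bl_max {T} (S : T -> Prop) d f m : (forall p q, 0 <= d p q) ->
  bounded_lip S d f -> bounded_lip S d (fun p => Rmax (f p) m).
Proof.
  intros hd [M [H1 [H2 H3]]]. exists (M + Rabs m). generalize (Rabs_pos m). intros hm.
  split; [lra|split].
  - intros p hp. generalize (H2 p hp). intros h. apply Rabs_le_between in h.
    apply Rabs_le. unfold Rmax; destruct Rle_dec; generalize (Rle_abs m) (Rle_abs (- m)); rewrite Rabs_Ropp; lra.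
  - intros p q hp hq. apply Rle_trans with (Rabs (f p - f q)).
    + unfold Rmax; repeat destruct Rle_dec; unfold Rabs; repeat destruct Rcase_abs; lra.
    + generalize (H3 p q hp hq) (hd p q). nra.
Qed.

Lemma min_at_zero (f g : R -> R) xl xr x : xl <= 0 <= xr -> xl <= x <= xr ->
  (forall x, xl <= x <= xr -> is_derive f x (x * g x) /\ 0 <= g x) -> f 0 <= f x.
Proof.
  intros h0 hx H. destruct (Rle_or_lt 0 x) as [h|h].
  - apply (deriv_nonneg_le f (fun x => x * g x) 0 x h). intros t ht.
    destruct (H t ltac:(lra)). split; auto. nra.
  - assert (- f x <= - f 0); [|lra].
    apply (deriv_nonneg_le (fun t => - f t) (fun t => - (t * g t)) x 0); [lra|]. intros t ht.
    destruct (H t ltac:(lra)) as [h1 h2]. split; [exact (is_derive_opp _ _ _ h1)|nra].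
Qed.

Section Graphs.
Variables lam xl xr r0 : R.
Hypothesis hl : xl < 0.
Hypothesis hr : 0 < xr.
Hypothesis hr0 : 0 < r0.
Hypothesis hR : forall x, xl <= x <= xr -> r0 <= rr lam x.

Lemma r0_third : r0 <= 1 / 3.
Proof. generalize (hR 0 ltac:(lra)). unfold rr. lra. Qed.

Lemma AA_pos x y : xl <= x <= xr -> y <> 0 -> 0 < AA lam x y.
Proof.
  intros hx hy. unfold AA. generalize (hR x hx) (pow2_ge_0 x). intros.
  assert (0 < y ^ 2) by (apply pow2_gt_0; auto). nra.
Qed.

Lemma AA_ge_x x y : xl <= x <= xr -> r0 * x ^ 2 <= AA lam x y.
Proof. intros hx. unfold AA. generalize (hR x hx) (pow2_ge_0 x) (pow2_ge_0 y). nra. Qed.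

Lemma AA_ge_y x y : xl <= x <= xr -> y ^ 2 <= AA lam x y.
Proof. intros hx. unfold AA. generalize (hR x hx) (pow2_ge_0 x) (pow2_ge_0 y). nra. Qed.

(** Away from x = 0, Y^2 decreases and Y^2 + (2/3) x^2 increases, both because Y^2 <= m; with r0 <=
    1/3 this makes [AA] at least of the order of Y(0)^2 + x^2. The denominator m is left general
    since [graph_exists] applies the lemma to an equation whose denominator has been cut off from
    below. *)
Lemma graph_bounds_gen (Y m : R -> R) :
  (forall x, xl <= x <= xr -> is_derive Y x (- (2 / 3) * x * Y x / m x) /\ 0 < m x /\ Y x ^ 2 <= m x) ->
  forall x, xl <= x <= xr -> Y x ^ 2 <= Y 0 ^ 2 /\ Y 0 ^ 2 - 2 / 3 * x ^ 2 <= Y x ^ 2 /\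
    r0 / 2 * (Y 0 ^ 2 + x ^ 2) <= AA lam x (Y x).
Proof.
  intros H x hx.
  assert (A1 : - Y 0 ^ 2 <= - Y x ^ 2).
  { apply (min_at_zero (fun x => - Y x ^ 2) (fun x => 4 / 3 * (Y x ^ 2 / m x)) xl xr x); [lra|auto|].
    intros t ht. destruct (H t ht) as [h1 [h2 h3]]. split.
    - auto_derive; [side_derive|]. derive_rw h1. field. lra.
    - assert (0 <= Y t ^ 2 / m t); [|lra]. apply Rdiv_le_0_compat; [apply pow2_ge_0|auto]. }
  assert (A2 : Y 0 ^ 2 + 2 / 3 * 0 ^ 2 <= Y x ^ 2 + 2 / 3 * x ^ 2).
  { apply (min_at_zero (fun x => Y x ^ 2 + 2 / 3 * x ^ 2) (fun x => 4 / 3 * (1 - Y x ^ 2 / m x)) xl xr x); [lra|auto|].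
    intros t ht. destruct (H t ht) as [h1 [h2 h3]]. split.
    - auto_derive; [side_derive|]. derive_rw h1. field. lra.
    - assert (Y t ^ 2 / m t <= 1); [|lra]. apply (proj2 (Rle_div_l _ _ _ h2)); lra. }
  split; [lra|split; [simpl in *; lra|]].
  generalize r0_third (hR x hx). unfold AA. intros. simpl pow in A2.
  generalize (pow2_ge_0 x) (pow2_ge_0 (Y 0)) (pow2_ge_0 (Y x)). simpl. nra.
Qed.

Lemma graph_bounds Y x : graph lam xl xr Y -> xl <= x <= xr ->
  Y x ^ 2 <= Y 0 ^ 2 /\ Y 0 ^ 2 - 2 / 3 * x ^ 2 <= Y x ^ 2 /\
  r0 / 2 * (Y 0 ^ 2 + x ^ 2) <= AA lam x (Y x).
Proof.
  intros hY. revert x. apply (graph_bounds_gen Y (fun x => AA lam x (Y x))).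
  intros x hx. destruct (hY x hx) as [h1 h2]. split; [exact h2|split].
  - now apply AA_pos.
  - now apply AA_ge_y.
Qed.

Lemma graph_abs_le Y x : graph lam xl xr Y -> xl <= x <= xr -> Rabs (Y x) <= Rabs (Y 0).
Proof.
  intros hY hx. apply Rsqr_le_abs_0. rewrite !Rsqr_pow2. now apply (graph_bounds Y x).
Qed.

Lemma graph_exists x0 y0 : xl <= x0 <= xr -> y0 <> 0 ->
  exists Y, graph lam xl xr Y /\ Y x0 = y0.
Proof.
  intros hx0 hy0.
  (* Cut-off level for the denominator: the lower bound of [graph_bounds_gen], combined with y0^2 <=
     Y(0)^2, will show that [AA] never drops below it. *)
  set (mu := r0 / 2 * y0 ^ 2).
  assert (hy2 : 0 < y0 ^ 2) by (apply pow2_gt_0; auto).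
  assert (hmu : 0 < mu) by (unfold mu; nra).
  set (W := xr - xl).
  set (k := 2 / 3 * W / mu).
  (* The a priori Gronwall bound for the cut-off equation, so that clamping y at B is never felt on
     [xl, xr]. *)
  set (B := Rabs y0 * exp (k * W)).
  assert (hk : 0 <= k). { unfold k, W. apply Rdiv_le_0_compat; lra. }
  assert (hB : 0 <= B). { unfold B. apply Rmult_le_pos; [apply Rabs_pos|left; apply exp_pos]. }
  set (cx := fun x => Rmax xl (Rmin xr x)).
  assert (hcx : forall x, xl <= cx x <= xr).
  { intros x. unfold cx, Rmax, Rmin. repeat destruct Rle_dec; lra. }
  assert (hcxW : forall x, Rabs (cx x) <= W).
  { intros x. generalize (hcx x). intros. apply Rabs_le. unfold W. lra. }
  assert (hcid : forall x, xl <= x <= xr -> cx x = x).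
  { intros x hx. unfold cx, Rmax, Rmin. repeat destruct Rle_dec; lra. }
  set (m := fun x y => Rmax (AA lam (cx x) (clamp B y)) mu).
  assert (hm : forall x y, mu <= m x y). { intros; apply Rmax_r. }
  set (g := fun p : plane => - (2 / 3) * cx (fst p) * clamp B (snd p) * / m (fst p) (snd p)).
  assert (D := dist1_pos).
  assert (b1 : bounded_lip (fun _ => True) dist1 (fun p => cx (fst p))).
  { exists (W + 1). assert (0 <= W) by (unfold W; lra). split; [lra|split].
    - intros p _. generalize (hcxW (fst p)). lra.
    - intros p q _ _. apply Rle_trans with (Rabs (fst p - fst q)).
      + unfold cx, Rmax, Rmin. repeat destruct Rle_dec; unfold Rabs; repeat destruct Rcase_abs; lra.
      + unfold dist1. generalize (Rabs_pos (fst p - fst q)) (Rabs_pos (snd p - snd q)). nra. }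
  assert (b2 : bounded_lip (fun _ => True) dist1 (fun p => clamp B (snd p))).
  { exists (B + 1). split; [lra|split].
    - intros p _. apply Rabs_le. generalize (clamp_bound B (snd p) hB). lra.
    - intros p q _ _. eapply Rle_trans; [apply clamp_lip; auto|]. unfold dist1.
      generalize (Rabs_pos (fst p - fst q)) (Rabs_pos (snd p - snd q)). nra. }
  assert (bg : bounded_lip (fun _ => True) dist1 g).
  { unfold g. apply bl_mult; [auto| |].
    - apply bl_mult; [auto| |exact b2]. apply bl_mult; [auto| |exact b1]. now apply bl_const.
    - apply (bl_inv _ _ D _ mu hmu).
      + intros p _. generalize (hm (fst p) (snd p)). intros. rewrite Rabs_pos_eq; lra.
      + unfold m. apply bl_max; auto. unfold AA. apply bl_plus.
        * apply bl_mult; auto.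
          -- unfold rr. apply bl_minus; [now apply bl_const|]. apply bl_mult; auto. now apply bl_const.
          -- apply (bl_pow _ _ D (fun p => cx (fst p)) 2 b1).
        * apply (bl_pow _ _ D (fun p => clamp B (snd p)) 2 b2). }
  assert (bg' := bg). destruct bg' as [M [M0 [M1 M2]]].
  (* The scalar equation is run as a planar system with a constant first component, and time is
     shifted so that x0 corresponds to 0. *)
  destruct (picard_existence (fun _ _ _ => 0) (fun t _ y => g (t + x0, y)) (M + 1) M 0 y0)
    as [_z [y [_ [hy hd]]]].
  - intros x y t _ cy. split; [apply continuous_const|].
    apply (bl_continuous g (fun s => s + x0) y t bg); [|apply cy].
    apply (is_derive_cont _ _ 1). auto_derive; auto.
  - lra.
  - intros t x y x' y'. rewrite Rminus_diag, Rabs_R0. generalize (Rabs_pos (x - x')) (Rabs_pos (y - y')).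
    intros. split; [nra|]. generalize (M2 (t + x0, y) (t + x0, y') I I). unfold dist1; simpl.
    rewrite Rminus_diag, Rabs_R0. nra.
  - intros t x y. rewrite Rabs_R0. split; auto.
  - set (Y := fun x => y (x - x0)).
    assert (hY0 : Y x0 = y0). { unfold Y. rewrite Rminus_diag. exact hy. }
    assert (hYd : forall x, is_derive Y x (g (x, Y x))).
    { intros x. unfold Y.
      replace (g (x, y (x - x0))) with (1 * g (x - x0 + x0, y (x - x0))).
      - apply (is_derive_comp y (fun x => x - x0)); [apply hd|]. auto_derive; auto.
      - rewrite Rmult_1_l. replace (x - x0 + x0) with x by (unfold Rminus; rewrite Rplus_assoc, Rplus_opp_l, Rplus_0_r; reflexivity). reflexivity. }
    clearbody Y. clear hd hy _z y.
    assert (hgr : forall x, Rabs (g (x, Y x)) <= k * Rabs (Y x)).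
    { intros x. unfold g; simpl. rewrite !Rabs_mult. rewrite Rabs_inv.
      assert (Rabs (- (2 / 3)) = 2 / 3) as -> by (rewrite Rabs_Ropp, Rabs_pos_eq; lra).
      assert (h1 := hcxW x). assert (h2 : Rabs (clamp B (Y x)) <= Rabs (Y x)).
      { generalize (clamp_lip B (Y x) 0 hB). rewrite (clamp_id B 0), !Rminus_0_r by lra. auto. }
      assert (h3 : / Rabs (m x (Y x)) <= / mu).
      { apply Rinv_le_contravar; auto. generalize (hm x (Y x)). intros; rewrite Rabs_pos_eq; lra. }
      assert (0 < / Rabs (m x (Y x))).
      { apply Rinv_0_lt_compat. generalize (hm x (Y x)). intros; rewrite Rabs_pos_eq; lra. }
      apply Rle_trans with (2 / 3 * W * Rabs (Y x) * / mu).
      - generalize (Rabs_pos (cx x)) (Rabs_pos (clamp B (Y x))). intros.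
        apply Rmult_le_compat; [|lra| |exact h3].
        + apply Rmult_le_pos; [lra|auto].
        + apply Rmult_le_compat; [lra|auto|lra|exact h2].
      - unfold k, Rdiv. right; ring. }
    assert (hGB : forall x, xl <= x <= xr -> Rabs (Y x) <= B).
    { intros x hx.
      generalize (gronwall_abs Y (fun x => g (x, Y x)) k xl xr x x0 (fun t _ => conj (hYd t) (hgr t)) hx hx0).
      rewrite hY0. intros h. eapply Rle_trans; [exact h|]. unfold B.
      apply Rmult_le_compat_l; [apply Rabs_pos|].
      assert (Rabs (x - x0) <= W) by (apply Rabs_le; unfold W; lra).
      assert (k * Rabs (x - x0) <= k * W) by nra.
      destruct H0 as [h'|h']; [left; now apply exp_increasing|rewrite h'; lra]. }
    assert (nz : forall x, xl <= x <= xr -> Y x <> 0).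
    { intros x hx e. apply hy0. rewrite <- hY0.
      apply (gronwall_zero Y (fun x => g (x, Y x)) k xl xr x0 x (fun t _ => conj (hYd t) (hgr t))); auto. }
    assert (geq : forall x, xl <= x <= xr -> is_derive Y x (- (2 / 3) * x * Y x / Rmax (AA lam x (Y x)) mu)).
    { intros x hx. generalize (hYd x). unfold g, m; simpl. rewrite hcid by auto.
      rewrite clamp_id by (apply Rabs_le_between; auto). auto. }
    assert (Mp : forall x, 0 < Rmax (AA lam x (Y x)) mu).
    { intros x. eapply Rlt_le_trans; [exact hmu|apply Rmax_r]. }
    assert (Hb := graph_bounds_gen Y (fun x => Rmax (AA lam x (Y x)) mu)).
    assert (Hb' : forall x, xl <= x <= xr -> Y x ^ 2 <= Y 0 ^ 2 /\ Y 0 ^ 2 - 2 / 3 * x ^ 2 <= Y x ^ 2 /\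
      r0 / 2 * (Y 0 ^ 2 + x ^ 2) <= AA lam x (Y x)).
    { apply Hb. intros x hx. split; [now apply geq|split; [apply Mp|]]. cbv beta.
      eapply Rle_trans; [exact (AA_ge_y x (Y x) hx)|apply Rmax_l]. }
    (* Along the solution [AA] >= r0/2 Y(0)^2 >= [mu], so the maximum in the denominator is [AA] and
       Y solves the original equation. *)
    exists Y. split; auto. intros x hx. split; [now apply nz|].
    unfold FF. rewrite <- (Rmax_left (AA lam x (Y x)) mu) at 1; [now apply geq|].
    destruct (Hb' x hx) as [_ [_ h]]. destruct (Hb' x0 hx0) as [h' _]. rewrite hY0 in h'.
    unfold mu. generalize (pow2_ge_0 x). nra.
Qed.

(* A first integral of the field for [lam = 0]. *)
Definition HH (x y : R) : R := y * (x ^ 2 + y ^ 2).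

(** The derivative of [HH] along a graph is -2 lam x^4 Y / AA. As x^2 / AA <= 1/r0, it is bounded by
    (2 |lam| / r0) |HH|, a rate that does not depend on the orbit, so C serves all graphs at
    once. *)
Lemma graph_HH : exists C, 1 <= C /\ forall Y x x', graph lam xl xr Y ->
  xl <= x <= xr -> xl <= x' <= xr -> Rabs (HH x (Y x)) <= C * Rabs (HH x' (Y x')).
Proof.
  set (k := 2 * Rabs lam / r0).
  assert (hk : 0 <= k). { unfold k. apply Rdiv_le_0_compat; auto. generalize (Rabs_pos lam); lra. }
  exists (exp (k * (xr - xl))). split.
  { rewrite <- exp_0. assert (0 <= k * (xr - xl)) by nra.
    destruct H as [h|h]; [left; now apply exp_increasing|rewrite <- h; lra]. }
  intros Y x x' hY hx hx'.
  eapply Rle_trans.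
  - apply (gronwall_abs (fun x => HH x (Y x)) (fun x => -2 * lam * x ^ 4 * Y x / AA lam x (Y x)) k xl xr x x'); auto.
    intros t ht. destruct (hY t ht) as [nz hd]. assert (Ap := AA_pos t (Y t) ht nz). split.
    + unfold HH. auto_derive; [side_derive|]. derive_rw hd.
      unfold FF, AA, rr in *. field. lra.
    + unfold Rdiv. rewrite !Rabs_mult, Rabs_inv, (Rabs_pos_eq (AA _ _ _)) by lra.
      assert (h1 := AA_ge_x t (Y t) ht).
      assert (h2 : Rabs (t ^ 4) * / AA lam t (Y t) <= t ^ 2 / r0).
      { rewrite Rabs_pos_eq by (replace (t ^ 4) with ((t ^ 2) ^ 2) by ring; apply pow2_ge_0).
        apply (proj1 (Rle_div_r _ _ _ hr0)). replace (t ^ 4 * / AA lam t (Y t) * r0) with (t ^ 2 * ((r0 * t ^ 2) / AA lam t (Y t))) by (field; lra).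
        apply Rle_trans with (t ^ 2 * 1); [|right; ring]. apply Rmult_le_compat_l; [apply pow2_ge_0|].
        apply (proj2 (Rle_div_l _ _ _ Ap)); lra. }
      unfold HH. rewrite Rabs_mult, (Rabs_pos_eq (t ^ 2 + _)) by (generalize (pow2_ge_0 t) (pow2_ge_0 (Y t)); lra).
      assert (Rabs (-2) = 2) as -> by (rewrite Rabs_left; lra).
      apply Rle_trans with (2 * Rabs lam * Rabs (Y t) * (t ^ 2 / r0)).
      * replace (2 * Rabs lam * Rabs (t ^ 4) * Rabs (Y t) * / AA lam t (Y t))
          with (2 * Rabs lam * Rabs (Y t) * (Rabs (t ^ 4) * / AA lam t (Y t))) by ring.
        apply Rmult_le_compat_l; auto. generalize (Rabs_pos lam) (Rabs_pos (Y t)); nra.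
      * unfold k. apply Rle_trans with (2 * Rabs lam / r0 * (Rabs (Y t) * t ^ 2)); [right; field; lra|].
        apply Rmult_le_compat_l; auto. apply Rmult_le_compat_l; [apply Rabs_pos|].
        generalize (pow2_ge_0 (Y t)); lra.
  - rewrite Rmult_comm. apply Rmult_le_compat_r; [apply Rabs_pos|].
    assert (k * Rabs (x - x') <= k * (xr - xl)).
    { apply Rmult_le_compat_l; auto. apply Rabs_le. lra. }
    destruct H as [h|h]; [left; now apply exp_increasing|rewrite h; lra].
Qed.
End Graphs.

Lemma taylor_lip (f df : R -> R) (M a b : R) :
  (forall x, Rmin a b <= x <= Rmax a b -> is_derive f x (df x) /\ Rabs (df x - df a) <= M * Rabs (x - a)) ->
  0 <= M -> Rabs (f b - f a - df a * (b - a)) <= M * (b - a) ^ 2.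
Proof.
  intros H hM.
  replace (f b - f a - df a * (b - a)) with ((f b - df a * b) - (f a - df a * a)) by ring.
  replace (M * (b - a) ^ 2) with (M * Rabs (b - a) * Rabs (b - a))
    by (rewrite <- (pow2_abs (b - a)); ring).
  apply (deriv_lip (fun x => f x - df a * x) (fun x => df x - df a)). intros x hx.
  destruct (H x hx) as [h1 h2]. split.
  - auto_derive; [side_derive|]. derive_rw h1. ring.
  - eapply Rle_trans; [exact h2|]. apply Rmult_le_compat_l; auto.
    revert hx. unfold Rmin, Rmax. destruct Rle_dec; intros; unfold Rabs; repeat destruct Rcase_abs; lra.
Qed.

(** * Orbits away from the y-axis *)

Section Secants.
Variables lam xl xr r0 b : R.
Hypothesis hl : xl < 0.
Hypothesis hr : 0 < xr.
Hypothesis hr0 : 0 < r0.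
Hypothesis hR : forall x, xl <= x <= xr -> r0 <= rr lam x.
Hypothesis hb : 0 < b.

(** Both sections lie in such a zone. There [AA] >= r0 b^2, so the slope field is bounded and
    Lipschitz, uniformly down to y = 0. *)
Definition away (p : plane) : Prop := xl <= fst p <= xr /\ b <= Rabs (fst p) /\ Rabs (snd p) <= 1.

Lemma bl_fst_away : bounded_lip away dist1 fst.
Proof.
  exists (xr - xl + 1). split; [lra|split].
  - intros p [h _]. apply Rabs_le. lra.
  - intros p q _ _. unfold dist1. generalize (Rabs_pos (fst p - fst q)) (Rabs_pos (snd p - snd q)). nra.
Qed.

Lemma bl_snd_away : bounded_lip away dist1 snd.
Proof.
  exists 1. split; [lra|split].
  - intros p [_ [_ h]]. exact h.
  - intros p q _ _. unfold dist1. generalize (Rabs_pos (fst p - fst q)) (Rabs_pos (snd p - snd q)). nra.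
Qed.

Lemma bl_rr_away : bounded_lip away dist1 (fun p => rr lam (fst p)).
Proof.
  unfold rr. apply bl_minus; [apply bl_const, dist1_pos|].
  apply bl_mult; [apply dist1_pos|apply bl_const, dist1_pos|apply bl_fst_away].
Qed.

Lemma bl_AA_away : bounded_lip away dist1 (fun p => AA lam (fst p) (snd p)).
Proof.
  unfold AA. apply bl_plus; [|apply (bl_pow _ _ dist1_pos snd 2), bl_snd_away].
  apply bl_mult; [apply dist1_pos|apply bl_rr_away|apply (bl_pow _ _ dist1_pos fst 2), bl_fst_away].
Qed.

Lemma AA_away_lower p : away p -> r0 * b ^ 2 <= Rabs (AA lam (fst p) (snd p)).
Proof.
  intros [h1 [h2 h3]].
  assert (h4 := AA_ge_x lam xl xr r0 hR (fst p) (snd p) h1).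
  rewrite Rabs_pos_eq; [|generalize (pow2_ge_0 (fst p)); nra].
  rewrite <- (pow2_abs (fst p)) in h4. assert (b ^ 2 <= Rabs (fst p) ^ 2) by (apply pow_incr; lra). nra.
Qed.

Lemma bl_inv_AA_away : bounded_lip away dist1 (fun p => / AA lam (fst p) (snd p)).
Proof.
  apply (bl_inv away dist1 dist1_pos _ (r0 * b ^ 2)); [|apply AA_away_lower|apply bl_AA_away].
  apply Rmult_lt_0_compat; auto. apply pow_lt; auto.
Qed.

Lemma bl_FF_away : bounded_lip away dist1 (fun p => FF lam (fst p) (snd p)).
Proof.
  unfold FF, Rdiv. apply bl_mult; [apply dist1_pos| |apply bl_inv_AA_away].
  apply bl_mult; [apply dist1_pos| |apply bl_snd_away].
  apply bl_mult; [apply dist1_pos|apply bl_const, dist1_pos|apply bl_fst_away].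
Qed.

Definition same_side (x x' : R) : Prop := (b <= x /\ b <= x') \/ (x <= - b /\ x' <= - b).

(** C is the same for all graphs. This is what allows a graph that itself varies with the parameter
    to be expanded at a moving point. Staying on one side keeps the segment between the two
    abscissas away from x = 0. *)
Lemma graph_secant : exists C, 0 <= C /\ forall Z x x', graph lam xl xr Z -> Rabs (Z 0) <= 1 ->
  xl <= x <= xr -> xl <= x' <= xr -> same_side x x' ->
  Rabs (Z x - Z x') <= C * Rabs (x - x') /\
  Rabs (Z x - Z x' - FF lam x' (Z x') * (x - x')) <= C * (x - x') ^ 2.
Proof.
  destruct bl_FF_away as [M [M0 [M1 M2]]].
  exists (M + M * (1 + M)). split; [nra|]. intros Z x x' hZ hZ0 hx hx' hs.
  assert (hin : forall t, Rmin x' x <= t <= Rmax x' x -> xl <= t <= xr /\ b <= Rabs t).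
  { intros t. unfold Rmin, Rmax. destruct Rle_dec; intros; (split; [lra|]); destruct hs;
      unfold Rabs; destruct Rcase_abs; lra. }
  assert (haw : forall t, Rmin x' x <= t <= Rmax x' x -> away (t, Z t)).
  { intros t ht. destruct (hin t ht). split; [|split]; simpl; auto.
    eapply Rle_trans; [apply (graph_abs_le lam xl xr r0 hl hr hr0 hR Z t hZ); auto|auto]. }
  assert (hlip : forall t, Rmin x' x <= t <= Rmax x' x -> Rabs (Z t - Z x') <= M * Rabs (t - x')).
  { intros t ht. apply (deriv_lip Z (fun t => FF lam t (Z t))). intros r hrr.
    assert (hr' : Rmin x' x <= r <= Rmax x' x).
    { revert ht hrr. unfold Rmin, Rmax. repeat destruct Rle_dec; lra. }
    split; [apply hZ, hin; auto|]. apply (M1 (r, Z r)). now apply haw. }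
  assert (ex : Rmin x' x <= x <= Rmax x' x) by (split; [apply Rmin_r|apply Rmax_r]).
  assert (ex' : Rmin x' x <= x' <= Rmax x' x) by (split; [apply Rmin_l|apply Rmax_l]).
  split.
  - generalize (hlip x ex) (Rabs_pos (x - x')). nra.
  - apply Rle_trans with (M * (1 + M) * (x - x') ^ 2); [|generalize (pow2_ge_0 (x - x')); nra].
    apply (taylor_lip Z (fun t => FF lam t (Z t))); [|nra]. intros t ht. split; [apply hZ, hin; auto|].
    eapply Rle_trans; [apply (M2 (t, Z t) (x', Z x')); apply haw; auto|]. unfold dist1; simpl.
    generalize (hlip t ht) (Rabs_pos (t - x')). nra.
Qed.
End Secants.

(** * The linearised equation along an orbit and its integrating factor *)

Section Kernel.
Variables lam xl xr r0 : R.
Hypothesis hl : xl < 0.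
Hypothesis hr : 0 < xr.
Hypothesis hr0 : 0 < r0.
Hypothesis hR : forall x, xl <= x <= xr -> r0 <= rr lam x.

Definition kk (x y : R) : R := y ^ 2 / (rr lam x * AA lam x y).

Lemma kk_primitive Y : graph lam xl xr Y ->
  exists K, forall x, xl <= x <= xr -> is_derive K x (kk x (Y x)).
Proof.
  intros hY. set (cx := fun x => Rmax xl (Rmin xr x)).
  assert (hcx : forall x, xl <= cx x <= xr).
  { intros x. unfold cx, Rmax, Rmin. repeat destruct Rle_dec; lra. }
  assert (hcid : forall x, xl <= x <= xr -> cx x = x).
  { intros x hx. unfold cx, Rmax, Rmin. repeat destruct Rle_dec; lra. }
  exists (prim (fun x => kk (cx x) (Y (cx x)))). intros x hx.
  rewrite <- (hcid x hx) at 2 3. apply (prim_derive (fun x => kk (cx x) (Y (cx x)))). clear x hx. intros x.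
  apply (continuous_comp cx (fun x => kk x (Y x))).
  - apply (lip_continuous cx 1). intros s. unfold cx, Rmax, Rmin.
    repeat destruct Rle_dec; unfold Rabs; repeat destruct Rcase_abs; lra.
  - destruct (hY (cx x) (hcx x)) as [nz hd].
    assert (Ap := AA_pos lam xl xr r0 hr0 hR (cx x) (Y (cx x)) (hcx x) nz).
    assert (Rp := hR (cx x) (hcx x)).
    apply (@ex_derive_continuous R_AbsRing R_NormedModule).
    unfold kk, AA, rr in *. auto_derive. repeat split; auto; try (eexists; eassumption).
    apply Rgt_not_eq, Rlt_gt, Rmult_lt_0_compat; simpl in *; lra.
Qed.

Lemma kk_bound x y : xl <= x <= xr -> y <> 0 -> 0 <= kk x y <= 1 / r0.
Proof.
  intros hx hy. assert (h1 := hR x hx). assert (h2 := AA_pos lam xl xr r0 hr0 hR x y hx hy).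
  assert (h3 := AA_ge_y lam xl xr r0 hr0 hR x y hx).
  assert (p : 0 < rr lam x * AA lam x y) by nra. unfold kk. split.
  - apply Rdiv_le_0_compat; auto. apply pow2_ge_0.
  - apply (proj2 (Rle_div_l _ _ _ p)).
    apply Rle_trans with (1 / r0 * (r0 * AA lam x y)).
    + replace (1 / r0 * (r0 * AA lam x y)) with (AA lam x y) by (field; lra). auto.
    + apply Rmult_le_compat_l; [apply Rdiv_le_0_compat; lra|]. apply Rmult_le_compat_r; lra.
Qed.

(** The divided difference of [FF] in its second argument, hence its partial derivative on the
    diagonal y = z. With it the difference of two graphs solves a linear equation exactly, without a
    remainder. *)
Definition mm (x y z : R) : R := - (2 / 3) * x * (rr lam x * x ^ 2 - y * z) / (AA lam x y * AA lam x z).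

Lemma FF_sub x y z : xl <= x <= xr -> y <> 0 -> z <> 0 ->
  FF lam x z - FF lam x y = mm x y z * (z - y).
Proof.
  intros hx hy hz. assert (h1 := AA_pos lam xl xr r0 hr0 hR x y hx hy).
  assert (h2 := AA_pos lam xl xr r0 hr0 hR x z hx hz).
  unfold FF, mm, AA in *. field. lra.
Qed.

(** Since |y z| <= (y^2 + z^2) / 2, the numerator is at most half the sum of the two denominators,
    and the quotient is at most the mean of their inverses. *)
Lemma mm_bound x y z mu : xl <= x <= xr -> 0 < mu -> mu <= AA lam x y -> mu <= AA lam x z ->
  Rabs (mm x y z) <= 2 / 3 * (xr - xl) / mu.
Proof.
  intros hx hmu h1 h2. unfold mm.
  set (a := AA lam x y) in *. set (c := AA lam x z) in *.
  assert (h3 : Rabs (rr lam x * x ^ 2 - y * z) <= (a + c) / 2).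
  { assert (0 <= rr lam x * x ^ 2). { generalize (hR x hx) (pow2_ge_0 x). nra. }
    unfold a, c, AA. apply Rabs_le. generalize (pow2_ge_0 (y - z)) (pow2_ge_0 (y + z)). simpl. intros; split; lra. }
  assert (h4 : Rabs x <= xr - xl) by (apply Rabs_le; lra).
  unfold Rdiv at 1. rewrite !Rabs_mult, Rabs_inv, (Rabs_pos_eq (a * c)) by nra.
  assert (Rabs (- (2 / 3)) = 2 / 3) as -> by (rewrite Rabs_Ropp, Rabs_pos_eq; lra).
  apply Rle_trans with (2 / 3 * (xr - xl) * ((a + c) / 2) * / (a * c)).
  - apply Rmult_le_compat_r; [left; apply Rinv_0_lt_compat; nra|].
    generalize (Rabs_pos x) (Rabs_pos (rr lam x * x ^ 2 - y * z)). intros.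
    apply Rmult_le_compat; auto; try lra.
  - replace (2 / 3 * (xr - xl) * ((a + c) / 2) * / (a * c)) with (2 / 3 * (xr - xl) * ((/ a + / c) / 2))
      by (field; lra).
    unfold Rdiv. apply Rmult_le_compat_l; [lra|].
    assert (/ a <= / mu) by (apply Rinv_le_contravar; auto).
    assert (/ c <= / mu) by (apply Rinv_le_contravar; auto). lra.
Qed.

Lemma mm_sub x y z mu : xl <= x <= xr -> 0 < mu -> mu <= AA lam x y -> mu <= AA lam x z ->
  Rabs y <= 1 -> Rabs z <= 1 ->
  Rabs (mm x y z - mm x y y) <=
    2 / 3 * (xr - xl) * (3 * Rabs (rr lam x) * (xr - xl) ^ 2 + 1) / (mu * mu * mu) * Rabs (z - y).
Proof.
  intros hx hmu h1 h2 hy hz.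
  (* Over the common denominator the difference contains the factor z - y; q is the remaining
     polynomial. *)
  set (q := rr lam x * x ^ 2 * (y + z) + y * (rr lam x * x ^ 2 - y * z)).
  assert (E : mm x y z - mm x y y = 2 / 3 * x * q * / (AA lam x y * AA lam x y * AA lam x z) * (z - y)).
  { unfold mm, q, AA in *. field. split; lra. }
  rewrite E, !Rabs_mult.
  apply Rmult_le_compat_r; [apply Rabs_pos|].
  set (a := AA lam x y) in *. set (c := AA lam x z) in *.
  assert (hx' : Rabs x <= xr - xl) by (apply Rabs_le; lra).
  assert (hq : Rabs q <= 3 * Rabs (rr lam x) * (xr - xl) ^ 2 + 1).
  { assert (hx2 : Rabs (x ^ 2) <= (xr - xl) ^ 2).
    { rewrite <- RPow_abs. apply pow_incr. split; [apply Rabs_pos|auto]. }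
    assert (hrx : Rabs (rr lam x * x ^ 2) <= Rabs (rr lam x) * (xr - xl) ^ 2).
    { rewrite Rabs_mult. apply Rmult_le_compat_l; [apply Rabs_pos|auto]. }
    revert hrx. unfold q. generalize (rr lam x * x ^ 2). intros t ht.
    eapply Rle_trans; [apply Rabs_triang|]. rewrite !Rabs_mult.
    generalize (Rabs_triang y z) (Rabs_triang t (- (y * z))). rewrite Rabs_Ropp, Rabs_mult.
    change (t + - (y * z)) with (t - y * z).
    generalize (Rabs_pos y) (Rabs_pos z) (Rabs_pos t) (Rabs_pos (y + z)) (Rabs_pos (t - y * z)). intros.
    assert (Rabs t * Rabs (y + z) <= Rabs t * 2) by (apply Rmult_le_compat_l; lra).
    assert (Rabs y * Rabs z <= 1 * 1) by (apply Rmult_le_compat; lra).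
    assert (Rabs y * Rabs (t - y * z) <= 1 * (Rabs t + 1)) by (apply Rmult_le_compat; lra).
    lra. }
  assert (hmu3 : mu * mu * mu <= a * a * c).
  { apply Rmult_le_compat; try nra. }
  assert (0 < mu * mu * mu) by (apply Rmult_lt_0_compat; nra).
  rewrite Rabs_inv, (Rabs_pos_eq (a * a * c)), (Rabs_pos_eq (2 / 3)) by lra. unfold Rdiv at 2.
  apply Rmult_le_compat; [| | |now apply Rinv_le_contravar].
  - generalize (Rabs_pos x) (Rabs_pos q). intros. apply Rmult_le_pos; lra.
  - left; apply Rinv_0_lt_compat; lra.
  - apply Rmult_le_compat; auto; try lra. generalize (Rabs_pos x); lra. apply Rabs_pos.
Qed.

(** For lam = 0 this is a multiple of the y-derivative of the first integral [HH]. For general lam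
    the logarithmic derivative of [AA] differs from the required - mm by -3 lam x^2 / AA. Writing
    x^2 / AA = 1 / rr - kk, the first part is absorbed by rr^(-3) and the second by the exponential
    of the primitive K of [kk]. *)
Definition weight (K Y : R -> R) (x : R) : R := AA lam x (Y x) / rr lam x ^ 3 * exp (-3 * lam * K x).

(* [weight K Y] solves the equation adjoint to the linearisation [v' = mm x Y Y v] along Y. *)
Lemma weight_derive K Y x : graph lam xl xr Y -> xl <= x <= xr ->
  is_derive K x (kk x (Y x)) ->
  is_derive (weight K Y) x (- mm x (Y x) (Y x) * weight K Y x).
Proof.
  intros hY hx hK. destruct (hY x hx) as [nz hd].
  assert (Ap := AA_pos lam xl xr r0 hr0 hR x (Y x) hx nz).
  assert (Rp := hR x hx).
  unfold weight, mm, kk, FF, AA, rr in *. auto_derive.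
  - repeat split; auto; try (eexists; eassumption). repeat apply Rmult_integral_contrapositive_currified; lra.
  - derive_rw hd. derive_rw hK. unfold Rminus. 
    replace (- (3)) with (-3) by ring. field. unfold Rminus in *. split; lra.
Qed.

Lemma weight_pos K Y x : graph lam xl xr Y -> xl <= x <= xr -> 0 < weight K Y x.
Proof.
  intros hY hx. destruct (hY x hx) as [nz hd].
  assert (Ap := AA_pos lam xl xr r0 hr0 hR x (Y x) hx nz).
  assert (Rp := hR x hx). unfold weight. apply Rmult_lt_0_compat; [|apply exp_pos].
  apply Rdiv_lt_0_compat; auto. apply pow_lt; lra.
Qed.
End Kernel.

(** * Error terms at a fixed parameter *)

Definition bigO (V : R -> Prop) (s : R) (n : nat) (e : R -> R) : Prop :=
  exists C, 0 <= C /\ forall t, V t -> Rabs (e t) <= C * Rabs (t - s) ^ n.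

Section BigO.
Variables (V : R -> Prop) (s : R).
Hypothesis hV : forall t, V t -> Rabs (t - s) <= 1.

Lemma bigO_const c : bigO V s 0 (fun _ => c).
Proof. exists (Rabs c). split; [apply Rabs_pos|]. intros; simpl; lra. Qed.

Lemma bigO_ext n e f : (forall t, V t -> e t = f t) -> bigO V s n e -> bigO V s n f.
Proof. intros H [C [h1 h2]]. exists C. split; auto. intros t ht. rewrite <- H; auto. Qed.

Lemma bigO_plus n e f : bigO V s n e -> bigO V s n f -> bigO V s n (fun t => e t + f t).
Proof.
  intros [C [h1 h2]] [D [k1 k2]]. exists (C + D). split; [lra|]. intros t ht.
  eapply Rle_trans; [apply Rabs_triang|]. generalize (h2 t ht) (k2 t ht). lra.
Qed.

Lemma bigO_opp n e : bigO V s n e -> bigO V s n (fun t => - e t).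
Proof. intros [C [h1 h2]]. exists C. split; auto. intros t ht. rewrite Rabs_Ropp; auto. Qed.

Lemma bigO_minus n e f : bigO V s n e -> bigO V s n f -> bigO V s n (fun t => e t - f t).
Proof. intros. apply bigO_plus; auto. now apply bigO_opp. Qed.

Lemma bigO_mult n m e f : bigO V s n e -> bigO V s m f -> bigO V s (n + m) (fun t => e t * f t).
Proof.
  intros [C [h1 h2]] [D [k1 k2]]. exists (C * D). split; [nra|]. intros t ht.
  rewrite Rabs_mult, pow_add.
  replace (C * D * (Rabs (t - s) ^ n * Rabs (t - s) ^ m)) with
    ((C * Rabs (t - s) ^ n) * (D * Rabs (t - s) ^ m)) by ring.
  apply Rmult_le_compat; auto using Rabs_pos.
Qed.

Lemma bigO_scal n c e : bigO V s n e -> bigO V s n (fun t => c * e t).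
Proof. intros h. apply (bigO_mult 0 n (fun _ => c) e); auto. apply bigO_const. Qed.

Lemma bigO_le n C e f : 0 <= C -> (forall t, V t -> Rabs (e t) <= C * Rabs (f t)) ->
  bigO V s n f -> bigO V s n e.
Proof.
  intros hC H [D [k1 k2]]. exists (C * D). split; [nra|]. intros t ht.
  eapply Rle_trans; [now apply H|]. rewrite Rmult_assoc. apply Rmult_le_compat_l; auto.
Qed.

Lemma bigO_down e : bigO V s 2 e -> bigO V s 1 e.
Proof.
  intros [C [h1 h2]]. exists C. split; auto. intros t ht. eapply Rle_trans; [now apply h2|].
  apply Rmult_le_compat_l; auto. generalize (hV t ht) (Rabs_pos (t - s)). simpl. nra.
Qed.

Lemma bigO_id : bigO V s 1 (fun t => t - s).
Proof. exists 1. split; [lra|]. intros; simpl; lra. Qed.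

Lemma bigO_2_derive (f : R -> R) l : locally s V ->
  bigO V s 2 (fun t => f t - f s - l * (t - s)) -> is_derive f s l.
Proof.
  intros [d hd] [C [h1 h2]]. apply is_derive_Reals. intros e he.
  assert (h0 : 0 < Rmin d (e / (C + 1))).
  { apply Rmin_glb_lt; [apply cond_pos|]. apply Rdiv_lt_0_compat; lra. }
  exists (mkposreal _ h0). intros h hh hlt. simpl in hlt.
  assert (a1 : Rabs h < d) by (eapply Rlt_le_trans; [exact hlt|apply Rmin_l]).
  assert (a2 : Rabs h < e / (C + 1)) by (eapply Rlt_le_trans; [exact hlt|apply Rmin_r]).
  assert (hv : V (s + h)).
  { apply hd. change (Rabs (s + h - s) < d). replace (s + h - s) with h by ring. auto. }
  specialize (h2 (s + h) hv). replace (s + h - s) with h in h2 by ring.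
  replace ((f (s + h) - f s) / h - l) with ((f (s + h) - f s - l * h) / h) by (field; auto).
  unfold Rdiv. rewrite Rabs_mult, Rabs_inv.
  assert (p : 0 < Rabs h) by now apply Rabs_pos_lt.
  apply Rle_lt_trans with (C * Rabs h).
  - apply (Rmult_le_reg_r (Rabs h)); auto. rewrite Rmult_assoc, Rinv_l by lra. simpl in h2. lra.
  - apply (Rmult_lt_compat_r (C + 1)) in a2; [|lra]. unfold Rdiv in a2.
    rewrite Rmult_assoc, Rinv_l in a2 by lra. nra.
Qed.
End BigO.

(** The cube root of |t|. Zero is treated apart because [Rpower] has the value 1 at base 0. *)
Definition cr (t : R) : R := if Req_EM_T t 0 then 0 else Rpower (Rabs t) (1 / 3).

Lemma cr_0 : cr 0 = 0.
Proof. unfold cr. destruct Req_EM_T; lra. Qed.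

Lemma cr_nz t : t <> 0 -> cr t = Rpower (Rabs t) (1 / 3).
Proof. intros h. unfold cr. destruct Req_EM_T; [lra|auto]. Qed.

Lemma cr_pos t : 0 <= cr t.
Proof. unfold cr. destruct Req_EM_T; [lra|]. left; apply exp_pos. Qed.

Lemma cr_gt0 t : t <> 0 -> 0 < cr t.
Proof. intros h. rewrite cr_nz by auto. apply exp_pos. Qed.

Lemma cr_cube t : cr t ^ 3 = Rabs t.
Proof.
  destruct (Req_dec t 0) as [e|h].
  - subst. rewrite cr_0, Rabs_R0. ring.
  - rewrite cr_nz by auto. rewrite <- Rpower_pow by apply exp_pos. rewrite Rpower_mult.
    replace (1 / 3 * INR 3) with 1 by (simpl; field). apply Rpower_1. now apply Rabs_pos_lt.
Qed.

(** Inequalities for [cr] are proved by passing to cubes, where [cr_cube] removes the root. *)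
Lemma cube_le x y : 0 <= y -> x ^ 3 <= y ^ 3 -> x <= y.
Proof.
  intros hy h. destruct (Rle_or_lt x y) as [l|l]; auto. exfalso.
  assert (0 < (x - y) * (x * x + x * y + y * y)). { apply Rmult_lt_0_compat; nra. } simpl in h. nra.
Qed.

Lemma cr_le s t : Rabs s <= Rabs t -> cr s <= cr t.
Proof. intros h. apply cube_le; [apply cr_pos|]. now rewrite !cr_cube. Qed.

Lemma cr_le_of_cube x C t : 1 <= C -> x ^ 3 <= C * Rabs t -> x <= C * cr t.
Proof.
  intros hC h. assert (p := cr_pos t). apply cube_le; [nra|].
  replace ((C * cr t) ^ 3) with (C ^ 3 * cr t ^ 3) by ring. rewrite cr_cube.
  eapply Rle_trans; [exact h|]. apply Rmult_le_compat_r; [apply Rabs_pos|].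
  assert (1 <= C * C) by nra. simpl. nra.
Qed.

Lemma cr_ge_of_cube x c t : 0 <= x -> 0 <= c <= 1 -> c * Rabs t <= x ^ 3 -> c * cr t <= x.
Proof.
  intros hx hc h. apply cube_le; auto.
  replace ((c * cr t) ^ 3) with (c ^ 3 * cr t ^ 3) by ring. rewrite cr_cube.
  eapply Rle_trans; [|exact h]. apply Rmult_le_compat_r; [apply Rabs_pos|].
  assert (c * c <= 1) by nra. simpl. nra.
Qed.

Lemma cr_ge_id t : Rabs t <= 1 -> Rabs t <= cr t.
Proof.
  intros h. rewrite <- (Rmult_1_l (cr t)). apply cr_le_of_cube; [lra|].
  generalize (Rabs_pos t). simpl. intros. assert (Rabs t * Rabs t <= 1) by nra. nra.
Qed.

Lemma FF_0 lam x : FF lam x 0 = 0.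
Proof. unfold FF, Rdiv. ring. Qed.

(** The function B / (a^2 + x^2) is the majorant of the integrands concentrated on |x| <= a. Its
    integral over any interval is at most pi B / a, however small a is. *)
Lemma atan_scale_derive B a x : 0 < a -> is_derive (fun x => B / a * atan (x / a)) x (B / (a ^ 2 + x ^ 2)).
Proof.
  intros ha. assert (h : 0 < a ^ 2 + x ^ 2) by (generalize (pow_lt a 2 ha) (pow2_ge_0 x); lra).
  auto_derive; [lra|]. unfold Rsqr. field. split; apply Rgt_not_eq; assumption.
Qed.

Lemma atan_osc u v : atan u - atan v <= PI.
Proof. generalize (atan_bound u) (atan_bound v). lra. Qed.

Lemma graph_sign lam xl xr Y x x' : graph lam xl xr Y -> xl <= x <= xr -> xl <= x' <= xr -> 0 < Y x * Y x'.
Proof.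
  intros hY hx hx'. destruct (hY x hx) as [n1 _]. destruct (hY x' hx') as [n2 _].
  destruct (Rlt_or_le 0 (Y x * Y x')) as [h|h]; auto. exfalso.
  assert (K : forall u v, xl <= u -> u <= v -> v <= xr -> (Y u <= 0 <= Y v \/ Y v <= 0 <= Y u) -> False).
  { intros u v h1 h2 h3 h4. destruct (IVT_le Y u v 0 h2) as [z [hz E]]; auto.
    - intros t ht. destruct (hY t ltac:(lra)) as [_ d]. eapply is_derive_cont; exact d.
    - destruct (hY z ltac:(lra)). auto. }
  assert (h' : Y x <= 0 <= Y x' \/ Y x' <= 0 <= Y x).
  { destruct (Rle_or_lt (Y x) 0), (Rle_or_lt (Y x') 0); try lra; exfalso; [|nra].
    assert (0 < (- Y x) * (- Y x')) by (apply Rmult_lt_0_compat; lra). lra. }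
  destruct (Rle_or_lt x x'); [apply (K x x'); lra|apply (K x' x); lra].
Qed.

Lemma bl_comp2 {T} (S : T -> Prop) d (S2 : plane -> Prop) g u v : (forall p q, 0 <= d p q) ->
  bounded_lip S2 dist1 g -> bounded_lip S d u -> bounded_lip S d v ->
  (forall p, S p -> S2 (u p, v p)) -> bounded_lip S d (fun p => g (u p, v p)).
Proof.
  intros hd [M [M0 [M1 M2]]] [N [N0 [N1 N2]]] [P [P0 [P1 P2]]] h. exists (M + M * (N + P)).
  assert (0 <= M * (N + P)) by nra. split; [lra|split].
  - intros p hp. generalize (M1 _ (h p hp)). lra.
  - intros p q hp hq. eapply Rle_trans; [apply M2; auto|]. unfold dist1; simpl.
    generalize (N2 p q hp hq) (P2 p q hp hq) (hd p q). intros.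
    apply Rle_trans with (M * (N * d p q + P * d p q)); [apply Rmult_le_compat_l; lra|nra].
Qed.

Lemma bl_comp1 {T} (S : T -> Prop) d (S1 : R -> Prop) g u : (forall p q, 0 <= d p q) ->
  bounded_lip S1 (fun s t => Rabs (s - t)) g -> bounded_lip S d u ->
  (forall p, S p -> S1 (u p)) -> bounded_lip S d (fun p => g (u p)).
Proof.
  intros hd [M [M0 [M1 M2]]] [N [N0 [N1 N2]]] h. exists (M + M * N).
  assert (0 <= M * N) by nra. split; [lra|split].
  - intros p hp. generalize (M1 _ (h p hp)). lra.
  - intros p q hp hq. eapply Rle_trans; [apply M2; auto|].
    generalize (N2 p q hp hq) (hd p q). intros.
    apply Rle_trans with (M * (N * d p q)); [apply Rmult_le_compat_l; lra|nra].
Qed.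

(** * The transition map *)

(* [s] parametrises the ingoing section by [(c1 s, c2 s)]; the outgoing section is
   [al x + be y = 0] near [(x1, 0)].  The orbit through [(c1 s, c2 s)] is the graph of [Yf s],
   it leaves at [(f1 s, f2 s)], and [Kf s] is a primitive of [kk] along it. *)
Section Transition.
Variables lam xl xr r0 b rho x1 eps m0 m1 M1 : R.
Variables c1 c2 dc1 dc2 al be dal dbe f1 f2 : R -> R.
Variables Yf Kf : R -> R -> R.
Hypothesis hl : xl < 0.
Hypothesis hr : 0 < xr.
Hypothesis hr0 : 0 < r0.
Hypothesis hR : forall x, xl <= x <= xr -> r0 <= rr lam x.
Hypothesis hb : 0 < b.
Hypothesis heps : 0 < eps <= 1 / 2.
Hypothesis hm0 : 0 < m0.
Hypothesis hm1 : 0 < m1.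
Hypothesis hrho : 0 < rho <= 1.
Hypothesis hx1 : xl <= x1 - rho /\ x1 + rho <= - b.
Hypothesis hc : forall s, Rabs s < eps -> is_derive c1 s (dc1 s) /\ is_derive c2 s (dc2 s).
Let dR (s t : R) := Rabs (s - t).
Let dom (s : R) := Rabs s < eps.
Hypothesis hdc : bounded_lip dom dR dc1 /\ bounded_lip dom dR dc2.
Hypothesis hcx : forall s, Rabs s < eps -> b <= c1 s <= xr /\ Rabs (c2 s) <= 1.
Hypothesis hc2 : forall s, Rabs s < eps -> m1 * Rabs s <= Rabs (c2 s) <= M1 * Rabs s.
Hypothesis hal : forall x, Rabs (x - x1) <= rho -> is_derive al x (dal x).
Hypothesis hbe : forall y, Rabs y <= rho -> is_derive be y (dbe y).
Hypothesis hdal : bounded_lip (fun x => Rabs (x - x1) <= rho) dR dal.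
Hypothesis hdbe : bounded_lip (fun y => Rabs y <= rho) dR dbe.
Hypothesis hD : forall x x' y y', Rabs (x - x1) <= rho -> Rabs (x' - x1) <= rho ->
  Rabs y <= rho -> Rabs y' <= rho -> m0 <= Rabs (dal x + FF lam x' y' * dbe y).
Hypothesis hY : forall s, 0 < Rabs s < eps ->
  graph lam xl xr (Yf s) /\ Yf s (c1 s) = c2 s /\ Yf s (f1 s) = f2 s /\
  Rabs (f1 s - x1) <= rho /\ Rabs (Yf s 0) <= rho /\ al (f1 s) + be (f2 s) = 0 /\
  (forall x, xl <= x <= xr -> is_derive (Kf s) x (kk lam x (Yf s x))).

Lemma dR_pos s t : 0 <= dR s t.
Proof. apply Rabs_pos. Qed.

Lemma c_range s : Rabs s < eps -> xl <= c1 s <= xr.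
Proof. intros h. destruct (hcx s h). lra. Qed.

Lemma f_range s : 0 < Rabs s < eps -> xl <= f1 s <= xr /\ f1 s <= - b.
Proof.
  intros h. destruct (hY s h) as [_ [_ [_ [h1 _]]]]. apply Rabs_le_between in h1. lra.
Qed.

Lemma f2_small s : 0 < Rabs s < eps -> Rabs (f2 s) <= Rabs (Yf s 0).
Proof.
  intros h. destruct (hY s h) as [h1 [_ [h2 _]]]. rewrite <- h2.
  apply (graph_abs_le lam xl xr r0); auto. now apply f_range.
Qed.

Lemma c_taylor : exists M, 0 <= M /\ forall s t, Rabs s < eps -> Rabs t < eps ->
  Rabs (c1 t - c1 s) <= M * Rabs (t - s) /\ Rabs (c2 t - c2 s) <= M * Rabs (t - s) /\
  Rabs (c1 t - c1 s - dc1 s * (t - s)) <= M * (t - s) ^ 2 /\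
  Rabs (c2 t - c2 s - dc2 s * (t - s)) <= M * (t - s) ^ 2.
Proof.
  destruct hdc as [[M [M0 [M1' M2]]] [N [N0 [N1 N2]]]]. exists (M + N). split; [lra|].
  intros s t hs ht.
  assert (hin : forall x, Rmin s t <= x <= Rmax s t -> Rabs x < eps).
  { intros x. apply Rabs_def2 in hs. apply Rabs_def2 in ht.
    unfold Rmin, Rmax; destruct Rle_dec; intros; apply Rabs_def1; lra. }
  assert (A1 : Rabs (c1 t - c1 s) <= M * Rabs (t - s)).
  { apply (deriv_lip c1 dc1). intros x hx. split; [apply hc|apply M1']; apply hin; auto. }
  assert (A2 : Rabs (c2 t - c2 s) <= N * Rabs (t - s)).
  { apply (deriv_lip c2 dc2). intros x hx. split; [apply hc|apply N1]; apply hin; auto. }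
  assert (A3 : Rabs (c1 t - c1 s - dc1 s * (t - s)) <= M * (t - s) ^ 2).
  { apply (taylor_lip c1 dc1); auto. intros x hx. split; [apply hc|apply M2]; auto; now apply hin. }
  assert (A4 : Rabs (c2 t - c2 s - dc2 s * (t - s)) <= N * (t - s) ^ 2).
  { apply (taylor_lip c2 dc2); auto. intros x hx. split; [apply hc|apply N2]; auto; now apply hin. }
  generalize (Rabs_pos (t - s)) (pow2_ge_0 (t - s)). repeat split; nra.
Qed.

Lemma section_taylor : exists M, 0 <= M /\ forall x x' y y',
  Rabs (x - x1) <= rho -> Rabs (x' - x1) <= rho -> Rabs y <= rho -> Rabs y' <= rho ->
  Rabs (al x' - al x - dal x * (x' - x)) <= M * (x' - x) ^ 2 /\
  Rabs (be y' - be y - dbe y * (y' - y)) <= M * (y' - y) ^ 2.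
Proof.
  destruct hdal as [M [M0 [M1' M2]]]. destruct hdbe as [N [N0 [N1 N2]]]. exists (M + N). split; [lra|].
  intros x x' y y' hx hx' hy hy'.
  apply Rabs_le_between in hx. apply Rabs_le_between in hx'.
  apply Rabs_le_between in hy. apply Rabs_le_between in hy'.
  assert (A1 : Rabs (al x' - al x - dal x * (x' - x)) <= M * (x' - x) ^ 2).
  { apply (taylor_lip al dal); auto. intros z hz.
    assert (Rabs (z - x1) <= rho).
    { apply Rabs_le. revert hz. unfold Rmin, Rmax; destruct Rle_dec; lra. }
    split; [now apply hal|apply M2; auto; apply Rabs_le; lra]. }
  assert (A2 : Rabs (be y' - be y - dbe y * (y' - y)) <= N * (y' - y) ^ 2).
  { apply (taylor_lip be dbe); auto. intros z hz.
    assert (Rabs z <= rho).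
    { apply Rabs_le. revert hz. unfold Rmin, Rmax; destruct Rle_dec; lra. }
    split; [now apply hbe|apply N2; auto; apply Rabs_le; lra]. }
  generalize (pow2_ge_0 (x' - x)) (pow2_ge_0 (y' - y)). split; nra.
Qed.

(* Secant slopes instead of tangents make this bound free of any smallness assumption. *)
Lemma exit_increment : exists M, 0 <= M /\ forall s t, 0 < Rabs s < eps -> 0 < Rabs t < eps ->
  Rabs (f1 t - f1 s) <= M * Rabs (Yf t (f1 s) - f2 s) /\
  Rabs (f2 t - f2 s) <= M * Rabs (Yf t (f1 s) - f2 s).
Proof.
  destruct (bl_FF_away lam xl xr r0 b hl hr hr0 hR hb) as [N [N0 [N1 _]]].
  destruct hdbe as [M [M0 [M1' _]]].
  exists (M / m0 + 1 + N * (M / m0)).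
  assert (0 <= M / m0) by (apply Rdiv_le_0_compat; auto). split; [nra|].
  intros s t hs ht.
  destruct (hY s hs) as [s1 [s2 [s3 [s4 [s5 [s6 _]]]]]].
  destruct (hY t ht) as [t1 [t2 [t3 [t4 [t5 [t6 _]]]]]].
  assert (fs := f_range s hs). assert (ft := f_range t ht).
  assert (f2s := f2_small s hs). assert (f2t := f2_small t ht).
  destruct (MVT_any (Yf t) (fun x => FF lam x (Yf t x)) (f1 s) (f1 t)) as [xi [hxi E1]].
  { intros x hx. apply t1. revert hx. unfold Rmin, Rmax; destruct Rle_dec; lra. }
  destruct (MVT_any al dal (f1 s) (f1 t)) as [z1 [hz1 E2]].
  { intros x hx. apply hal. apply Rabs_le. apply Rabs_le_between in s4, t4.
    revert hx. unfold Rmin, Rmax; destruct Rle_dec; lra. }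
  destruct (MVT_any be dbe (f2 s) (f2 t)) as [z2 [hz2 E3]].
  { intros x hx. apply hbe. apply Rabs_le. 
    assert (g1 : Rabs (f2 s) <= rho) by lra. assert (g2 : Rabs (f2 t) <= rho) by lra.
    apply Rabs_le_between in g1, g2. revert hx. unfold Rmin, Rmax; destruct Rle_dec; lra. }
  assert (hxi' : Rabs (xi - x1) <= rho).
  { apply Rabs_le. apply Rabs_le_between in s4, t4. revert hxi. unfold Rmin, Rmax; destruct Rle_dec; lra. }
  assert (hz1' : Rabs (z1 - x1) <= rho).
  { apply Rabs_le. apply Rabs_le_between in s4, t4. revert hz1. unfold Rmin, Rmax; destruct Rle_dec; lra. }
  assert (hz2' : Rabs z2 <= rho).
  { apply Rabs_le. 
    assert (g1 : Rabs (f2 s) <= rho) by lra. assert (g2 : Rabs (f2 t) <= rho) by lra.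
    apply Rabs_le_between in g1, g2. revert hz2. unfold Rmin, Rmax; destruct Rle_dec; lra. }
  assert (hxr : xl <= xi <= xr) by (apply Rabs_le_between in hxi'; lra).
  assert (hYxi : Rabs (Yf t xi) <= rho).
  { eapply Rle_trans; [apply (graph_abs_le lam xl xr r0); auto|auto]. }
  (* The mean values of al, be and of the graph are attained at three unrelated points, which is why
     [hD] asks for transversality at independent arguments. As both exit points lie on the section,
     the increments of al and be add up to 0. *)
  set (D := dal z1 + FF lam xi (Yf t xi) * dbe z2).
  assert (hDm : m0 <= Rabs D) by (apply hD; auto).
  set (e := Yf t (f1 s) - f2 s).
  assert (R1 : f2 t - f2 s = e + FF lam xi (Yf t xi) * (f1 t - f1 s)).
  { cbv beta in E1. unfold e. rewrite <- t3. lra. }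
  assert (R2 : D * (f1 t - f1 s) = - dbe z2 * e).
  { unfold D. assert (dal z1 * (f1 t - f1 s) + dbe z2 * (f2 t - f2 s) = 0) by lra.
    rewrite R1 in H0. lra. }
  assert (B1 : Rabs (f1 t - f1 s) <= M / m0 * Rabs e).
  { apply (Rmult_le_reg_l m0); auto. replace (m0 * (M / m0 * Rabs e)) with (M * Rabs e) by (field; lra).
    apply Rle_trans with (Rabs D * Rabs (f1 t - f1 s)).
    - apply Rmult_le_compat_r; [apply Rabs_pos|auto].
    - rewrite <- Rabs_mult, R2, Rabs_mult, Rabs_Ropp. apply Rmult_le_compat_r; [apply Rabs_pos|auto]. }
  assert (hF : Rabs (FF lam xi (Yf t xi)) <= N).
  { apply (N1 (xi, Yf t xi)). split; [|split]; simpl; auto; [|lra].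
    apply Rabs_le_between in hxi'. rewrite Rabs_left1; lra. }
  generalize (Rabs_pos e). intros he.
  assert (hNM : 0 <= N * (M / m0)) by now apply Rmult_le_pos.
  split.
  { eapply Rle_trans; [exact B1|]. apply Rmult_le_compat_r; lra. }
  rewrite R1. eapply Rle_trans; [apply Rabs_triang|]. rewrite Rabs_mult.
  assert (Rabs (FF lam xi (Yf t xi)) * Rabs (f1 t - f1 s) <= N * (M / m0 * Rabs e)).
  { apply Rmult_le_compat; auto using Rabs_pos. }
  fold e in H0 |- *. replace ((M / m0 + 1 + N * (M / m0)) * Rabs e) with
    (Rabs e + N * (M / m0 * Rabs e) + M / m0 * Rabs e) by ring.
  assert (0 <= M / m0 * Rabs e) by now apply Rmult_le_pos. lra.
Qed.

(** The derivative in x of the section function al + be along the orbit at its exit; it is nonzero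
    by transversality. *)
Definition slope (s : R) : R := dal (f1 s) + FF lam (f1 s) (f2 s) * dbe (f2 s).
(** The s-derivative of the height at which the orbit crosses the fixed vertical line through the
    exit point. The last factor is the same derivative at the fixed entry abscissa; the quotient of
    weights transports it along the orbit. *)
Definition stretch (s : R) : R :=
  weight lam (Kf s) (Yf s) (c1 s) / weight lam (Kf s) (Yf s) (f1 s) *
  (dc2 s - FF lam (c1 s) (c2 s) * dc1 s).

Section AtPoint.
Variable s : R.
Hypothesis hs : 0 < Rabs s < eps.
(** Parameters kept away from 0, so that [AA] has a positive lower bound on all the orbits
    concerned. The constants depend on s and may blow up as s tends to 0, which is harmless since
    only the derivative at s is sought here. *)
Let V (t : R) := 0 < Rabs t < eps /\ Rabs s / 2 <= Rabs t.

Lemma V_self : V s.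
Proof. split; auto. lra. Qed.

Lemma V_le1 t : V t -> Rabs (t - s) <= 1.
Proof.
  intros [h _]. generalize (Rabs_triang t (- s)). rewrite Rabs_Ropp. unfold Rminus. lra.
Qed.

Lemma V_locally : locally s V.
Proof.
  assert (h : 0 < Rmin (Rabs s / 2) (eps - Rabs s)) by (apply Rmin_glb_lt; lra).
  exists (mkposreal _ h). intros t ht. change (Rabs (t - s) < Rmin (Rabs s / 2) (eps - Rabs s)) in ht.
  assert (h1 := Rlt_le_trans _ _ _ ht (Rmin_l _ _)). assert (h2 := Rlt_le_trans _ _ _ ht (Rmin_r _ _)).
  generalize (Rabs_triang_inv2 t s) (Rabs_triang_inv t s) (Rabs_triang_inv s t). rewrite (Rabs_minus_sym s t).
  intros. split; lra.
Qed.

Lemma AA_lower_near : exists mu, 0 < mu /\ forall t x, V t -> xl <= x <= xr -> mu <= AA lam x (Yf t x).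
Proof.
  exists (r0 / 2 * (m1 * (Rabs s / 2)) ^ 2). split.
  { apply Rmult_lt_0_compat; [lra|]. apply pow_lt. apply Rmult_lt_0_compat; lra. }
  intros t x [ht ht2] hx. destruct (hY t ht) as [g [e _]].
  assert (Bd := graph_bounds lam xl xr r0 hl hr hr0 hR (Yf t) x g hx). destruct Bd as [_ [_ B3]].
  eapply Rle_trans; [|exact B3]. apply Rmult_le_compat_l; [lra|].
  apply Rle_trans with (Yf t 0 ^ 2); [|generalize (pow2_ge_0 x); lra].
  rewrite <- (pow2_abs (Yf t 0)). apply pow_incr. split; [nra|].
  apply Rle_trans with (m1 * Rabs t); [apply Rmult_le_compat_l; lra|].
  eapply Rle_trans; [apply hc2; lra|]. rewrite <- e. apply (graph_abs_le lam xl xr r0); auto.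
  apply c_range; lra.
Qed.

Lemma diff_derive t x : V t -> xl <= x <= xr ->
  is_derive (fun x => Yf t x - Yf s x) x (mm lam x (Yf s x) (Yf t x) * (Yf t x - Yf s x)).
Proof.
  intros [ht _] hx. destruct (hY t ht) as [g _]. destruct (hY s hs) as [g' _].
  destruct (g x hx) as [n1 d1]. destruct (g' x hx) as [n2 d2].
  rewrite <- (FF_sub lam xl xr r0) by auto. exact (is_derive_minus _ _ _ _ _ d1 d2).
Qed.

Lemma diff_bound : exists C, 0 <= C /\ forall t x, V t -> xl <= x <= xr ->
  Rabs (Yf t x - Yf s x) <= C * Rabs (Yf t (c1 s) - c2 s).
Proof.
  destruct AA_lower_near as [mu [hmu Hmu]].
  set (k := 2 / 3 * (xr - xl) / mu).
  assert (hk : 0 <= k) by (unfold k; apply Rdiv_le_0_compat; lra).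
  exists (exp (k * (xr - xl))). split; [left; apply exp_pos|]. intros t x ht hx.
  destruct (hY s hs) as [_ [e _]]. rewrite <- e.
  assert (hcs : xl <= c1 s <= xr) by (apply c_range; lra).
  eapply Rle_trans.
  - apply (gronwall_abs (fun x => Yf t x - Yf s x)
      (fun x => mm lam x (Yf s x) (Yf t x) * (Yf t x - Yf s x)) k xl xr x (c1 s)); auto.
    intros z hz. split; [now apply diff_derive|]. rewrite Rabs_mult.
    apply Rmult_le_compat_r; [apply Rabs_pos|].
    apply (mm_bound lam xl xr r0); auto. apply Hmu; auto using V_self.
  - rewrite Rmult_comm. apply Rmult_le_compat_r; [apply Rabs_pos|].
    assert (h : k * Rabs (x - c1 s) <= k * (xr - xl)).
    { apply Rmult_le_compat_l; auto. apply Rabs_le. lra. }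
    destruct h as [h|h]; [left; now apply exp_increasing|rewrite h; lra].
Qed.

(** The weighted difference of the two graphs has a derivative proportional to mm(Ys, Yt) - mm(Ys,
    Ys), so it is quadratic in the difference. Hence to first order the weighted difference is the
    same at entry and at exit. *)
Lemma weighted_diff : exists C, 0 <= C /\ forall t, V t ->
  Rabs (weight lam (Kf s) (Yf s) (f1 s) * (Yf t (f1 s) - f2 s) -
        weight lam (Kf s) (Yf s) (c1 s) * (Yf t (c1 s) - c2 s))
   <= C * Rabs (Yf t (c1 s) - c2 s) ^ 2.
Proof.
  destruct AA_lower_near as [mu [hmu Hmu]].
  destruct diff_bound as [C [hC HC]].
  destruct (hY s hs) as [g [e1 [e2 [hf [ha [_ hK]]]]]].
  set (w := weight lam (Kf s) (Yf s)).
  assert (hw : forall x, xl <= x <= xr -> is_derive w x (- mm lam x (Yf s x) (Yf s x) * w x)).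
  { intros x hx. apply (weight_derive lam xl xr r0); auto. }
  destruct (cont_bounded w xl xr) as [W [hW HW]].
  { intros x hx. eapply is_derive_cont. now apply hw. }
  destruct (cont_bounded (rr lam) xl xr) as [P [hP HP]].
  { intros x hx. apply (is_derive_cont _ _ (- lam)). unfold rr. auto_derive; auto; ring. }
  set (Q := 2 / 3 * (xr - xl) * (3 * P * (xr - xl) ^ 2 + 1) / (mu * mu * mu)).
  assert (hmu3 : 0 < mu * mu * mu) by (apply Rmult_lt_0_compat; nra).
  assert (hQ : 0 <= Q).
  { unfold Q. apply Rdiv_le_0_compat; auto. generalize (pow2_ge_0 (xr - xl)). intros.
    apply Rmult_le_pos; nra. }
  exists (W * (C * C) * Q * (xr - xl)). split.
  { apply Rmult_le_pos; [|lra]. apply Rmult_le_pos; auto. apply Rmult_le_pos; nra. }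
  intros t ht. rewrite <- e1, <- e2.
  assert (hcs : xl <= c1 s <= xr) by (apply c_range; lra).
  assert (hfs := proj1 (f_range s hs)).
  set (del := Rabs (Yf t (c1 s) - c2 s)).
  apply Rle_trans with (W * (C * C) * Q * del ^ 2 * Rabs (f1 s - c1 s)).
  2:{ rewrite e1. fold del. assert (Rabs (f1 s - c1 s) <= xr - xl) by (apply Rabs_le; lra).
      assert (0 <= W * (C * C) * Q * del ^ 2).
      { apply Rmult_le_pos; [|apply pow2_ge_0]. apply Rmult_le_pos; auto. apply Rmult_le_pos; nra. }
      nra. }
  apply (deriv_lip (fun x => w x * (Yf t x - Yf s x))
    (fun x => w x * (Yf t x - Yf s x) * (mm lam x (Yf s x) (Yf t x) - mm lam x (Yf s x) (Yf s x)))).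
  intros x hx.
  assert (hxI : xl <= x <= xr) by (revert hx; unfold Rmin, Rmax; destruct Rle_dec; lra).
  split.
  - assert (d1 := hw x hxI). assert (d2 := diff_derive t x ht hxI).
    replace (w x * (Yf t x - Yf s x) * (mm lam x (Yf s x) (Yf t x) - mm lam x (Yf s x) (Yf s x)))
      with (- mm lam x (Yf s x) (Yf s x) * w x * (Yf t x - Yf s x)
         + w x * (mm lam x (Yf s x) (Yf t x) * (Yf t x - Yf s x))) by ring.
    exact (is_derive_mult w (fun x => Yf t x - Yf s x) x _ _ d1 d2 Rmult_comm).
  - assert (hd := HC t x ht hxI). fold del in hd.
    assert (hq : Rabs (mm lam x (Yf s x) (Yf t x) - mm lam x (Yf s x) (Yf s x)) <= Q * (C * del)).
    { destruct ht as [ht ht']. destruct (hY t ht) as [gt [_ [_ [_ [hat _]]]]].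
      eapply Rle_trans; [apply (mm_sub lam xl xr hl hr x (Yf s x) (Yf t x) mu); auto|].
      - apply Hmu; auto using V_self.
      - apply Hmu; auto. now split.
      - eapply Rle_trans; [apply (graph_abs_le lam xl xr r0); auto|lra].
      - eapply Rle_trans; [apply (graph_abs_le lam xl xr r0); auto|lra].
      - apply Rmult_le_compat; auto using Rabs_pos.
        + apply Rdiv_le_0_compat; auto. generalize (pow2_ge_0 (xr - xl)) (Rabs_pos (rr lam x)). intros.
          apply Rmult_le_pos; nra.
        + unfold Q, Rdiv. apply Rmult_le_compat_r; [left; now apply Rinv_0_lt_compat|].
          apply Rmult_le_compat_l; [lra|]. generalize (HP x hxI) (pow2_ge_0 (xr - xl)). nra. }
    rewrite !Rabs_mult.
    assert (hdel : 0 <= del) by apply Rabs_pos.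
    apply Rle_trans with (W * (C * del) * (Q * (C * del))); [|right; ring].
    apply Rmult_le_compat; auto using Rabs_pos.
    + apply Rmult_le_pos; apply Rabs_pos.
    + apply Rmult_le_compat; auto using Rabs_pos.
Qed.

Lemma in_away_c t : Rabs t < eps -> away xl xr b (c1 t, c2 t).
Proof.
  intros h. destruct (hcx t h) as [h1 h2]. split; [|split]; simpl; auto.
  - lra.
  - rewrite Rabs_pos_eq; lra.
Qed.

Lemma in_away_f t : 0 < Rabs t < eps -> away xl xr b (f1 t, f2 t).
Proof.
  intros h. destruct (hY t h) as [_ [_ [_ [h1 [h2 _]]]]]. assert (h3 := f_range t h).
  assert (h4 := f2_small t h). split; [|split]; simpl; try lra. rewrite Rabs_left1; lra.
Qed.

Lemma exit_derive :
  is_derive f1 s (- dbe (f2 s) / slope s * stretch s) /\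
  is_derive f2 s (dal (f1 s) / slope s * stretch s).
Proof.
  assert (hV := V_le1).
  destruct c_taylor as [Mc [hMc HMc]].
  destruct (graph_secant lam xl xr r0 b hl hr hr0 hR hb) as [G [hG HG]].
  destruct (bl_FF_away lam xl xr r0 b hl hr hr0 hR hb) as [Fb [Fb0 [Fb1 Fb2]]].
  destruct exit_increment as [Mf [hMf HMf]].
  destruct section_taylor as [Ms [hMs HMs]].
  destruct weighted_diff as [Cw [hCw HCw]].
  destruct (hY s hs) as [g [y1 [y2 [hf [ha [hsec hK]]]]]].
  assert (hs' : Rabs s < eps) by lra.
  assert (c1O : bigO V s 1 (fun t => c1 t - c1 s)).
  { exists Mc. split; auto. intros t [ht _]. rewrite pow_1. apply HMc; lra. }
  assert (c2O : bigO V s 1 (fun t => c2 t - c2 s)).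
  { exists Mc. split; auto. intros t [ht _]. rewrite pow_1. apply HMc; lra. }
  assert (c1O2 : bigO V s 2 (fun t => c1 t - c1 s - dc1 s * (t - s))).
  { exists Mc. split; auto. intros t [ht _]. rewrite pow2_abs. apply HMc; lra. }
  assert (c2O2 : bigO V s 2 (fun t => c2 t - c2 s - dc2 s * (t - s))).
  { exists Mc. split; auto. intros t [ht _]. rewrite pow2_abs. apply HMc; lra. }
  assert (FcO : bigO V s 1 (fun t => FF lam (c1 t) (c2 t) - FF lam (c1 s) (c2 s))).
  { exists (Fb * (2 * Mc)). split; [nra|]. intros t [ht _]. rewrite pow_1.
    eapply Rle_trans; [apply (Fb2 (c1 t, c2 t) (c1 s, c2 s)); apply in_away_c; lra|].
    unfold dist1; simpl. destruct (HMc s t hs' ltac:(lra)) as [h1 [h2 _]].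
    rewrite Rmult_assoc. apply Rmult_le_compat_l; auto. lra. }
  set (e0 := fun t => Yf t (c1 s) - c2 s).
  set (W := dc2 s - FF lam (c1 s) (c2 s) * dc1 s).
  (* The orbit of t is followed from its own entry abscissa to that of s; the uniform secant
     estimate makes the error quadratic in c1 t - c1 s. *)
  assert (r1 : bigO V s 2 (fun t => Yf t (c1 s) - c2 t - FF lam (c1 t) (c2 t) * (c1 s - c1 t))).
  { apply (bigO_le V s 2 G _ (fun t => (c1 t - c1 s) * (c1 t - c1 s)) hG).
    - intros t [ht _]. destruct (hY t ht) as [gt [yt1 [_ [_ [hat _]]]]].
      replace (Rabs ((c1 t - c1 s) * (c1 t - c1 s))) with ((c1 s - c1 t) ^ 2)
        by (rewrite Rabs_mult, <- (pow2_abs (c1 s - c1 t)), (Rabs_minus_sym (c1 s)); ring).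
      rewrite <- yt1. apply HG; auto; try (apply c_range; lra); [lra|].
      left. split; [apply hcx; lra|apply (proj1 (hcx t ltac:(lra)))].
    - apply (bigO_mult V s 1 1); auto. }
  assert (e0O2 : bigO V s 2 (fun t => e0 t - W * (t - s))).
  { apply (bigO_ext V s 2 (fun t => (Yf t (c1 s) - c2 t - FF lam (c1 t) (c2 t) * (c1 s - c1 t))
      + ((c2 t - c2 s - dc2 s * (t - s)) - (FF lam (c1 t) (c2 t) - FF lam (c1 s) (c2 s)) * (c1 t - c1 s)
         - FF lam (c1 s) (c2 s) * (c1 t - c1 s - dc1 s * (t - s))))).
    - intros t ht. unfold e0, W. ring.
    - apply bigO_plus; auto. apply bigO_minus; [apply bigO_minus; auto|].
      + now apply (bigO_mult V s 1 1).
      + now apply bigO_scal. }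
  assert (e0O : bigO V s 1 e0).
  { apply (bigO_ext V s 1 (fun t => (e0 t - W * (t - s)) + W * (t - s))); [intros; ring|].
    apply bigO_plus; [now apply bigO_down|]. apply bigO_scal, bigO_id. }
  set (e1 := fun t => Yf t (f1 s) - f2 s).
  set (wc := weight lam (Kf s) (Yf s) (c1 s)) in *. set (wf := weight lam (Kf s) (Yf s) (f1 s)) in *.
  assert (hwf : 0 < wf).
  { apply (weight_pos lam xl xr r0); auto. now apply f_range. }
  assert (weO2 : bigO V s 2 (fun t => wf * e1 t - wc * e0 t)).
  { apply (bigO_le V s 2 Cw _ (fun t => e0 t * e0 t) hCw).
    - intros t ht. rewrite Rabs_mult. unfold e1, e0. generalize (HCw t ht). simpl. rewrite Rmult_1_r. auto.
    - now apply (bigO_mult V s 1 1). }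
  assert (e1O2 : bigO V s 2 (fun t => e1 t - wc / wf * W * (t - s))).
  { apply (bigO_ext V s 2 (fun t => / wf * (wf * e1 t - wc * e0 t) + wc / wf * (e0 t - W * (t - s)))).
    - intros t ht. field. lra.
    - apply bigO_plus; now apply bigO_scal. }
  assert (e1O : bigO V s 1 e1).
  { apply (bigO_ext V s 1 (fun t => (e1 t - wc / wf * W * (t - s)) + wc / wf * W * (t - s))); [intros; ring|].
    apply bigO_plus; [now apply bigO_down|]. apply bigO_scal, bigO_id. }
  assert (f1O : bigO V s 1 (fun t => f1 t - f1 s)).
  { apply (bigO_le V s 1 Mf _ e1 hMf); auto. intros t [ht _]. now apply HMf. }
  assert (f2O : bigO V s 1 (fun t => f2 t - f2 s)).
  { apply (bigO_le V s 1 Mf _ e1 hMf); auto. intros t [ht _]. now apply HMf. }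
  assert (FfO : bigO V s 1 (fun t => FF lam (f1 t) (f2 t) - FF lam (f1 s) (f2 s))).
  { apply (bigO_le V s 1 (Fb * (2 * Mf)) _ e1); auto; [nra|]. intros t [ht _].
    eapply Rle_trans; [apply (Fb2 (f1 t, f2 t) (f1 s, f2 s)); apply in_away_f; auto|].
    unfold dist1; simpl. destruct (HMf s t hs ht) as [h1 h2]. fold (e1 t) in h1, h2.
    rewrite Rmult_assoc. apply Rmult_le_compat_l; auto. lra. }
  set (F := FF lam (f1 s) (f2 s)) in *.
  (* [q1] (the orbit of t near its exit) and [q2] (the section) are two linear relations for the
     increments of f1 and f2, with right-hand sides e1 and 0 up to second order. Their determinant
     is [slope s], and Cramer's rule gives the two derivatives. *)
  assert (q1 : bigO V s 2 (fun t => e1 t - ((f2 t - f2 s) - F * (f1 t - f1 s)))).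
  { apply (bigO_ext V s 2 (fun t => (Yf t (f1 s) - f2 t - FF lam (f1 t) (f2 t) * (f1 s - f1 t))
       - (FF lam (f1 t) (f2 t) - F) * (f1 t - f1 s))).
    - intros t ht. unfold e1. ring.
    - apply bigO_minus; [|now apply (bigO_mult V s 1 1)].
      apply (bigO_le V s 2 G _ (fun t => (f1 t - f1 s) * (f1 t - f1 s)) hG).
      + intros t [ht _]. destruct (hY t ht) as [gt [_ [yt2 [_ [hat _]]]]].
        replace (Rabs ((f1 t - f1 s) * (f1 t - f1 s))) with ((f1 s - f1 t) ^ 2)
          by (rewrite Rabs_mult, <- (pow2_abs (f1 s - f1 t)), (Rabs_minus_sym (f1 s)); ring).
        rewrite <- yt2. destruct (f_range s hs), (f_range t ht). apply HG; auto; [lra|]. now right.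
      + now apply (bigO_mult V s 1 1). }
  assert (q2 : bigO V s 2 (fun t => dal (f1 s) * (f1 t - f1 s) + dbe (f2 s) * (f2 t - f2 s))).
  { assert (u1 : bigO V s 2 (fun t => al (f1 t) - al (f1 s) - dal (f1 s) * (f1 t - f1 s))).
    { apply (bigO_le V s 2 Ms _ (fun t => (f1 t - f1 s) * (f1 t - f1 s)) hMs); [|now apply (bigO_mult V s 1 1)].
      intros t [ht _]. destruct (hY t ht) as [gt [_ [yt2 [hft [hat _]]]]].
      rewrite Rabs_mult. replace (Rabs (f1 t - f1 s) * Rabs (f1 t - f1 s)) with ((f1 t - f1 s) ^ 2)
        by (rewrite <- (pow2_abs (f1 t - f1 s)); ring).
      apply (HMs (f1 s) (f1 t) 0 0); auto; rewrite Rabs_R0; lra. }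
    assert (u2 : bigO V s 2 (fun t => be (f2 t) - be (f2 s) - dbe (f2 s) * (f2 t - f2 s))).
    { apply (bigO_le V s 2 Ms _ (fun t => (f2 t - f2 s) * (f2 t - f2 s)) hMs); [|now apply (bigO_mult V s 1 1)].
      intros t [ht _]. destruct (hY t ht) as [gt [_ [yt2 [hft [hat _]]]]].
      rewrite Rabs_mult. replace (Rabs (f2 t - f2 s) * Rabs (f2 t - f2 s)) with ((f2 t - f2 s) ^ 2)
        by (rewrite <- (pow2_abs (f2 t - f2 s)); ring).
      apply (HMs x1 x1 (f2 s) (f2 t)); try (rewrite Rminus_diag, Rabs_R0; lra).
      - generalize (f2_small s hs); lra.
      - generalize (f2_small t ht); lra. }
    apply (bigO_ext V s 2 (fun t => - ((al (f1 t) - al (f1 s) - dal (f1 s) * (f1 t - f1 s))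
       + (be (f2 t) - be (f2 s) - dbe (f2 s) * (f2 t - f2 s))))).
    - intros t [ht _]. destruct (hY t ht) as [gt [_ [_ [_ [_ [hst _]]]]]]. lra.
    - now apply bigO_opp, bigO_plus. }
  assert (hSl : m0 <= Rabs (slope s)).
  { apply hD; auto; generalize (f2_small s hs); lra. }
  assert (nz : slope s <> 0). { intros E. rewrite E, Rabs_R0 in hSl. lra. }
  assert (hstr : stretch s = wc / wf * W) by reflexivity.
  split; apply (bigO_2_derive V); try apply V_locally; rewrite hstr.
  - apply (bigO_ext V s 2 (fun t => / slope s *
      ((dal (f1 s) * (f1 t - f1 s) + dbe (f2 s) * (f2 t - f2 s))
       + dbe (f2 s) * (e1 t - ((f2 t - f2 s) - F * (f1 t - f1 s)))
       - dbe (f2 s) * (e1 t - wc / wf * W * (t - s))))).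
    + intros t ht. assert (E : slope s = dal (f1 s) + F * dbe (f2 s)) by reflexivity.
      assert (nz' : dal (f1 s) + F * dbe (f2 s) <> 0) by (rewrite <- E; auto).
      rewrite E. field. split; auto; lra.
    + apply bigO_scal, bigO_minus; [apply bigO_plus|]; auto; now apply bigO_scal.
  - apply (bigO_ext V s 2 (fun t => / slope s *
      (F * (dal (f1 s) * (f1 t - f1 s) + dbe (f2 s) * (f2 t - f2 s))
       - dal (f1 s) * (e1 t - ((f2 t - f2 s) - F * (f1 t - f1 s)))
       + dal (f1 s) * (e1 t - wc / wf * W * (t - s))))).
    + intros t ht. assert (E : slope s = dal (f1 s) + F * dbe (f2 s)) by reflexivity.
      assert (nz' : dal (f1 s) + F * dbe (f2 s) <> 0) by (rewrite <- E; auto).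
      rewrite E. field. split; auto; lra.
    + apply bigO_scal, bigO_plus; [apply bigO_minus|]; now apply bigO_scal.
Qed.
End AtPoint.

(** * Behaviour of the derivative as the orbit approaches the axis *)

Hypothesis hrb : rho <= b.
Hypothesis hsec0 : al x1 + be 0 = 0.
Hypothesis hsgn : forall s t, Rabs s < eps -> Rabs t < eps -> 0 < s * t -> 0 < c2 s * c2 t.
Hypothesis hf0 : f1 0 = x1 /\ f2 0 = 0.
Hypothesis hdc20 : dc2 0 <> 0.

Lemma nz_dom s : Rabs s < eps -> s <> 0 -> 0 < Rabs s < eps.
Proof. intros h1 h2. split; auto. now apply Rabs_pos_lt. Qed.

Lemma Y0_nz s : 0 < Rabs s < eps -> 0 < Rabs (Yf s 0).
Proof.
  intros h. destruct (hY s h) as [g _]. apply Rabs_pos_lt. apply g. lra.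
Qed.

Lemma HH_0 y : Rabs (HH 0 y) = Rabs y ^ 3.
Proof. unfold HH. rewrite RPow_abs. f_equal. ring. Qed.

Lemma HH_lower x y : b <= Rabs x -> Rabs y * b ^ 2 <= Rabs (HH x y).
Proof.
  intros hx. unfold HH. rewrite Rabs_mult. apply Rmult_le_compat_l; [apply Rabs_pos|].
  rewrite Rabs_pos_eq by (generalize (pow2_ge_0 x) (pow2_ge_0 y); lra).
  rewrite <- (pow2_abs x). assert (b ^ 2 <= Rabs x ^ 2) by (apply pow_incr; lra).
  generalize (pow2_ge_0 y). lra.
Qed.

(** |HH| is the cube of the intercept on x = 0, at least b^2 |y| where |x| >= b, and at most a
    multiple of |y| at the entry. [graph_HH] compares these values along one orbit. *)
Lemma intercept_size : exists c C, 0 < c <= 1 /\ 1 <= C /\ forall s, 0 < Rabs s < eps ->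
  c * cr s <= Rabs (Yf s 0) <= C * cr s /\ Rabs (f2 s) <= C * Rabs s.
Proof.
  destruct (graph_HH lam xl xr r0 hl hr hr0 hR) as [C0 [hC0 HC0]].
  assert (hM1 : 0 <= M1).
  { assert (hs : 0 < Rabs (eps / 2) < eps) by (rewrite Rabs_pos_eq; lra).
    destruct (hc2 (eps / 2) ltac:(lra)) as [_ h]. generalize (Rabs_pos (c2 (eps / 2))). nra. }
  set (B := xr ^ 2 + 1).
  assert (hB : 0 < B) by (unfold B; generalize (pow2_ge_0 xr); lra).
  set (C := 1 + C0 * (M1 * B)).
  assert (0 <= C0 * (M1 * B)) by (apply Rmult_le_pos; nra).
  assert (hb2 : 0 < b ^ 2) by (apply pow_lt; auto).
  set (c := Rmin 1 (m1 * b ^ 2 / C0)).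
  assert (hc0 : 0 < c <= 1).
  { unfold c. split; [|apply Rmin_l]. apply Rmin_glb_lt; [lra|]. apply Rdiv_lt_0_compat; [nra|lra]. }
  set (D := C0 * C / b ^ 2).
  assert (hDp : 0 <= D) by (unfold D; apply Rdiv_le_0_compat; [unfold C; nra|auto]).
  exists c, (C + D). split; [auto|split; [unfold C; lra|]].
  intros s hs. destruct (hY s hs) as [g [y1 [y2 _]]].
  assert (hs' : Rabs s < eps) by lra.
  destruct (hcx s hs') as [hx hy]. destruct (hc2 s hs') as [h1 h2].
  assert (rc : xl <= c1 s <= xr) by lra. assert (rf := f_range s hs).
  assert (r00 : xl <= 0 <= xr) by lra.
  assert (A1 := HC0 _ 0 (c1 s) g r00 rc). assert (A2 := HC0 _ (c1 s) 0 g rc r00).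
  assert (A3 := HC0 _ (f1 s) 0 g (proj1 rf) r00).
  rewrite y1, HH_0 in A1, A2. rewrite y2, HH_0 in A3.
  assert (L1 := HH_lower (c1 s) (c2 s) ltac:(rewrite Rabs_pos_eq; lra)).
  assert (L2 := HH_lower (f1 s) (f2 s) ltac:(rewrite Rabs_left1; lra)).
  assert (U : Rabs (HH (c1 s) (c2 s)) <= M1 * Rabs s * B).
  { unfold HH. rewrite Rabs_mult. apply Rmult_le_compat; auto using Rabs_pos.
    rewrite Rabs_pos_eq by (generalize (pow2_ge_0 (c1 s)) (pow2_ge_0 (c2 s)); lra).
    unfold B. rewrite <- (pow2_abs (c2 s)).
    assert (c1 s ^ 2 <= xr ^ 2) by (apply pow_incr; lra).
    assert (Rabs (c2 s) ^ 2 <= 1 ^ 2) by (apply pow_incr; split; [apply Rabs_pos|auto]). lra. }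
  assert (U3 : Rabs (Yf s 0) ^ 3 <= C * Rabs s).
  { eapply Rle_trans; [exact A1|]. apply Rle_trans with (C0 * (M1 * Rabs s * B)).
    - apply Rmult_le_compat_l; [lra|auto].
    - unfold C. generalize (Rabs_pos s). nra. }
  split; [split|].
  - apply cr_ge_of_cube; [apply Rabs_pos|lra|].
    apply Rle_trans with (m1 * b ^ 2 / C0 * Rabs s).
    + apply Rmult_le_compat_r; [apply Rabs_pos|apply Rmin_r].
    + apply (Rmult_le_reg_l C0); [lra|].
      replace (C0 * (m1 * b ^ 2 / C0 * Rabs s)) with (m1 * Rabs s * b ^ 2) by (field; lra).
      eapply Rle_trans; [|exact A2]. eapply Rle_trans; [|exact L1]. apply Rmult_le_compat_r; lra.
  - apply Rle_trans with (C * cr s).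
    + apply cr_le_of_cube; auto. unfold C; lra.
    + generalize (cr_pos s). nra.
  - apply (Rmult_le_reg_r (b ^ 2)); auto. eapply Rle_trans; [exact L2|]. eapply Rle_trans; [exact A3|].
    apply Rle_trans with (C0 * (C * Rabs s)); [apply Rmult_le_compat_l; lra|].
    replace ((C + D) * Rabs s * b ^ 2) with (C * Rabs s * b ^ 2 + C0 * (C * Rabs s)) by (unfold D; field; lra).
    assert (0 <= C * Rabs s * b ^ 2); [|lra].
    apply Rmult_le_pos; [|lra]. apply Rmult_le_pos; [unfold C; lra|apply Rabs_pos].
Qed.

Lemma dal_lower x : Rabs (x - x1) <= rho -> m0 <= Rabs (dal x).
Proof.
  intros hx. generalize (hD x x 0 0 hx hx). rewrite Rabs_R0, FF_0, Rmult_0_l, Rplus_0_r. intros h. apply h; lra.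
Qed.

Lemma f_at_zero : exists C, 0 <= C /\ forall s, Rabs s < eps ->
  Rabs (f1 s - f1 0) <= C * Rabs s /\ Rabs (f2 s - f2 0) <= C * Rabs s.
Proof.
  destruct intercept_size as [c [C [hc0 [hC H]]]]. destruct hdbe as [M [M0 [MM _]]].
  destruct hf0 as [e1 e2].
  exists (M * C / m0 + C). assert (0 <= M * C / m0) by (apply Rdiv_le_0_compat; nra).
  split; [lra|]. intros s hs.
  destruct (Req_dec s 0) as [z|nz].
  { subst. rewrite !Rminus_diag, Rabs_R0. lra. }
  assert (hs' := nz_dom s hs nz). destruct (H s hs') as [_ h2].
  destruct (hY s hs') as [_ [_ [_ [hf [ha [hsec _]]]]]]. assert (hf2 := f2_small s hs').
  rewrite e1, e2, Rminus_0_r. assert (ps := Rabs_pos s). split; [|nra].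
  destruct (MVT_any al dal x1 (f1 s)) as [z1 [hz1 E1]].
  { intros x hx. apply hal. apply Rabs_le. apply Rabs_le_between in hf.
    revert hx. unfold Rmin, Rmax; destruct Rle_dec; lra. }
  assert (E2 : Rabs (be (f2 s) - be 0) <= M * Rabs (f2 s)).
  { replace (f2 s) with (f2 s - 0) at 2 by ring. apply (deriv_lip be dbe). intros y hy.
    assert (Rabs y <= rho).
    { apply Rabs_le. assert (Rabs (f2 s) <= rho) by lra. apply Rabs_le_between in H1.
      revert hy. unfold Rmin, Rmax; destruct Rle_dec; lra. }
    split; [now apply hbe|now apply MM]. }
  assert (hz : Rabs (z1 - x1) <= rho).
  { apply Rabs_le. apply Rabs_le_between in hf. revert hz1. unfold Rmin, Rmax; destruct Rle_dec; lra. }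
  assert (hdz := dal_lower z1 hz).
  assert (A : Rabs (dal z1) * Rabs (f1 s - x1) <= M * Rabs (f2 s)).
  { rewrite <- Rabs_mult, <- E1. replace (al (f1 s) - al x1) with (- (be (f2 s) - be 0)) by lra.
    now rewrite Rabs_Ropp. }
  apply Rle_trans with (M * C / m0 * Rabs s); [|nra].
  apply (Rmult_le_reg_l m0); auto. replace (m0 * (M * C / m0 * Rabs s)) with (M * (C * Rabs s)) by (field; lra).
  apply Rle_trans with (Rabs (dal z1) * Rabs (f1 s - x1)).
  - apply Rmult_le_compat_r; [apply Rabs_pos|auto].
  - eapply Rle_trans; [exact A|]. apply Rmult_le_compat_l; auto.
Qed.

(** The integral E over the orbit from exit to entry. Its limit value 0 at s = 0 is inserted by
    hand, since [hY] describes no orbit for that parameter. *)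
Definition excess (s : R) : R := if Req_EM_T s 0 then 0 else Kf s (c1 s) - Kf s (f1 s).

Lemma excess_nz s : s <> 0 -> excess s = Kf s (c1 s) - Kf s (f1 s).
Proof. intros h. unfold excess. destruct Req_EM_T; [lra|auto]. Qed.

Lemma AA_lower_intercept s x : 0 < Rabs s < eps -> xl <= x <= xr ->
  r0 / 2 * (Rabs (Yf s 0) ^ 2 + x ^ 2) <= AA lam x (Yf s x).
Proof.
  intros hs hx. rewrite pow2_abs. apply (graph_bounds lam xl xr r0); auto. apply (hY s hs).
Qed.

(** From below, the nonnegative integrand is at least k on an interval of length a around 0. From
    above, it is at most 2 a^2 / (r0^2 (a^2 + x^2)), whose integral is at most 2 pi a / r0^2. *)
Lemma excess_size : exists k C, 0 < k /\ 0 <= C /\ forall s, 0 < Rabs s < eps ->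
  k * Rabs (Yf s 0) <= excess s <= C * Rabs (Yf s 0).
Proof.
  set (R1 := rr lam xl + rr lam xr).
  assert (hR1 : forall x, xl <= x <= xr -> rr lam x <= R1).
  { intros x hx. assert (h1 := hR xl ltac:(lra)). assert (h2 := hR xr ltac:(lra)).
    unfold R1, rr in *. destruct (Rle_or_lt 0 lam); nra. }
  assert (R1p : 0 < R1). { generalize (hR xl ltac:(lra)) (hR xr ltac:(lra)). unfold R1. lra. }
  (* For |x| <= a/2 the numerator of [kk] is at least a^2 / 2 and its denominator at most R1 (R1/4 +
     1) a^2. *)
  set (k := 1 / (2 * R1 * (R1 / 4 + 1))).
  assert (hk : 0 < k). { unfold k. apply Rdiv_lt_0_compat; [lra|]. apply Rmult_lt_0_compat; lra. }
  exists k, (2 / (r0 * r0) * PI). generalize PI_RGT_0. intros hpi.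
  assert (hr2 : 0 < 2 / (r0 * r0)) by (apply Rdiv_lt_0_compat; nra).
  split; [auto|split; [nra|]]. intros s hs. destruct (hY s hs) as [g [_ [_ [_ [ha [_ hK]]]]]].
  assert (ap := Y0_nz s hs). set (a := Rabs (Yf s 0)) in *.
  assert (a2 : a ^ 2 = Yf s 0 ^ 2) by apply pow2_abs.
  assert (rf := f_range s hs). destruct (hcx s ltac:(lra)) as [rc _].
  rewrite excess_nz by (intros e; rewrite e, Rabs_R0 in hs; lra). split.
  - assert (S1 : Kf s (f1 s) <= Kf s (- (a / 2))).
    { apply (deriv_nonneg_le _ (fun x => kk lam x (Yf s x))); [lra|]. intros x hx. split; [apply hK; lra|].
      apply (kk_bound lam xl xr r0); auto; [lra|]. apply g; lra. }
    assert (S2 : Kf s (a / 2) <= Kf s (c1 s)).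
    { apply (deriv_nonneg_le _ (fun x => kk lam x (Yf s x))); [lra|]. intros x hx. split; [apply hK; lra|].
      apply (kk_bound lam xl xr r0); auto; [lra|]. apply g; lra. }
    destruct (MVT_le (Kf s) (fun x => kk lam x (Yf s x)) (- (a / 2)) (a / 2)) as [z [hz E]]; [lra| |].
    { intros x hx. apply hK. lra. }
    assert (hzI : xl <= z <= xr) by lra.
    assert (k <= kk lam z (Yf s z)).
    { destruct (graph_bounds lam xl xr r0 hl hr hr0 hR (Yf s) z g hzI) as [B1 [B2 _]].
      assert (z2 : z ^ 2 <= a ^ 2 / 4). { rewrite <- (pow2_abs z).
        assert (Rabs z <= a / 2) by (apply Rabs_le; lra).
        assert (Rabs z ^ 2 <= (a / 2) ^ 2) by (apply pow_incr; split; [apply Rabs_pos|auto]). simpl in *; lra. }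
      assert (nzz : Yf s z <> 0) by (apply g; auto).
      assert (Ap := AA_pos lam xl xr r0 hr0 hR z (Yf s z) hzI nzz).
      assert (rz := hR1 z hzI). assert (rz0 := hR z hzI).
      assert (p : 0 < rr lam z * AA lam z (Yf s z)) by (apply Rmult_lt_0_compat; lra).
      unfold kk. apply (proj1 (Rle_div_r _ _ _ p)).
      assert (Au : AA lam z (Yf s z) <= (R1 / 4 + 1) * a ^ 2).
      { unfold AA. assert (rr lam z * z ^ 2 <= R1 * (a ^ 2 / 4)).
        { apply Rmult_le_compat; auto; [lra|apply pow2_ge_0]. } lra. }
      assert (rr lam z * AA lam z (Yf s z) <= R1 * ((R1 / 4 + 1) * a ^ 2)).
      { apply Rmult_le_compat; lra. }
      apply Rle_trans with (k * (R1 * ((R1 / 4 + 1) * a ^ 2))); [apply Rmult_le_compat_l; lra|].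
      replace (k * (R1 * ((R1 / 4 + 1) * a ^ 2))) with (a ^ 2 / 2) by (unfold k; field; lra).
      generalize (pow2_ge_0 a). lra. }
    cbv beta in E. replace (a / 2 - - (a / 2)) with a in E by field. nra.
  - apply Rle_trans with (Rabs (Kf s (c1 s) - Kf s (f1 s))); [apply Rle_abs|].
    eapply Rle_trans.
    + apply (deriv_compare (Kf s) (fun x => kk lam x (Yf s x))
        (fun x => (2 / (r0 * r0) * a ^ 2) / a * atan (x / a)) (fun x => 2 / (r0 * r0) * a ^ 2 / (a ^ 2 + x ^ 2))).
      lra. intros x hx. assert (hxI : xl <= x <= xr) by lra.
      split; [now apply hK|split; [now apply atan_scale_derive|]].
      assert (nzx : Yf s x <> 0) by (apply g; auto).
      rewrite Rabs_pos_eq by (apply (kk_bound lam xl xr r0); auto).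
      assert (Al := AA_lower_intercept s x hs hxI). fold a in Al.
      assert (rx := hR x hxI).
      destruct (graph_bounds lam xl xr r0 hl hr hr0 hR (Yf s) x g hxI) as [B1 _].
      assert (q : 0 < a ^ 2 + x ^ 2) by (generalize (pow_lt a 2 ap) (pow2_ge_0 x); lra).
      unfold kk.
      assert (p : r0 * (r0 / 2 * (a ^ 2 + x ^ 2)) <= rr lam x * AA lam x (Yf s x)).
      { apply Rmult_le_compat; nra. }
      assert (p0 : 0 < r0 * (r0 / 2 * (a ^ 2 + x ^ 2))) by (apply Rmult_lt_0_compat; nra).
      unfold Rdiv at 1.
      apply Rle_trans with (a ^ 2 * / (r0 * (r0 / 2 * (a ^ 2 + x ^ 2)))).
      * apply Rmult_le_compat; [apply pow2_ge_0|left; apply Rinv_0_lt_compat; lra|lra|now apply Rinv_le_contravar].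
      * right. field. split; lra.
    + cbv beta. replace (2 / (r0 * r0) * a ^ 2 / a) with (2 / (r0 * r0) * a) by (field; lra).
      rewrite <- Rmult_minus_distr_l.
      apply Rle_trans with (2 / (r0 * r0) * a * PI); [|right; ring].
      apply Rmult_le_compat_l; [nra|apply atan_osc].
Qed.

Lemma same_sign_graphs s t x : 0 < Rabs s < eps -> 0 < Rabs t < eps -> 0 < s * t ->
  xl <= x <= xr -> 0 < Yf s x * Yf t x.
Proof.
  intros hs ht hst hx. destruct (hY s hs) as [g [e _]]. destruct (hY t ht) as [g' [e' _]].
  assert (A1 := graph_sign lam xl xr (Yf s) x (c1 s) g hx (c_range s ltac:(lra))).
  assert (A2 := graph_sign lam xl xr (Yf t) x (c1 t) g' hx (c_range t ltac:(lra))).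
  rewrite e in A1. rewrite e' in A2.
  assert (A3 := hsgn s t ltac:(lra) ltac:(lra) hst).
  assert (A4 := Rmult_lt_0_compat _ _ A1 A2).
  replace (Yf s x * c2 s * (Yf t x * c2 t)) with (Yf s x * Yf t x * (c2 s * c2 t)) in A4 by ring.
  destruct (Rlt_or_le 0 (Yf s x * Yf t x)) as [h|h]; auto. nra.
Qed.

Lemma diff_derive_gen s t x : 0 < Rabs s < eps -> 0 < Rabs t < eps -> xl <= x <= xr ->
  is_derive (fun x => Yf t x - Yf s x) x (mm lam x (Yf s x) (Yf t x) * (Yf t x - Yf s x)).
Proof.
  intros hs ht hx. destruct (hY t ht) as [g _]. destruct (hY s hs) as [g' _].
  destruct (g x hx) as [n1 d1]. destruct (g' x hx) as [n2 d2].
  rewrite <- (FF_sub lam xl xr r0) by auto. exact (is_derive_minus _ _ _ _ _ d1 d2).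
Qed.

(* For graphs of the same sign [|(Yf t - Yf s) / Yf s|] is nondecreasing on [x >= 0]. *)
Lemma diff_ingoing s t x : 0 < Rabs s < eps -> 0 < Rabs t < eps -> 0 < s * t -> 0 <= x <= c1 s ->
  Rabs (Yf t x - Yf s x) * Rabs (c2 s) <= Rabs (Yf s 0) * Rabs (Yf t (c1 s) - c2 s).
Proof.
  intros hs ht hst hx. destruct (hY s hs) as [g [e _]].
  assert (cr' := c_range s ltac:(lra)).
  set (q := fun x => (Yf t x - Yf s x) / Yf s x).
  assert (M : q x ^ 2 <= q (c1 s) ^ 2).
  { apply (deriv_nonneg_le (fun x => q x ^ 2) (fun x => 2 * q x ^ 2 *
      (mm lam x (Yf s x) (Yf t x) + 2 / 3 * x / AA lam x (Yf s x)))); [lra|].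
    intros z hz. assert (hzI : xl <= z <= xr) by lra.
    destruct (g z hzI) as [n1 d1]. destruct (hY t ht) as [g' _]. destruct (g' z hzI) as [n2 d2].
    assert (Ap := AA_pos lam xl xr r0 hr0 hR z (Yf s z) hzI n1).
    assert (Ap' := AA_pos lam xl xr r0 hr0 hR z (Yf t z) hzI n2). split.
    - unfold q. auto_derive; [repeat split; auto; eexists; eassumption|].
      derive_rw d1. derive_rw d2. unfold FF, mm, AA in *. field. repeat split; auto; lra.
    - assert (sg := same_sign_graphs s t z hs ht hst hzI).
      apply Rmult_le_pos; [generalize (pow2_ge_0 (q z)); lra|].
      (* The terms of indefinite sign cancel; what is left is nonnegative for z >= 0 because the two
         graphs lie on the same side of the axis. *)
      replace (mm lam z (Yf s z) (Yf t z) + 2 / 3 * z / AA lam z (Yf s z)) with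
        (2 / 3 * z * (Yf t z ^ 2 + Yf s z * Yf t z) / (AA lam z (Yf s z) * AA lam z (Yf t z))).
      + apply Rdiv_le_0_compat; [|now apply Rmult_lt_0_compat].
        apply Rmult_le_pos; [lra|]. generalize (pow2_ge_0 (Yf t z)); lra.
      + unfold mm, AA in *. field. lra. }
  assert (nx : Yf s x <> 0) by (apply g; lra).
  assert (nc : c2 s <> 0) by (rewrite <- e; apply g; auto).
  assert (M' : Rabs (q x) <= Rabs (q (c1 s))).
  { apply Rsqr_le_abs_0. now rewrite !Rsqr_pow2. }
  unfold q in M'. rewrite e in M'. unfold Rdiv in M'. rewrite !Rabs_mult, !Rabs_inv in M'.
  assert (px := Rabs_pos_lt _ nx). assert (pc := Rabs_pos_lt _ nc).
  apply (Rmult_le_compat_r (Rabs (Yf s x) * Rabs (c2 s))) in M'; [|left; now apply Rmult_lt_0_compat].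
  replace (Rabs (Yf t x - Yf s x) * / Rabs (Yf s x) * (Rabs (Yf s x) * Rabs (c2 s)))
    with (Rabs (Yf t x - Yf s x) * Rabs (c2 s)) in M' by (field; lra).
  replace (Rabs (Yf t (c1 s) - c2 s) * / Rabs (c2 s) * (Rabs (Yf s x) * Rabs (c2 s)))
    with (Rabs (Yf s x) * Rabs (Yf t (c1 s) - c2 s)) in M' by (field; lra).
  eapply Rle_trans; [exact M'|]. apply Rmult_le_compat_r; [apply Rabs_pos|].
  apply (graph_abs_le lam xl xr r0); auto. lra.
Qed.

Lemma AA_lower_comparable s t x k : 0 < Rabs s < eps -> 0 < Rabs t < eps -> xl <= x <= xr ->
  1 <= k -> Rabs (Yf s 0) <= k * Rabs (Yf t 0) ->
  r0 / (2 * k ^ 2) * (Rabs (Yf s 0) ^ 2 + x ^ 2) <= AA lam x (Yf t x).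
Proof.
  intros hs ht hx hk h. eapply Rle_trans; [|apply (AA_lower_intercept t x ht hx)].
  assert (k2 : 0 < k ^ 2) by (apply pow_lt; lra).
  replace (r0 / (2 * k ^ 2) * (Rabs (Yf s 0) ^ 2 + x ^ 2)) with (r0 / 2 * ((Rabs (Yf s 0) ^ 2 + x ^ 2) / k ^ 2)) by (field; lra).
  apply Rmult_le_compat_l; [lra|]. apply (proj2 (Rle_div_l _ _ _ k2)).
  assert (Rabs (Yf s 0) ^ 2 <= (k * Rabs (Yf t 0)) ^ 2) by (apply pow_incr; split; [apply Rabs_pos|auto]).
  rewrite Rpow_mult_distr in H. generalize (pow2_ge_0 x). assert (1 <= k ^ 2) by (simpl; nra). nra.
Qed.

(** For x <= 0 the part of [mm] coming from rr x^2 makes the difference shrink as x moves away from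
    0, so this part, whose absolute integral is logarithmically large, has the favourable sign. The
    part coming from the product of the two graphs is integrable uniformly in a, and the exponential
    in [P] compensates it. *)
Lemma diff_outgoing k : 1 <= k -> exists C, 0 <= C /\ forall s t x, 0 < Rabs s < eps -> 0 < Rabs t < eps ->
  Rabs (Yf s 0) <= k * Rabs (Yf t 0) -> Rabs (Yf t 0) <= k * Rabs (Yf s 0) ->
  xl <= x <= 0 -> Rabs (Yf t x - Yf s x) <= C * Rabs (Yf t 0 - Yf s 0).
Proof.
  (* The derivative of a^2 / (a^2 + x^2) is -2 x a^2 / (a^2 + x^2)^2; [kap] is the factor by which
     it outweighs the adverse term of 2 mm, bounded through the lower estimates of the two
     denominators. *)
  intros hk. set (kap := 8 / 3 * k ^ 3 / (r0 * r0)).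
  assert (hr2 : 0 < r0 * r0) by nra.
  assert (hkap : 0 <= kap). { unfold kap. apply Rdiv_le_0_compat; auto. generalize (pow_lt k 3); lra. }
  exists (exp kap). split; [left; apply exp_pos|]. intros s t x hs ht h1 h2 hx.
  assert (ap := Y0_nz s hs). set (a := Rabs (Yf s 0)) in *.
  assert (q : forall z, 0 < a ^ 2 + z ^ 2) by (intros z; generalize (pow_lt a 2 ap) (pow2_ge_0 z); lra).
  set (P := fun x => (Yf t x - Yf s x) ^ 2 * exp (kap * (a ^ 2 / (a ^ 2 + x ^ 2)))).
  assert (M : P x <= P 0).
  { apply (deriv_nonneg_le P (fun x => (Yf t x - Yf s x) ^ 2 * exp (kap * (a ^ 2 / (a ^ 2 + x ^ 2)))
      * (2 * mm lam x (Yf s x) (Yf t x) - kap * (2 * x * a ^ 2 / (a ^ 2 + x ^ 2) ^ 2)))); [lra|].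
    intros z hz. assert (hzI : xl <= z <= xr) by lra.
    assert (qz := q z). split.
    - assert (dd := diff_derive_gen s t z hs ht hzI). unfold P.
      set (del := fun x => Yf t x - Yf s x) in *.
      change (is_derive (fun x => del x ^ 2 * exp (kap * (a ^ 2 / (a ^ 2 + x ^ 2)))) z
        (del z ^ 2 * exp (kap * (a ^ 2 / (a ^ 2 + z ^ 2))) *
          (2 * mm lam z (Yf s z) (Yf t z) - kap * (2 * z * a ^ 2 / (a ^ 2 + z ^ 2) ^ 2)))).
      change (is_derive del z (mm lam z (Yf s z) (Yf t z) * del z)) in dd. clearbody del.
      auto_derive; [repeat split; [eexists; eassumption|simpl in qz; lra]|].
      derive_rw dd. replace (a * (a * 1) + z * (z * 1)) with (a ^ 2 + z ^ 2) by ring.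
      replace (a * (a * 1)) with (a ^ 2) by ring. unfold Rdiv. field. lra.
    - apply Rmult_le_pos.
      { apply Rmult_le_pos; [apply pow2_ge_0|left; apply exp_pos]. }
      destruct (hY s hs) as [g _]. destruct (hY t ht) as [g' _].
      destruct (g z hzI) as [n1 d1]. destruct (g' z hzI) as [n2 d2].
      assert (Ap := AA_pos lam xl xr r0 hr0 hR z (Yf s z) hzI n1).
      assert (Ap' := AA_pos lam xl xr r0 hr0 hR z (Yf t z) hzI n2).
      assert (L1 := AA_lower_intercept s z hs hzI). fold a in L1.
      assert (L2 := AA_lower_comparable s t z k hs ht hzI hk h1). fold a in L2.
      assert (b1 := graph_abs_le lam xl xr r0 hl hr hr0 hR (Yf s) z g hzI). fold a in b1.
      assert (b2 := graph_abs_le lam xl xr r0 hl hr hr0 hR (Yf t) z g' hzI).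
      assert (YZ : Rabs (Yf s z * Yf t z) <= k * a ^ 2).
      { rewrite Rabs_mult. replace (k * a ^ 2) with (a * (k * a)) by ring.
        apply Rmult_le_compat; auto using Rabs_pos. lra. }
      assert (k2 : 0 < k ^ 2) by (apply pow_lt; lra).
      assert (AAl : (r0 / 2 * (a ^ 2 + z ^ 2)) * (r0 / (2 * k ^ 2) * (a ^ 2 + z ^ 2))
         <= AA lam z (Yf s z) * AA lam z (Yf t z)).
      { apply Rmult_le_compat; auto; apply Rmult_le_pos; try lra. apply Rdiv_le_0_compat; lra. }
      assert (AA0 : 0 < (r0 / 2 * (a ^ 2 + z ^ 2)) * (r0 / (2 * k ^ 2) * (a ^ 2 + z ^ 2))).
      { apply Rmult_lt_0_compat; apply Rmult_lt_0_compat; try lra. apply Rdiv_lt_0_compat; lra. }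
      assert (B : Yf s z * Yf t z / (AA lam z (Yf s z) * AA lam z (Yf t z))
          <= 4 * k ^ 3 / (r0 * r0) * (a ^ 2 / (a ^ 2 + z ^ 2) ^ 2)).
      { apply Rle_trans with (k * a ^ 2 * / ((r0 / 2 * (a ^ 2 + z ^ 2)) * (r0 / (2 * k ^ 2) * (a ^ 2 + z ^ 2)))).
        - apply Rle_trans with (k * a ^ 2 * / (AA lam z (Yf s z) * AA lam z (Yf t z))).
          + apply Rmult_le_compat_r; [left; apply Rinv_0_lt_compat; now apply Rmult_lt_0_compat|].
            generalize (Rle_abs (Yf s z * Yf t z)); lra.
          + apply Rmult_le_compat_l; [generalize (pow2_ge_0 a); nra|]. now apply Rinv_le_contravar.
        - right. field. repeat split; lra. }
      assert (E : 2 * mm lam z (Yf s z) (Yf t z) = 4 / 3 * (- z) *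
         (rr lam z * z ^ 2 / (AA lam z (Yf s z) * AA lam z (Yf t z))
           - Yf s z * Yf t z / (AA lam z (Yf s z) * AA lam z (Yf t z)))).
      { unfold mm. field. lra. }
      rewrite E.
      assert (0 <= rr lam z * z ^ 2 / (AA lam z (Yf s z) * AA lam z (Yf t z))).
      { apply Rdiv_le_0_compat; [|now apply Rmult_lt_0_compat]. generalize (hR z hzI) (pow2_ge_0 z). nra. }
      replace (kap * (2 * z * a ^ 2 / (a ^ 2 + z ^ 2) ^ 2)) with
        (- (4 / 3 * (- z) * (4 * k ^ 3 / (r0 * r0) * (a ^ 2 / (a ^ 2 + z ^ 2) ^ 2))))
        by (unfold kap; field; split; lra).
      revert B H. generalize (Yf s z * Yf t z / (AA lam z (Yf s z) * AA lam z (Yf t z))).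
      generalize (4 * k ^ 3 / (r0 * r0) * (a ^ 2 / (a ^ 2 + z ^ 2) ^ 2)).
      generalize (rr lam z * z ^ 2 / (AA lam z (Yf s z) * AA lam z (Yf t z))).
      intros u v w hv hu. assert (0 <= - z * (u - w + v)) by (apply Rmult_le_pos; lra). lra. }
  unfold P in M.
  assert (E1 : 1 <= exp (kap * (a ^ 2 / (a ^ 2 + x ^ 2)))).
  { rewrite <- exp_0. assert (0 <= kap * (a ^ 2 / (a ^ 2 + x ^ 2))).
    { apply Rmult_le_pos; auto. apply Rdiv_le_0_compat; auto. apply pow2_ge_0. }
    destruct H as [H|H]; [left; now apply exp_increasing|rewrite <- H; lra]. }
  replace (a ^ 2 / (a ^ 2 + 0 ^ 2)) with 1 in M by (field; lra). rewrite Rmult_1_r in M.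
  assert (Ek : 1 <= exp kap).
  { rewrite <- exp_0. destruct hkap as [H|H]; [left; now apply exp_increasing|rewrite <- H; lra]. }
  rewrite <- (Rabs_pos_eq (exp kap)) by lra. rewrite <- Rabs_mult.
  apply Rsqr_le_abs_0. rewrite !Rsqr_pow2, Rpow_mult_distr.
  generalize (pow2_ge_0 (Yf t x - Yf s x)) (pow2_ge_0 (Yf t 0 - Yf s 0)). intros u v.
  apply Rle_trans with ((Yf t x - Yf s x) ^ 2 * exp (kap * (a ^ 2 / (a ^ 2 + x ^ 2)))); [nra|].
  eapply Rle_trans; [exact M|]. rewrite Rmult_comm. apply Rmult_le_compat_r; auto. simpl; nra.
Qed.

(** The scaling is that of the derivative |s|^(-2/3) of a cube root. At every abscissa two
    comparable orbits on the same side differ by at most a multiple of |s - t| / cr s ^ 2, the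
    integrands then by this times a / (a^2 + x^2), which has integral at most pi. The remaining
    terms come from the displaced end points. *)
Lemma excess_diff : exists C, 0 <= C /\ forall s t, 0 < Rabs s < eps -> 0 < Rabs t < eps -> 0 < s * t ->
  Rabs s <= Rabs t <= 2 * Rabs s ->
  Rabs (excess s - excess t) * cr s ^ 2 <= C * (Rabs (s - t) + Rabs (f1 s - f1 t)).
Proof.
  destruct intercept_size as [c [C [hc0 [hC H]]]].
  destruct (graph_secant lam xl xr r0 b hl hr hr0 hR hb) as [G [hG HG]].
  destruct c_taylor as [Mc [hMc HMc]].
  (* For |s| <= |t| <= 2 |s| one has cr t <= 2 cr s, so by [intercept_size] the two intercepts
     differ at most by this factor. *)
  set (k := 2 * C / c).
  assert (hk : 1 <= k). { unfold k. apply (proj1 (Rle_div_r 1 (2 * C) c ltac:(lra))). lra. }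
  destruct (diff_outgoing k hk) as [Co [hCo HCo]].
  assert (hGM : 0 <= G * Mc + Mc) by (generalize (Rmult_le_pos _ _ hG hMc); lra).
  set (Ci := (G * Mc + Mc) * C / m1 / c ^ 2).
  assert (c2p : 0 < c ^ 2) by (apply pow_lt; lra).
  assert (hCi : 0 <= Ci).
  { unfold Ci. repeat apply Rdiv_le_0_compat; auto. apply Rmult_le_pos; lra. }
  set (Cd := Ci + Co * Ci).
  assert (hCd : 0 <= Cd) by (unfold Cd; generalize (Rmult_le_pos _ _ hCo hCi); lra).
  assert (k2 : 0 < k ^ 2) by (apply pow_lt; lra).
  set (CD := Cd * (1 + k) * (4 * k ^ 2) / (r0 * r0)).
  assert (hr2 : 0 < r0 * r0) by nra.
  assert (hCD : 0 <= CD).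
  { unfold CD. apply Rdiv_le_0_compat; auto. apply Rmult_le_pos; [apply Rmult_le_pos; lra|lra]. }
  assert (hpi := PI_RGT_0).
  exists (CD * PI + Mc / r0 + 1 / r0).
  assert (hMr : 0 <= Mc / r0) by (apply Rdiv_le_0_compat; lra).
  assert (h1r : 0 <= 1 / r0) by (apply Rdiv_le_0_compat; lra).
  assert (hCDpi : 0 <= CD * PI) by (apply Rmult_le_pos; lra).
  split; [lra|]. intros s t hs ht hst hst2.
  destruct (H s hs) as [[s1 s2] _]. destruct (H t ht) as [[t1 t2] _].
  destruct (hY s hs) as [g [ys [_ [_ [has [_ hKs]]]]]]. destruct (hY t ht) as [g' [yt [_ [_ [hat [_ hKt]]]]]].
  assert (cs := c_range s ltac:(lra)). assert (ct := c_range t ltac:(lra)).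
  assert (cs' := proj1 (hcx s ltac:(lra))). assert (ct' := proj1 (hcx t ltac:(lra))).
  assert (fs := f_range s hs). assert (ft := f_range t ht).
  assert (crs : 0 < cr s) by (apply cr_gt0; intros e; rewrite e, Rabs_R0 in hs; lra).
  assert (crst : cr s <= cr t) by (apply cr_le; lra).
  assert (crts : cr t <= 2 * cr s).
  { apply cube_le; [lra|]. replace ((2 * cr s) ^ 3) with (8 * cr s ^ 3) by ring. rewrite !cr_cube. lra. }
  assert (st : Rabs (Yf s 0) <= k * Rabs (Yf t 0)).
  { apply Rle_trans with (k * (c * cr s)).
    - replace (k * (c * cr s)) with (2 * (C * cr s)) by (unfold k; field; lra).
      generalize (Rabs_pos (Yf s 0)); lra.
    - apply Rmult_le_compat_l; [lra|]. apply Rle_trans with (c * cr t); [apply Rmult_le_compat_l; lra|lra]. }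
  assert (ts : Rabs (Yf t 0) <= k * Rabs (Yf s 0)).
  { apply Rle_trans with (k * (c * cr s)); [|apply Rmult_le_compat_l; lra].
    replace (k * (c * cr s)) with (C * (2 * cr s)) by (unfold k; field; lra).
    apply Rle_trans with (C * cr t); [lra|apply Rmult_le_compat_l; lra]. }
  assert (ap := Y0_nz s hs). set (a := Rabs (Yf s 0)) in *.
  set (ds := Rabs (s - t)).
  assert (hds : 0 <= ds) by apply Rabs_pos.
  assert (D0 : Rabs (Yf t (c1 s) - c2 s) <= (G * Mc + Mc) * ds).
  { destruct (HMc s t ltac:(lra) ltac:(lra)) as [u1 [u2 _]].
    rewrite (Rabs_minus_sym t s) in u1, u2. fold ds in u1, u2.
    replace (Yf t (c1 s) - c2 s) with ((Yf t (c1 s) - Yf t (c1 t)) + (c2 t - c2 s)) by (rewrite yt; ring).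
    eapply Rle_trans; [apply Rabs_triang|].
    assert (A := proj1 (HG (Yf t) (c1 s) (c1 t) g' ltac:(lra) cs ct (or_introl (conj (proj1 cs') (proj1 ct'))))).
    rewrite (Rabs_minus_sym (c1 s)) in A.
    assert (G * Rabs (c1 t - c1 s) <= G * (Mc * ds)) by (apply Rmult_le_compat_l; auto). lra. }
  (* In [diff_ingoing], |c2 s| is at least of order cr s ^ 3 and the intercept at most of order cr
     s, so two powers of [cr s] remain. *)
  assert (Din : forall x, 0 <= x <= c1 s -> Rabs (Yf t x - Yf s x) * cr s ^ 2 <= Ci * ds).
  { intros x hx. assert (A := diff_ingoing s t x hs ht hst hx). fold a in A.
    destruct (hc2 s ltac:(lra)) as [l1 _].
    assert (A' : Rabs (Yf t x - Yf s x) * (m1 * cr s ^ 3) <= C * cr s * ((G * Mc + Mc) * ds)).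
    { rewrite cr_cube. eapply Rle_trans; [apply Rmult_le_compat_l; [apply Rabs_pos|exact l1]|].
      eapply Rle_trans; [exact A|]. apply Rmult_le_compat; auto using Rabs_pos. lra. }
    assert (A2 : Rabs (Yf t x - Yf s x) * cr s ^ 2 <= (G * Mc + Mc) * C / m1 * ds).
    { apply (Rmult_le_reg_l (m1 * cr s)); [now apply Rmult_lt_0_compat|].
      replace (m1 * cr s * ((G * Mc + Mc) * C / m1 * ds)) with (C * cr s * ((G * Mc + Mc) * ds)) by (field; lra).
      replace (m1 * cr s * (Rabs (Yf t x - Yf s x) * cr s ^ 2)) with
       (Rabs (Yf t x - Yf s x) * (m1 * cr s ^ 3)) by ring. auto. }
    eapply Rle_trans; [exact A2|]. apply Rmult_le_compat_r; auto. unfold Ci, Rdiv.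
    assert (hh : 0 <= (G * Mc + Mc) * C * / m1).
    { apply Rmult_le_pos; [apply Rmult_le_pos; lra|left; now apply Rinv_0_lt_compat]. }
    assert (1 <= / c ^ 2).
    { rewrite <- Rinv_1. apply Rinv_le_contravar; auto. replace 1 with (1 ^ 2) by ring. apply pow_incr; lra. }
    rewrite <- (Rmult_1_r ((G * Mc + Mc) * C * / m1)) at 1. apply Rmult_le_compat_l; auto. }
  assert (Dall : forall x, f1 s <= x <= c1 s -> Rabs (Yf t x - Yf s x) * cr s ^ 2 <= Cd * ds).
  { intros x hx. destruct (Rle_or_lt 0 x) as [p|p].
    - eapply Rle_trans; [apply Din; lra|]. unfold Cd. apply Rmult_le_compat_r; auto. generalize (Rmult_le_pos _ _ hCo hCi); lra.
    - assert (A := HCo s t x hs ht st ts ltac:(lra)). assert (A0 := Din 0 ltac:(lra)).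
      assert (p2 : 0 < cr s ^ 2) by (apply pow_lt; auto).
      apply Rle_trans with (Co * (Ci * ds)); [|unfold Cd; generalize (Rmult_le_pos _ _ hCi hds); lra].
      apply Rle_trans with (Co * Rabs (Yf t 0 - Yf s 0) * cr s ^ 2); [apply Rmult_le_compat_r; lra|].
      rewrite Rmult_assoc. apply Rmult_le_compat_l; auto. }
  assert (p2 : 0 < cr s ^ 2) by (apply pow_lt; auto).
  assert (I1 : Rabs ((Kf s (c1 s) - Kf t (c1 s)) - (Kf s (f1 s) - Kf t (f1 s))) * cr s ^ 2 <= CD * PI * ds).
  { set (B := CD * a * (ds / cr s ^ 2)).
    assert (hB : 0 <= B / a).
    { unfold B. replace (CD * a * (ds / cr s ^ 2) / a) with (CD * (ds / cr s ^ 2)) by (field; split; lra).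
      apply Rmult_le_pos; auto. now apply Rdiv_le_0_compat. }
    assert (A : Rabs ((Kf s (c1 s) - Kf t (c1 s)) - (Kf s (f1 s) - Kf t (f1 s))) <=
       B / a * atan (c1 s / a) - B / a * atan (f1 s / a)).
    { apply (deriv_compare (fun x => Kf s x - Kf t x) (fun x => kk lam x (Yf s x) - kk lam x (Yf t x))
        (fun x => B / a * atan (x / a)) (fun x => B / (a ^ 2 + x ^ 2))); [lra|].
      intros x hx. assert (hxI : xl <= x <= xr) by lra.
      split; [exact (is_derive_minus _ _ _ _ _ (hKs x hxI) (hKt x hxI))|split; [now apply atan_scale_derive|]].
      destruct (g x hxI) as [n1 _]. destruct (g' x hxI) as [n2 _].
      assert (Ap := AA_pos lam xl xr r0 hr0 hR x (Yf s x) hxI n1).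
      assert (Ap' := AA_pos lam xl xr r0 hr0 hR x (Yf t x) hxI n2).
      assert (rp := hR x hxI).
      assert (q : 0 < a ^ 2 + x ^ 2) by (generalize (pow_lt a 2 ap) (pow2_ge_0 x); lra).
      assert (L1 := AA_lower_intercept s x hs hxI). fold a in L1.
      assert (L2 := AA_lower_comparable s t x k hs ht hxI hk st). fold a in L2.
      assert (b1 := graph_abs_le lam xl xr r0 hl hr hr0 hR (Yf s) x g hxI). fold a in b1.
      assert (b2 := graph_abs_le lam xl xr r0 hl hr hr0 hR (Yf t) x g' hxI).
      (* The factor [rr] cancels and leaves x^2 times a difference of squares; one power of a comes
         from the sum of the two graphs. *)
      replace (kk lam x (Yf s x) - kk lam x (Yf t x)) with
        (- (Yf t x - Yf s x) * (Yf s x + Yf t x) * (x ^ 2 / (AA lam x (Yf s x) * AA lam x (Yf t x))))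
        by (unfold kk, AA in *; field; repeat split; lra).
      rewrite !Rabs_mult, Rabs_Ropp.
      assert (W1 : Rabs (Yf t x - Yf s x) <= Cd * (ds / cr s ^ 2)).
      { apply (Rmult_le_reg_r (cr s ^ 2)); auto.
        replace (Cd * (ds / cr s ^ 2) * cr s ^ 2) with (Cd * ds) by (field; lra). now apply Dall. }
      assert (W2 : Rabs (Yf s x + Yf t x) <= (1 + k) * a).
      { eapply Rle_trans; [apply Rabs_triang|]. lra. }
      assert (AAl : (r0 / 2 * (a ^ 2 + x ^ 2)) * (r0 / (2 * k ^ 2) * (a ^ 2 + x ^ 2))
         <= AA lam x (Yf s x) * AA lam x (Yf t x)).
      { apply Rmult_le_compat; auto; apply Rmult_le_pos; try lra. apply Rdiv_le_0_compat; lra. }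
      assert (AA0 : 0 < (r0 / 2 * (a ^ 2 + x ^ 2)) * (r0 / (2 * k ^ 2) * (a ^ 2 + x ^ 2))).
      { apply Rmult_lt_0_compat; apply Rmult_lt_0_compat; try lra. apply Rdiv_lt_0_compat; lra. }
      assert (W3 : Rabs (x ^ 2 / (AA lam x (Yf s x) * AA lam x (Yf t x))) <= 4 * k ^ 2 / (r0 * r0) / (a ^ 2 + x ^ 2)).
      { rewrite Rabs_pos_eq by (apply Rdiv_le_0_compat; [apply pow2_ge_0|now apply Rmult_lt_0_compat]).
        apply Rle_trans with ((a ^ 2 + x ^ 2) * / ((r0 / 2 * (a ^ 2 + x ^ 2)) * (r0 / (2 * k ^ 2) * (a ^ 2 + x ^ 2)))).
        - apply Rmult_le_compat; [apply pow2_ge_0|left; apply Rinv_0_lt_compat; now apply Rmult_lt_0_compat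
            |generalize (pow2_ge_0 a); lra|now apply Rinv_le_contravar].
        - right. field. repeat split; lra. }
      apply Rle_trans with (Cd * (ds / cr s ^ 2) * ((1 + k) * a) * (4 * k ^ 2 / (r0 * r0) / (a ^ 2 + x ^ 2))).
      - apply Rmult_le_compat; auto using Rabs_pos.
        + apply Rmult_le_pos; apply Rabs_pos.
        + apply Rmult_le_compat; auto using Rabs_pos.
      - right. unfold B, CD. field. repeat split; lra. }
    rewrite <- Rmult_minus_distr_l in A.
    assert (A' : Rabs ((Kf s (c1 s) - Kf t (c1 s)) - (Kf s (f1 s) - Kf t (f1 s))) <= B / a * PI).
    { eapply Rle_trans; [exact A|]. apply Rmult_le_compat_l; auto. apply atan_osc. }
    apply Rle_trans with (B / a * PI * cr s ^ 2); [apply Rmult_le_compat_r; lra|].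
    right. unfold B. field. split; lra. }
  assert (Klip : forall u v, xl <= u <= xr -> xl <= v <= xr -> Rabs (Kf t v - Kf t u) <= 1 / r0 * Rabs (v - u)).
  { intros u v hu hv. apply (deriv_lip (Kf t) (fun x => kk lam x (Yf t x))). intros x hx.
    assert (hxI : xl <= x <= xr) by (revert hx; unfold Rmin, Rmax; destruct Rle_dec; lra).
    split; [now apply hKt|]. destruct (g' x hxI) as [n2 _].
    destruct (kk_bound lam xl xr r0 hr0 hR x (Yf t x) hxI n2). rewrite Rabs_pos_eq; auto. }
  rewrite !excess_nz by (intros e; rewrite e, Rabs_R0 in *; lra).
  replace (Kf s (c1 s) - Kf s (f1 s) - (Kf t (c1 t) - Kf t (f1 t))) with
    (((Kf s (c1 s) - Kf t (c1 s)) - (Kf s (f1 s) - Kf t (f1 s))) + ((Kf t (c1 s) - Kf t (c1 t)) + (Kf t (f1 t) - Kf t (f1 s)))) by ring.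
  assert (cr1 : cr s ^ 2 <= 1).
  { assert (cr s <= 1). { apply cube_le; [lra|]. rewrite cr_cube. simpl; lra. } replace 1 with (1 ^ 2) by ring. apply pow_incr; lra. }
  assert (K1 := Klip (c1 t) (c1 s) ct cs). assert (K2 := Klip (f1 s) (f1 t) (proj1 fs) (proj1 ft)).
  destruct (HMc t s ltac:(lra) ltac:(lra)) as [u1 _]. fold ds in u1.
  rewrite (Rabs_minus_sym (f1 t)) in K2.
  eapply Rle_trans; [apply Rmult_le_compat_r; [lra|apply Rabs_triang]|].
  rewrite Rmult_plus_distr_r.
  assert (K3 : Rabs ((Kf t (c1 s) - Kf t (c1 t)) + (Kf t (f1 t) - Kf t (f1 s))) <= Mc / r0 * ds + 1 / r0 * Rabs (f1 s - f1 t)).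
  { eapply Rle_trans; [apply Rabs_triang|].
    assert (1 / r0 * Rabs (c1 s - c1 t) <= 1 / r0 * (Mc * ds)) by (apply Rmult_le_compat_l; auto).
    replace (Mc / r0 * ds) with (1 / r0 * (Mc * ds)) by (field; lra). lra. }
  generalize (Rabs_pos ((Kf t (c1 s) - Kf t (c1 t)) + (Kf t (f1 t) - Kf t (f1 s)))) (Rabs_pos (f1 s - f1 t)).
  intros z1 z2.
  assert (z3 : Rabs ((Kf t (c1 s) - Kf t (c1 t)) + (Kf t (f1 t) - Kf t (f1 s))) * cr s ^ 2 <=
    Rabs ((Kf t (c1 s) - Kf t (c1 t)) + (Kf t (f1 t) - Kf t (f1 s))) * 1) by (apply Rmult_le_compat_l; auto).
  assert (z4 : 0 <= CD * PI * Rabs (f1 s - f1 t)) by now apply Rmult_le_pos.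
  assert (z5 : 0 <= Mc / r0 * Rabs (f1 s - f1 t)) by now apply Rmult_le_pos.
  assert (z6 : 0 <= 1 / r0 * ds) by now apply Rmult_le_pos.
  rewrite !Rmult_plus_distr_r, !Rmult_plus_distr_l. lra.
Qed.

Lemma excess_bound : exists C, 0 <= C /\ forall s, Rabs s < eps -> Rabs (excess s) <= C * cr s.
Proof.
  destruct intercept_size as [c [C [hc0 [hC H]]]]. destruct excess_size as [k [D [hk [hD0 HD0]]]].
  exists (D * C). split; [nra|]. intros s hs. destruct (Req_dec s 0) as [z|nz].
  - subst. unfold excess. destruct Req_EM_T; [|lra]. rewrite Rabs_R0, cr_0. lra.
  - assert (hs' := nz_dom s hs nz). destruct (H s hs') as [[_ h] _]. destruct (HD0 s hs') as [h1 h2].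
    rewrite Rabs_pos_eq by (generalize (Rabs_pos (Yf s 0)); nra).
    eapply Rle_trans; [exact h2|]. rewrite Rmult_assoc. now apply Rmult_le_compat_l.
Qed.

(** If |t| <= 8 |s - t|, the sizes of the two values suffice, as cr t <= 2 cr (s - t). Otherwise s
    and t have the same sign and are comparable, and [excess_diff] gives a multiple of |s - t| / cr
    s ^ 2, where |s - t| = cr (s - t) ^ 3 and cr (s - t) <= cr s. *)
Lemma excess_holder L : 0 <= L ->
  (forall s t, Rabs s < eps -> Rabs t < eps -> Rabs (f1 s - f1 t) <= L * Rabs (s - t)) ->
  bounded_lip dom (fun s t => cr (s - t)) excess.
Proof.
  intros hL HL. destruct excess_bound as [K [hK HK]]. destruct excess_diff as [D [hD0 HD0]].
  set (M := 4 * K + D * (1 + L)).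
  assert (hDL : 0 <= D * (1 + L)) by (apply Rmult_le_pos; lra).
  assert (main : forall s t, Rabs s < eps -> Rabs t < eps -> Rabs s <= Rabs t ->
    Rabs (excess s - excess t) <= M * cr (s - t)).
  { intros s t hs ht hst.
    assert (U : Rabs (excess s - excess t) <= K * cr s + K * cr t).
    { eapply Rle_trans; [apply Rabs_triang|]. rewrite Rabs_Ropp. generalize (HK s hs) (HK t ht). lra. }
    assert (cst := cr_le s t hst). assert (p := cr_pos (s - t)). assert (ps := cr_pos s).
    assert (far : Rabs t <= 8 * Rabs (s - t) -> Rabs (excess s - excess t) <= M * cr (s - t)).
    { intros h. assert (h' : cr t <= 2 * cr (s - t)).
      { apply cube_le; [lra|]. replace ((2 * cr (s - t)) ^ 3) with (8 * cr (s - t) ^ 3) by ring. now rewrite !cr_cube. }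
      assert (K * cr s <= K * (2 * cr (s - t))) by (apply Rmult_le_compat_l; lra).
      assert (K * cr t <= K * (2 * cr (s - t))) by (apply Rmult_le_compat_l; lra).
      assert (0 <= D * (1 + L) * cr (s - t)) by now apply Rmult_le_pos.
      unfold M. rewrite Rmult_plus_distr_r. lra. }
    destruct (Rle_or_lt (Rabs t) (8 * Rabs (s - t))) as [h|h]; [now apply far|].
    assert (nz : s <> 0). { intros e. subst. rewrite Rminus_0_l, Rabs_Ropp in h. generalize (Rabs_pos t); lra. }
    assert (nz' : t <> 0). { intros e. subst. rewrite Rabs_R0 in h. generalize (Rabs_pos (s - 0)); lra. }
    assert (sg : 0 < s * t).
    { destruct (Rtotal_order s 0) as [a|[a|a]], (Rtotal_order t 0) as [a'|[a'|a']]; try tauto.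
      - replace (s * t) with (- s * - t) by ring. apply Rmult_lt_0_compat; lra.
      - exfalso. revert h. unfold Rabs; repeat destruct Rcase_abs; lra.
      - exfalso. revert h. unfold Rabs; repeat destruct Rcase_abs; lra.
      - now apply Rmult_lt_0_compat. }
    assert (tr := Rabs_triang_inv t (- (s - t))). rewrite Rabs_Ropp in tr.
    assert (h2 : Rabs t <= 2 * Rabs s).
    { replace t with (s - (s - t)) at 1 by ring. eapply Rle_trans; [apply Rabs_triang|]. rewrite Rabs_Ropp.
      generalize (Rabs_triang s (- (s - t))). rewrite Rabs_Ropp. replace (s + - (s - t)) with t by ring.
      intros. lra. }
    assert (h3 : cr (s - t) <= cr s) by (apply cr_le; lra).
    assert (A := HD0 s t (nz_dom s hs nz) (nz_dom t ht nz') sg (conj hst h2)).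
    assert (crs : 0 < cr s) by now apply cr_gt0.
    assert (p2 : 0 < cr s ^ 2) by (apply pow_lt; auto).
    apply (Rmult_le_reg_r (cr s ^ 2)); auto. eapply Rle_trans; [exact A|].
    apply Rle_trans with (D * ((1 + L) * Rabs (s - t))).
    - apply Rmult_le_compat_l; auto. generalize (HL s t hs ht). lra.
    - rewrite <- (cr_cube (s - t)).
      assert (q : cr (s - t) ^ 2 <= cr s ^ 2) by (apply pow_incr; lra).
      apply Rle_trans with (D * (1 + L) * cr (s - t) * cr s ^ 2).
      + replace (D * ((1 + L) * cr (s - t) ^ 3)) with (D * (1 + L) * cr (s - t) * cr (s - t) ^ 2) by ring.
        apply Rmult_le_compat_l; auto. now apply Rmult_le_pos.
      + apply Rmult_le_compat_r; [lra|]. apply Rmult_le_compat_r; auto. unfold M; lra. }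
  exists (K + M). assert (0 <= M) by (unfold M; lra). split; [lra|split].
  - intros s hs. eapply Rle_trans; [now apply HK|].
    assert (cr s <= 1). { apply cube_le; [lra|]. rewrite cr_cube. unfold dom in hs. simpl; lra. }
    generalize (cr_pos s). nra.
  - intros s t hs ht. apply Rle_trans with (M * cr (s - t)); [|generalize (cr_pos (s - t)); nra].
    destruct (Rle_or_lt (Rabs s) (Rabs t)) as [h|h].
    + now apply main.
    + rewrite Rabs_minus_sym. replace (cr (s - t)) with (cr (t - s)).
      * apply main; auto. lra.
      * apply Rle_antisym; apply cr_le; rewrite (Rabs_minus_sym s t); lra.
Qed.

(** [stretch] divided by [slope], without the exponential: it depends on the entry and exit data
    alone, so it inherits whatever regularity these have, also at s = 0. *)
Definition factor (s : R) : R :=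
  AA lam (c1 s) (c2 s) * rr lam (f1 s) ^ 3 * / AA lam (f1 s) (f2 s) * / rr lam (c1 s) ^ 3 *
  (dc2 s - FF lam (c1 s) (c2 s) * dc1 s) * / slope s.

Lemma dom0 : Rabs 0 < eps.
Proof. rewrite Rabs_R0. lra. Qed.

Lemma f_box s : Rabs s < eps -> Rabs (f1 s - x1) <= rho /\ Rabs (f2 s) <= rho.
Proof.
  intros hs. destruct (Req_dec s 0) as [z|nz].
  - subst. destruct hf0 as [-> ->]. rewrite Rminus_diag, Rabs_R0. lra.
  - assert (hs' := nz_dom s hs nz). destruct (hY s hs') as [_ [_ [_ [h [h' _]]]]]. split; auto.
    generalize (f2_small s hs'). lra.
Qed.

Lemma f_away s : Rabs s < eps -> away xl xr b (f1 s, f2 s).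
Proof.
  intros hs. destruct (f_box s hs) as [h h']. apply Rabs_le_between in h.
  split; [|split]; simpl; try lra. rewrite Rabs_left1; lra.
Qed.

Lemma c_away s : Rabs s < eps -> away xl xr b (c1 s, c2 s).
Proof.
  intros hs. destruct (hcx s hs) as [h h']. split; [|split]; simpl; try lra. rewrite Rabs_pos_eq; lra.
Qed.

Lemma slope_lower s : Rabs s < eps -> m0 <= Rabs (slope s).
Proof. intros hs. destruct (f_box s hs). now apply hD. Qed.

Lemma factor_bl d : (forall s t : R, 0 <= d s t) ->
  bounded_lip dom d c1 -> bounded_lip dom d c2 -> bounded_lip dom d dc1 -> bounded_lip dom d dc2 ->
  bounded_lip dom d f1 -> bounded_lip dom d f2 ->
  bounded_lip dom d factor /\ bounded_lip dom d (fun s => dal (f1 s)) /\ bounded_lip dom d (fun s => dbe (f2 s)).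
Proof.
  intros hd bc1 bc2 bdc1 bdc2 bf1 bf2.
  assert (bA := bl_AA_away lam xl xr b hl hr).
  assert (bIA := bl_inv_AA_away lam xl xr r0 b hl hr hr0 hR hb).
  assert (bF := bl_FF_away lam xl xr r0 b hl hr hr0 hR hb).
  assert (bR := bl_rr_away lam xl xr b hl hr).
  assert (bda : bounded_lip dom d (fun s => dal (f1 s))).
  { apply (bl_comp1 dom d (fun x => Rabs (x - x1) <= rho)); auto. intros s hs. now apply f_box. }
  assert (bdb : bounded_lip dom d (fun s => dbe (f2 s))).
  { apply (bl_comp1 dom d (fun x => Rabs x <= rho)); auto. intros s hs. now apply f_box. }
  assert (bFf : bounded_lip dom d (fun s => FF lam (f1 s) (f2 s))).
  { apply (bl_comp2 dom d (away xl xr b) (fun p => FF lam (fst p) (snd p)) f1 f2); auto. exact f_away. }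
  assert (bFc : bounded_lip dom d (fun s => FF lam (c1 s) (c2 s))).
  { apply (bl_comp2 dom d (away xl xr b) (fun p => FF lam (fst p) (snd p)) c1 c2); auto. exact c_away. }
  split; [|split]; auto. unfold factor.
  assert (bRf : bounded_lip dom d (fun s => rr lam (f1 s))).
  { apply (bl_comp2 dom d (away xl xr b) (fun p => rr lam (fst p)) f1 f2); auto. exact f_away. }
  assert (bRc : bounded_lip dom d (fun s => rr lam (c1 s))).
  { apply (bl_comp2 dom d (away xl xr b) (fun p => rr lam (fst p)) c1 c2); auto. exact c_away. }
  apply bl_mult; auto.
  2:{ apply (bl_inv dom d hd _ m0); auto.
      - intros s hs. now apply slope_lower.
      - unfold slope. apply bl_plus; auto. now apply bl_mult. }
  apply bl_mult; auto.
  2:{ apply bl_minus; auto. now apply bl_mult. }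
  apply bl_mult; auto.
  2:{ apply (bl_inv dom d hd _ (r0 ^ 3)); [now apply pow_lt| |now apply bl_pow].
      intros s hs. rewrite <- RPow_abs. apply pow_incr. split; [lra|].
      assert (h := hR (c1 s) (c_range s hs)). rewrite Rabs_pos_eq; lra. }
  apply bl_mult; auto.
  2:{ apply (bl_comp2 dom d (away xl xr b) (fun p => / AA lam (fst p) (snd p)) f1 f2); auto. exact f_away. }
  apply bl_mult; auto; [|now apply bl_pow].
  apply (bl_comp2 dom d (away xl xr b) (fun p => AA lam (fst p) (snd p)) c1 c2); auto. exact c_away.
Qed.

Definition df1 (s : R) : R := - dbe (f2 s) * factor s * exp (-3 * lam * excess s).
Definition df2 (s : R) : R := dal (f1 s) * factor s * exp (-3 * lam * excess s).

Lemma f_derive_nz s : Rabs s < eps -> s <> 0 -> is_derive f1 s (df1 s) /\ is_derive f2 s (df2 s).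
Proof.
  intros hs nz. assert (hs' := nz_dom s hs nz). destruct (exit_derive s hs') as [d1 d2].
  destruct (hY s hs') as [g [e1 [e2 _]]].
  assert (rc := c_range s hs). assert (rf := proj1 (f_range s hs')).
  assert (Rc := hR _ rc). assert (Rf := hR _ rf).
  assert (Af : 0 < AA lam (f1 s) (f2 s)).
  { rewrite <- e2. apply (AA_pos lam xl xr r0); auto. now apply g. }
  assert (sl : slope s <> 0).
  { intros e. generalize (slope_lower s hs). rewrite e, Rabs_R0. lra. }
  assert (E : stretch s = factor s * slope s * exp (-3 * lam * excess s)).
  { unfold stretch, weight, factor. rewrite excess_nz, e1, e2 by auto.
    replace (-3 * lam * (Kf s (c1 s) - Kf s (f1 s))) with (-3 * lam * Kf s (c1 s) + - (-3 * lam * Kf s (f1 s))) by ring.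
    rewrite exp_plus, exp_Ropp. field. repeat split; auto; try lra. apply Rgt_not_eq, exp_pos. }
  rewrite E in d1, d2. split.
  - replace (df1 s) with (- dbe (f2 s) / slope s * (factor s * slope s * exp (-3 * lam * excess s))); auto.
    unfold df1. field. auto.
  - replace (df2 s) with (dal (f1 s) / slope s * (factor s * slope s * exp (-3 * lam * excess s))); auto.
    unfold df2. field. auto.
Qed.

Lemma df_bl d : (forall s t : R, 0 <= d s t) -> bounded_lip dom d excess ->
  bounded_lip dom d c1 -> bounded_lip dom d c2 -> bounded_lip dom d dc1 -> bounded_lip dom d dc2 ->
  bounded_lip dom d f1 -> bounded_lip dom d f2 -> bounded_lip dom d df1 /\ bounded_lip dom d df2.
Proof.
  intros hd bE bc1 bc2 bdc1 bdc2 bf1 bf2.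
  destruct (factor_bl d) as [bP [ba bb]]; auto.
  assert (bX : bounded_lip dom d (fun s => exp (-3 * lam * excess s))).
  { apply bl_exp; auto. apply bl_mult; auto. now apply bl_const. }
  unfold df1, df2. split; apply bl_mult; auto; apply bl_mult; auto. now apply bl_opp.
Qed.

Lemma c_bl : bounded_lip dom dR c1 /\ bounded_lip dom dR c2.
Proof.
  destruct c_taylor as [M [hM HM]]. split.
  - exists (M + xr). split; [lra|split].
    + intros s hs. destruct (hcx s hs). rewrite Rabs_pos_eq; lra.
    + intros s t hs ht. destruct (HM t s ht hs) as [h _]. unfold dR. generalize (Rabs_pos (s - t)). nra.
  - exists (M + 1). split; [lra|split].
    + intros s hs. destruct (hcx s hs). lra.
    + intros s t hs ht. destruct (HM t s ht hs) as [_ [h _]]. unfold dR. generalize (Rabs_pos (s - t)). nra.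
Qed.

(** With cr s + cr t as distance, [bounded_lip] records only the cube-root modulus at 0, all that is
    known of the exit map and of [excess] at first. *)
Lemma bl_from_zero f B C : 0 <= B -> 0 <= C -> (forall s, Rabs s < eps -> Rabs (f s) <= B) ->
  (forall s, Rabs s < eps -> Rabs (f s - f 0) <= C * cr s) ->
  bounded_lip dom (fun s t => cr s + cr t) f.
Proof.
  intros hB hC h1 h2. exists (B + C). split; [lra|split].
  - intros s hs. generalize (h1 s hs). lra.
  - intros s t hs ht. replace (f s - f t) with ((f s - f 0) - (f t - f 0)) by ring.
    eapply Rle_trans; [apply Rabs_triang|]. rewrite Rabs_Ropp.
    generalize (h2 s hs) (h2 t ht) (cr_pos s) (cr_pos t). nra.
Qed.

(** There is no orbit to linearise along at s = 0; the derivative there is the limit of the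
    derivatives at s <> 0, by the mean value theorem. *)
Lemma derive_at_zero f df M : 0 <= M ->
  (forall s, Rabs s < eps -> s <> 0 -> is_derive f s (df s)) -> continuous f 0 ->
  (forall s, Rabs s < eps -> Rabs (df s - df 0) <= M * cr s) -> is_derive f 0 (df 0).
Proof.
  intros hM Hd Hc0 HM. apply is_derive_Reals. intros e he.
  set (q := e / (M + 1)). assert (hq : 0 < q) by (apply Rdiv_lt_0_compat; lra).
  assert (h0 : 0 < Rmin eps (q ^ 3)) by (apply Rmin_glb_lt; [lra|now apply pow_lt]).
  exists (mkposreal _ h0). intros h hh hlt. simpl in hlt. rewrite Rplus_0_l.
  assert (a1 := Rlt_le_trans _ _ _ hlt (Rmin_l _ _)). assert (a2 := Rlt_le_trans _ _ _ hlt (Rmin_r _ _)).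
  destruct (MVT_gen f 0 h df) as [z [hz E]].
  - intros x hx. apply Hd.
    + apply Rabs_def2 in a1. apply Rabs_def1; revert hx; unfold Rmin, Rmax; destruct Rle_dec; lra.
    + revert hx. unfold Rmin, Rmax; destruct Rle_dec; lra.
  - intros x hx. apply continuity_pt_filterlim. destruct (Req_dec x 0) as [z|nz]; [now subst|].
    apply (is_derive_cont _ _ (df x)). apply Hd; auto.
    apply Rabs_def2 in a1. apply Rabs_def1; revert hx; unfold Rmin, Rmax; destruct Rle_dec; lra.
  - assert (hzh : Rabs z <= Rabs h).
    { revert hz. unfold Rmin, Rmax, Rabs; repeat destruct Rle_dec; repeat destruct Rcase_abs; lra. }
    replace ((f h - f 0) / h - df 0) with (df z - df 0) by (rewrite E; field; auto).
    eapply Rle_lt_trans; [apply HM; lra|].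
    assert (cz : cr z <= q).
    { apply cube_le; [lra|]. rewrite cr_cube. lra. }
    assert (e = (M + 1) * q) by (unfold q; field; lra). generalize (cr_pos z). nra.
Qed.

(** The same algebra is run twice, with two distances. The first run differentiates the exit map at
    0 and makes it Lipschitz; this feeds [excess_holder], and the second run yields the Hoelder
    bound of the derivatives. The final estimate is the obstruction to more regularity. *)
Lemma transition_regularity : lam <> 0 ->
  (forall s, Rabs s < eps -> is_derive f1 s (df1 s) /\ is_derive f2 s (df2 s)) /\
  bounded_lip dom (fun s t => cr (s - t)) df1 /\ bounded_lip dom (fun s t => cr (s - t)) df2 /\
  exists k C, 0 < k /\ 0 <= C /\ forall s, Rabs s < eps -> k * cr s <= Rabs (df2 s - df2 0) + C * Rabs s.
Proof.
  intros hlam.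
  assert (d0p : forall s t, 0 <= cr s + cr t) by (intros s t; generalize (cr_pos s) (cr_pos t); lra).
  destruct f_at_zero as [Cf [hCf HCf]]. destruct excess_bound as [Ce [hCe HCe]].
  destruct c_bl as [bc1 bc2]. destruct hdc as [bdc1 bdc2].
  assert (idcr : forall s, Rabs s < eps -> Rabs s <= cr s) by (intros s hs; apply cr_ge_id; lra).
  assert (cr1 : forall s, Rabs s < eps -> cr s <= 1).
  { intros s hs. apply cube_le; [lra|]. rewrite cr_cube. simpl; lra. }
  assert (tod0 : forall f, bounded_lip dom dR f -> bounded_lip dom (fun s t => cr s + cr t) f).
  { intros f. apply (bl_dist_le dom dR _ 1); auto; [lra|]. intros s t hs ht. unfold dR.
    generalize (Rabs_triang s (- t)). rewrite Rabs_Ropp. generalize (idcr s hs) (idcr t ht). unfold Rminus. lra. }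
  assert (f0 : excess 0 = 0) by (unfold excess; destruct Req_EM_T; lra).
  assert (bE0 : bounded_lip dom (fun s t => cr s + cr t) excess).
  { apply (bl_from_zero excess Ce Ce); auto.
    - intros s hs. generalize (HCe s hs) (cr1 s hs) (cr_pos s). nra.
    - intros s hs. rewrite f0, Rminus_0_r. auto. }
  assert (bf1_0 : bounded_lip dom (fun s t => cr s + cr t) f1).
  { apply (bl_from_zero f1 (xr - xl) Cf); auto; [lra| |].
    - intros s hs. destruct (f_away s hs) as [h _]. simpl in h. apply Rabs_le; lra.
    - intros s hs. destruct (HCf s hs) as [h _]. generalize (idcr s hs). nra. }
  assert (bf2_0 : bounded_lip dom (fun s t => cr s + cr t) f2).
  { apply (bl_from_zero f2 1 Cf); auto; [lra| |].
    - intros s hs. destruct (f_away s hs) as [_ [_ h]]. simpl in h. lra.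
    - intros s hs. destruct (HCf s hs) as [_ h]. generalize (idcr s hs). nra. }
  (* First run: only comparisons with s = 0 enter, yet it bounds df1 and df2 everywhere and controls
     them at 0. *)
  destruct (df_bl _ d0p bE0 (tod0 _ bc1) (tod0 _ bc2) (tod0 _ bdc1) (tod0 _ bdc2) bf1_0 bf2_0) as [[N1 [hN1 [HB1 HN1]]] [N2 [hN2 [HB2 HN2]]]].
  assert (cf1 : continuous f1 0).
  { apply continuous_eps. intros e he.
    assert (h : 0 < Rmin eps (e / (Cf + 1))) by (apply Rmin_glb_lt; [lra|apply Rdiv_lt_0_compat; lra]).
    exists (Rmin eps (e / (Cf + 1))). split; auto. intros s hs. rewrite Rminus_0_r in hs.
    assert (a1 := Rlt_le_trans _ _ _ hs (Rmin_l _ _)). assert (a2 := Rlt_le_trans _ _ _ hs (Rmin_r _ _)).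
    eapply Rle_lt_trans; [apply HCf; auto|].
    apply (Rmult_lt_compat_l (Cf + 1)) in a2; [|lra].
    replace ((Cf + 1) * (e / (Cf + 1))) with e in a2 by (field; lra). generalize (Rabs_pos s). lra. }
  assert (cf2 : continuous f2 0).
  { apply continuous_eps. intros e he.
    assert (h : 0 < Rmin eps (e / (Cf + 1))) by (apply Rmin_glb_lt; [lra|apply Rdiv_lt_0_compat; lra]).
    exists (Rmin eps (e / (Cf + 1))). split; auto. intros s hs. rewrite Rminus_0_r in hs.
    assert (a1 := Rlt_le_trans _ _ _ hs (Rmin_l _ _)). assert (a2 := Rlt_le_trans _ _ _ hs (Rmin_r _ _)).
    eapply Rle_lt_trans; [apply HCf; auto|].
    apply (Rmult_lt_compat_l (Cf + 1)) in a2; [|lra].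
    replace ((Cf + 1) * (e / (Cf + 1))) with e in a2 by (field; lra). generalize (Rabs_pos s). lra. }
  assert (D : forall s, Rabs s < eps -> is_derive f1 s (df1 s) /\ is_derive f2 s (df2 s)).
  { intros s hs. destruct (Req_dec s 0) as [z|nz]; [subst; split|now apply f_derive_nz].
    - apply (derive_at_zero f1 df1 N1); auto.
      + intros s h1 h2. now apply f_derive_nz.
      + intros s h1. generalize (HN1 s 0 h1 dom0). now rewrite cr_0, Rplus_0_r.
    - apply (derive_at_zero f2 df2 N2); auto.
      + intros s h1 h2. now apply f_derive_nz.
      + intros s h1. generalize (HN2 s 0 h1 dom0). now rewrite cr_0, Rplus_0_r. }
  assert (hin : forall s t x, Rabs s < eps -> Rabs t < eps -> Rmin s t <= x <= Rmax s t -> Rabs x < eps).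
  { intros s t x h1 h2. apply Rabs_def2 in h1. apply Rabs_def2 in h2.
    unfold Rmin, Rmax; destruct Rle_dec; intros; apply Rabs_def1; lra. }
  assert (L1 : forall s t, Rabs s < eps -> Rabs t < eps -> Rabs (f1 s - f1 t) <= N1 * Rabs (s - t)).
  { intros s t hs ht. apply (deriv_lip f1 df1). intros x hx.
    assert (Rabs x < eps) by (apply (hin t s); auto). split; [now apply D|now apply HB1]. }
  assert (L2 : forall s t, Rabs s < eps -> Rabs t < eps -> Rabs (f2 s - f2 t) <= N2 * Rabs (s - t)).
  { intros s t hs ht. apply (deriv_lip f2 df2). intros x hx.
    assert (Rabs x < eps) by (apply (hin t s); auto). split; [now apply D|now apply HB2]. }
  assert (bf1 : bounded_lip dom dR f1).
  { exists (N1 + (xr - xl)). split; [lra|split].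
    - intros s hs. destruct (f_away s hs) as [h _]. simpl in h. apply Rabs_le; lra.
    - intros s t hs ht. generalize (L1 s t hs ht) (Rabs_pos (s - t)). unfold dR. nra. }
  assert (bf2 : bounded_lip dom dR f2).
  { exists (N2 + 1). split; [lra|split].
    - intros s hs. destruct (f_away s hs) as [_ [_ h]]. simpl in h. lra.
    - intros s t hs ht. generalize (L2 s t hs ht) (Rabs_pos (s - t)). unfold dR. nra. }
  (* Second run, with the distance cr (s - t): every Lipschitz ingredient qualifies because |s - t|
     <= cr (s - t) for |s - t| <= 1. *)
  assert (toH : forall f, bounded_lip dom dR f -> bounded_lip dom (fun s t => cr (s - t)) f).
  { intros f. apply (bl_dist_le dom dR _ 1); [lra| |intros; apply cr_pos]. intros s t hs ht. unfold dR.
    rewrite Rmult_1_l. apply cr_ge_id. unfold dom in hs, ht.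
    generalize (Rabs_triang s (- t)). rewrite Rabs_Ropp. unfold Rminus. lra. }
  assert (bEH := excess_holder N1 hN1 L1).
  destruct (df_bl _ (fun s t => cr_pos (s - t)) bEH (toH _ bc1) (toH _ bc2) (toH _ bdc1) (toH _ bdc2) (toH _ bf1) (toH _ bf2)) as [H1 H2].
  split; [exact D|split; [exact H1|split; [exact H2|]]].
  destruct (factor_bl dR dR_pos bc1 bc2 bdc1 bdc2 bf1 bf2) as [bP [ba _]].
  destruct (bl_mult dom dR dR_pos _ _ ba bP) as [M [hM [HM1 HM2]]].
  set (P := fun s => dal (f1 s) * factor s).
  assert (P0 : 0 < Rabs (P 0)).
  { apply Rabs_pos_lt. unfold P. apply Rmult_integral_contrapositive_currified.
    - intros e. generalize (dal_lower (f1 0) (proj1 (f_box 0 dom0))). rewrite e, Rabs_R0. lra.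
    - destruct (hcx 0 dom0) as [hc0 _]. assert (rc := c_range 0 dom0). assert (Rc := hR _ rc).
      destruct (f_away 0 dom0) as [rf [rf' _]]. simpl in rf, rf'. assert (Rf := hR _ rf).
      assert (Ac := AA_away_lower lam xl xr r0 b hr0 hR hb _ (c_away 0 dom0)).
      assert (Af := AA_away_lower lam xl xr r0 b hr0 hR hb _ (f_away 0 dom0)). simpl in Ac, Af.
      assert (rb : 0 < r0 * (b * (b * 1))) by (apply Rmult_lt_0_compat; [|apply Rmult_lt_0_compat]; lra).
      assert (e2 : c2 0 = 0).
      { destruct (hc2 0 dom0) as [_ h]. rewrite Rabs_R0, Rmult_0_r in h.
        destruct (Req_dec (c2 0) 0) as [e|e]; auto. apply Rabs_pos_lt in e. lra. }
      assert (n1 : rr lam (f1 0) ^ 3 <> 0) by (apply pow_nonzero; lra).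
      assert (n2 : rr lam (c1 0) ^ 3 <> 0) by (apply pow_nonzero; lra).
      unfold factor. revert n1 n2. generalize (rr lam (f1 0) ^ 3) (rr lam (c1 0) ^ 3). intros u v n1 n2.
      repeat apply Rmult_integral_contrapositive_currified.
      + intros e. rewrite e, Rabs_R0 in Ac. lra.
      + auto.
      + apply Rinv_neq_0_compat. intros e. rewrite e, Rabs_R0 in Af. lra.
      + now apply Rinv_neq_0_compat.
      + rewrite e2, FF_0. lra.
      + apply Rinv_neq_0_compat. intros e. generalize (slope_lower 0 dom0). rewrite e, Rabs_R0. lra. }
  destruct excess_size as [k [Ck [hk [hCk HCk]]]]. destruct intercept_size as [c [C [hc0 [hC HC]]]].
  set (w := 3 * Rabs lam * Ce).
  assert (hw : 0 <= w) by (unfold w; generalize (Rabs_pos lam); intros; apply Rmult_le_pos; lra).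
  assert (lp : 0 < Rabs lam) by now apply Rabs_pos_lt.
  set (kk0 := Rabs (P 0) * (exp (- w) * (3 * Rabs lam * (k * c)))).
  assert (hkk : 0 < kk0).
  { unfold kk0. apply Rmult_lt_0_compat; auto. apply Rmult_lt_0_compat; [apply exp_pos|].
    apply Rmult_lt_0_compat; nra. }
  exists kk0, (M * exp w). split; auto. split; [apply Rmult_le_pos; auto; left; apply exp_pos|].
  intros s hs. destruct (Req_dec s 0) as [z|nz].
  { subst. rewrite cr_0, Rminus_diag, Rabs_R0. lra. }
  assert (hs' := nz_dom s hs nz).
  set (z := -3 * lam * excess s).
  assert (az : Rabs z = 3 * Rabs lam * Rabs (excess s)).
  { unfold z. rewrite !Rabs_mult. replace (Rabs (-3)) with 3 by (rewrite Rabs_left; lra). ring. }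
  assert (zw : Rabs z <= w).
  { rewrite az. unfold w. apply Rmult_le_compat_l; [lra|].
    apply Rle_trans with (Ce * cr s); [now apply HCe|]. rewrite <- (Rmult_1_r Ce) at 2.
    apply Rmult_le_compat_l; auto. }
  assert (zl : 3 * Rabs lam * (k * c * cr s) <= Rabs z).
  { rewrite az. apply Rmult_le_compat_l; [lra|]. destruct (HCk s hs') as [h1 _]. destruct (HC s hs') as [[h2 _] _].
    apply Rle_trans with (excess s); [|apply Rle_abs]. eapply Rle_trans; [|exact h1].
    rewrite Rmult_assoc. apply Rmult_le_compat_l; lra. }
  apply Rabs_le_between in zw.
  assert (ez : exp z <= exp w).
  { destruct (proj2 zw) as [h|h]; [left; now apply exp_increasing|rewrite h; lra]. }
  assert (ex : exp (- w) * Rabs z <= Rabs (exp z - 1)).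
  { destruct (MVT_any exp exp 0 z) as [xi [hxi E]].
    { intros x _. apply is_derive_Reals, derivable_pt_lim_exp. }
    rewrite exp_0, Rminus_0_r in E. rewrite E, Rabs_mult. apply Rmult_le_compat_r; [apply Rabs_pos|].
    rewrite Rabs_pos_eq by (left; apply exp_pos).
    assert (h : - w <= xi) by (revert hxi; unfold Rmin, Rmax; destruct Rle_dec; lra).
    destruct h as [h|h]; [left; now apply exp_increasing|rewrite h; lra]. }
  (* P is Lipschitz, so the first term is O(|s|). In the second, P 0 <> 0 and |exp z - 1| is bounded
     below by a multiple of |z|, hence by a multiple of lam times the cube root of |s|. *)
  assert (E2 : df2 s - df2 0 = (P s - P 0) * exp z + P 0 * (exp z - 1)).
  { unfold df2, P, z. rewrite f0, Rmult_0_r, exp_0. ring. }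
  assert (HP := HM2 s 0 hs dom0). unfold dR in HP. rewrite Rminus_0_r in HP. fold (P s) (P 0) in HP.
  assert (T : Rabs (P 0 * (exp z - 1)) <= Rabs (df2 s - df2 0) + Rabs ((P s - P 0) * exp z)).
  { replace (P 0 * (exp z - 1)) with ((df2 s - df2 0) + - ((P s - P 0) * exp z)) by (rewrite E2; ring).
    eapply Rle_trans; [apply Rabs_triang|]. rewrite Rabs_Ropp. lra. }
  rewrite !Rabs_mult, (Rabs_pos_eq (exp z)) in T by (left; apply exp_pos).
  assert (T1 : Rabs (P s - P 0) * exp z <= M * Rabs s * exp w).
  { apply Rmult_le_compat; auto; [apply Rabs_pos|left; apply exp_pos]. }
  assert (T2 : kk0 * cr s <= Rabs (P 0) * Rabs (exp z - 1)).
  { unfold kk0. rewrite Rmult_assoc. apply Rmult_le_compat_l; [lra|].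
    eapply Rle_trans; [|exact ex]. rewrite Rmult_assoc. apply Rmult_le_compat_l; [left; apply exp_pos|].
    lra. }
  lra.
Qed.
End Transition.

(** * Smooth domains in the plane *)

Lemma locally_plane (p : plane) (P : plane -> Prop) :
  locally p P <-> exists e, 0 < e /\ forall q, Rabs (fst q - fst p) < e -> Rabs (snd q - snd p) < e -> P q.
Proof.
  split.
  - intros [e He]. exists e. split; [apply cond_pos|]. intros q h1 h2. apply He. now split.
  - intros [e [he He]]. exists (mkposreal e he). intros q [h1 h2]. now apply He.
Qed.

Lemma locally_R (x : R) (P : R -> Prop) :
  locally x P <-> exists e, 0 < e /\ forall y, Rabs (y - x) < e -> P y.
Proof.
  split.
  - intros [e He]. exists e. split; [apply cond_pos|]. intros q h1. now apply He.
  - intros [e [he He]]. exists (mkposreal e he). intros q h1. now apply He.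
Qed.

Lemma open_plane (U : plane -> Prop) :
  (forall p : plane, U p -> exists e, 0 < e /\
     forall q : plane, Rabs (fst q - fst p) < e -> Rabs (snd q - snd p) < e -> U q) -> open U.
Proof. intros H p hp. apply (proj2 (locally_plane p U)). now apply H. Qed.

Lemma open_box (a c r r' : R) : open (fun p : plane => Rabs (fst p - a) < r /\ Rabs (snd p - c) < r').
Proof.
  apply open_plane. intros p [h1 h2].
  exists (Rmin (r - Rabs (fst p - a)) (r' - Rabs (snd p - c))). split; [apply Rmin_glb_lt; lra|].
  intros q q1 q2. assert (q1' := Rlt_le_trans _ _ _ q1 (Rmin_l _ _)). assert (q2' := Rlt_le_trans _ _ _ q2 (Rmin_r _ _)).
  split.
  - replace (fst q - a) with ((fst q - fst p) + (fst p - a)) by ring. eapply Rle_lt_trans; [apply Rabs_triang|lra].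
  - replace (snd q - c) with ((snd q - snd p) + (snd p - c)) by ring. eapply Rle_lt_trans; [apply Rabs_triang|lra].
Qed.

Lemma finite_subfamily_bound (U : nat -> plane -> Prop) (l : list (plane -> Prop)) :
  (forall m n p, (m <= n)%nat -> U m p -> U n p) ->
  (forall V, In V l -> exists n, V = U n) -> exists n, forall V p, In V l -> V p -> U n p.
Proof.
  intros mono. induction l as [|V l IH]; intros H.
  - exists O. intros V p [].
  - destruct (H V (or_introl eq_refl)) as [n Hn]. destruct IH as [m Hm]; [intros W hW; apply H; now right|].
    exists (Nat.max n m). intros W p [e|hW] hp.
    + subst. apply (mono n); [lia|auto].
    + apply (mono m); [lia|]. eapply Hm; eassumption.
Qed.

(** The subcover property in the form used for boundedness and closedness: the largest index in a
    finite subfamily of an increasing cover already suffices. *)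
Lemma compact_increasing (N : plane -> Prop) (U : nat -> plane -> Prop) : compact_set N ->
  (forall n, open (U n)) -> (forall m n p, (m <= n)%nat -> U m p -> U n p) ->
  (forall p, N p -> exists n, U n p) -> exists n, forall p, N p -> U n p.
Proof.
  intros hN ho mono hc. destruct (hN (fun V => exists n, V = U n)) as [l [h1 h2]].
  - intros V [n ->]. apply ho.
  - intros p hp. destruct (hc p hp) as [n hn]. exists (U n). split; [now exists n|auto].
  - destruct (finite_subfamily_bound U l mono h1) as [n hn]. exists n. intros p hp.
    destruct (h2 p hp) as [V [hV hVp]]. eapply hn; eassumption.
Qed.

Lemma compact_bounded (N : plane -> Prop) : compact_set N -> exists B, 1 <= B /\ forall p, N p -> in_box B p.
Proof.
  intros hN.
  destruct (compact_increasing N (fun n p => Rabs (fst p - 0) < INR n /\ Rabs (snd p - 0) < INR n)) as [n hn]; auto.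
  - intros n. apply open_box.
  - intros m n p hmn [h1 h2]. apply le_INR in hmn. split; lra.
  - intros p _. destruct (INR_unbounded (Rabs (fst p - 0) + Rabs (snd p - 0))) as [n hn]. exists n.
    generalize (Rabs_pos (fst p - 0)) (Rabs_pos (snd p - 0)). split; lra.
  - exists (INR n + 1). split; [generalize (pos_INR n); lra|]. intros p hp. destruct (hn p hp) as [h1 h2].
    rewrite Rminus_0_r in h1, h2. apply Rabs_def2 in h1. apply Rabs_def2 in h2. split; lra.
Qed.

(** The complements of closed squares shrinking to p form an increasing open cover of N; one of them
    contains N, so N misses a square around p. *)
Lemma compact_closed (N : plane -> Prop) p : compact_set N -> ~ N p -> locally p (fun q => ~ N q).
Proof.
  intros hN hp.
  destruct (compact_increasing N (fun n q => / INR (S n) < Rabs (fst q - fst p) \/ / INR (S n) < Rabs (snd q - snd p)))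
    as [n hn]; auto.
  - intros n. apply open_plane. intros q hq.
    destruct hq as [hq|hq].
    + exists (Rabs (fst q - fst p) - / INR (S n)). split; [lra|]. intros q' h1 _. left.
      generalize (Rabs_triang_inv (fst q - fst p) (fst q - fst q')).
      replace (fst q - fst p - (fst q - fst q')) with (fst q' - fst p) by ring.
      rewrite (Rabs_minus_sym (fst q) (fst q')). lra.
    + exists (Rabs (snd q - snd p) - / INR (S n)). split; [lra|]. intros q' _ h1. right.
      generalize (Rabs_triang_inv (snd q - snd p) (snd q - snd q')).
      replace (snd q - snd p - (snd q - snd q')) with (snd q' - snd p) by ring.
      rewrite (Rabs_minus_sym (snd q) (snd q')). lra.
  - intros m n q hmn hq. assert (/ INR (S n) <= / INR (S m)).
    { apply Rinv_le_contravar; [apply lt_0_INR; lia|apply le_INR; lia]. }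
    destruct hq; [left|right]; lra.
  - intros q hq.
    assert (d : 0 < Rabs (fst q - fst p) \/ 0 < Rabs (snd q - snd p)).
    { destruct (Req_dec (fst q) (fst p)) as [e1|e1]; [|left; apply Rabs_pos_lt; lra].
      destruct (Req_dec (snd q) (snd p)) as [e2|e2]; [|right; apply Rabs_pos_lt; lra].
      exfalso. apply hp. replace p with q; auto. destruct p, q; simpl in *; congruence. }
    assert (K : forall r, 0 < r -> exists n, / INR (S n) < r).
    { intros r hr. destruct (archimed_cor1 r hr) as [n [h1 h2]]. exists n.
      eapply Rle_lt_trans; [|exact h1]. apply Rinv_le_contravar; [apply lt_0_INR; lia|apply le_INR; lia]. }
    destruct d as [d|d]; destruct (K _ d) as [n hn]; exists n; [now left|now right].
  - apply locally_plane. exists (/ INR (S n)). split; [apply Rinv_0_lt_compat, lt_0_INR; lia|].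
    intros q h1 h2 hq. destruct (hn q hq); lra.
Qed.

(** Smoothness of the boundary and of parametrisations enters the estimates only through this
    C^(1,1) bound; shrinking the interval by half gives a compact one on which the second derivative
    is bounded. *)
Lemma smooth_C11 (h : R -> R) x0 : smooth_at h x0 -> exists r, 0 < r /\
  (forall x, Rabs (x - x0) <= r -> is_derive h x (Derive h x)) /\
  bounded_lip (fun x => Rabs (x - x0) <= r) (fun s t => Rabs (s - t)) (Derive h).
Proof.
  intros hs. apply locally_R in hs. destruct hs as [e [he H]].
  exists (e / 2). split; [lra|].
  assert (hin : forall x, Rabs (x - x0) <= e / 2 -> Rabs (x - x0) < e) by (intros; lra).
  assert (D1 : forall x, Rabs (x - x0) <= e / 2 -> is_derive h x (Derive h x)).
  { intros x hx. apply Derive_correct. exact (H x (hin x hx) 1%nat). }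
  assert (D2 : forall x, Rabs (x - x0) <= e / 2 -> is_derive (Derive h) x (Derive (Derive h) x)).
  { intros x hx. apply Derive_correct. exact (H x (hin x hx) 2%nat). }
  assert (D3 : forall x, Rabs (x - x0) <= e / 2 -> is_derive (Derive (Derive h)) x (Derive (Derive (Derive h)) x)).
  { intros x hx. apply Derive_correct. exact (H x (hin x hx) 3%nat). }
  split; auto.
  destruct (cont_bounded (Derive h) (x0 - e / 2) (x0 + e / 2)) as [M [hM HM]].
  { intros x hx. eapply is_derive_cont. apply D2. apply Rabs_le; lra. }
  destruct (cont_bounded (Derive (Derive h)) (x0 - e / 2) (x0 + e / 2)) as [M' [hM' HM']].
  { intros x hx. eapply is_derive_cont. apply D3. apply Rabs_le; lra. }
  exists (M + M'). split; [lra|split].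
  - intros x hx. apply Rabs_le_between in hx. generalize (HM x ltac:(lra)). lra.
  - intros x y hx hy. apply Rle_trans with (M' * Rabs (x - y)).
    + apply (deriv_lip (Derive h) (Derive (Derive h))). intros z hz.
      assert (x0 - e / 2 <= z <= x0 + e / 2).
      { apply Rabs_le_between in hx. apply Rabs_le_between in hy. revert hz. unfold Rmin, Rmax; destruct Rle_dec; lra. }
      split; [apply D2; apply Rabs_le; lra|now apply HM'].
    + generalize (Rabs_pos (x - y)). nra.
Qed.

Lemma ex_derive_n_affine (h : R -> R) p k x n :
  (forall m, ex_derive_n h m (p + k * x)) -> locally x (fun y => forall m, ex_derive_n h m (p + k * y)) ->
  ex_derive_n (fun s => h (p + k * s)) n x.
Proof.
  intros H0 Hl. apply (ex_derive_n_ext (fun s => (fun y => h (y + p)) (k * s))).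
  { intros t. simpl. f_equal. ring. }
  destruct (Req_dec k 0) as [e|nz].
  - subst. apply (ex_derive_n_ext (fun s => h (0 + p))).
    { intros t. simpl. f_equal. ring. }
    apply ex_derive_n_const.
  - apply (ex_derive_n_comp_scal (fun y => h (y + p)) k n x).
    apply locally_R in Hl. destruct Hl as [e [he He]]. apply locally_R.
    exists (e * Rabs k). assert (pk := Rabs_pos_lt _ nz). split; [nra|]. intros y hy j _.
    apply ex_derive_n_comp_trans.
    replace (y + p) with (p + k * (y / k)) by (field; auto). apply He.
    replace (y / k - x) with ((y - k * x) / k) by (field; auto).
    unfold Rdiv. rewrite Rabs_mult, Rabs_inv. apply (Rmult_lt_reg_r (Rabs k)); auto.
    rewrite Rmult_assoc, Rinv_l by lra. lra.
Qed.

Lemma smooth_at_affine (h : R -> R) p k : smooth_at h p -> smooth_at (fun s => h (p + k * s)) 0.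
Proof.
  intros hs. apply locally_R in hs. destruct hs as [e [he He]]. apply locally_R.
  set (d := e / (Rabs k + 1)). assert (pk := Rabs_pos k).
  assert (hd : 0 < d) by (apply Rdiv_lt_0_compat; lra).
  assert (K : forall y, Rabs y < d -> Rabs (p + k * y - p) < e).
  { intros y hy. replace (p + k * y - p) with (k * y) by ring. rewrite Rabs_mult.
    assert (e = (Rabs k + 1) * d) by (unfold d; field; lra). generalize (Rabs_pos y). nra. }
  exists d. split; auto. intros y hy. rewrite Rminus_0_r in hy. intros n. apply ex_derive_n_affine.
  - intros m. now apply He, K.
  - apply locally_R. exists (d - Rabs y). split; [lra|]. intros z hz m. apply He, K.
    replace z with ((z - y) + y) by ring. eapply Rle_lt_trans; [apply Rabs_triang|lra].
Qed.

Lemma smooth_at_lin p k : smooth_at (fun s => p + k * s) 0.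
Proof.
  apply (smooth_at_affine (fun x => x)). apply locally_R. exists 1. split; [lra|]. intros y _ n.
  assert (K : forall m, exists c, forall t, Derive_n (fun x : R => x) (S m) t = c).
  { induction m as [|m [c hc]].
    - exists 1. intros t. apply Derive_id.
    - exists 0. intros t. change (Derive (Derive_n (fun x : R => x) (S m)) t = 0).
      rewrite (Derive_ext _ (fun _ => c)); [apply Derive_const|exact hc]. }
  destruct n as [|[|n]]; [exact I|apply ex_derive_id|].
  destruct (K n) as [c hc].
  apply (ex_derive_ext (fun _ => c)); [intros t; symmetry; apply hc|apply ex_derive_const].
Qed.

(* Near p the set N is [al x + be y <= 0]; separating the variables treats graphs over
   either axis alike. *)
Record local_eq (N : plane -> Prop) (p : plane) (al be dal dbe : R -> R) (rho : R) : Prop := {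
  le_rho : 0 < rho;
  le_al : forall x, Rabs (x - fst p) <= rho -> is_derive al x (dal x);
  le_be : forall y, Rabs (y - snd p) <= rho -> is_derive be y (dbe y);
  le_dal : bounded_lip (fun x => Rabs (x - fst p) <= rho) (fun s t => Rabs (s - t)) dal;
  le_dbe : bounded_lip (fun y => Rabs (y - snd p) <= rho) (fun s t => Rabs (s - t)) dbe;
  le_0 : al (fst p) + be (snd p) = 0;
  le_N : forall q, Rabs (fst q - fst p) <= rho -> Rabs (snd q - snd p) <= rho -> (N q <-> al (fst q) + be (snd q) <= 0);
  le_bd : forall q, Rabs (fst q - fst p) < rho -> Rabs (snd q - snd p) < rho -> al (fst q) + be (snd q) = 0 -> bd N q
}.

Lemma bounded_lip_scal (S : R -> Prop) c f : bounded_lip S (fun s t => Rabs (s - t)) f ->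
  bounded_lip S (fun s t => Rabs (s - t)) (fun x => c * f x).
Proof.
  intros h. apply bl_mult; auto; [intros; apply Rabs_pos|]. apply bl_const. intros; apply Rabs_pos.
Qed.

(** Besides the equation, the graph gives explicit curves in the boundary with any prescribed speed
    along the axis over which it is a graph. These show that vanishing of the derivative of the
    equation along X means tangency, and they provide a regular parametrisation. *)
Lemma local_boundary (N : plane -> Prop) (p : plane) : smooth_domain N -> bd N p ->
  exists al be dal dbe rho, local_eq N p al be dal dbe rho /\
   (forall X : plane -> plane, dal (fst p) * fst (X p) + dbe (snd p) * snd (X p) = 0 -> tau X N p) /\
   exists c, local_param (bd N) p c.
Proof.
  intros [_ hsm] hbd. destruct (hsm p (proj1 hbd)) as [h|h]; [destruct hbd; contradiction|].
  destruct h as [bb [h [e [he [hs [hp hloc]]]]]].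
  destruct (smooth_C11 h _ hs) as [r1 [hr1 [D1 BL1]]].
  apply locally_plane in hloc. destruct hloc as [r2 [hr2 hloc]].
  set (rho := Rmin r1 (r2 / 2)).
  assert (hrho : 0 < rho) by (apply Rmin_glb_lt; lra).
  assert (rho1 : rho <= r1) by apply Rmin_l. assert (rho2 : rho < r2).
  { apply Rle_lt_trans with (r2 / 2); [apply Rmin_r|lra]. }
  assert (blc : forall (S : R -> Prop) c, bounded_lip S (fun s t => Rabs (s - t)) (fun _ => c)).
  { intros S c. apply bl_const. intros; apply Rabs_pos. }
  destruct bb; simpl in hs, hp, hloc, D1, BL1.
  - set (al := fun x => e * x). set (be := fun y => - (e * h y)).
    assert (hN : forall q : plane, Rabs (fst q - fst p) <= rho -> Rabs (snd q - snd p) <= rho -> (N q <-> al (fst q) + be (snd q) <= 0)).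
    { intros q q1 q2. rewrite (hloc q) by lra. unfold al, be. split; intros; lra. }
    assert (hbd' : forall q : plane, Rabs (fst q - fst p) < rho -> Rabs (snd q - snd p) < rho -> al (fst q) + be (snd q) = 0 -> bd N q).
    { intros q q1 q2 q0. split; [apply hN; lra|]. intros hl. apply locally_plane in hl. destruct hl as [d [hd Hd]].
      (* Moving the first coordinate by e t raises the defining function by e^2 t > 0 within the
         box, so a zero of it cannot be an interior point of N. *)
      set (t := Rmin (d / 2) ((rho - Rabs (fst q - fst p)) / 2) / Rabs e).
      assert (pe := Rabs_pos_lt _ he).
      assert (ht0 : 0 < Rmin (d / 2) ((rho - Rabs (fst q - fst p)) / 2)) by (apply Rmin_glb_lt; lra).
      assert (ht : 0 < t) by (unfold t; now apply Rdiv_lt_0_compat).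
      assert (het : Rabs (e * t) = Rmin (d / 2) ((rho - Rabs (fst q - fst p)) / 2)).
      { rewrite Rabs_mult, (Rabs_pos_eq t) by lra. unfold t. field. lra. }
      assert (m1 := Rmin_l (d / 2) ((rho - Rabs (fst q - fst p)) / 2)).
      assert (m2 := Rmin_r (d / 2) ((rho - Rabs (fst q - fst p)) / 2)).
      assert (Hq : N (fst q + e * t, snd q)).
      { apply Hd; simpl; [|rewrite Rminus_diag, Rabs_R0; auto].
        replace (fst q + e * t - fst q) with (e * t) by ring. lra. }
      apply hN in Hq; simpl in *; [|
        replace (fst q + e * t - fst p) with ((fst q - fst p) + e * t) by ring;
        eapply Rle_trans; [apply Rabs_triang|lra] | lra].
      unfold al, be in *. assert (0 < (e * e) * t) by (apply Rmult_lt_0_compat; nra). lra. }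
    (* The speed k is left free: k equal to the second component of X gives the tangency, k = 1 the
       parametrisation. *)
    assert (C : forall k, smooth_curve_in (bd N) p (fun s => (h (snd p + k * s), snd p + k * s)) /\
        velocity0 (fun s => (h (snd p + k * s), snd p + k * s)) = (k * Derive h (snd p), k)).
    { intros k. split.
      - split; [|split; [|split]]; simpl.
        + rewrite Rmult_0_r, Rplus_0_r. rewrite <- hp. now destruct p.
        + now apply smooth_at_affine.
        + apply smooth_at_lin.
        + assert (c1 : continuous (fun s => h (snd p + k * s)) 0).
          { apply (is_derive_cont _ _ (k * Derive h (snd p))).
            assert (dd := D1 (snd p) ltac:(rewrite Rminus_diag, Rabs_R0; lra)).
            apply (is_derive_comp h (fun s => snd p + k * s) 0 (Derive h (snd p)) k); [now rewrite Rmult_0_r, Rplus_0_r|].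
            auto_derive; auto; ring. }
          assert (c2 : continuous (fun s => snd p + k * s) 0).
          { apply (is_derive_cont _ _ k). auto_derive; auto; ring. }
          destruct (proj1 (continuous_eps _ _) c1 rho hrho) as [d1 [hd1 H1]].
          destruct (proj1 (continuous_eps _ _) c2 rho hrho) as [d2 [hd2 H2]].
          apply locally_R. exists (Rmin d1 d2). split; [now apply Rmin_glb_lt|]. intros s hs'.
          specialize (H1 s (Rlt_le_trans _ _ _ hs' (Rmin_l _ _))). specialize (H2 s (Rlt_le_trans _ _ _ hs' (Rmin_r _ _))).
          rewrite Rmult_0_r, Rplus_0_r in H1, H2.
          apply hbd'; simpl; auto. now rewrite hp. unfold al, be; ring.
      - unfold velocity0; simpl. f_equal; apply is_derive_unique.
        + apply (is_derive_comp h (fun s => snd p + k * s) 0 (Derive h (snd p)) k).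
          * rewrite Rmult_0_r, Rplus_0_r. apply D1. rewrite Rminus_diag, Rabs_R0; lra.
          * auto_derive; auto; ring.
        + auto_derive; auto; ring. }
    exists al, be, (fun _ => e), (fun y => - e * Derive h y), rho. split; [|split].
    + constructor; auto.
      * intros x _. unfold al. auto_derive; auto; ring.
      * intros y hy. unfold be. assert (dd := D1 y ltac:(lra)). auto_derive; [side_derive|]. derive_rw dd. ring.
      * apply bounded_lip_scal. apply (bl_subset (fun x => Rabs (x - snd p) <= r1)); auto. intros; lra.
      * unfold al, be. rewrite hp. ring.
    + intros X hX. split; auto. destruct (C (snd (X p))) as [C1 C2]. eexists. split; [exact C1|].
      rewrite C2. rewrite (surjective_pairing (X p)) at 3. f_equal.
      apply (Rmult_eq_reg_l e); auto. lra.
    + destruct (C 1) as [C1 C2]. eexists. split; [exact C1|]. rewrite C2. intros E. inversion E. lra.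
  (* The case of a graph over the x-axis. Here [al] carries h and is evaluated at the abscissa,
     whatever the name of its bound variable. *)
  - set (be := fun x => e * x). set (al := fun y => - (e * h y)).
    assert (hN : forall q : plane, Rabs (fst q - fst p) <= rho -> Rabs (snd q - snd p) <= rho -> (N q <-> al (fst q) + be (snd q) <= 0)).
    { intros q q1 q2. rewrite (hloc q) by lra. unfold al, be. split; intros; lra. }
    assert (hbd' : forall q : plane, Rabs (fst q - fst p) < rho -> Rabs (snd q - snd p) < rho -> al (fst q) + be (snd q) = 0 -> bd N q).
    { intros q q1 q2 q0. split; [apply hN; lra|]. intros hl. apply locally_plane in hl. destruct hl as [d [hd Hd]].
      set (t := Rmin (d / 2) ((rho - Rabs (snd q - snd p)) / 2) / Rabs e).
      assert (pe := Rabs_pos_lt _ he).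
      assert (ht0 : 0 < Rmin (d / 2) ((rho - Rabs (snd q - snd p)) / 2)) by (apply Rmin_glb_lt; lra).
      assert (ht : 0 < t) by (unfold t; now apply Rdiv_lt_0_compat).
      assert (het : Rabs (e * t) = Rmin (d / 2) ((rho - Rabs (snd q - snd p)) / 2)).
      { rewrite Rabs_mult, (Rabs_pos_eq t) by lra. unfold t. field. lra. }
      assert (m1 := Rmin_l (d / 2) ((rho - Rabs (snd q - snd p)) / 2)).
      assert (m2 := Rmin_r (d / 2) ((rho - Rabs (snd q - snd p)) / 2)).
      assert (Hq : N (fst q, snd q + e * t)).
      { apply Hd; simpl; [rewrite Rminus_diag, Rabs_R0; auto|].
        replace (snd q + e * t - snd q) with (e * t) by ring. lra. }
      apply hN in Hq; simpl in *; [|lra|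
        replace (snd q + e * t - snd p) with ((snd q - snd p) + e * t) by ring;
        eapply Rle_trans; [apply Rabs_triang|lra]].
      unfold al, be in *. assert (0 < (e * e) * t) by (apply Rmult_lt_0_compat; nra). lra. }
    assert (C : forall k, smooth_curve_in (bd N) p (fun s => (fst p + k * s, h (fst p + k * s))) /\
        velocity0 (fun s => (fst p + k * s, h (fst p + k * s))) = (k, k * Derive h (fst p))).
    { intros k. split.
      - split; [|split; [|split]]; simpl.
        + rewrite Rmult_0_r, Rplus_0_r. rewrite <- hp. now destruct p.
        + apply smooth_at_lin.
        + now apply smooth_at_affine.
        + assert (c1 : continuous (fun s => h (fst p + k * s)) 0).
          { apply (is_derive_cont _ _ (k * Derive h (fst p))).
            assert (dd := D1 (fst p) ltac:(rewrite Rminus_diag, Rabs_R0; lra)).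
            apply (is_derive_comp h (fun s => fst p + k * s) 0 (Derive h (fst p)) k); [now rewrite Rmult_0_r, Rplus_0_r|].
            auto_derive; auto; ring. }
          assert (c2 : continuous (fun s => fst p + k * s) 0).
          { apply (is_derive_cont _ _ k). auto_derive; auto; ring. }
          destruct (proj1 (continuous_eps _ _) c1 rho hrho) as [d1 [hd1 H1]].
          destruct (proj1 (continuous_eps _ _) c2 rho hrho) as [d2 [hd2 H2]].
          apply locally_R. exists (Rmin d1 d2). split; [now apply Rmin_glb_lt|]. intros s hs'.
          specialize (H1 s (Rlt_le_trans _ _ _ hs' (Rmin_l _ _))). specialize (H2 s (Rlt_le_trans _ _ _ hs' (Rmin_r _ _))).
          rewrite Rmult_0_r, Rplus_0_r in H1, H2.
          apply hbd'; simpl; auto. now rewrite hp. unfold al, be; ring.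
      - unfold velocity0; simpl. f_equal; apply is_derive_unique.
        + auto_derive; auto; ring.
        + apply (is_derive_comp h (fun s => fst p + k * s) 0 (Derive h (fst p)) k).
          * rewrite Rmult_0_r, Rplus_0_r. apply D1. rewrite Rminus_diag, Rabs_R0; lra.
          * auto_derive; auto; ring. }
    exists al, be, (fun y => - e * Derive h y), (fun _ => e), rho. split; [|split].
    + constructor; auto.
      * intros y hy. unfold al. assert (dd := D1 y ltac:(lra)). auto_derive; [side_derive|]. derive_rw dd. ring.
      * intros x _. unfold be. auto_derive; auto; ring.
      * apply bounded_lip_scal. apply (bl_subset (fun x => Rabs (x - fst p) <= r1)); auto. intros; lra.
      * unfold al, be. rewrite hp. ring.
    + intros X hX. split; auto. destruct (C (fst (X p))) as [C1 C2]. eexists. split; [exact C1|].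
      rewrite C2. rewrite (surjective_pairing (X p)) at 3. f_equal.
      apply (Rmult_eq_reg_l e); auto. lra.
    + destruct (C 1) as [C1 C2]. eexists. split; [exact C1|]. rewrite C2. intros E. inversion E. lra.
Qed.

(** * Orbits in an isolating block *)

Lemma interval_0 t s : Rmin 0 t <= s <= Rmax 0 t -> Rabs s <= Rabs t.
Proof. unfold Rmin, Rmax, Rabs; destruct Rle_dec; repeat destruct Rcase_abs; lra. Qed.

Section BlockFlow.
Variables (lam B : R) (N : plane -> Prop) (Phi : plane -> R -> plane).
Hypothesis hB : 1 <= B.
Hypothesis hNB : forall p, N p -> in_box B p.
Hypothesis hPhi0 : forall p, Phi p 0 = p.
Hypothesis hPhi : forall p t, solves_at (Xc lam (B + 1)) (Phi p) t.

(** The box in which the clamped and the true field agree. It exceeds the box around N by 1 on each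
    side, so an orbit starting in N follows the complete flow [Phi] for a short time in both
    directions, inside N or not. *)
Definition inner (p : plane) : Prop := in_box (B + 1) p.

Lemma N_inner p : N p -> inner p.
Proof. intros h. destruct (hNB p h). split; lra. Qed.

Lemma Phi_cont p t : continuous (fun s => fst (Phi p s)) t /\ continuous (fun s => snd (Phi p s)) t.
Proof. apply (solves_cont (Xc lam (B + 1))). apply hPhi. Qed.

Lemma Phi_eps p t e : 0 < e -> exists d, 0 < d /\ forall s, Rabs (s - t) < d ->
  Rabs (fst (Phi p s) - fst (Phi p t)) < e /\ Rabs (snd (Phi p s) - snd (Phi p t)) < e.
Proof.
  intros he. destruct (Phi_cont p t) as [h1 h2].
  destruct (proj1 (continuous_eps _ _) h1 e he) as [d1 [hd1 H1]].
  destruct (proj1 (continuous_eps _ _) h2 e he) as [d2 [hd2 H2]].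
  exists (Rmin d1 d2). split; [now apply Rmin_glb_lt|]. intros s hs. split.
  - apply H1. eapply Rlt_le_trans; [exact hs|apply Rmin_l].
  - apply H2. eapply Rlt_le_trans; [exact hs|apply Rmin_r].
Qed.

Lemma Phi_locally p t (P : plane -> Prop) : locally (Phi p t) P -> locally t (fun s => P (Phi p s)).
Proof.
  intros h. apply locally_plane in h. destruct h as [e [he He]]. destruct (Phi_eps p t e he) as [d [hd Hd]].
  apply locally_R. exists d. split; auto. intros s hs. apply He; now apply Hd.
Qed.

Lemma Phi_solves p t : inner (Phi p t) -> solves_at (Xp lam) (Phi p) t.
Proof. intros h. apply (solves_Xc lam (B + 1)); auto. Qed.

Lemma Phi_flow p t : (forall s, Rmin 0 t <= s <= Rmax 0 t -> inner (Phi p s)) -> flow (Xp lam) p t (Phi p t).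
Proof.
  intros h. rewrite <- (hPhi0 p) at 1. apply flow_of_solution. intros s hs. now apply Phi_solves, h.
Qed.

Lemma Phi_flow_eq p t q : (forall s, Rmin 0 t <= s <= Rmax 0 t -> inner (Phi p s)) ->
  flow (Xp lam) p t q -> q = Phi p t.
Proof.
  intros h hf. apply (flow_unique_along lam (Phi p) p t q hf (hPhi0 p)). intros s hs. now apply Phi_solves, h.
Qed.

Lemma Phi_near p : N p -> exists e, 0 < e /\ forall t, Rabs t < e -> inner (Phi p t).
Proof.
  intros h. destruct (Phi_eps p 0 1 ltac:(lra)) as [d [hd Hd]]. exists d. split; auto. intros t ht.
  destruct (Hd t) as [h1 h2]; [now rewrite Rminus_0_r|]. rewrite hPhi0 in h1, h2.
  destruct (hNB p h). apply Rabs_def2 in h1. apply Rabs_def2 in h2. split; lra.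
Qed.

Lemma Phi_shift p s t : Phi (Phi p s) t = Phi p (s + t).
Proof.
  symmetry.
  apply (Xc_unique lam (B + 1) (fun r => Phi p (s + r)) (Phi (Phi p s)) (Rmin 0 t) (Rmax 0 t) 0).
  - lra.
  - intros r _. split; [|apply hPhi]. destruct (hPhi p (s + r)) as [d1 d2].
    assert (ds : is_derive (fun r => s + r) r 1) by (auto_derive; auto; ring).
    split.
    + generalize (is_derive_comp (fun z => fst (Phi p z)) (fun r => s + r) r _ _ d1 ds).
      intros h. replace (fst (Xc lam (B + 1) (Phi p (s + r)))) with (scal 1 (fst (Xc lam (B + 1) (Phi p (s + r))))); auto.
      apply (scal_one (K := R_AbsRing)).
    + generalize (is_derive_comp (fun z => snd (Phi p z)) (fun r => s + r) r _ _ d2 ds).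
      intros h. replace (snd (Xc lam (B + 1) (Phi p (s + r)))) with (scal 1 (snd (Xc lam (B + 1) (Phi p (s + r))))); auto.
      apply (scal_one (K := R_AbsRing)).
  - split; [apply Rmin_l|apply Rmax_l].
  - now rewrite Rplus_0_r, hPhi0.
  - split; [apply Rmin_r|apply Rmax_r].
Qed.

(** Each time comes with its own solution and only its end point is known to lie in N. Uniqueness
    identifies these end points with points of one solution, which therefore stays in the box and
    coincides with [Phi]. *)
Lemma forward_in_N p : N p -> (forall t, 0 <= t -> exists q, flow (Xp lam) p t q /\ N q) ->
  forall t, 0 <= t -> N (Phi p t).
Proof.
  intros hp H t ht. destruct (H t ht) as [q [[v [v0 [vt hv]]] hq]].
  rewrite Rmin_left, Rmax_right in hv by lra.
  assert (E : v t = Phi p t).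
  { apply (Xc_unique lam (B + 1) v (Phi p) 0 t 0); try lra.
    - intros s hs. split; [|apply hPhi]. apply (solves_Xc lam (B + 1)); [|now apply hv].
      apply N_inner. destruct (H s (proj1 hs)) as [r [hr hNr]].
      rewrite <- (flow_unique_along lam v p s r hr v0); auto.
      intros z hz. apply hv. rewrite Rmin_left, Rmax_right in hz; lra.
    - now rewrite v0, hPhi0. }
  now rewrite <- E, vt.
Qed.

Lemma forward_flow p t : 0 <= t -> (forall s, 0 <= s <= t -> N (Phi p s)) -> flow (Xp lam) p t (Phi p t).
Proof.
  intros ht h. apply Phi_flow. rewrite Rmin_left, Rmax_right by lra. intros s hs. now apply N_inner, h.
Qed.

Section Crossing.
Variables (p : plane) (al be dal dbe : R -> R) (rho : R).
Hypothesis hle : local_eq N p al be dal dbe rho.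

(** The derivative along the field of the local defining function al + be. At a boundary point a
    negative value means entry into N, a positive one exit. *)
Definition cross (q : plane) : R :=
  dal (fst q) * fst (Xp lam q) + dbe (snd q) * snd (Xp lam q).

Lemma psi_derive r t : Rabs (fst (Phi r t) - fst p) <= rho -> Rabs (snd (Phi r t) - snd p) <= rho ->
  inner (Phi r t) -> is_derive (fun s => al (fst (Phi r s)) + be (snd (Phi r s))) t (cross (Phi r t)).
Proof.
  intros h1 h2 h3. destruct (Phi_solves r t h3) as [d1 d2].
  assert (e1 := le_al _ _ _ _ _ _ _ hle _ h1). assert (e2 := le_be _ _ _ _ _ _ _ hle _ h2).
  unfold cross.
  replace (dal (fst (Phi r t)) * fst (Xp lam (Phi r t)) + dbe (snd (Phi r t)) * snd (Xp lam (Phi r t)))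
   with (fst (Xp lam (Phi r t)) * dal (fst (Phi r t)) + snd (Xp lam (Phi r t)) * dbe (snd (Phi r t))) by ring.
  apply (is_derive_plus (fun s => al (fst (Phi r s))) (fun s => be (snd (Phi r s)))).
  - exact (is_derive_comp al (fun s => fst (Phi r s)) t _ _ e1 d1).
  - exact (is_derive_comp be (fun s => snd (Phi r s)) t _ _ e2 d2).
Qed.

Lemma crossing_neg q : Rabs (fst q - fst p) < rho -> Rabs (snd q - snd p) < rho ->
  al (fst q) + be (snd q) = 0 -> cross q < 0 ->
  exists e, 0 < e /\ (forall t, Rabs t < e -> inner (Phi q t)) /\
    (forall t, 0 < t < e -> N (Phi q t)) /\ (forall t, - e < t < 0 -> ~ N (Phi q t)).
Proof.
  intros h1 h2 h0 hc.
  assert (hq : N q) by (apply (le_N _ _ _ _ _ _ _ hle); lra).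
  destruct (Phi_near q hq) as [e1 [he1 H1]].
  assert (m : 0 < Rmin (rho - Rabs (fst q - fst p)) (rho - Rabs (snd q - snd p))) by (apply Rmin_glb_lt; lra).
  destruct (Phi_eps q 0 _ m) as [e2 [he2 H2]].
  assert (d := psi_derive q 0). rewrite hPhi0 in d.
  specialize (d ltac:(lra) ltac:(lra) (N_inner q hq)).
  destruct (deriv_neg_local _ _ _ d hc) as [e3 [he3 [H3 H4]]]. rewrite hPhi0, h0 in H3, H4.
  assert (box : forall t, Rabs t < e2 -> Rabs (fst (Phi q t) - fst p) <= rho /\ Rabs (snd (Phi q t) - snd p) <= rho).
  { intros t ht. destruct (H2 t) as [u1 u2]; [now rewrite Rminus_0_r|]. rewrite hPhi0 in u1, u2.
    assert (u1' := Rlt_le_trans _ _ _ u1 (Rmin_l _ _)). assert (u2' := Rlt_le_trans _ _ _ u2 (Rmin_r _ _)). split.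
    - replace (fst (Phi q t) - fst p) with ((fst (Phi q t) - fst q) + (fst q - fst p)) by ring.
      eapply Rle_trans; [apply Rabs_triang|lra].
    - replace (snd (Phi q t) - snd p) with ((snd (Phi q t) - snd q) + (snd q - snd p)) by ring.
      eapply Rle_trans; [apply Rabs_triang|lra]. }
  exists (Rmin e1 (Rmin e2 e3)).
  assert (m1 := Rmin_l e1 (Rmin e2 e3)). assert (m2 := Rmin_r e1 (Rmin e2 e3)).
  assert (m3 := Rmin_l e2 e3). assert (m4 := Rmin_r e2 e3).
  split; [apply Rmin_glb_lt; [|apply Rmin_glb_lt]; auto|]. split; [|split].
  - intros t ht. apply H1. lra.
  - intros t ht. destruct (box t) as [b1 b2]; [rewrite Rabs_pos_eq; lra|].
    apply (le_N _ _ _ _ _ _ _ hle); auto. left. apply H3. lra.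
  - intros t ht. destruct (box t) as [b1 b2]; [rewrite Rabs_left; lra|].
    rewrite (le_N _ _ _ _ _ _ _ hle) by auto. apply Rlt_not_le. apply H4. lra.
Qed.

Lemma crossing_pos q : Rabs (fst q - fst p) < rho -> Rabs (snd q - snd p) < rho ->
  al (fst q) + be (snd q) = 0 -> 0 < cross q ->
  exists e, 0 < e /\ (forall t, Rabs t < e -> inner (Phi q t)) /\
    (forall t, - e < t < 0 -> N (Phi q t)) /\ (forall t, 0 < t < e -> ~ N (Phi q t)).
Proof.
  intros h1 h2 h0 hc.
  assert (hq : N q) by (apply (le_N _ _ _ _ _ _ _ hle); lra).
  destruct (Phi_near q hq) as [e1 [he1 H1]].
  assert (m : 0 < Rmin (rho - Rabs (fst q - fst p)) (rho - Rabs (snd q - snd p))) by (apply Rmin_glb_lt; lra).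
  destruct (Phi_eps q 0 _ m) as [e2 [he2 H2]].
  assert (d := psi_derive q 0). rewrite hPhi0 in d.
  specialize (d ltac:(lra) ltac:(lra) (N_inner q hq)).
  destruct (deriv_pos_local _ _ _ d hc) as [e3 [he3 [H3 H4]]]. rewrite hPhi0, h0 in H3, H4.
  assert (box : forall t, Rabs t < e2 -> Rabs (fst (Phi q t) - fst p) <= rho /\ Rabs (snd (Phi q t) - snd p) <= rho).
  { intros t ht. destruct (H2 t) as [u1 u2]; [now rewrite Rminus_0_r|]. rewrite hPhi0 in u1, u2.
    assert (u1' := Rlt_le_trans _ _ _ u1 (Rmin_l _ _)). assert (u2' := Rlt_le_trans _ _ _ u2 (Rmin_r _ _)). split.
    - replace (fst (Phi q t) - fst p) with ((fst (Phi q t) - fst q) + (fst q - fst p)) by ring.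
      eapply Rle_trans; [apply Rabs_triang|lra].
    - replace (snd (Phi q t) - snd p) with ((snd (Phi q t) - snd q) + (snd q - snd p)) by ring.
      eapply Rle_trans; [apply Rabs_triang|lra]. }
  exists (Rmin e1 (Rmin e2 e3)).
  assert (m1 := Rmin_l e1 (Rmin e2 e3)). assert (m2 := Rmin_r e1 (Rmin e2 e3)).
  assert (m3 := Rmin_l e2 e3). assert (m4 := Rmin_r e2 e3).
  split; [apply Rmin_glb_lt; [|apply Rmin_glb_lt]; auto|]. split; [|split].
  - intros t ht. apply H1. lra.
  - intros t ht. destruct (box t) as [b1 b2]; [rewrite Rabs_left; lra|].
    apply (le_N _ _ _ _ _ _ _ hle); auto. left. apply H4. lra.
  - intros t ht. destruct (box t) as [b1 b2]; [rewrite Rabs_pos_eq; lra|].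
    rewrite (le_N _ _ _ _ _ _ _ hle) by auto. apply Rlt_not_le. apply H3. lra.
Qed.

Lemma inner_path q e t : (forall t, Rabs t < e -> inner (Phi q t)) -> Rabs t < e ->
  forall s, Rmin 0 t <= s <= Rmax 0 t -> inner (Phi q s).
Proof. intros H ht s hs. apply H. generalize (interval_0 t s hs). lra. Qed.

Lemma nplus_of_cross q : Rabs (fst q - fst p) < rho -> Rabs (snd q - snd p) < rho ->
  al (fst q) + be (snd q) = 0 -> cross q < 0 -> nplus (Xp lam) N q /\ ~ nminus (Xp lam) N q.
Proof.
  intros h1 h2 h0 hc. destruct (crossing_neg q h1 h2 h0 hc) as [e [he [H1 [H2 H3]]]]. split.
  - split; [now apply (le_bd _ _ _ _ _ _ _ hle)|]. exists e. split; auto. intros s r hs hf.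
    rewrite (Phi_flow_eq q s r); auto. apply (inner_path q e); auto. rewrite Rabs_left; lra.
  - intros [_ [t [ht H]]]. set (s := Rmin t e / 2).
    assert (hm : 0 < Rmin t e) by now apply Rmin_glb_lt.
    assert (s < t /\ s < e) by (unfold s; generalize (Rmin_l t e) (Rmin_r t e); lra).
    assert (0 < s) by (unfold s; lra).
    apply (H s (Phi q s)); [lra| |apply H2; lra]. apply Phi_flow. apply (inner_path q e); auto.
    rewrite Rabs_pos_eq; lra.
Qed.

Lemma nminus_of_cross q : Rabs (fst q - fst p) < rho -> Rabs (snd q - snd p) < rho ->
  al (fst q) + be (snd q) = 0 -> 0 < cross q -> nminus (Xp lam) N q /\ ~ nplus (Xp lam) N q.
Proof.
  intros h1 h2 h0 hc. destruct (crossing_pos q h1 h2 h0 hc) as [e [he [H1 [H2 H3]]]]. split.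
  - split; [now apply (le_bd _ _ _ _ _ _ _ hle)|]. exists e. split; auto. intros s r hs hf.
    rewrite (Phi_flow_eq q s r); auto. apply (inner_path q e); auto. rewrite Rabs_pos_eq; lra.
  - intros [_ [t [ht H]]]. set (s := Rmin t e / 2).
    assert (hm : 0 < Rmin t e) by now apply Rmin_glb_lt.
    assert (s < t /\ s < e) by (unfold s; generalize (Rmin_l t e) (Rmin_r t e); lra).
    assert (0 < s) by (unfold s; lra).
    apply (H (- s) (Phi q (- s))); [lra| |apply H2; lra]. apply Phi_flow. apply (inner_path q e); auto.
    rewrite Rabs_left; lra.
Qed.
End Crossing.

Hypothesis hN : isolating_block (Xp lam) (fun p => p = origin) N.

Lemma N_compact : compact_set N.
Proof. apply hN. Qed.

Lemma N_closed p : ~ N p -> locally p (fun q => ~ N q).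
Proof. apply compact_closed, N_compact. Qed.

Lemma N_origin : N origin.
Proof. destruct hN as [_ [[h _] _]]. now apply h. Qed.

Lemma const_flow p t : Xp lam p = (0, 0) -> flow (Xp lam) p t p.
Proof.
  intros h. exists (fun _ => p). split; [|split]; auto. intros s _. split; rewrite h; simpl.
  - apply (is_derive_const (fst p)).
  - apply (is_derive_const (snd p)).
Qed.

Lemma Xp_origin : Xp lam origin = (0, 0).
Proof. unfold Xp, origin. f_equal; ring. Qed.

Lemma equilibrium_origin p : N p -> Xp lam p = (0, 0) -> p = origin.
Proof.
  intros hp h. destruct hN as [_ [[_ [_ hm]] _]].
  apply (hm (fun q => q = p)); auto; [intros q ->; auto|].
  intros q -> t. exists p. split; auto. now apply const_flow.
Qed.

Lemma tau_iff p : nplus (Xp lam) N p /\ nminus (Xp lam) N p <-> tau (Xp lam) N p.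
Proof. destruct hN as [_ [_ [h _]]]. apply h. Qed.

(** The field vanishes at the origin, so the constant curve makes it tangent to the boundary there.
    A boundary origin would thus be in [tau] and in n^+, although its constant orbit never leaves
    N. *)
Lemma origin_interior : locally origin N.
Proof.
  destruct (classic (locally origin N)) as [h|h]; auto. exfalso.
  assert (hbd : bd N origin) by (split; [apply N_origin|auto]).
  assert (ht : tau (Xp lam) N origin).
  { split; auto. exists (fun _ => origin). split.
    - split; [auto|split; [|split]]; simpl.
      + apply locally_R. exists 1. split; [lra|]. intros y _ k. apply ex_derive_n_const.
      + apply locally_R. exists 1. split; [lra|]. intros y _ k. apply ex_derive_n_const.
      + apply locally_R. exists 1. split; [lra|auto].
    - rewrite Xp_origin. unfold velocity0; simpl. now rewrite !Derive_const. }
  apply tau_iff in ht. destruct ht as [[_ [t [ht H]]] _].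
  apply (H (- t / 2) origin); [lra|apply const_flow, Xp_origin|apply N_origin].
Qed.

(** The sign of [cross] decides, and a zero means tangency, where the block condition puts the point
    in both sets. *)
Lemma boundary_cases p : bd N p -> nplus (Xp lam) N p \/ nminus (Xp lam) N p.
Proof.
  intros hb. destruct (local_boundary N p (proj1 hN) hb) as [al [be [dal [dbe [rho [hle [ht _]]]]]]].
  assert (hr := le_rho _ _ _ _ _ _ _ hle). assert (h0 := le_0 _ _ _ _ _ _ _ hle).
  assert (z1 : Rabs (fst p - fst p) < rho) by (rewrite Rminus_diag, Rabs_R0; auto).
  assert (z2 : Rabs (snd p - snd p) < rho) by (rewrite Rminus_diag, Rabs_R0; auto).
  destruct (Rtotal_order (cross dal dbe p) 0) as [h|[h|h]].
  - left. apply (nplus_of_cross p al be dal dbe rho hle p); auto.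
  - left. apply tau_iff. now apply ht.
  - right. apply (nminus_of_cross p al be dal dbe rho hle p); auto.
Qed.

Lemma cross_neg_of p al be dal dbe rho : local_eq N p al be dal dbe rho ->
  (forall X : plane -> plane, dal (fst p) * fst (X p) + dbe (snd p) * snd (X p) = 0 -> tau X N p) ->
  ~ nminus (Xp lam) N p -> cross dal dbe p < 0.
Proof.
  intros hle ht hn. 
  assert (hr := le_rho _ _ _ _ _ _ _ hle). assert (h0 := le_0 _ _ _ _ _ _ _ hle).
  assert (z1 : Rabs (fst p - fst p) < rho) by (rewrite Rminus_diag, Rabs_R0; auto).
  assert (z2 : Rabs (snd p - snd p) < rho) by (rewrite Rminus_diag, Rabs_R0; auto).
  destruct (Rtotal_order (cross dal dbe p) 0) as [h|[h|h]]; auto; exfalso; apply hn.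
  - apply tau_iff. now apply ht.
  - apply (nminus_of_cross p al be dal dbe rho hle p); auto.
Qed.

Lemma cross_pos_of p al be dal dbe rho : local_eq N p al be dal dbe rho ->
  (forall X : plane -> plane, dal (fst p) * fst (X p) + dbe (snd p) * snd (X p) = 0 -> tau X N p) ->
  ~ nplus (Xp lam) N p -> 0 < cross dal dbe p.
Proof.
  intros hle ht hn. 
  assert (hr := le_rho _ _ _ _ _ _ _ hle). assert (h0 := le_0 _ _ _ _ _ _ _ hle).
  assert (z1 : Rabs (fst p - fst p) < rho) by (rewrite Rminus_diag, Rabs_R0; auto).
  assert (z2 : Rabs (snd p - snd p) < rho) by (rewrite Rminus_diag, Rabs_R0; auto).
  destruct (Rtotal_order (cross dal dbe p) 0) as [h|[h|h]]; auto; exfalso; apply hn.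
  - apply (nplus_of_cross p al be dal dbe rho hle p); auto.
  - apply tau_iff. now apply ht.
Qed.

Lemma not_nminus_of_forward p e : N p -> 0 < e -> (forall t, 0 < t < e -> N (Phi p t)) -> ~ nminus (Xp lam) N p.
Proof.
  intros hp he H [_ [t [ht H']]]. destruct (Phi_near p hp) as [e' [he' H'']].
  set (s := Rmin t (Rmin e e') / 2).
  assert (hm : 0 < Rmin t (Rmin e e')) by (repeat apply Rmin_glb_lt; auto).
  assert (m1 := Rmin_l t (Rmin e e')). assert (m2 := Rmin_r t (Rmin e e')).
  assert (m3 := Rmin_l e e'). assert (m4 := Rmin_r e e').
  apply (H' s (Phi p s)); [unfold s; lra| |apply H; unfold s; lra].
  apply Phi_flow. apply (inner_path p e'); auto. rewrite Rabs_pos_eq; unfold s; lra.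
Qed.

Lemma not_nplus_of_backward p e : N p -> 0 < e -> (forall t, - e < t < 0 -> N (Phi p t)) -> ~ nplus (Xp lam) N p.
Proof.
  intros hp he H [_ [t [ht H']]]. destruct (Phi_near p hp) as [e' [he' H'']].
  set (s := Rmin t (Rmin e e') / 2).
  assert (hm : 0 < Rmin t (Rmin e e')) by (repeat apply Rmin_glb_lt; auto).
  assert (m1 := Rmin_l t (Rmin e e')). assert (m2 := Rmin_r t (Rmin e e')).
  assert (m3 := Rmin_l e e'). assert (m4 := Rmin_r e e').
  apply (H' (- s) (Phi p (- s))); [unfold s; lra| |apply H; unfold s; lra].
  apply Phi_flow. apply (inner_path p e'); auto. rewrite Rabs_left; unfold s; lra.
Qed.

(** At the last time of the uninterrupted stay the orbit is on the boundary. If that point were not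
    in n^-, the field would point strictly into N there and the stay would continue. *)
Lemma exit_exists p : nplus (Xp lam) N p -> ~ aplus (Xp lam) N p ->
  exists q, exit_point (Xp lam) N p q /\ nminus (Xp lam) N q.
Proof.
  intros hp ha.
  assert (hNp : N p) by apply hp.
  assert (hex : exists t, 0 <= t /\ ~ N (Phi p t)).
  { destruct (classic (exists t, 0 <= t /\ ~ N (Phi p t))) as [h|h]; auto. exfalso. apply ha. split; auto.
    assert (H : forall t, 0 <= t -> N (Phi p t)).
    { intros t ht. destruct (classic (N (Phi p t))); auto. exfalso; apply h; now exists t. }
    intros t ht. exists (Phi p t). split; auto. apply forward_flow; auto. intros s hs. apply H; lra. }
  destruct hex as [t1 [ht1 hn]].
  destruct (last_time (fun t => N (Phi p t)) t1 ht1) as [T [hT [H1 H2]]]; auto.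
  - now rewrite hPhi0.
  - intros t ht. apply (Phi_locally p t (fun q => ~ N q)). now apply N_closed.
  - assert (hNT : N (Phi p T)) by (apply H1; lra).
    exists (Phi p T). split.
    + exists T. split; [lra|split; [|split]].
      * apply forward_flow; [lra|auto].
      * intros s r hs hf. rewrite (Phi_flow_eq p s r); auto.
        rewrite Rmin_left, Rmax_right by lra. intros z hz. apply N_inner, H1. lra.
      * intros e he. destruct (Phi_near (Phi p T) hNT) as [e' [he' H3]].
        destruct (H2 (Rmin e e')) as [s [hs hns]]; [now apply Rmin_glb_lt|].
        assert (m1 := Rmin_l e e'). assert (m2 := Rmin_r e e').
        exists s, (Phi p s). split; [lra|split; auto]. apply Phi_flow.
        rewrite Rmin_left, Rmax_right by lra. intros z hz.
        destruct (Rle_or_lt z T); [apply N_inner, H1; lra|].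
        replace z with (T + (z - T)) by ring. rewrite <- Phi_shift. apply H3. rewrite Rabs_pos_eq; lra.
    + assert (hbd : bd N (Phi p T)).
      { split; auto. intros hl. apply Phi_locally, locally_R in hl. destruct hl as [e [he He]].
        destruct (H2 e he) as [s [hs hns]]. apply hns, He. rewrite Rabs_pos_eq; lra. }
      destruct (classic (nminus (Xp lam) N (Phi p T))) as [h|h]; auto. exfalso.
      destruct (local_boundary N _ (proj1 hN) hbd) as [al [be [dal [dbe [rho [hle [ht _]]]]]]].
      assert (hc := cross_neg_of _ _ _ _ _ _ hle ht h).
      assert (hr := le_rho _ _ _ _ _ _ _ hle). assert (h0 := le_0 _ _ _ _ _ _ _ hle).
      destruct (crossing_neg _ al be dal dbe rho hle (Phi p T)) as [e [he [K1 [K2 K3]]]]; auto;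
        try (rewrite Rminus_diag, Rabs_R0; auto).
      destruct (H2 e he) as [s [hs hns]]. apply hns.
      replace s with (T + (s - T)) by ring. rewrite <- Phi_shift. apply K2. lra.
Qed.

(** * The x-axis inside the block *)

Lemma axis_invariant p : snd p = 0 -> forall t, snd (Phi p t) = 0.
Proof.
  intros hp t.
  apply (gronwall_zero (fun s => snd (Phi p s)) (fun s => snd (Xc lam (B + 1) (Phi p s))) (2 / 3 * (B + 1))
    (Rmin 0 t) (Rmax 0 t) t 0).
  - intros s _. split; [apply hPhi|]. unfold Xc, Xp; simpl.
    set (u := fst (Phi p s)). set (v := snd (Phi p s)).
    rewrite !Rabs_mult, (Rabs_pos_eq (2 / 3)) by lra.
    assert (h1 : Rabs (clamp (B + 1) u) <= B + 1) by (apply Rabs_le, clamp_bound; lra).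
    assert (h2 : Rabs (clamp (B + 1) v) <= Rabs v).
    { generalize (clamp_lip (B + 1) v 0 ltac:(lra)). rewrite (clamp_id (B + 1) 0), !Rminus_0_r by lra. auto. }
    generalize (Rabs_pos (clamp (B + 1) u)) (Rabs_pos (clamp (B + 1) v)). intros.
    apply Rmult_le_compat; auto; lra.
  - split; [apply Rmin_r|apply Rmax_r].
  - split; [apply Rmin_l|apply Rmax_l].
  - now rewrite hPhi0.
Qed.

Lemma Xp_fst p : fst (Xp lam p) = - AA lam (fst p) (snd p).
Proof. destruct p as [x y]. unfold Xp, AA, rr; simpl. field. Qed.

Lemma Xp_axis x : Xp lam (x, 0) = (- (rr lam x * x ^ 2), 0).
Proof. unfold Xp, rr. f_equal; field. Qed.

Lemma axis_local x : N (x, 0) -> x <> 0 -> 0 < rr lam x -> exists e, 0 < e /\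
  (forall t, 0 < t < e -> fst (Phi (x, 0) t) < x) /\ (forall t, - e < t < 0 -> x < fst (Phi (x, 0) t)).
Proof.
  intros hn hx hr. destruct (Phi_solves (x, 0) 0) as [d _]; [rewrite hPhi0; now apply N_inner|].
  rewrite hPhi0, Xp_axis in d. simpl in d.
  assert (x2 : 0 < x * (x * 1)) by (generalize (Rsqr_pos_lt x hx); unfold Rsqr; lra).
  destruct (deriv_neg_local _ _ _ d) as [e [he [h1 h2]]]; [nra|]. rewrite hPhi0 in h1, h2. simpl in h1, h2.
  exists e. split; [auto|split]; intros t ht; [apply h1; lra|apply h2; lra].
Qed.

(** The sign sg covers both half-axes at once. Positivity of [rr] is carried along so that the field
    points to the left at every nonzero point of the segment. *)
Definition axis_in (sg r : R) : Prop := 0 <= r /\ forall z, 0 <= z <= r -> N (sg * z, 0) /\ 0 < rr lam (sg * z).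

Lemma axis_extend sg r : Rabs sg = 1 -> axis_in sg r -> locally (sg * r, 0) N -> exists r', r < r' /\ axis_in sg r'.
Proof.
  intros hsg [h0 h] hl. apply locally_plane in hl. destruct hl as [e [he He]].
  assert (hrr := proj2 (h r ltac:(lra))). assert (pl := Rabs_pos lam).
  set (d := rr lam (sg * r) / (2 * (Rabs lam + 1))).
  assert (hd : 0 < d) by (apply Rdiv_lt_0_compat; lra).
  assert (hm : 0 < Rmin (e / 2) d) by (apply Rmin_glb_lt; lra).
  assert (m1 := Rmin_l (e / 2) d). assert (m2 := Rmin_r (e / 2) d).
  exists (r + Rmin (e / 2) d). split; [lra|]. split; [lra|]. intros z hz.
  destruct (Rle_or_lt z r) as [hzr|hzr]; [apply h; lra|].
  assert (E : Rabs (sg * (z - r)) = z - r) by (rewrite Rabs_mult, hsg, Rabs_pos_eq; lra).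
  split.
  - apply He; simpl; [|rewrite Rminus_diag, Rabs_R0; auto].
    replace (sg * z - sg * r) with (sg * (z - r)) by ring. lra.
  - replace (rr lam (sg * z)) with (rr lam (sg * r) - lam * (sg * (z - r))) by (unfold rr; ring).
    assert (Rabs (lam * (sg * (z - r))) <= Rabs lam * d).
    { rewrite Rabs_mult, E. apply Rmult_le_compat_l; lra. }
    assert (Rabs lam * d <= rr lam (sg * r) / 2).
    { replace (rr lam (sg * r) / 2) with ((Rabs lam + 1) * d) by (unfold d; field; lra). nra. }
    generalize (Rle_abs (lam * (sg * (z - r)))). lra.
Qed.

Lemma axis_end sg : Rabs sg = 1 -> exists r, 0 < r /\ axis_in sg r /\ bd N (sg * r, 0) /\
  forall r', axis_in sg r' -> r' <= r.
Proof.
  intros hsg.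
  assert (E0 : axis_in sg 0).
  { split; [lra|]. intros z hz. replace z with 0 by lra. rewrite Rmult_0_r. split; [apply N_origin|unfold rr; lra]. }
  destruct (completeness (axis_in sg)) as [r [H1 H2]].
  - exists B. intros r [hr0 hr]. destruct (hr r ltac:(lra)) as [h _]. destruct (hNB _ h) as [h1 _]. simpl in h1.
    rewrite <- (Rabs_pos_eq r), <- (Rmult_1_l (Rabs r)), <- hsg, <- Rabs_mult by lra. apply Rabs_le. lra.
  - now exists 0.
  - assert (r0' : 0 <= r) by now apply H1.
    assert (Hlt : forall z, 0 <= z < r -> N (sg * z, 0) /\ 0 < rr lam (sg * z)).
    { intros z hz. destruct (classic (exists r', axis_in sg r' /\ z < r')) as [[r' [[_ h] hz']]|hn].
      - apply h; lra.
      - exfalso. assert (r <= z); [|lra]. apply H2. intros r' hr'. destruct (Rle_or_lt r' z); auto.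
        exfalso. apply hn. now exists r'. }
    assert (HN : N (sg * r, 0)).
    { destruct (classic (N (sg * r, 0))) as [h|h]; auto. exfalso. apply N_closed, locally_plane in h.
      destruct h as [e [he He]]. destruct r0' as [rp|rp].
      - set (z := Rmax 0 (r - e / 2)).
        assert (hz : 0 <= z < r /\ r - z < e) by (unfold z, Rmax; destruct Rle_dec; lra).
        apply (He (sg * z, 0)); simpl; [|rewrite Rminus_diag, Rabs_R0; auto|now apply Hlt].
        replace (sg * z - sg * r) with (sg * (z - r)) by ring. rewrite Rabs_mult, hsg, Rabs_left; lra.
      - apply (He (sg * r, 0)); [rewrite Rminus_diag, Rabs_R0; auto|rewrite Rminus_diag, Rabs_R0; auto|].
        rewrite <- rp, Rmult_0_r. apply N_origin. }
    assert (HR : 0 < rr lam (sg * r)).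
    { destruct (Rtotal_order (rr lam (sg * r)) 0) as [h|[h|h]]; auto; exfalso.
      - destruct r0' as [rp|rp]; [|rewrite <- rp in h; unfold rr in h; lra].
        set (q := rr lam (sg * r)) in *.
        assert (hq : lam * sg * r = 1 / 3 - q) by (unfold q, rr; ring).
        (* If [rr] were negative at the end, it would vanish at this earlier point of the segment,
           where it is known to be positive. *)
        assert (hz : r * (1 / 3 / (1 / 3 - q)) < r).
        { rewrite <- (Rmult_1_r r) at 2. apply Rmult_lt_compat_l; auto. apply Rlt_div_l; lra. }
        assert (hz0 : 0 <= r * (1 / 3 / (1 / 3 - q))).
        { apply Rmult_le_pos; [lra|]. apply Rdiv_le_0_compat; lra. }
        destruct (Hlt _ (conj hz0 hz)) as [_ hh]. unfold rr in hh.
        replace (lam * (sg * (r * (1 / 3 / (1 / 3 - q))))) with (lam * sg * r * (1 / 3 / (1 / 3 - q))) in hh by ring.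
        rewrite hq in hh. replace ((1 / 3 - q) * (1 / 3 / (1 / 3 - q))) with (1 / 3) in hh by (field; lra). lra.
      (* A zero of [rr] is an equilibrium in N other than the origin, which maximal invariance of
         the origin excludes. *)
      - assert (e := equilibrium_origin (sg * r, 0) HN). rewrite Xp_axis, h in e.
        specialize (e ltac:(f_equal; ring)). inversion e. rewrite H0 in h. unfold rr in h. lra. }
    assert (HE : axis_in sg r).
    { split; auto. intros z [hz1 [hz2|hz2]]; [apply Hlt; lra|subst; auto]. }
    assert (Hn : ~ locally (sg * r, 0) N).
    { intros hl. destruct (axis_extend sg r hsg HE hl) as [r' [h h']]. generalize (H1 r' h'). lra. }
    exists r. split; [|split; [|split]]; auto.
    + destruct r0' as [rp|rp]; auto. exfalso. apply Hn. rewrite <- rp, Rmult_0_r. apply origin_interior.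
    + now split.
Qed.

Section AxisEnds.
Variables x0 x1 : R.
Hypothesis hx0 : 0 < x0.
Hypothesis hx1 : x1 < 0.
Hypothesis hseg : forall x, x1 <= x <= x0 -> N (x, 0) /\ 0 < rr lam x.
Hypothesis hbd0 : bd N (x0, 0).
Hypothesis hbd1 : bd N (x1, 0).
Hypothesis hmax : forall r, axis_in 1 r -> r <= x0.

Lemma axis_small_forward x : x1 < x <= x0 -> x <> 0 -> exists e, 0 < e /\ forall t, 0 < t < e ->
  N (Phi (x, 0) t).
Proof.
  intros hx hn. destruct (hseg x ltac:(lra)) as [h1 h2].
  destruct (axis_local x h1 hn h2) as [e [he [H1 _]]].
  destruct (Phi_eps (x, 0) 0 (x - x1) ltac:(lra)) as [d [hd Hd]].
  exists (Rmin e d). split; [now apply Rmin_glb_lt|]. intros t ht.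
  assert (m1 := Rmin_l e d). assert (m2 := Rmin_r e d).
  destruct (Hd t) as [h _]; [rewrite Rminus_0_r, Rabs_pos_eq; lra|]. rewrite hPhi0 in h; simpl in h.
  apply Rabs_def2 in h. rewrite (surjective_pairing (Phi (x, 0) t)), axis_invariant by auto.
  specialize (H1 t ltac:(lra)). apply hseg. lra.
Qed.

Lemma axis_small_backward x : x1 <= x < x0 -> x <> 0 -> exists e, 0 < e /\ forall t, - e < t < 0 ->
  N (Phi (x, 0) t).
Proof.
  intros hx hn. destruct (hseg x ltac:(lra)) as [h1 h2].
  destruct (axis_local x h1 hn h2) as [e [he [_ H1]]].
  destruct (Phi_eps (x, 0) 0 (x0 - x) ltac:(lra)) as [d [hd Hd]].
  exists (Rmin e d). split; [now apply Rmin_glb_lt|]. intros t ht.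
  assert (m1 := Rmin_l e d). assert (m2 := Rmin_r e d).
  destruct (Hd t) as [h _]; [rewrite Rminus_0_r, Rabs_left; lra|]. rewrite hPhi0 in h; simpl in h.
  apply Rabs_def2 in h. rewrite (surjective_pairing (Phi (x, 0) t)), axis_invariant by auto.
  specialize (H1 t ltac:(lra)). apply hseg. lra.
Qed.

Lemma ingoing_not_nminus : ~ nminus (Xp lam) N (x0, 0).
Proof.
  destruct (axis_small_forward x0) as [e [he H]]; [lra|lra|].
  apply (not_nminus_of_forward (x0, 0) e); auto. apply hbd0.
Qed.

Lemma outgoing_not_nplus : ~ nplus (Xp lam) N (x1, 0).
Proof.
  destruct (axis_small_backward x1) as [e [he H]]; [lra|lra|].
  apply (not_nplus_of_backward (x1, 0) e); auto. apply hbd1.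
Qed.

Lemma ingoing_nplus : nplus (Xp lam) N (x0, 0).
Proof. destruct (boundary_cases _ hbd0); auto. now apply ingoing_not_nminus in H. Qed.

Lemma outgoing_nminus : nminus (Xp lam) N (x1, 0).
Proof. destruct (boundary_cases _ hbd1); auto. now apply outgoing_not_nplus in H. Qed.

(** A nonzero inner point has short orbit pieces in N both before and after it, since the axis is
    invariant and run through to the left. A boundary point belongs to n^+ or n^-, and each of these
    forbids one of the two pieces. *)
Lemma axis_interior x : x1 < x < x0 -> locally (x, 0) N.
Proof.
  intros hx. destruct (Req_dec x 0) as [e|e]; [subst; apply origin_interior|].
  destruct (classic (locally (x, 0) N)) as [h|h]; auto. exfalso.
  assert (hb : bd N (x, 0)) by (split; auto; apply hseg; lra).
  destruct (boundary_cases _ hb) as [h'|h']; revert h'.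
  - destruct (axis_small_backward x) as [d [hd H]]; [lra|auto|].
    apply (not_nplus_of_backward (x, 0) d); auto. apply hb.
  - destruct (axis_small_forward x) as [d [hd H]]; [lra|auto|].
    apply (not_nminus_of_forward (x, 0) d); auto. apply hb.
Qed.

(** Suppose the stay in [0, x0] ends at T. The abscissa is still positive at T, because its equation
    is linearly bounded, and it decreases there, so it remains in the segment a moment longer. *)
Lemma ingoing_stays t : 0 <= t -> N (Phi (x0, 0) t).
Proof.
  intros ht. set (xi := fun s => fst (Phi (x0, 0) s)).
  assert (Hin : forall s, 0 <= xi s <= x0 -> N (Phi (x0, 0) s)).
  { intros s hs. rewrite (surjective_pairing (Phi (x0, 0) s)), axis_invariant by auto. apply hseg.
    unfold xi in hs. lra. }
  destruct (classic (0 <= xi t <= x0)) as [h|h]; [now apply Hin|]. exfalso.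
  assert (xi0 : xi 0 = x0) by (unfold xi; now rewrite hPhi0).
  assert (hcont : forall s, continuous xi s) by (intros s; exact (proj1 (Phi_cont _ s))).
  destruct (last_time (fun s => 0 <= xi s <= x0) t ht) as [T [hT [H1 H2]]]; auto.
  - rewrite xi0; lra.
  - intros s hs. assert (d : 0 < Rmax (- xi s) (xi s - x0)).
    { unfold Rmax; destruct Rle_dec; lra. }
    destruct (proj1 (continuous_eps xi s) (hcont s) _ d) as [e [he He]].
    apply locally_R. exists e. split; auto. intros y hy. specialize (He y hy). apply Rabs_def2 in He.
    revert He. unfold Rmax; destruct Rle_dec; lra.
  - assert (hd : forall s, 0 <= s <= T -> is_derive xi s (- (rr lam (xi s) * xi s ^ 2))).
    { intros s hs. destruct (Phi_solves (x0, 0) s) as [d _]; [apply N_inner, Hin, H1; auto|].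
      rewrite Xp_fst, axis_invariant in d by auto. unfold AA in d. fold (xi s) in d.
      replace (- (rr lam (xi s) * xi s ^ 2)) with (- (rr lam (xi s) * xi s ^ 2 + 0 ^ 2)) by ring. exact d. }
    assert (hpos : 0 < xi T).
    { apply (gronwall_sign xi (fun s => - (rr lam (xi s) * xi s ^ 2)) ((1 / 3 + Rabs lam * x0) * x0) 0 T T 0); try lra.
      intros s hs. split; [now apply hd|]. specialize (H1 s hs).
      replace (- (rr lam (xi s) * xi s ^ 2)) with (- (rr lam (xi s) * xi s) * xi s) by ring.
      rewrite Rabs_mult. apply Rmult_le_compat_r; [apply Rabs_pos|].
      rewrite Rabs_Ropp, Rabs_mult. apply Rmult_le_compat; try apply Rabs_pos; [|rewrite Rabs_pos_eq; lra].
      unfold rr. eapply Rle_trans; [apply Rabs_triang|]. rewrite Rabs_Ropp, Rabs_mult.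
      rewrite (Rabs_pos_eq (1 / 3)), (Rabs_pos_eq (xi s)) by lra.
      apply Rplus_le_compat_l, Rmult_le_compat_l; [apply Rabs_pos|lra]. }
    specialize (H1 T ltac:(lra)) as hxT.
    assert (hlt : - (rr lam (xi T) * xi T ^ 2) < 0).
    { destruct (hseg (xi T) ltac:(lra)). assert (0 < xi T ^ 2) by (apply pow_lt; auto). nra. }
    destruct (deriv_neg_local xi T _ (hd T ltac:(lra)) hlt) as [e [he [K1 _]]].
    destruct (proj1 (continuous_eps xi T) (hcont T) _ hpos) as [e' [he' K2]].
    destruct (H2 (Rmin e e')) as [s [hs hns]]; [now apply Rmin_glb_lt|].
    assert (m1 := Rmin_l e e'). assert (m2 := Rmin_r e e').
    apply hns. specialize (K1 s ltac:(lra)). specialize (K2 s ltac:(rewrite Rabs_pos_eq; lra)).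
    apply Rabs_def2 in K2. lra.
Qed.

Lemma ingoing_aplus : aplus (Xp lam) N (x0, 0).
Proof.
  split; [apply ingoing_nplus|]. intros t ht. exists (Phi (x0, 0) t). split; [|now apply ingoing_stays].
  apply forward_flow; auto. intros s hs. apply ingoing_stays; lra.
Qed.

Lemma Phi_lipschitz tau0 : exists k, 0 <= k /\ forall p q, sq_dist (Phi p tau0) (Phi q tau0) <= k * sq_dist p q.
Proof.
  destruct (Xc_gronwall lam (B + 1) ltac:(lra)) as [k [hk H]].
  exists (exp (k * Rabs (tau0 - 0))). split; [left; apply exp_pos|]. intros p q.
  rewrite <- (hPhi0 p) at 2. rewrite <- (hPhi0 q) at 2. rewrite Rmult_comm.
  apply (H (Phi p) (Phi q) (Rmin 0 tau0) (Rmax 0 tau0)); auto.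
  - split; [apply Rmin_r|apply Rmax_r].
  - split; [apply Rmin_l|apply Rmax_l].
Qed.

Definition small (e : R) (p : plane) : Prop := Rabs (fst p) < e /\ Rabs (snd p) < e.

Lemma bounded_orbit_origin q : (forall t, N (Phi q t)) -> q = origin.
Proof.
  intros h. destruct hN as [_ [[_ [_ hm]] _]].
  apply (hm (fun p => forall t, N (Phi p t))); auto.
  - intros p hp. rewrite <- (hPhi0 p). apply hp.
  - intros p hp t. exists (Phi p t). split.
    + apply Phi_flow. intros s _. apply N_inner, hp.
    + intros s. rewrite Phi_shift. apply hp.
Qed.

(* The limit points of a forward orbit in N form an invariant set, so only the origin is one. *)
Lemma forward_orbit_limit p : (forall t, 0 <= t -> N (Phi p t)) ->
  forall e, 0 < e -> exists T, 0 <= T /\ forall t, T <= t -> small e (Phi p t).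
Proof.
  intros H e he.
  (* Either some point of N is approached at arbitrarily late times by positions outside the small
     box, or each point of N has a neighbourhood whose late visits are all in the box, and finitely
     many of these cover N. *)
  destruct (classic (exists q, N q /\ forall d T, 0 < d -> 0 <= T -> exists t, T <= t /\
     Rabs (fst (Phi p t) - fst q) < d /\ Rabs (snd (Phi p t) - snd q) < d /\ ~ small e (Phi p t))) as [[q [hq Hq]]|hno].
  - exfalso.
    assert (E : q = origin).
    { apply bounded_orbit_origin. intros t0. destruct (classic (N (Phi q t0))) as [h|h]; auto. exfalso.
      apply N_closed, locally_plane in h. destruct h as [d [hd Hd]].
      destruct (Phi_lipschitz t0) as [k [hk Hk]].
      (* With this radius the Lipschitz bound of the time-t0 map gives a squared distance at most 2
         k r^2 < d^2. *)
      set (r := d / (2 * (k + 1))). assert (hr : 0 < r) by (apply Rdiv_lt_0_compat; lra).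
      destruct (Hq r (Rabs t0) hr (Rabs_pos t0)) as [t [ht [a1 [a2 _]]]].
      assert (hh := Hk (Phi p t) q). rewrite Phi_shift in hh.
      assert (S0 : sq_dist (Phi p t) q <= 2 * r ^ 2).
      { unfold sq_dist. rewrite <- (pow2_abs (fst (Phi p t) - fst q)), <- (pow2_abs (snd (Phi p t) - snd q)).
        assert (b1 : Rabs (fst (Phi p t) - fst q) ^ 2 <= r ^ 2) by (apply pow_incr; split; [apply Rabs_pos|lra]).
        assert (b2 : Rabs (snd (Phi p t) - snd q) ^ 2 <= r ^ 2) by (apply pow_incr; split; [apply Rabs_pos|lra]). lra. }
      assert (S1 : sq_dist (Phi p (t + t0)) (Phi q t0) < d ^ 2).
      { apply Rle_lt_trans with (k * (2 * r ^ 2)).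
        - eapply Rle_trans; [exact hh|]. now apply Rmult_le_compat_l.
        - assert (ed : d = 2 * (k + 1) * r) by (unfold r; field; lra). rewrite ed.
          assert (0 < r ^ 2) by now apply pow_lt.
          replace ((2 * (k + 1) * r) ^ 2) with (4 * (k + 1) ^ 2 * r ^ 2) by ring. nra. }
      unfold sq_dist in S1.
      apply (Hd (Phi p (t + t0))).
      - rewrite <- (Rabs_pos_eq d) by lra. apply Rsqr_lt_abs_0. rewrite !Rsqr_pow2.
        generalize (pow2_ge_0 (snd (Phi p (t + t0)) - snd (Phi q t0))). lra.
      - rewrite <- (Rabs_pos_eq d) by lra. apply Rsqr_lt_abs_0. rewrite !Rsqr_pow2.
        generalize (pow2_ge_0 (fst (Phi p (t + t0)) - fst (Phi q t0))). lra.
      - apply H. generalize (Rle_abs (- t0)). rewrite Rabs_Ropp. lra. }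
    destruct (Hq e 0 he ltac:(lra)) as [t [_ [a1 [a2 a3]]]]. apply a3. subst q. simpl in *.
    rewrite Rminus_0_r in a1, a2. now split.
  - destruct (N_compact (fun U => open U /\ exists T, 0 <= T /\ forall t, T <= t -> U (Phi p t) -> small e (Phi p t))) as [l [h1 h2]].
    + intros U [hU _]. exact hU.
    + intros q hq.
      destruct (classic (exists d T, 0 < d /\ 0 <= T /\ forall t, T <= t -> Rabs (fst (Phi p t) - fst q) < d ->
        Rabs (snd (Phi p t) - snd q) < d -> small e (Phi p t))) as [[d [T [hd [hT HT]]]]|hn].
      * exists (fun z => Rabs (fst z - fst q) < d /\ Rabs (snd z - snd q) < d). split; [split|].
        -- apply open_box.
        -- exists T. split; auto. intros t ht [b1 b2]. now apply HT.
        -- rewrite !Rminus_diag, Rabs_R0. auto.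
      * exfalso. apply hno. exists q. split; auto. intros d T hd hT.
        destruct (classic (exists t, T <= t /\ Rabs (fst (Phi p t) - fst q) < d /\
          Rabs (snd (Phi p t) - snd q) < d /\ ~ small e (Phi p t))) as [h|h]; auto.
        exfalso. apply hn. exists d, T. split; [auto|split; [auto|]]. intros t ht b1 b2.
        destruct (classic (small e (Phi p t))); auto. exfalso. apply h. exists t. auto.
    + assert (K : exists T, 0 <= T /\ forall U, In U l -> forall t, T <= t -> U (Phi p t) -> small e (Phi p t)).
      { clear h2. induction l as [|U l IH].
        - exists 0. split; [lra|]. intros U [].
        - destruct IH as [T [hT HT]]; [intros V hV; apply h1; now right|].
          destruct (h1 U (or_introl eq_refl)) as [_ [T' [hT' HT']]].
          exists (Rmax T T'). assert (m1 := Rmax_l T T'). assert (m2 := Rmax_r T T').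
          split; [lra|]. intros V [e1|hV] t ht hVt.
          + subst. apply HT'; auto. lra.
          + apply (HT V); auto. lra. }
      destruct K as [T [hT HT]]. exists T. split; auto. intros t ht.
      destruct (h2 (Phi p t)) as [U [hU hUt]]; [apply H; lra|]. now apply (HT U).
Qed.

(** An orbit that stays in N tends to the origin. Near it x decreases to 0 and is thus nonnegative,
    so y^2 does not decrease; as y tends to 0, the orbit lies on the axis. It then comes from the
    ingoing segment, whose only boundary point is its end. *)
Lemma aplus_unique p : aplus (Xp lam) N p -> p = (x0, 0).
Proof.
  intros [hp hfw]. assert (hbp : bd N p) by apply hp. assert (hNp : N p) by apply hbp.
  assert (H := forward_in_N p hNp hfw).
  set (x := fun t => fst (Phi p t)). set (y := fun t => snd (Phi p t)).
  assert (hd : forall t, 0 <= t -> is_derive x t (- AA lam (x t) (y t)) /\ is_derive y t (2 / 3 * x t * y t)).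
  { intros t ht. destruct (Phi_solves p t) as [d1 d2]; [now apply N_inner, H|]. rewrite Xp_fst in d1. split; auto.
    replace (2 / 3 * x t * y t) with (snd (Xp lam (Phi p t))); auto.
    unfold x, y. destruct (Phi p t); reflexivity. }
  assert (hbox : forall t, 0 <= t -> Rabs (x t) <= B /\ Rabs (y t) <= B).
  { intros t ht. destruct (hNB _ (H t ht)). split; apply Rabs_le; auto. }
  (* Chosen so that |lam| e < 1/3, hence [rr] > 0 for |x| < e. *)
  set (e := 1 / (3 * (Rabs lam + 1))). assert (pl := Rabs_pos lam).
  assert (he : 0 < e) by (apply Rdiv_lt_0_compat; lra).
  assert (hrs : forall z, Rabs z < e -> 0 < rr lam z).
  { intros z hz. unfold rr. assert (Rabs (lam * z) <= Rabs lam * e).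
    { rewrite Rabs_mult. apply Rmult_le_compat_l; lra. }
    assert ((Rabs lam + 1) * e = 1 / 3) by (unfold e; field; lra).
    generalize (Rle_abs (lam * z)). nra. }
  destruct (forward_orbit_limit p H e he) as [T [hT HT]].
  assert (xdec : forall s t, T <= s -> s <= t -> x t <= x s).
  { intros s t hs hst. assert (- x s <= - x t); [|lra].
    apply (deriv_nonneg_le (fun t => - x t) (fun t => - - AA lam (x t) (y t)) s t hst). intros z hz.
    destruct (hd z ltac:(lra)) as [d1 _]. split; [exact (is_derive_opp _ _ _ d1)|].
    destruct (HT z ltac:(lra)) as [a1 _]. assert (hz' := hrs _ a1).
    unfold AA. generalize (pow2_ge_0 (x z)) (pow2_ge_0 (y z)). fold (x z) in hz'. nra. }
  assert (xpos : forall t, T <= t -> 0 <= x t).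
  { intros t ht. destruct (Rle_or_lt 0 (x t)) as [h|h]; auto. exfalso.
    destruct (forward_orbit_limit p H (- x t) ltac:(lra)) as [T' [hT' HT']].
    destruct (HT' (Rmax t T') (Rmax_r _ _)) as [a1 _]. fold (x (Rmax t T')) in a1.
    generalize (xdec t (Rmax t T') ht (Rmax_l _ _)). apply Rabs_def2 in a1. lra. }
  assert (yT : y T = 0).
  { destruct (Req_dec (y T) 0) as [h|h]; auto. exfalso.
    destruct (forward_orbit_limit p H (Rabs (y T)) (Rabs_pos_lt _ h)) as [T' [hT' HT']].
    destruct (HT' (Rmax T T') (Rmax_r _ _)) as [_ a2]. fold (y (Rmax T T')) in a2.
    assert (A : y T ^ 2 <= y (Rmax T T') ^ 2).
    { apply (deriv_nonneg_le (fun t => y t ^ 2) (fun t => 4 / 3 * x t * y t ^ 2) T (Rmax T T') (Rmax_l _ _)).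
      intros z hz. destruct (hd z ltac:(lra)) as [_ d2]. split.
      - auto_derive; [side_derive|]. derive_rw d2. field.
      - generalize (xpos z (proj1 hz)) (pow2_ge_0 (y z)). intros. apply Rmult_le_pos; lra. }
    rewrite <- (pow2_abs (y T)), <- (pow2_abs (y (Rmax T T'))) in A.
    generalize (Rabs_pos (y (Rmax T T'))). intros. simpl in A. nra. }
  assert (y0 : forall t, 0 <= t <= T -> y t = 0).
  { intros t ht. apply (gronwall_zero y (fun t => 2 / 3 * x t * y t) (2 / 3 * B) 0 T t T); auto; [|lra].
    intros z hz. destruct (hd z ltac:(lra)) as [_ d2]. split; auto.
    rewrite !Rabs_mult, (Rabs_pos_eq (2 / 3)) by lra. apply Rmult_le_compat_r; [apply Rabs_pos|].
    apply Rmult_le_compat_l; [lra|]. apply hbox; lra. }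
  assert (hpx : p = (x 0, 0)).
  { assert (E : p = (x 0, y 0)) by (unfold x, y; rewrite hPhi0; apply surjective_pairing).
    rewrite (y0 0) in E by lra. exact E. }
  assert (yall : forall t, y t = 0).
  { intros t. unfold y. rewrite hpx. now apply axis_invariant. }
  assert (hd' : forall t, 0 <= t -> is_derive x t (- (rr lam (x t) * x t) * x t)).
  { intros t ht. destruct (hd t ht) as [d1 _]. rewrite yall in d1. unfold AA in d1.
    replace (- (rr lam (x t) * x t) * x t) with (- (rr lam (x t) * x t ^ 2 + 0 ^ 2)) by ring. exact d1. }
  assert (rrb : forall t, 0 <= t -> Rabs (rr lam (x t)) <= 1 / 3 + Rabs lam * B).
  { intros t ht. unfold rr. eapply Rle_trans; [apply Rabs_triang|]. rewrite Rabs_Ropp, Rabs_mult, (Rabs_pos_eq (1 / 3)) by lra.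
    apply Rplus_le_compat_l, Rmult_le_compat_l; [lra|]. now apply hbox. }
  assert (gx : forall t, 0 <= t <= T -> is_derive x t (- (rr lam (x t) * x t) * x t) /\
     Rabs (- (rr lam (x t) * x t) * x t) <= (1 / 3 + Rabs lam * B) * B * Rabs (x t)).
  { intros t ht. split; [apply hd'; lra|]. rewrite Rabs_mult. apply Rmult_le_compat_r; [apply Rabs_pos|].
    rewrite Rabs_Ropp, Rabs_mult. apply Rmult_le_compat; try apply Rabs_pos; [apply rrb; lra|apply hbox; lra]. }
  assert (xT : 0 < x T).
  { destruct (xpos T ltac:(lra)) as [h|h]; auto. exfalso.
    assert (x 0 = 0).
    { apply (gronwall_zero x (fun t => - (rr lam (x t) * x t) * x t) ((1 / 3 + Rabs lam * B) * B) 0 T 0 T gx); auto; lra. }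
    apply hbp. rewrite hpx, H0. apply origin_interior. }
  assert (x0p : forall t, 0 <= t <= T -> 0 < x t).
  { intros t ht. apply (gronwall_sign x (fun t => - (rr lam (x t) * x t) * x t) ((1 / 3 + Rabs lam * B) * B) 0 T t T gx); auto; lra. }
  (* On the axis [rr] satisfies a linear equation along the orbit, with coefficient lam x^2, so its
     sign near the origin at time T was already that at time 0. *)
  assert (rp : forall t, 0 <= t <= T -> 0 < rr lam (x t)).
  { intros t ht. apply (gronwall_sign (fun t => rr lam (x t)) (fun t => lam * x t ^ 2 * rr lam (x t)) (Rabs lam * B ^ 2) 0 T t T); auto; [|lra|].
    - intros z hz. split.
      + assert (d := hd' z ltac:(lra)). unfold rr in d |- *. auto_derive; [side_derive|]. derive_rw d. ring.
      + rewrite Rabs_mult. apply Rmult_le_compat_r; [apply Rabs_pos|]. rewrite Rabs_mult, <- RPow_abs.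
        apply Rmult_le_compat_l; [lra|]. apply pow_incr. split; [apply Rabs_pos|]. apply hbox; lra.
    - apply hrs. apply (HT T ltac:(lra)). }
  (* By the intermediate value theorem the orbit runs through all abscissas between x 0 and 0, so
     this whole segment lies in N. *)
  assert (hax : axis_in 1 (x 0)).
  { split; [left; apply x0p; lra|]. intros z hz. rewrite Rmult_1_l. split.
    - destruct (proj1 hz) as [hz0|hz0]; [|rewrite <- hz0; apply N_origin].
      destruct (forward_orbit_limit p H z hz0) as [T' [hT' HT']].
      destruct (HT' T' ltac:(lra)) as [a1 _]. fold (x T') in a1. apply Rabs_def2 in a1.
      destruct (IVT_le x 0 T' z hT') as [s [hs E]].
      + intros t ht. exact (proj1 (Phi_cont p t)).
      + lra.
      + replace (z, 0) with (Phi p s); [apply H; lra|].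
        rewrite (surjective_pairing (Phi p s)). fold (x s) (y s). now rewrite yall, E.
    - assert (r0x := rp 0 ltac:(lra)). unfold rr in *. destruct (Rle_or_lt 0 lam); nra. }
  assert (hle := hmax _ hax).
  rewrite hpx. f_equal. destruct hle as [h|h]; auto. exfalso.
  apply hbp. rewrite hpx. apply axis_interior. generalize (x0p 0 ltac:(lra)). lra.
Qed.

Lemma positive_rr_interval : exists rs r0, 0 < rs <= 1 /\ 0 < r0 /\
  forall x, x1 - rs <= x <= x0 + rs -> r0 <= rr lam x.
Proof.
  destruct (hseg x0 ltac:(lra)) as [_ h0]. destruct (hseg x1 ltac:(lra)) as [_ h1].
  set (r0 := Rmin (rr lam x0) (rr lam x1) / 2).
  assert (hm : 0 < Rmin (rr lam x0) (rr lam x1)) by now apply Rmin_glb_lt.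
  assert (m1 := Rmin_l (rr lam x0) (rr lam x1)). assert (m2 := Rmin_r (rr lam x0) (rr lam x1)).
  assert (pl := Rabs_pos lam).
  set (rs := Rmin 1 (r0 / (Rabs lam + 1))).
  assert (hr0 : 0 < r0) by (unfold r0; lra).
  assert (hrs : 0 < rs) by (apply Rmin_glb_lt; [lra|apply Rdiv_lt_0_compat; lra]).
  exists rs, r0. split; [split; [auto|apply Rmin_l]|split; auto].
  assert (hl : Rabs lam * rs <= r0).
  { assert (rs <= r0 / (Rabs lam + 1)) by apply Rmin_r.
    apply Rle_trans with ((Rabs lam + 1) * (r0 / (Rabs lam + 1))); [|right; field; lra].
    apply Rmult_le_compat; lra. }
  intros x hx. unfold r0, rr in *. generalize (Rle_abs lam) (Rle_abs (- lam)). rewrite Rabs_Ropp. intros.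
  destruct (Rle_or_lt 0 lam); nra.
Qed.

Lemma cross_bl p al be dal dbe rho : local_eq N p al be dal dbe rho -> N p ->
  bounded_lip (fun q => (Rabs (fst q - fst p) <= rho /\ Rabs (snd q - snd p) <= rho) /\ inner q) dist1 (cross dal dbe).
Proof.
  intros hle hp. unfold cross. destruct (Xc_bl lam (B + 1) ltac:(lra)) as [b1 b2].
  set (S := fun q : plane => (Rabs (fst q - fst p) <= rho /\ Rabs (snd q - snd p) <= rho) /\ inner q).
  assert (b1' : bounded_lip S dist1 (fun q => fst (Xp lam q))).
  { apply (bl_ext S dist1 (fun q => fst (Xc lam (B + 1) q))).
    - intros q [_ hq]. now rewrite Xc_in_box.
    - apply (bl_subset (fun _ => True)); auto. }
  assert (b2' : bounded_lip S dist1 (fun q => snd (Xp lam q))).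
  { apply (bl_ext S dist1 (fun q => snd (Xc lam (B + 1) q))).
    - intros q [_ hq]. now rewrite Xc_in_box.
    - apply (bl_subset (fun _ => True)); auto. }
  assert (f1 : bounded_lip S dist1 fst).
  { exists (B + 2). split; [lra|split].
    - intros q [_ [h _]]. apply Rabs_le. lra.
    - intros q r _ _. unfold dist1. generalize (Rabs_pos (fst q - fst r)) (Rabs_pos (snd q - snd r)). nra. }
  assert (f2 : bounded_lip S dist1 snd).
  { exists (B + 2). split; [lra|split].
    - intros q [_ [_ h]]. apply Rabs_le. lra.
    - intros q r _ _. unfold dist1. generalize (Rabs_pos (fst q - fst r)) (Rabs_pos (snd q - snd r)). nra. }
  assert (D := dist1_pos).
  apply bl_plus; apply bl_mult; auto.
  - apply (bl_comp1 S dist1 (fun x => Rabs (x - fst p) <= rho)); auto; [apply hle|]. intros q hq. apply hq.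
  - apply (bl_comp1 S dist1 (fun x => Rabs (x - snd p) <= rho)); auto; [apply hle|]. intros q hq. apply hq.
Qed.

Lemma near_inner p q : N p -> Rabs (fst q - fst p) <= 1 -> Rabs (snd q - snd p) <= 1 -> inner q.
Proof.
  intros hp h1 h2. destruct (hNB p hp). apply Rabs_le_between in h1. apply Rabs_le_between in h2. split; lra.
Qed.

Lemma cross_near p al be dal dbe rho : local_eq N p al be dal dbe rho -> N p -> cross dal dbe p <> 0 ->
  exists r, 0 < r < rho /\ forall q, Rabs (fst q - fst p) <= r -> Rabs (snd q - snd p) <= r ->
    0 < cross dal dbe q * cross dal dbe p.
Proof.
  intros hle hp hc. assert (hr := le_rho _ _ _ _ _ _ _ hle).
  destruct (cross_bl p al be dal dbe rho hle hp) as [M [hM [_ HM]]].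
  assert (pc := Rabs_pos_lt _ hc).
  set (c0 := cross dal dbe p) in *.
  set (r := Rmin (Rmin (rho / 2) 1) (Rabs c0 / (4 * (M + 1)))).
  assert (hd : 0 < Rabs c0 / (4 * (M + 1))) by (apply Rdiv_lt_0_compat; lra).
  assert (0 < r) by (repeat apply Rmin_glb_lt; lra).
  assert (r1 : r <= Rmin (rho / 2) 1) by apply Rmin_l. assert (r2 : r <= Rabs c0 / (4 * (M + 1))) by apply Rmin_r.
  assert (r3 := Rmin_l (rho / 2) 1). assert (r4 := Rmin_r (rho / 2) 1).
  exists r. split; [lra|]. intros q h1 h2.
  assert (A : Rabs (cross dal dbe q - c0) <= M * dist1 q p).
  { apply HM.
    - split; [split; lra|]. apply (near_inner p q hp); lra.
    - split; [|now apply N_inner]. rewrite !Rminus_diag, Rabs_R0. lra. }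
  assert (A2 : Rabs (cross dal dbe q - c0) <= Rabs c0 / 2).
  { eapply Rle_trans; [exact A|]. apply Rle_trans with (M * (2 * r)).
    - apply Rmult_le_compat_l; auto. unfold dist1. lra.
    - apply Rle_trans with ((M + 1) * (2 * (Rabs c0 / (4 * (M + 1))))); [|right; field; lra].
      apply Rmult_le_compat; lra. }
  revert A2 pc. unfold Rabs. repeat destruct Rcase_abs; intros; nra.
Qed.

(** Every point of the closed inner segment has a square around it inside N; compactness of the
    segment gives them a common height. *)
Lemma tube_in_N rho : 0 < rho -> exists r2, 0 < r2 /\ forall x y, x1 + rho <= x <= x0 - rho -> Rabs y <= r2 -> N (x, y).
Proof.
  intros hrho.
  assert (H : forall t, exists d : posreal, x1 + rho <= t <= x0 - rho ->
    forall q : plane, Rabs (fst q - t) < d -> Rabs (snd q) < d -> N q).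
  { intros t. destruct (classic (x1 + rho <= t <= x0 - rho)) as [h|h].
    - assert (hl := axis_interior t ltac:(lra)). apply locally_plane in hl. destruct hl as [e [he He]].
      exists (mkposreal e he). intros _ q h1 h2. apply He; simpl in *; auto. now rewrite Rminus_0_r.
    - exists (mkposreal 1 Rlt_0_1). tauto. }
  set (del := fun t => proj1_sig (constructive_indefinite_description _ (H t))).
  assert (Hdel : forall t, x1 + rho <= t <= x0 - rho ->
    forall q : plane, Rabs (fst q - t) < del t -> Rabs (snd q) < del t -> N q).
  { intros t. exact (proj2_sig (constructive_indefinite_description _ (H t))). }
  destruct (compactness_value_1d (x1 + rho) (x0 - rho) del) as [d Hd].
  exists (d / 2). split; [generalize (cond_pos d); lra|]. intros x y hx hy.
  apply NNPP. intros hn. apply (Hd x hx). intros [t [ht [h1 h2]]]. apply hn.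
  apply (Hdel t ht); simpl; auto. generalize (cond_pos d). lra.
Qed.

(** Passage from graphs over the x-axis back to orbits in time. The orbit stays on the graph as long
    as it is over [xl, xr], and there x decreases at a speed bounded below, so the left end is
    reached in finite time. *)
Lemma trajectory_on_graph xl xr r0 Y P : xl < 0 -> 0 < xr -> 0 < r0 ->
  - (B + 1) <= xl -> xr <= B + 1 ->
  (forall x, xl <= x <= xr -> r0 <= rr lam x) -> graph lam xl xr Y -> Rabs (Y 0) < 1 ->
  xl < fst P < xr -> snd P = Y (fst P) ->
  exists T, 0 < T /\ fst (Phi P T) = xl /\ forall t, 0 <= t <= T ->
    xl <= fst (Phi P t) <= xr /\ snd (Phi P t) = Y (fst (Phi P t)) /\
    is_derive (fun t => fst (Phi P t)) t (- AA lam (fst (Phi P t)) (snd (Phi P t))) /\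
    0 < AA lam (fst (Phi P t)) (snd (Phi P t)).
Proof.
  intros hl hr hr0 hxlB hxrB hR hY ha hP1 hP2.
  assert (nz0 : Y 0 <> 0) by (apply hY; lra).
  set (mu := r0 / 2 * Y 0 ^ 2).
  assert (hmu : 0 < mu).
  { unfold mu. apply Rmult_lt_0_compat; [lra|]. rewrite <- pow2_abs. apply pow_lt. now apply Rabs_pos_lt. }
  assert (hA : forall z, xl <= z <= xr -> mu <= AA lam z (Y z)).
  { intros z hz. destruct (graph_bounds lam xl xr r0 hl hr hr0 hR Y z hY hz) as [_ [_ h]].
    unfold mu. generalize (pow2_ge_0 z). nra. }
  assert (hYb : forall z, xl <= z <= xr -> Rabs (Y z) < 1).
  { intros z hz. eapply Rle_lt_trans; [apply (graph_abs_le lam xl xr r0); eauto|auto]. }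
  set (x := fun t => fst (Phi P t)). set (y := fun t => snd (Phi P t)).
  set (reg := fun t => xl <= x t <= xr /\ Rabs (y t) <= 1).
  assert (hinn : forall t, reg t -> inner (Phi P t)).
  { intros t [h1 h2]. apply Rabs_le_between in h2. unfold x, y in *. split; lra. }
  assert (hd : forall t, reg t -> is_derive x t (- AA lam (x t) (y t)) /\ is_derive y t (2 / 3 * x t * y t)).
  { intros t ht. destruct (Phi_solves P t (hinn t ht)) as [d1 d2]. rewrite Xp_fst in d1. split; auto.
    replace (2 / 3 * x t * y t) with (snd (Xp lam (Phi P t))); auto.
    unfold x, y. destruct (Phi P t); reflexivity. }
  assert (R1 : exists R1, 0 <= R1 /\ forall z, xl <= z <= xr -> Rabs (rr lam z) <= R1).
  { apply cont_bounded. intros z hz. apply (is_derive_cont _ _ (- lam)). unfold rr. auto_derive; auto; ring. }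
  destruct R1 as [R1 [hR1 HR1]].
  set (W := xr - xl). set (k := 2 / 3 * W * (R1 * W ^ 2 + 1) / mu).
  (* The difference y - Y x solves a homogeneous linear equation with bounded coefficient and starts
     from 0. *)
  assert (on : forall t, 0 <= t -> (forall s, 0 <= s <= t -> reg s) -> y t = Y (x t)).
  { intros t ht hreg. apply Rminus_diag_uniq.
    apply (gronwall_zero (fun s => y s - Y (x s))
      (fun s => 2 / 3 * x s * (rr lam (x s) * x s ^ 2 - y s * Y (x s)) / AA lam (x s) (Y (x s)) * (y s - Y (x s))) k 0 t t 0); try lra.
    - intros s hs. assert (hrs := hreg s hs). destruct (hd s hrs) as [d1 d2].
      destruct hrs as [hxs hys]. destruct (hY (x s) hxs) as [nz dY]. assert (Ap := hA (x s) hxs). split.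
      + assert (d3 : is_derive (fun s => Y (x s)) s (- AA lam (x s) (y s) * FF lam (x s) (Y (x s)))).
        { exact (is_derive_comp Y x s _ _ dY d1). }
        replace (2 / 3 * x s * (rr lam (x s) * x s ^ 2 - y s * Y (x s)) / AA lam (x s) (Y (x s)) * (y s - Y (x s)))
          with (2 / 3 * x s * y s - - AA lam (x s) (y s) * FF lam (x s) (Y (x s))).
        * exact (is_derive_minus _ _ _ _ _ d2 d3).
        * unfold FF, AA in *. field. lra.
      + rewrite Rabs_mult. apply Rmult_le_compat_r; [apply Rabs_pos|].
        assert (hx' : Rabs (x s) <= W) by (apply Rabs_le; unfold W; lra).
        assert (hq : Rabs (rr lam (x s) * x s ^ 2 - y s * Y (x s)) <= R1 * W ^ 2 + 1).
        { eapply Rle_trans; [apply Rabs_triang|]. rewrite Rabs_Ropp, !Rabs_mult, <- RPow_abs.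
          assert (Rabs (rr lam (x s)) * Rabs (x s) ^ 2 <= R1 * W ^ 2).
          { apply Rmult_le_compat; [apply Rabs_pos|apply pow_le, Rabs_pos|now apply HR1|].
            apply pow_incr. split; [apply Rabs_pos|auto]. }
          assert (Rabs (y s) * Rabs (Y (x s)) <= 1 * 1).
          { apply Rmult_le_compat; try apply Rabs_pos; auto. left; now apply hYb. } lra. }
        unfold k. assert (h23 : 0 < 2 / 3) by lra. revert h23. generalize (2 / 3). intros c23 h23.
        unfold Rdiv. rewrite !Rabs_mult, Rabs_inv, (Rabs_pos_eq (AA _ _ _)), (Rabs_pos_eq c23) by lra.
        apply Rmult_le_compat.
        * apply Rmult_le_pos; [|apply Rabs_pos]. apply Rmult_le_pos; [lra|apply Rabs_pos].
        * left; apply Rinv_0_lt_compat; lra.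
        * apply Rmult_le_compat; try apply Rabs_pos; auto.
          -- apply Rmult_le_pos; [lra|apply Rabs_pos].
          -- apply Rmult_le_compat_l; lra.
        * apply Rinv_le_contravar; auto.
    - unfold x, y. rewrite hPhi0. lra. }
  assert (reg0 : reg 0).
  { unfold reg, x, y. rewrite hPhi0. split; [lra|]. rewrite hP2. left. apply hYb. lra. }
  assert (xle : forall t, 0 <= t -> (forall s, 0 <= s <= t -> reg s) -> x t <= fst P - mu * t).
  { intros t ht hreg. assert (h : - (x 0 + mu * 0) <= - (x t + mu * t)).
    { apply (deriv_nonneg_le (fun t => - (x t + mu * t)) (fun t => - (- AA lam (x t) (y t) + mu)) 0 t ht).
      intros s hs. destruct (hd s (hreg s hs)) as [d1 _]. split.
      - auto_derive; [side_derive|]. derive_rw d1. ring.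
      - rewrite (on s) by (intros; try apply hreg; lra). generalize (hA (x s) (proj1 (hreg s hs))). lra. }
    unfold x at 1 in h. rewrite hPhi0 in h. lra. }
  set (t1 := (fst P - xl) / mu + 1).
  assert (ht1 : 0 <= t1). { unfold t1. assert (0 <= (fst P - xl) / mu) by (apply Rdiv_le_0_compat; lra). lra. }
  assert (hex : exists t, 0 <= t /\ ~ reg t).
  { destruct (classic (exists t, 0 <= t /\ ~ reg t)) as [h|h]; auto. exfalso.
    assert (hall : forall s, 0 <= s -> reg s).
    { intros s hs. destruct (classic (reg s)); auto. exfalso; apply h; now exists s. }
    assert (A := xle t1 ht1 (fun s hs => hall s (proj1 hs))). destruct (hall t1 ht1) as [A2 _].
    replace (mu * t1) with (fst P - xl + mu) in A by (unfold t1; field; lra). lra. }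
  destruct hex as [t2 [ht2 hn2]].
  assert (cx : forall t, continuous x t) by (intros t; exact (proj1 (Phi_cont P t))).
  assert (cy : forall t, continuous y t) by (intros t; exact (proj2 (Phi_cont P t))).
  destruct (last_time reg t2 ht2 reg0 hn2) as [T [hT [H1 H2]]].
  { intros t ht. apply (Phi_locally P t (fun q => ~ (xl <= fst q <= xr /\ Rabs (snd q) <= 1))).
    apply locally_plane. unfold reg, x, y in ht.
    set (u := fst (Phi P t)) in *. set (v := snd (Phi P t)) in *.
    exists (Rmax (Rmax (xl - u) (u - xr)) (Rabs v - 1)). split.
    - apply NNPP. intros h. apply ht. revert h. unfold Rmax. repeat destruct Rle_dec; intros; split; lra.
    - intros q q1 q2 [h1 h2]. generalize (Rabs_triang_inv v (snd q)). rewrite (Rabs_minus_sym v).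
      apply Rabs_def2 in q1. revert q1 q2. unfold Rmax. repeat destruct Rle_dec; lra. }
  assert (regT := H1 T ltac:(lra)).
  assert (yT := on T ltac:(lra) H1).
  assert (xT := xle T ltac:(lra) H1).
  (* The stay cannot end through the other sides of the region: |y| < 1 strictly on the graph, and x
     is below its initial value, which is less than xr. *)
  assert (E : x T = xl).
  { destruct regT as [[[h|h] _] _]; auto. exfalso.
    assert (yb : Rabs (y T) < 1) by (rewrite yT; apply hYb; apply H1; lra).
    assert (d : 0 < Rmin (Rmin (x T - xl) (xr - x T)) (1 - Rabs (y T))).
    { repeat apply Rmin_glb_lt; try lra. assert (0 <= mu * T) by (apply Rmult_le_pos; lra). lra. }
    destruct (Phi_eps P T _ d) as [e [he He]]. destruct (H2 e he) as [s [hs hns]]. apply hns.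
    destruct (He s) as [a1 a2]; [rewrite Rabs_pos_eq; lra|]. fold (x s) (x T) in a1. fold (y s) (y T) in a2.
    assert (m1 := Rmin_l (Rmin (x T - xl) (xr - x T)) (1 - Rabs (y T))).
    assert (m2 := Rmin_r (Rmin (x T - xl) (xr - x T)) (1 - Rabs (y T))).
    assert (m3 := Rmin_l (x T - xl) (xr - x T)). assert (m4 := Rmin_r (x T - xl) (xr - x T)).
    apply Rabs_def2 in a1. generalize (Rabs_triang_inv (y s) (y T)). split; lra. }
  exists T. split; [|split; [exact E|]].
  - destruct (proj1 hT) as [h|h]; auto. exfalso. rewrite <- h in E. unfold x in E. rewrite hPhi0 in E. lra.
  - intros t ht. assert (rt := H1 t ht). assert (ot := on t ltac:(lra) (fun s hs => H1 s ltac:(lra))).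
    fold (x t) (y t). split; [apply rt|split; [exact ot|split]].
    + exact (proj1 (hd t rt)).
    + rewrite ot. generalize (hA (x t) (proj1 rt)). lra.
Qed.

Lemma boundary_eq p al be dal dbe rho q : local_eq N p al be dal dbe rho ->
  Rabs (fst q - fst p) < rho -> Rabs (snd q - snd p) < rho -> bd N q -> al (fst q) + be (snd q) = 0.
Proof.
  intros hle h1 h2 [hq hn].
  assert (hle0 : al (fst q) + be (snd q) <= 0) by (apply (le_N _ _ _ _ _ _ _ hle); auto; lra).
  destruct hle0 as [h|h]; auto. exfalso. apply hn.
  assert (c1 : continuous al (fst q)) by (exact (is_derive_cont _ _ _ (le_al _ _ _ _ _ _ _ hle _ (Rlt_le _ _ h1)))).
  assert (c2 : continuous be (snd q)) by (exact (is_derive_cont _ _ _ (le_be _ _ _ _ _ _ _ hle _ (Rlt_le _ _ h2)))).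
  set (e := - (al (fst q) + be (snd q)) / 2).
  destruct (proj1 (continuous_eps _ _) c1 e ltac:(unfold e; lra)) as [d1 [hd1 H1]].
  destruct (proj1 (continuous_eps _ _) c2 e ltac:(unfold e; lra)) as [d2 [hd2 H2]].
  apply locally_plane. exists (Rmin (Rmin d1 d2) (Rmin (rho - Rabs (fst q - fst p)) (rho - Rabs (snd q - snd p)))).
  split; [repeat apply Rmin_glb_lt; lra|]. intros r r1 r2.
  assert (m1 := Rmin_l (Rmin d1 d2) (Rmin (rho - Rabs (fst q - fst p)) (rho - Rabs (snd q - snd p)))).
  assert (m2 := Rmin_r (Rmin d1 d2) (Rmin (rho - Rabs (fst q - fst p)) (rho - Rabs (snd q - snd p)))).
  assert (m3 := Rmin_l d1 d2). assert (m4 := Rmin_r d1 d2).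
  assert (m5 := Rmin_l (rho - Rabs (fst q - fst p)) (rho - Rabs (snd q - snd p))).
  assert (m6 := Rmin_r (rho - Rabs (fst q - fst p)) (rho - Rabs (snd q - snd p))).
  apply (le_N _ _ _ _ _ _ _ hle).
  - replace (fst r - fst p) with ((fst r - fst q) + (fst q - fst p)) by ring.
    eapply Rle_trans; [apply Rabs_triang|lra].
  - replace (snd r - snd p) with ((snd r - snd q) + (snd q - snd p)) by ring.
    eapply Rle_trans; [apply Rabs_triang|lra].
  - specialize (H1 (fst r) ltac:(lra)). specialize (H2 (snd r) ltac:(lra)).
    apply Rabs_def2 in H1. apply Rabs_def2 in H2. unfold e in *. lra.
Qed.

(** * Exit points of orbits close to the axis *)

Section Exit.
Variables (al0 be0 dal0 dbe0 al1 be1 dal1 dbe1 : R -> R) (rho0 rho1 rho r0 r2 g3 : R).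
Hypothesis hle0 : local_eq N (x0, 0) al0 be0 dal0 dbe0 rho0.
Hypothesis hle1 : local_eq N (x1, 0) al1 be1 dal1 dbe1 rho1.
Hypothesis hrho : 0 < rho <= 1.
Hypothesis hrho0 : rho < rho0.
Hypothesis hrho1 : rho < rho1.
Hypothesis hsep : x1 + rho < 0 /\ 0 < x0 - rho.
Hypothesis hc0 : forall q, Rabs (fst q - x0) <= rho -> Rabs (snd q) <= rho -> cross dal0 dbe0 q < 0.
Hypothesis hc1 : forall q, Rabs (fst q - x1) <= rho -> Rabs (snd q) <= rho -> 0 < cross dal1 dbe1 q.
Hypothesis hr0 : 0 < r0.
Hypothesis hR : forall x, x1 - rho <= x <= x0 + rho -> r0 <= rr lam x.
Hypothesis hr2 : 0 < r2 <= rho.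
Hypothesis htube : forall x y, x1 + rho <= x <= x0 - rho -> Rabs y <= r2 -> N (x, y).
Hypothesis hg3 : 0 < g3.
Hypothesis hbeyond : forall y, Rabs y <= g3 -> 0 < al1 (x1 - rho) + be1 y.

(** The orbit stays in N first because al0 + be0 decreases from 0, then because it runs in the tube
    around the axis. Near the outgoing end al1 + be1 increases strictly and is positive at x1 - rho,
    so it vanishes once, at the exit. *)
Lemma exit_on_graph P Y : Rabs (fst P - x0) < rho -> Rabs (snd P) < rho ->
  al0 (fst P) + be0 (snd P) = 0 -> graph lam (x1 - rho) (x0 + rho) Y -> snd P = Y (fst P) ->
  Rabs (Y 0) < Rmin r2 g3 ->
  exists q, exit_point (Xp lam) N P q /\ Rabs (fst q - x1) <= rho /\ Y (fst q) = snd q /\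
    al1 (fst q) + be1 (snd q) = 0.
Proof.
  intros hP1 hP2 hP0 hY hPY ha.
  assert (ha2 := Rlt_le_trans _ _ _ ha (Rmin_l _ _)). assert (ha3 := Rlt_le_trans _ _ _ ha (Rmin_r _ _)).
  assert (hx0B : - B <= x0 <= B) by (apply (hNB _ (proj1 hbd0))).
  assert (hx1B : - B <= x1 <= B) by (apply (hNB _ (proj1 hbd1))).
  apply Rabs_def2 in hP1.
  destruct (trajectory_on_graph (x1 - rho) (x0 + rho) r0 Y P) as [T [hT [ET HT]]]; auto; try lra.
  set (x := fun t => fst (Phi P t)) in *. set (y := fun t => snd (Phi P t)) in *.
  assert (hy : forall t, 0 <= t <= T -> Rabs (y t) <= Rabs (Y 0)).
  { intros t ht. destruct (HT t ht) as [h1 [h2 _]]. unfold y. rewrite h2.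
    apply (graph_abs_le lam (x1 - rho) (x0 + rho) r0); auto; lra. }
  assert (hinn : forall t, 0 <= t <= T -> inner (Phi P t)).
  { intros t ht. destruct (HT t ht) as [h1 _]. assert (h2 := hy t ht). unfold y in h2.
    assert (h3 : Rabs (snd (Phi P t)) <= B + 1) by lra. apply Rabs_le_between in h3. split; lra. }
  assert (xdec : forall s t, 0 <= s -> s <= t -> t <= T -> x t <= x s).
  { intros s t h1 h2 h3. assert (h : - x s <= - x t); [|lra].
    apply (deriv_nonneg_le (fun t => - x t) (fun t => - - AA lam (x t) (y t)) s t h2). intros z hz.
    destruct (HT z ltac:(lra)) as [_ [_ [d1 d2]]]. split; [exact (is_derive_opp _ _ _ d1)|].
    change (0 < AA lam (x z) (y z)) in d2. lra. }
  assert (x00 : x 0 = fst P) by (unfold x; now rewrite hPhi0).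
  assert (cx : forall t, continuous x t) by (intros t; exact (proj1 (Phi_cont P t))).
  assert (xT : x T = x1 - rho) by exact ET.
  destruct (IVT_le x 0 T (x1 + rho)) as [t1 [ht1 E1]]; [lra|auto|right; lra|].
  assert (psi0 : forall t, 0 <= t <= T -> x0 - rho <= x t -> N (Phi P t)).
  { intros t ht hx.
    assert (A : - (al0 (x 0) + be0 (y 0)) <= - (al0 (x t) + be0 (y t))).
    { apply (deriv_nonneg_le (fun t => - (al0 (x t) + be0 (y t))) (fun t => - cross dal0 dbe0 (Phi P t)) 0 t); [lra|].
      intros z hz. assert (b1 := xdec z t ltac:(lra) ltac:(lra) ltac:(lra)). assert (b2 := xdec 0 z ltac:(lra) ltac:(lra) ltac:(lra)).
      assert (b3 : Rabs (x z - x0) <= rho) by (apply Rabs_le; lra).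
      assert (b4 := hy z ltac:(lra)). assert (b5 : Rabs (y z) <= rho) by lra. split.
      - apply (is_derive_opp (fun t => al0 (x t) + be0 (y t))).
        apply (psi_derive (x0, 0) al0 be0 dal0 dbe0 rho0 hle0); simpl.
        + change (Rabs (x z - x0) <= rho0). lra.
        + rewrite Rminus_0_r. change (Rabs (y z) <= rho0). lra.
        + apply hinn; lra.
      - generalize (hc0 (Phi P z) b3 b5). lra. }
    rewrite x00 in A. unfold y at 1 in A. rewrite hPhi0, hP0 in A.
    assert (b1 := xdec 0 t ltac:(lra) ltac:(lra) ltac:(lra)). assert (b4 := hy t ht).
    apply (le_N _ _ _ _ _ _ _ hle0); simpl.
    - change (Rabs (x t - x0) <= rho0). apply Rabs_le; lra.
    - rewrite Rminus_0_r. change (Rabs (y t) <= rho0). lra.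
    - change (al0 (x t) + be0 (y t) <= 0). lra. }
  assert (pre : forall t, 0 <= t <= t1 -> N (Phi P t)).
  { intros t ht. destruct (Rle_or_lt (x0 - rho) (x t)) as [h|h]; [apply psi0; lra|].
    rewrite (surjective_pairing (Phi P t)). apply htube.
    - assert (b := xdec t t1 ltac:(lra) ltac:(lra) ltac:(lra)). fold (x t). lra.
    - fold (y t). generalize (hy t ltac:(lra)). lra. }
  assert (box1 : forall t, t1 <= t <= T -> Rabs (x t - x1) <= rho /\ Rabs (y t) <= rho).
  { intros t ht. assert (b1 := xdec t1 t ltac:(lra) ltac:(lra) ltac:(lra)).
    assert (b2 := xdec t T ltac:(lra) ltac:(lra) ltac:(lra)). split; [apply Rabs_le; lra|].
    generalize (hy t ltac:(lra)). lra. }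
  set (psi := fun t => al1 (x t) + be1 (y t)).
  assert (dpsi : forall t, t1 <= t <= T -> is_derive psi t (cross dal1 dbe1 (Phi P t)) /\ 0 < cross dal1 dbe1 (Phi P t)).
  { intros t ht. destruct (box1 t ht) as [b1 b2]. split.
    - apply (psi_derive (x1, 0) al1 be1 dal1 dbe1 rho1 hle1); simpl.
      + change (Rabs (x t - x1) <= rho1). lra.
      + rewrite Rminus_0_r. change (Rabs (y t) <= rho1). lra.
      + apply hinn; lra.
    - now apply hc1. }
  assert (inN : forall t, t1 <= t <= T -> (N (Phi P t) <-> psi t <= 0)).
  { intros t ht. destruct (box1 t ht) as [b1 b2]. apply (le_N _ _ _ _ _ _ _ hle1); simpl.
    - change (Rabs (x t - x1) <= rho1). lra.
    - rewrite Rminus_0_r. change (Rabs (y t) <= rho1). lra. }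
  assert (p1 : psi t1 <= 0) by (apply inN; [lra|apply pre; lra]).
  assert (pT : 0 < psi T).
  { unfold psi. rewrite xT. apply hbeyond. generalize (hy T ltac:(lra)). lra. }
  destruct (IVT_le psi t1 T 0) as [t2 [ht2 E2]]; [lra| |lra|].
  { intros t ht. eapply is_derive_cont. apply (dpsi t ht). }
  assert (ht2T : t2 < T) by (destruct (proj2 ht2) as [h|h]; [auto|subst; lra]).
  exists (Phi P t2). split; [|split; [|split]].
  - exists t2. split; [lra|split; [|split]].
    + apply Phi_flow. rewrite Rmin_left, Rmax_right by lra. intros s hs. apply hinn. lra.
    + intros s r hs hf. rewrite (Phi_flow_eq P s r); auto.
      * destruct (Rle_or_lt s t1) as [h|h]; [apply pre; lra|]. apply inN; [lra|]. rewrite <- E2.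
        apply (deriv_nonneg_le psi (fun t => cross dal1 dbe1 (Phi P t))); [lra|]. intros z hz.
        destruct (dpsi z ltac:(lra)). split; auto; lra.
      * rewrite Rmin_left, Rmax_right by lra. intros z hz. apply hinn. lra.
    + intros e he. set (s := Rmin (t2 + e / 2) T).
      assert (hs : t2 < s /\ s <= T /\ s < t2 + e).
      { unfold s, Rmin. destruct Rle_dec; lra. }
      exists s, (Phi P s). split; [lra|split].
      * apply Phi_flow. rewrite Rmin_left, Rmax_right by lra. intros z hz. apply hinn. lra.
      * rewrite inN by lra. apply Rlt_not_le. rewrite <- E2.
        apply (deriv_pos_lt psi (fun t => cross dal1 dbe1 (Phi P t))); [lra|]. intros z hz. apply dpsi. lra.
  - apply (box1 t2). lra.
  - destruct (HT t2 ltac:(lra)) as [_ [h _]]. now rewrite h.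
  - exact E2.
Qed.
End Exit.

Lemma pos_prod_neg x y : 0 < x * y -> y < 0 -> x < 0.
Proof. nra. Qed.

Lemma pos_prod_pos x y : 0 < x * y -> 0 < y -> 0 < x.
Proof. nra. Qed.

Lemma cross_axis dal dbe x : cross dal dbe (x, 0) = - (dal x * (rr lam x * x ^ 2)).
Proof. unfold cross. rewrite Xp_axis. simpl. ring. Qed.

(** The flow crosses the section, so dal0 x0 <> 0. Differentiating al0 + be0 = 0 along c then shows
    that a parametrisation with Derive c2 0 = 0 would have zero velocity; the height c2 is thus a
    local coordinate on the section. *)
Lemma section_curve_data al0 be0 dal0 dbe0 rho0 (c : R -> plane) :
  local_eq N (x0, 0) al0 be0 dal0 dbe0 rho0 -> cross dal0 dbe0 (x0, 0) < 0 ->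
  local_param (bd N) (x0, 0) c ->
  exists e d Mc, 0 < e /\ 0 < d /\ 0 <= Mc /\
   let c1 := fun s => fst (c s) in let c2 := fun s => snd (c s) in
   (forall s, Rabs s < e -> is_derive c1 s (Derive c1 s) /\ is_derive c2 s (Derive c2 s)) /\
   (bounded_lip (fun s => Rabs s < e) (fun s t => Rabs (s - t)) (Derive c1) /\
    bounded_lip (fun s => Rabs s < e) (fun s t => Rabs (s - t)) (Derive c2)) /\
   c1 0 = x0 /\ c2 0 = 0 /\ Derive c2 0 <> 0 /\
   (forall s, Rabs s < e -> d * Rabs s <= Rabs (c2 s) <= 3 * d * Rabs s) /\
   (forall s t, Rabs s < e -> Rabs t < e -> 0 < s * t -> 0 < c2 s * c2 t) /\
   (forall s, Rabs s < e -> Rabs (c1 s - x0) <= Mc * Rabs s) /\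
   (forall s, Rabs s < e -> bd N (c s)).
Proof.
  intros hle hc [[hc0 [hs1 [hs2 hloc]]] hvel].
  set (c1 := fun s => fst (c s)) in *. set (c2 := fun s => snd (c s)) in *.
  assert (c10 : c1 0 = x0) by (unfold c1; now rewrite hc0).
  assert (c20 : c2 0 = 0) by (unfold c2; now rewrite hc0).
  destruct (smooth_C11 c1 0 hs1) as [r1 [hr1 [D1 BL1]]]. destruct (smooth_C11 c2 0 hs2) as [r2 [hr2 [D2 BL2]]].
  apply locally_R in hloc. destruct hloc as [r3 [hr3 hloc]].
  assert (z0 : forall r, 0 < r -> Rabs (0 - 0) <= r) by (intros; rewrite Rminus_diag, Rabs_R0; lra).
  assert (d10 := D1 0 (z0 _ hr1)). assert (d20 := D2 0 (z0 _ hr2)).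
  assert (hrho := le_rho _ _ _ _ _ _ _ hle).
  assert (hda : dal0 x0 <> 0).
  { intros E. rewrite cross_axis, E in hc. lra. }
  assert (nz : Derive c2 0 <> 0).
  { intros E.
    destruct (proj1 (continuous_eps _ _) (is_derive_cont _ _ _ d10) rho0 hrho) as [e1 [he1 H1]].
    destruct (proj1 (continuous_eps _ _) (is_derive_cont _ _ _ d20) rho0 hrho) as [e2 [he2 H2]].
    assert (hz : is_derive (fun s => al0 (c1 s) + be0 (c2 s)) 0 (Derive c1 0 * dal0 x0 + Derive c2 0 * dbe0 0)).
    { apply (is_derive_plus (fun s => al0 (c1 s)) (fun s => be0 (c2 s))).
      - apply (is_derive_comp al0 c1 0); auto. rewrite c10. apply (le_al _ _ _ _ _ _ _ hle). simpl.
        rewrite Rminus_diag, Rabs_R0. lra.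
      - apply (is_derive_comp be0 c2 0); auto. rewrite c20. apply (le_be _ _ _ _ _ _ _ hle). simpl.
        rewrite Rminus_diag, Rabs_R0. lra. }
    assert (hz' : is_derive (fun s => al0 (c1 s) + be0 (c2 s)) 0 0).
    { apply (is_derive_ext_loc (fun _ => 0)); [|apply (is_derive_const 0)].
      apply locally_R. exists (Rmin (Rmin e1 e2) r3). split; [repeat apply Rmin_glb_lt; auto|]. intros s hs.
      assert (m1 := Rmin_l (Rmin e1 e2) r3). assert (m2 := Rmin_r (Rmin e1 e2) r3).
      assert (m3 := Rmin_l e1 e2). assert (m4 := Rmin_r e1 e2).
      symmetry. apply (boundary_eq (x0, 0) al0 be0 dal0 dbe0 rho0 (c s) hle); simpl.
      - rewrite <- c10. apply H1. lra.
      - rewrite <- c20. apply H2. lra.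
      - apply hloc. lra. }
    apply is_derive_unique in hz. apply is_derive_unique in hz'. rewrite hz in hz'. rewrite E, Rmult_0_l, Rplus_0_r in hz'.
    apply Rmult_integral in hz'. destruct hz' as [hz'|hz']; [|auto].
    apply hvel. unfold velocity0. fold c1 c2. now rewrite E, hz'. }
  (* On |s| < e the derivative of c2 varies by at most d around a value of size 2 d, which explains
     the bounds d and 3 d and the constant sign. *)
  set (d := Rabs (Derive c2 0) / 2). assert (hd : 0 < d) by (unfold d; apply Rabs_pos_lt in nz; lra).
  destruct BL1 as [N1 [hN1 [B1 L1]]]. destruct BL2 as [N2 [hN2 [B2 L2]]].
  set (e := Rmin (Rmin r1 r2) (Rmin r3 (d / (N2 + 1)))).
  assert (hq : 0 < d / (N2 + 1)) by (apply Rdiv_lt_0_compat; lra).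
  assert (he : 0 < e) by (repeat apply Rmin_glb_lt; auto).
  assert (m1 : e <= r1) by (eapply Rle_trans; [apply Rmin_l|apply Rmin_l]).
  assert (m2 : e <= r2) by (eapply Rle_trans; [apply Rmin_l|apply Rmin_r]).
  assert (m3 : e <= r3) by (eapply Rle_trans; [apply Rmin_r|apply Rmin_l]).
  assert (m4 : e <= d / (N2 + 1)) by (eapply Rle_trans; [apply Rmin_r|apply Rmin_r]).
  assert (in1 : forall s, Rabs s < e -> Rabs (s - 0) <= r1) by (intros; rewrite Rminus_0_r; lra).
  assert (in2 : forall s, Rabs s < e -> Rabs (s - 0) <= r2) by (intros; rewrite Rminus_0_r; lra).
  assert (in0 : forall s x, Rabs s < e -> Rmin 0 s <= x <= Rmax 0 s -> Rabs x < e).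
  { intros s x h1 h2. generalize (interval_0 s x h2). lra. }
  assert (near : forall s, Rabs s < e -> Rabs (Derive c2 s - Derive c2 0) <= d).
  { intros s hs. eapply Rle_trans; [apply L2; auto|]. rewrite Rminus_0_r.
    apply Rle_trans with ((N2 + 1) * (d / (N2 + 1))); [|right; field; lra].
    apply Rmult_le_compat; try lra. apply Rabs_pos. }
  assert (mv : forall s, Rabs s < e -> exists xi, c2 s = Derive c2 xi * s /\ Rabs (Derive c2 xi - Derive c2 0) <= d).
  { intros s hs. destruct (MVT_any c2 (Derive c2) 0 s) as [xi [hxi E]].
    - intros x hx. apply D2, in2. now apply (in0 s).
    - rewrite c20, !Rminus_0_r in E. exists xi. split; auto. apply near. now apply (in0 s). }
  exists e, d, N1. split; [auto|split; [auto|split; [auto|]]]. cbv zeta.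
  split; [|split; [|split; [|split; [|split; [|split; [|split; [|split]]]]]]]; auto.
  - split; [exists N1|exists N2]; (split; [auto|split]); auto.
  - intros s hs. destruct (mv s hs) as [xi [E hxi]]. change (snd (c s)) with (c2 s). rewrite E, Rabs_mult.
    assert (h1 : Rabs (Derive c2 0) - d <= Rabs (Derive c2 xi)).
    { generalize (Rabs_triang_inv (Derive c2 0) (Derive c2 0 - Derive c2 xi)). rewrite (Rabs_minus_sym (Derive c2 0)).
      replace (Derive c2 0 - (Derive c2 0 - Derive c2 xi)) with (Derive c2 xi) by ring. lra. }
    assert (h2 : Rabs (Derive c2 xi) <= Rabs (Derive c2 0) + d).
    { generalize (Rabs_triang_inv (Derive c2 xi) (Derive c2 0)). lra. }
    assert (h3 : Rabs (Derive c2 0) = 2 * d) by (unfold d; lra). generalize (Rabs_pos s). nra.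
  - intros s t hs ht hst. destruct (mv s hs) as [xi [E hxi]]. destruct (mv t ht) as [ze [E' hze]].
    change (0 < c2 s * c2 t). rewrite E, E'.
    replace (Derive c2 xi * s * (Derive c2 ze * t)) with (Derive c2 xi * Derive c2 ze * (s * t)) by ring.
    apply Rmult_lt_0_compat; auto. unfold d in hxi, hze. revert hxi hze.
    assert (p := Rabs_pos_lt _ nz). revert p. unfold Rabs. repeat destruct Rcase_abs; intros; nra.
  - intros s hs. rewrite <- c10. change (Rabs (c1 s - c1 0) <= N1 * Rabs s).
    rewrite <- (Rminus_0_r s) at 2. apply (deriv_lip c1 (Derive c1)). intros x hx.
    assert (Rabs x < e) by now apply (in0 s). split; [now apply D1, in1|now apply B1, in1].
  - intros s hs. apply hloc. rewrite Rminus_0_r. lra.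
Qed.

(** * The block map read along a parametrisation of the ingoing boundary *)

Section Regularity.
Variable g : plane -> plane.
Hypothesis hg0 : g (x0, 0) = (x1, 0).
Hypothesis hg1 : forall p q, nplus (Xp lam) N p -> ~ aplus (Xp lam) N p -> exit_point (Xp lam) N p q -> g p = q.
Hypothesis hlam : lam <> 0.

Lemma block_map_regularity c : local_param (bd N) (x0, 0) c ->
  exists eps d1 d2 C k, 0 < eps /\ 0 < k /\ 0 <= C /\
   (forall s, Rabs s < eps -> is_derive (fun s => fst (g (c s))) s (d1 s) /\ is_derive (fun s => snd (g (c s))) s (d2 s)) /\
   (forall s t, Rabs s < eps -> Rabs t < eps ->
      Rabs (d1 s - d1 t) <= C * cr (s - t) /\ Rabs (d2 s - d2 t) <= C * cr (s - t)) /\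
   (forall s, Rabs s < eps -> k * cr s <= Rabs (d2 s - d2 0) + C * Rabs s) /\
   (forall s, 0 < Rabs s < eps -> nplus (Xp lam) N (c s) /\ ~ aplus (Xp lam) N (c s)).
Proof.
  intros hc.
  destruct (local_boundary N _ (proj1 hN) hbd0) as [al0 [be0 [dal0 [dbe0 [rho0 [hle0 [ht0 _]]]]]]].
  destruct (local_boundary N _ (proj1 hN) hbd1) as [al1 [be1 [dal1 [dbe1 [rho1 [hle1 [ht1 _]]]]]]].
  assert (hcr0 := cross_neg_of _ _ _ _ _ _ hle0 ht0 ingoing_not_nminus).
  assert (hcr1 := cross_pos_of _ _ _ _ _ _ hle1 ht1 outgoing_not_nplus).
  destruct (section_curve_data al0 be0 dal0 dbe0 rho0 c hle0 hcr0 hc)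
    as [e [d [Mc [he [hd [hMc [hcd [hcbl [c10 [c20 [nz [hc2 [hsgn [hc1 hcbd]]]]]]]]]]]]]].
  set (c1 := fun s => fst (c s)) in *. set (c2 := fun s => snd (c s)) in *.
  destruct positive_rr_interval as [rs [r0 [hrs [hr0 hR]]]].
  (* Both axis ends are at distance at least 2 b from 0, so with rho <= b the two sections stay in
     |x| >= b. *)
  set (b := Rmin x0 (- x1) / 2).
  assert (hb0 := Rmin_l x0 (- x1)). assert (hb1 := Rmin_r x0 (- x1)).
  assert (hb : 0 < b). { unfold b. assert (0 < Rmin x0 (- x1)) by (apply Rmin_glb_lt; lra). lra. }
  assert (hbx : 2 * b <= x0 /\ 2 * b <= - x1) by (unfold b; lra).
  destruct (cross_near _ _ _ _ _ _ hle0 (proj1 hbd0) ltac:(lra)) as [rA [hrA HA]].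
  destruct (cross_near _ _ _ _ _ _ hle1 (proj1 hbd1) ltac:(lra)) as [rB [hrB HB]].
  simpl in HA, HB.
  assert (hHA : forall q, Rabs (fst q - x0) <= rA -> Rabs (snd q) <= rA -> cross dal0 dbe0 q < 0).
  { intros q q1 q2. exact (pos_prod_neg _ _ (HA q q1 ltac:(now rewrite Rminus_0_r)) hcr0). }
  assert (hHB : forall q, Rabs (fst q - x1) <= rB -> Rabs (snd q) <= rB -> 0 < cross dal1 dbe1 q).
  { intros q q1 q2. exact (pos_prod_pos _ _ (HB q q1 ltac:(now rewrite Rminus_0_r)) hcr1). }
  assert (hl1' : x1 - rs < 0) by lra. assert (hr1' : 0 < x0 + rs) by lra.
  destruct (bl_FF_away lam (x1 - rs) (x0 + rs) r0 b hl1' hr1' hr0 hR hb) as [MF [hMF [_ HMF]]].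
  assert (bl1 := le_dal _ _ _ _ _ _ _ hle1). assert (bl2 := le_dbe _ _ _ _ _ _ _ hle1). simpl in bl1, bl2.
  destruct bl1 as [Md [hMd [Bd Ld]]]. destruct bl2 as [Mb [hMb [Bb Lb]]].
  set (a := Rabs (dal1 x1)).
  assert (ha : 0 < a).
  { unfold a. apply Rabs_pos_lt. intros E. rewrite cross_axis, E in hcr1. lra. }
  assert (hMFb : 0 <= MF * Mb) by now apply Rmult_le_pos.
  (* The bounds secure, in turn, positivity of [rr], distance from the origin, the crossing signs at
     both ends, and a change of at most a/4 each for dal1 and for the term with [FF]; these last two
     leave a/2 in [hD]. *)
  set (rho := Rmin (Rmin rs b) (Rmin (Rmin rA rB) (Rmin (a / (4 * (Md + 1))) (a / (4 * (MF * Mb + 1)))))).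
  assert (q1 : 0 < a / (4 * (Md + 1))) by (apply Rdiv_lt_0_compat; lra).
  assert (q2 : 0 < a / (4 * (MF * Mb + 1))) by (apply Rdiv_lt_0_compat; lra).
  assert (hrho : 0 < rho) by (repeat apply Rmin_glb_lt; lra).
  assert (n1 : rho <= Rmin rs b) by apply Rmin_l.
  assert (n2 : rho <= Rmin (Rmin rA rB) (Rmin (a / (4 * (Md + 1))) (a / (4 * (MF * Mb + 1))))) by apply Rmin_r.
  assert (n3 := Rmin_l rs b). assert (n4 := Rmin_r rs b).
  assert (n5 := Rmin_l (Rmin rA rB) (Rmin (a / (4 * (Md + 1))) (a / (4 * (MF * Mb + 1))))).
  assert (n6 := Rmin_r (Rmin rA rB) (Rmin (a / (4 * (Md + 1))) (a / (4 * (MF * Mb + 1))))).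
  assert (n7 := Rmin_l rA rB). assert (n8 := Rmin_r rA rB).
  assert (n9 := Rmin_l (a / (4 * (Md + 1))) (a / (4 * (MF * Mb + 1)))).
  assert (n10 := Rmin_r (a / (4 * (Md + 1))) (a / (4 * (MF * Mb + 1)))).
  set (xl := x1 - rho). set (xr := x0 + rho).
  assert (hl : xl < 0) by (unfold xl; lra). assert (hr : 0 < xr) by (unfold xr; lra).
  assert (hR' : forall x, xl <= x <= xr -> r0 <= rr lam x) by (intros x hx; apply hR; unfold xl, xr in hx; lra).
  assert (hx1' : xl <= x1 - rho /\ x1 + rho <= - b) by (unfold xl; lra).
  assert (hMdr : Md * rho <= a / 4).
  { apply Rle_trans with ((Md + 1) * (a / (4 * (Md + 1)))); [|right; field; lra]. apply Rmult_le_compat; lra. }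
  assert (hMFr : MF * Mb * rho <= a / 4).
  { apply Rle_trans with ((MF * Mb + 1) * (a / (4 * (MF * Mb + 1)))); [|right; field; lra]. apply Rmult_le_compat; lra. }
  assert (hD : forall x x' y y', Rabs (x - x1) <= rho -> Rabs (x' - x1) <= rho ->
     Rabs y <= rho -> Rabs y' <= rho -> a / 2 <= Rabs (dal1 x + FF lam x' y' * dbe1 y)).
  { intros x x' y y' h1 h2 h3 h4.
    assert (A1 : Rabs (dal1 x - dal1 x1) <= a / 4).
    { eapply Rle_trans; [apply Ld|]; [lra|rewrite Rminus_diag, Rabs_R0; lra|].
      eapply Rle_trans; [|exact hMdr]. apply Rmult_le_compat_l; auto. }
    assert (A2 : Rabs (FF lam x' y') <= MF * rho).
    { assert (h2' := h2). apply Rabs_le_between in h2'.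
      assert (w1 : away (x1 - rs) (x0 + rs) b (x', y')).
      { split; [|split]; simpl; [lra|rewrite Rabs_left1; lra|lra]. }
      assert (w2 : away (x1 - rs) (x0 + rs) b (x', 0)).
      { split; [|split]; simpl; [lra|rewrite Rabs_left1; lra|rewrite Rabs_R0; lra]. }
      assert (w3 := HMF _ _ w1 w2). simpl in w3. rewrite FF_0, Rminus_0_r in w3.
      unfold dist1 in w3; simpl in w3. rewrite Rminus_diag, Rabs_R0, Rplus_0_l, Rminus_0_r in w3.
      eapply Rle_trans; [exact w3|]. apply Rmult_le_compat_l; auto. }
    assert (A3 : Rabs (FF lam x' y' * dbe1 y) <= a / 4).
    { rewrite Rabs_mult. eapply Rle_trans; [|exact hMFr].
      replace (MF * Mb * rho) with (MF * rho * Mb) by ring. apply Rmult_le_compat; auto using Rabs_pos.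
      apply Bb. rewrite Rminus_0_r. lra. }
    generalize (Rabs_triang_inv (dal1 x1) (dal1 x1 - (dal1 x + FF lam x' y' * dbe1 y))).
    replace (dal1 x1 - (dal1 x1 - (dal1 x + FF lam x' y' * dbe1 y))) with (dal1 x + FF lam x' y' * dbe1 y) by ring.
    fold a.
    assert (Rabs (dal1 x1 - (dal1 x + FF lam x' y' * dbe1 y)) <= a / 4 + a / 4).
    { replace (dal1 x1 - (dal1 x + FF lam x' y' * dbe1 y)) with (- (dal1 x - dal1 x1) + - (FF lam x' y' * dbe1 y)) by ring.
      eapply Rle_trans; [apply Rabs_triang|]. rewrite !Rabs_Ropp. lra. }
    lra. }
  destruct (tube_in_N rho hrho) as [r2 [hr2 Htube]].
  set (r2' := Rmin r2 rho). assert (hr2' : 0 < r2') by now apply Rmin_glb_lt.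
  assert (n11 : r2' <= r2) by apply Rmin_l. assert (n12 : r2' <= rho) by apply Rmin_r.
  assert (sec0 := le_0 _ _ _ _ _ _ _ hle1). simpl in sec0.
  (* The defining function at the axis point beyond the exit. It is positive because the outgoing
     crossing makes al1 decrease in x; [g3] below is the height up to which be1 changes it by at
     most half. *)
  set (gam := al1 (x1 - rho) + be1 0).
  assert (hgam : 0 < gam).
  { assert (h : - al1 (x1 - rho) < - al1 x1).
    { apply (deriv_pos_lt (fun x => - al1 x) (fun x => - dal1 x)); [lra|]. intros x hx. split.
      - apply (is_derive_opp al1). apply (le_al _ _ _ _ _ _ _ hle1). simpl. apply Rabs_le; lra.
      - assert (h := hHB (x, 0)). simpl in h. rewrite Rabs_R0 in h.
        specialize (h ltac:(apply Rabs_le; lra) ltac:(lra)).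
        rewrite cross_axis in h.
        assert (hrx := hR x ltac:(lra)). assert (0 < x ^ 2) by (rewrite <- pow2_abs; apply pow_lt, Rabs_pos_lt; lra).
        assert (0 < rr lam x * x ^ 2) by (apply Rmult_lt_0_compat; lra).
        apply (pos_prod_pos _ (rr lam x * x ^ 2)); lra. }
    unfold gam. lra. }
  set (g3 := Rmin rho (gam / (2 * (Mb + 1)))).
  assert (hg3q : 0 < gam / (2 * (Mb + 1))) by (apply Rdiv_lt_0_compat; lra).
  assert (hg3 : 0 < g3) by now apply Rmin_glb_lt.
  assert (n13 : g3 <= rho) by apply Rmin_l. assert (n14 : g3 <= gam / (2 * (Mb + 1))) by apply Rmin_r.
  assert (hbeyond : forall y, Rabs y <= g3 -> 0 < al1 (x1 - rho) + be1 y).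
  { intros y hy.
    assert (A : Rabs (be1 y - be1 0) <= Mb * Rabs (y - 0)).
    { apply (deriv_lip be1 dbe1). intros z hz.
      assert (Rabs z <= rho1). { generalize (interval_0 y z hz). lra. }
      split; [apply (le_be _ _ _ _ _ _ _ hle1)|apply Bb]; simpl; rewrite Rminus_0_r; auto. }
    rewrite Rminus_0_r in A.
    assert (A2 : Mb * Rabs y <= gam / 2).
    { apply Rle_trans with ((Mb + 1) * (gam / (2 * (Mb + 1)))); [|right; field; lra].
      apply Rmult_le_compat; try lra. apply Rabs_pos. }
    generalize (Rle_abs (- (be1 y - be1 0))). rewrite Rabs_Ropp. unfold gam in *. lra. }
  destruct (graph_HH lam xl xr r0 hl hr hr0 hR') as [C0 [hC0 HC0]].
  set (eta := Rmin r2' g3). assert (heta : 0 < eta) by now apply Rmin_glb_lt.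
  assert (n15 : eta <= r2') by apply Rmin_l. assert (n16 : eta <= g3) by apply Rmin_r.
  set (Q := C0 * (3 * d * (xr ^ 2 + 1))).
  assert (hQ : 0 <= Q). { unfold Q. generalize (pow2_ge_0 xr). intros. apply Rmult_le_pos; [lra|apply Rmult_le_pos; lra]. }
  (* Small enough for the entry point to stay within rho of the axis end and, through |Y 0|^3 <= Q
     |s|, for the intercept to be below eta. *)
  set (eps := Rmin (Rmin (1 / 2) e) (Rmin (Rmin (rho / (2 * (Mc + 1))) (rho / (6 * (d + 1)))) (eta ^ 3 / (2 * (Q + 1))))).
  assert (he3 : 0 < eta ^ 3) by now apply pow_lt.
  assert (heps : 0 < eps).
  { repeat apply Rmin_glb_lt; try lra; apply Rdiv_lt_0_compat; lra. }
  assert (k1 : eps <= Rmin (1 / 2) e) by apply Rmin_l.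
  assert (k2 : eps <= Rmin (Rmin (rho / (2 * (Mc + 1))) (rho / (6 * (d + 1)))) (eta ^ 3 / (2 * (Q + 1)))) by apply Rmin_r.
  assert (k3 := Rmin_l (1 / 2) e). assert (k4 := Rmin_r (1 / 2) e).
  assert (k5 := Rmin_l (Rmin (rho / (2 * (Mc + 1))) (rho / (6 * (d + 1)))) (eta ^ 3 / (2 * (Q + 1)))).
  assert (k6 := Rmin_r (Rmin (rho / (2 * (Mc + 1))) (rho / (6 * (d + 1)))) (eta ^ 3 / (2 * (Q + 1)))).
  assert (k7 := Rmin_l (rho / (2 * (Mc + 1))) (rho / (6 * (d + 1)))).
  assert (k8 := Rmin_r (rho / (2 * (Mc + 1))) (rho / (6 * (d + 1)))).
  assert (hee : forall s, Rabs s < eps -> Rabs s < e) by (intros; lra).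
  assert (hs1 : forall s, Rabs s < eps -> Rabs (c1 s - x0) < rho).
  { intros s hs. eapply Rle_lt_trans; [apply hc1; auto|].
    apply Rle_lt_trans with ((Mc + 1) * (rho / (2 * (Mc + 1)))).
    - apply Rmult_le_compat; try lra. apply Rabs_pos.
    - replace ((Mc + 1) * (rho / (2 * (Mc + 1)))) with (rho / 2) by (field; lra). lra. }
  assert (hs2 : forall s, Rabs s < eps -> Rabs (c2 s) < rho).
  { intros s hs. eapply Rle_lt_trans; [apply (hc2 s (hee s hs))|].
    apply Rle_lt_trans with (3 * (d + 1) * (rho / (6 * (d + 1)))).
    - apply Rmult_le_compat; try lra. apply Rabs_pos.
    - replace (3 * (d + 1) * (rho / (6 * (d + 1)))) with (rho / 2) by (field; lra). lra. }
  assert (hcx : forall s, Rabs s < eps -> b <= c1 s <= xr /\ Rabs (c2 s) <= 1).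
  { intros s hs. assert (h1 := hs1 s hs). assert (h2 := hs2 s hs). apply Rabs_def2 in h1. unfold xr. lra. }
  assert (nz2 : forall s, 0 < Rabs s < eps -> c2 s <> 0).
  { intros s hs E. destruct (hc2 s (hee s (proj2 hs))) as [h _]. change (snd (c s)) with (c2 s) in h.
    rewrite E, Rabs_R0 in h. assert (0 < d * Rabs s) by (apply Rmult_lt_0_compat; lra). lra. }
  assert (hnp : forall s, 0 < Rabs s < eps -> nplus (Xp lam) N (c s) /\ ~ aplus (Xp lam) N (c s) /\
     al0 (c1 s) + be0 (c2 s) = 0).
  { intros s hs. assert (h1 := hs1 s (proj2 hs)). assert (h2 := hs2 s (proj2 hs)).
    assert (hb' := hcbd s (hee s (proj2 hs))).
    assert (E : al0 (c1 s) + be0 (c2 s) = 0).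
    { apply (boundary_eq (x0, 0) al0 be0 dal0 dbe0 rho0 (c s) hle0); simpl; auto; fold (c1 s) (c2 s); [lra|rewrite Rminus_0_r; lra]. }
    split; [|split; auto].
    - apply (nplus_of_cross (x0, 0) al0 be0 dal0 dbe0 rho0 hle0 (c s)); auto; simpl; fold (c1 s) (c2 s).
      + lra.
      + rewrite Rminus_0_r; lra.
      + apply hHA; fold (c1 s) (c2 s); lra.
    - intros hap. apply (nz2 s hs). unfold c2. now rewrite (aplus_unique (c s) hap). }
  set (f1 := fun s => fst (g (c s))). set (f2 := fun s => snd (g (c s))).
  (* The statement is made total in s so that the graph and its primitive can be chosen as functions
     of s; outside the range a dummy pair is returned. *)
  assert (Hall : forall s, exists YK : (R -> R) * (R -> R), 0 < Rabs s < eps ->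
     graph lam xl xr (fst YK) /\ fst YK (c1 s) = c2 s /\ fst YK (f1 s) = f2 s /\
     Rabs (f1 s - x1) <= rho /\ Rabs (fst YK 0) <= rho /\ al1 (f1 s) + be1 (f2 s) = 0 /\
     (forall x, xl <= x <= xr -> is_derive (snd YK) x (kk lam x (fst YK x)))).
  { intros s. destruct (classic (0 < Rabs s < eps)) as [hs|hs]; [|exists (fun _ => 0, fun _ => 0); tauto].
    assert (h1 := hs1 s (proj2 hs)). assert (h2 := hs2 s (proj2 hs)). destruct (hnp s hs) as [p1 [p2 p3]].
    assert (h1' := h1). apply Rabs_def2 in h1'.
    assert (rc : xl <= c1 s <= xr) by (unfold xl, xr; lra).
    destruct (graph_exists lam xl xr r0 hl hr hr0 hR' (c1 s) (c2 s) rc (nz2 s hs)) as [Y [gY eY]].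
    assert (aY : Rabs (Y 0) < eta).
    { assert (A := HC0 Y 0 (c1 s) gY ltac:(lra) rc). rewrite HH_0, eY in A.
      assert (U : Rabs (HH (c1 s) (c2 s)) <= 3 * d * Rabs s * (xr ^ 2 + 1)).
      { unfold HH. rewrite Rabs_mult. apply Rmult_le_compat; try apply Rabs_pos.
        - apply (hc2 s (hee s (proj2 hs))).
        - rewrite Rabs_pos_eq by (generalize (pow2_ge_0 (c1 s)) (pow2_ge_0 (c2 s)); lra).
          destruct (hcx s (proj2 hs)) as [u1 u2]. rewrite <- (pow2_abs (c2 s)).
          assert (c1 s ^ 2 <= xr ^ 2) by (apply pow_incr; lra).
          assert (Rabs (c2 s) ^ 2 <= 1 ^ 2) by (apply pow_incr; split; [apply Rabs_pos|auto]). lra. }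
      assert (A2 : Rabs (Y 0) ^ 3 <= eta ^ 3 / 2).
      { eapply Rle_trans; [exact A|]. apply Rle_trans with (Q * Rabs s).
        - replace (Q * Rabs s) with (C0 * (3 * d * Rabs s * (xr ^ 2 + 1))) by (unfold Q; ring).
          apply Rmult_le_compat_l; lra.
        - apply Rle_trans with ((Q + 1) * (eta ^ 3 / (2 * (Q + 1)))); [|right; field; lra].
          apply Rmult_le_compat; lra. }
      apply Rnot_le_lt. intros hh. assert (eta ^ 3 <= Rabs (Y 0) ^ 3) by (apply pow_incr; lra). lra. }
    destruct (exit_on_graph al0 be0 dal0 dbe0 al1 be1 dal1 dbe1 rho0 rho1 rho r0 r2' g3 hle0 hle1) with (P := c s) (Y := Y)
      as [q [hq [hq1 [hq2 hq3]]]]; auto; try lra.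
    { intros q u1 u2. apply hHA; lra. }
    { intros q u1 u2. apply hHB; lra. }
    { intros x y hx hy. apply Htube; lra. }
    assert (E := hg1 (c s) q p1 p2 hq).
    destruct (kk_primitive lam xl xr r0 hl hr hr0 hR' Y gY) as [K hK].
    exists (Y, K). intros _. simpl. unfold f1, f2. rewrite E.
    split; [auto|split; [auto|split; [auto|split; [auto|split; [lra|split; auto]]]]]. }
  set (Yf := fun s => fst (proj1_sig (constructive_indefinite_description _ (Hall s)))).
  set (Kf := fun s => snd (proj1_sig (constructive_indefinite_description _ (Hall s)))).
  assert (hY : forall s, 0 < Rabs s < eps ->
     graph lam xl xr (Yf s) /\ Yf s (c1 s) = c2 s /\ Yf s (f1 s) = f2 s /\
     Rabs (f1 s - x1) <= rho /\ Rabs (Yf s 0) <= rho /\ al1 (f1 s) + be1 (f2 s) = 0 /\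
     (forall x, xl <= x <= xr -> is_derive (Kf s) x (kk lam x (Yf s x)))).
  { intros s. exact (proj2_sig (constructive_indefinite_description _ (Hall s))). }
  clearbody Yf Kf. clear Hall.
  assert (hdcs : bounded_lip (fun s => Rabs s < eps) (fun s t => Rabs (s - t)) (Derive c1) /\
    bounded_lip (fun s => Rabs s < eps) (fun s t => Rabs (s - t)) (Derive c2)).
  { split; [apply (bl_subset (fun s => Rabs s < e) _ _ _ hee (proj1 hcbl))|apply (bl_subset (fun s => Rabs s < e) _ _ _ hee (proj2 hcbl))]. }
  assert (hf0 : f1 0 = x1 /\ f2 0 = 0).
  { assert (E : c 0 = (x0, 0)) by (exact (proj1 (proj1 hc))).
    unfold f1, f2. rewrite E, hg0. auto. }
  assert (HT := transition_regularity lam xl xr r0 b rho x1 eps (a / 2) d (3 * d) c1 c2 (Derive c1) (Derive c2)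
    al1 be1 dal1 dbe1 f1 f2 Yf Kf hl hr hr0 hR' hb ltac:(lra) ltac:(lra) hd ltac:(lra) hx1'
    (fun s hs => hcd s (hee s hs)) hdcs hcx (fun s hs => hc2 s (hee s hs))).
  destruct HT as [T1 [[C1 [hC1 [_ T2]]] [[C2 [hC2 [_ T3]]] [k [C [hk [hC T4]]]]]]]; auto.
  { intros x hx. apply (le_al _ _ _ _ _ _ _ hle1). simpl. lra. }
  { intros y hy. apply (le_be _ _ _ _ _ _ _ hle1). simpl. rewrite Rminus_0_r. lra. }
  { apply (bl_subset (fun x => Rabs (x - x1) <= rho1)); [intros; lra|]. now exists Md. }
  { apply (bl_subset (fun y => Rabs (y - 0) <= rho1)); [intros y hy; rewrite Rminus_0_r; lra|]. now exists Mb. }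
  { lra. }
  { intros s t hs ht. apply (hsgn s t); auto. }
  exists eps. eexists. eexists. exists (C1 + C2 + C), k. split; [auto|split; [auto|split; [lra|split; [exact T1|split; [|split]]]]].
  - intros s t hs ht. generalize (T2 s t hs ht) (T3 s t hs ht) (cr_pos (s - t)). intros u1 u2 u3.
    split.
    + eapply Rle_trans; [exact u1|]. apply Rmult_le_compat_r; lra.
    + eapply Rle_trans; [exact u2|]. apply Rmult_le_compat_r; lra.
  - intros s hs. eapply Rle_trans; [now apply T4|]. apply Rplus_le_compat_l.
    apply Rmult_le_compat_r; [apply Rabs_pos|lra].
  - intros s hs. destruct (hnp s hs) as [u1 [u2 _]]. auto.
Qed.
End Regularity.
End AxisEnds.
End BlockFlow.

(** * Hoelder classes *)

Lemma Int_part_4_3 : Int_part (4 / 3) = 1%Z.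
Proof. symmetry. apply Int_part_spec. simpl. lra. Qed.

Lemma frac_part_4_3 : frac_part (4 / 3) = 1 / 3.
Proof. unfold frac_part. rewrite Int_part_4_3. simpl. lra. Qed.

Section Classes.
Variables (f d : R -> R) (eps C : R).
Hypothesis heps : 0 < eps.
Hypothesis hC : 0 <= C.
Hypothesis hd : forall s, Rabs s < eps -> is_derive f s (d s).

Lemma Derive_n_1 s : Rabs s < eps -> Derive_n f 1 s = d s.
Proof. intros hs. apply is_derive_unique. now apply hd. Qed.

Lemma class_4_3_of_holder :
  (forall s t, Rabs s < eps -> Rabs t < eps -> Rabs (d s - d t) <= C * cr (s - t)) -> C_class (4 / 3) f 0.
Proof.
  intros h. unfold C_class. rewrite Int_part_4_3, frac_part_4_3.
  exists eps, C. split; [auto|split].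
  - intros j y hj hy. rewrite Rminus_0_r in hy. change (Z.to_nat 1) with 1%nat in hj.
    destruct j as [|[|j]]; [exact I| |lia]. exists (d y). now apply hd.
  - intros y z hy hz. rewrite Rminus_0_r in hy, hz. change (Z.to_nat 1) with 1%nat.
    rewrite !Derive_n_1 by auto. destruct (Req_dec y z) as [e|e].
    + subst. rewrite Rminus_diag, Rabs_R0. apply Rmult_le_pos; auto. left; apply exp_pos.
    + rewrite <- cr_nz by lra. now apply h.
Qed.

Variable k : R.
Hypothesis hk : 0 < k.
Hypothesis hlow : forall s, Rabs s < eps -> k * cr s <= Rabs (d s - d 0) + C * Rabs s.

(** Dividing k s^(1/3) <= M s^th + C s by s^(1/3) leaves positive powers of s on the right, which
    tend to 0. *)
Lemma not_power_bound th e M : 1 / 3 < th -> 0 < e ->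
  (forall s, 0 < s < e -> Rabs (d s - d 0) <= M * Rpower s th) -> False.
Proof.
  intros hth he H.
  set (M' := Rabs M + C + 1). assert (pM := Rabs_pos M).
  assert (hM' : 0 < M') by (unfold M'; lra).
  (* Both powers s^(th - 1/3) and s^(2/3) will be at most de, so the right-hand side is at most
     k/4. *)
  set (de := k / (4 * M')). assert (hde : 0 < de) by (apply Rdiv_lt_0_compat; lra).
  set (al := th - 1 / 3). assert (hal : 0 < al) by (unfold al; lra).
  set (s := Rmin (Rmin (e / 2) (eps / 2)) (Rmin (Rpower de (/ al)) (Rpower de (/ (2 / 3))))).
  assert (hs : 0 < s).
  { repeat apply Rmin_glb_lt; try lra; apply exp_pos. }
  assert (s1 : s <= Rmin (e / 2) (eps / 2)) by apply Rmin_l.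
  assert (s2 : s <= Rmin (Rpower de (/ al)) (Rpower de (/ (2 / 3)))) by apply Rmin_r.
  assert (s3 := Rmin_l (e / 2) (eps / 2)). assert (s4 := Rmin_r (e / 2) (eps / 2)).
  assert (s5 := Rmin_l (Rpower de (/ al)) (Rpower de (/ (2 / 3)))). assert (s6 := Rmin_r (Rpower de (/ al)) (Rpower de (/ (2 / 3)))).
  assert (P1 : Rpower s al <= de).
  { apply Rle_trans with (Rpower (Rpower de (/ al)) al); [apply Rle_Rpower_l; lra|].
    rewrite Rpower_mult, Rinv_l, Rpower_1 by lra. lra. }
  assert (P2 : Rpower s (2 / 3) <= de).
  { apply Rle_trans with (Rpower (Rpower de (/ (2 / 3))) (2 / 3)); [apply Rle_Rpower_l; lra|].
    rewrite Rpower_mult, Rinv_l, Rpower_1 by lra. lra. }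
  assert (A := hlow s ltac:(rewrite Rabs_pos_eq; lra)). rewrite (Rabs_pos_eq s) in A by lra.
  assert (B := H s ltac:(lra)).
  assert (E : cr s = Rpower s (1 / 3)) by (rewrite cr_nz, Rabs_pos_eq by lra; auto).
  assert (E1 : Rpower s th = Rpower s (1 / 3) * Rpower s al).
  { rewrite <- Rpower_plus. f_equal. unfold al. ring. }
  assert (E2 : s = Rpower s (1 / 3) * Rpower s (2 / 3)).
  { rewrite <- Rpower_plus. replace (1 / 3 + 2 / 3) with 1 by field. now rewrite Rpower_1. }
  rewrite E in A. rewrite E1 in B. rewrite E2 in A at 3.
  assert (pc : 0 < Rpower s (1 / 3)) by apply exp_pos.
  assert (p1 : 0 < Rpower s al) by apply exp_pos. assert (p2 : 0 < Rpower s (2 / 3)) by apply exp_pos.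
  revert A B P1 P2 pc p1 p2. generalize (Rpower s (1 / 3)) (Rpower s al) (Rpower s (2 / 3)) (Rabs (d s - d 0)).
  intros c u v w A B P1 P2 pc p1 p2.
  assert (B2 : M * (c * u) <= Rabs M * (c * de)).
  { apply Rle_trans with (Rabs M * (c * u)).
    - apply Rmult_le_compat_r; [nra|apply Rle_abs].
    - apply Rmult_le_compat_l; auto. apply Rmult_le_compat_l; lra. }
  assert (B3 : C * (c * v) <= C * (c * de)).
  { apply Rmult_le_compat_l; auto. apply Rmult_le_compat_l; lra. }
  assert (B4 : k * c <= (Rabs M + C) * de * c) by lra.
  assert (B5 : k <= (Rabs M + C) * de) by (apply (Rmult_le_reg_r c); auto).
  assert (B6 : (Rabs M + C) * de <= M' * de) by (apply Rmult_le_compat_r; unfold M'; lra).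
  replace (M' * de) with (k / 4) in B6 by (unfold de; field; lra). lra.
Qed.

(** If the integer part of a is 1, the class bounds the increment of d at 0 by a power a - 1 > 1/3.
    If it is larger, d is differentiable at 0 and the increment is even O(s). Both contradict
    [not_power_bound]. *)
Lemma not_class_above_4_3 a : 4 / 3 < a -> ~ C_class a f 0.
Proof.
  intros ha [e [M [he [h1 h2]]]].
  assert (hI : (1 <= Int_part a)%Z).
  { destruct (base_Int_part a) as [u v]. assert (IZR (Int_part a) > 0) by lra.
    apply lt_IZR in H. lia. }
  assert (hm : 0 < Rmin e eps) by now apply Rmin_glb_lt.
  assert (m1 := Rmin_l e eps). assert (m2 := Rmin_r e eps).
  destruct (Z.eq_dec (Int_part a) 1) as [E|E].
  - unfold frac_part in h2. rewrite E in h2. change (Z.to_nat 1) with 1%nat in h2.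
    apply (not_power_bound (a - 1) (Rmin e eps) M); auto; [lra|]. intros s hs.
    rewrite <- !Derive_n_1 by (try rewrite Rabs_R0; try rewrite Rabs_pos_eq; lra).
    generalize (h2 s 0). rewrite !Rminus_0_r, Rabs_R0, (Rabs_pos_eq s) by lra. intros h. apply h; lra.
  - assert (D : ex_derive (Derive_n f 1) 0).
    { apply (h1 2%nat 0); [lia|]. now rewrite Rminus_diag, Rabs_R0. }
    destruct D as [l D]. apply is_derive_Reals in D. destruct (D 1 Rlt_0_1) as [r Hr].
    assert (hr := cond_pos r).
    apply (not_power_bound 1 (Rmin r eps) (Rabs l + 1)); [lra|now apply Rmin_glb_lt|].
    intros s hs. assert (n1 := Rmin_l r eps). assert (n2 := Rmin_r r eps).
    specialize (Hr s ltac:(lra) ltac:(rewrite Rabs_pos_eq; lra)). rewrite Rplus_0_l in Hr.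
    rewrite !Derive_n_1 in Hr by (try rewrite Rabs_R0; try rewrite Rabs_pos_eq; lra).
    rewrite Rpower_1 by lra.
    replace (d s - d 0) with (((d s - d 0) / s - l) * s + l * s) by (field; lra).
    eapply Rle_trans; [apply Rabs_triang|]. rewrite !Rabs_mult, (Rabs_pos_eq s) by lra.
    rewrite Rmult_plus_distr_r, Rplus_comm. apply Rplus_le_compat_l. apply Rmult_le_compat_r; lra.
Qed.
End Classes.

Lemma class_4_3_cont f : C_class (4 / 3) f 0 -> continuous f 0.
Proof.
  unfold C_class. rewrite Int_part_4_3, frac_part_4_3. intros [e [M [he [h1 _]]]].
  apply (@ex_derive_continuous R_AbsRing R_NormedModule).
  apply (h1 1%nat 0); [change (Z.to_nat 1) with 1%nat; lia|]. now rewrite Rminus_diag, Rabs_R0.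
Qed.

Lemma cont_eq_of_punctured (f h : R -> R) e : 0 < e -> continuous f 0 -> continuous h 0 ->
  (forall s, 0 < Rabs s < e -> f s = h s) -> f 0 = h 0.
Proof.
  intros he hf hh E. apply NNPP. intros hne.
  assert (p : 0 < Rabs (f 0 - h 0) / 2) by (assert (0 < Rabs (f 0 - h 0)) by (apply Rabs_pos_lt; lra); lra).
  destruct (proj1 (continuous_eps f 0) hf _ p) as [d1 [hd1 H1]].
  destruct (proj1 (continuous_eps h 0) hh _ p) as [d2 [hd2 H2]].
  set (s := Rmin (Rmin d1 d2) e / 2).
  assert (hm : 0 < Rmin (Rmin d1 d2) e) by (repeat apply Rmin_glb_lt; auto).
  assert (m1 := Rmin_l (Rmin d1 d2) e). assert (m2 := Rmin_r (Rmin d1 d2) e).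
  assert (m3 := Rmin_l d1 d2). assert (m4 := Rmin_r d1 d2).
  assert (hs : Rabs s = s) by (apply Rabs_pos_eq; unfold s; lra).
  specialize (H1 s ltac:(rewrite Rminus_0_r, hs; unfold s; lra)).
  specialize (H2 s ltac:(rewrite Rminus_0_r, hs; unfold s; lra)).
  rewrite (E s) in H1 by (rewrite hs; unfold s; lra).
  generalize (Rabs_triang (h s - h 0) (- (h s - f 0))). rewrite Rabs_Ropp.
  replace (h s - h 0 + - (h s - f 0)) with (f 0 - h 0) by ring. lra.
Qed.

(** g is chosen as the exit point off a^+ and as the outgoing axis end at the single point of a^+.
    Any other extension of the class agrees with it off a^+, since exit points are unique, and at
    that point by continuity along one parametrisation. *)
Lemma block_map_of_isolating_block lam N : lam <> 0 ->
  isolating_block (Xp lam) (fun p => p = origin) N ->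
  exists g : plane -> plane, is_block_map (Xp lam) N (4 / 3) g /\
    forall a : R, 4 / 3 < a -> ~ class_at_aplus (Xp lam) N a g.
Proof.
  intros hlam hN.
  destruct (compact_bounded N (proj1 (proj1 hN))) as [B [hB hNB]].
  destruct (complete_flow_exists lam (B + 1) ltac:(lra)) as [Phi [hPhi0 hPhi]].
  destruct (axis_end lam B N hNB hN 1) as [x0 [hx0 [ha0 [hb0 hmax]]]]; [rewrite Rabs_R1; auto|].
  destruct (axis_end lam B N hNB hN (-1)) as [y1 [hy1 [ha1 [hb1 _]]]]; [rewrite Rabs_left; lra|].
  rewrite Rmult_1_l in hb0. set (x1 := -1 * y1) in *.
  assert (hx1 : x1 < 0) by (unfold x1; lra).
  assert (hseg : forall x, x1 <= x <= x0 -> N (x, 0) /\ 0 < rr lam x).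
  { intros x hx. destruct (Rle_or_lt 0 x) as [h|h].
    - rewrite <- (Rmult_1_l x). apply ha0. lra.
    - replace x with (-1 * - x) by ring. apply ha1. unfold x1 in hx. lra. }
  set (p0 := (x0, 0) : plane). set (q1 := (x1, 0) : plane).
  assert (hp0 : aplus (Xp lam) N p0) by (apply (ingoing_aplus lam B N Phi hB hNB hPhi0 hPhi hN x0 x1); auto).
  assert (hq1 : nminus (Xp lam) N q1) by (apply (outgoing_nminus lam B N Phi hB hNB hPhi0 hPhi hN x0 x1); auto).
  assert (huniq : forall p, aplus (Xp lam) N p -> p = p0).
  { intros p. apply (aplus_unique lam B N Phi hB hNB hPhi0 hPhi hN x0 x1); auto. }
  assert (Hg : forall p, exists q, (aplus (Xp lam) N p -> q = q1) /\
     (nplus (Xp lam) N p -> ~ aplus (Xp lam) N p -> exit_point (Xp lam) N p q /\ nminus (Xp lam) N q)).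
  { intros p. destruct (classic (aplus (Xp lam) N p)) as [h|h]; [exists q1; tauto|].
    destruct (classic (nplus (Xp lam) N p)) as [h'|h']; [|exists q1; tauto].
    destruct (exit_exists lam B N Phi hB hNB hPhi0 hPhi hN p h' h) as [q hq]. exists q. tauto. }
  set (g := fun p => proj1_sig (constructive_indefinite_description _ (Hg p))).
  assert (hg : forall p, (aplus (Xp lam) N p -> g p = q1) /\
     (nplus (Xp lam) N p -> ~ aplus (Xp lam) N p -> exit_point (Xp lam) N p (g p) /\ nminus (Xp lam) N (g p))).
  { intros p. exact (proj2_sig (constructive_indefinite_description _ (Hg p))). }
  clearbody g. clear Hg.
  assert (hg0 : g p0 = q1) by now apply hg.
  assert (hg1 : forall p q, nplus (Xp lam) N p -> ~ aplus (Xp lam) N p -> exit_point (Xp lam) N p q -> g p = q).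
  { intros p q h1 h2 h3. apply (exit_point_unique lam N p); auto. now apply hg. }
  assert (reg := block_map_regularity lam B N Phi hB hNB hPhi0 hPhi hN x0 x1 hx0 hx1 hseg hb0 hb1 hmax g hg0 hg1 hlam).
  destruct (local_boundary N p0 (proj1 hN) hb0) as [_ [_ [_ [_ [_ [_ [_ [c hc]]]]]]]].
  assert (hext : extends_pi (Xp lam) N g).
  { split.
    - intros p hp. destruct (classic (aplus (Xp lam) N p)) as [h|h].
      + now rewrite (proj1 (hg p) h).
      + now apply hg.
    - intros p h1 h2. now apply hg. }
  assert (hcl : class_at_aplus (Xp lam) N (4 / 3) g).
  { intros p c' hp hc'. rewrite (huniq p hp) in hc'.
    destruct (reg c' hc') as [eps [d1 [d2 [C [k [he [hk [hC [D [L [_ _]]]]]]]]]]].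
    split.
    - apply (class_4_3_of_holder _ d1 eps C); auto; [intros s hs; apply (D s hs)|intros s t hs ht; apply (L s t hs ht)].
    - apply (class_4_3_of_holder _ d2 eps C); auto; [intros s hs; apply (D s hs)|intros s t hs ht; apply (L s t hs ht)]. }
  exists g. split; [split; [auto|split; [auto|]]|].
  - intros g' [_ hext'] hcl' p hp.
    destruct (classic (aplus (Xp lam) N p)) as [h|h].
    + rewrite (huniq p h). destruct (reg c hc) as [eps [d1 [d2 [C [k [he [hk [hC [_ [_ [_ Hn]]]]]]]]]]].
      destruct (hcl p0 c hp0 hc) as [u1 u2]. destruct (hcl' p0 c hp0 hc) as [v1 v2].
      assert (E : forall s, 0 < Rabs s < eps -> g' (c s) = g (c s)).
      { intros s hs. destruct (Hn s hs) as [w1 w2]. symmetry. apply hg1; auto. }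
      assert (c0 : c 0 = p0) by (exact (proj1 (proj1 hc))).
      rewrite <- c0. rewrite (surjective_pairing (g' (c 0))), (surjective_pairing (g (c 0))). f_equal.
      * apply (cont_eq_of_punctured (fun s => fst (g' (c s))) (fun s => fst (g (c s))) eps); auto using class_4_3_cont.
        intros s hs. now rewrite E.
      * apply (cont_eq_of_punctured (fun s => snd (g' (c s))) (fun s => snd (g (c s))) eps); auto using class_4_3_cont.
        intros s hs. now rewrite E.
    + symmetry. apply hg1; auto.
  - intros a ha hcla. destruct (reg c hc) as [eps [d1 [d2 [C [k [he [hk [hC [D [_ [Lo _]]]]]]]]]]].
    destruct (hcla p0 c hp0 hc) as [_ h2]. revert h2.
    apply (not_class_above_4_3 _ d2 eps C he hC (fun s hs => proj2 (D s hs)) k hk Lo a ha).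
Qed.

(** * Small discs are isolating blocks *)

(** A gauge on the bounding square does the work: at points of N the radius fits into a member of
    the cover, elsewhere into the complement of N. [compactness_list] then gives finitely many
    centres. *)
Lemma closed_bounded_compact (N : plane -> Prop) B : (exists p, N p) ->
  (forall p, ~ N p -> locally p (fun q => ~ N q)) -> (forall p, N p -> in_box B p) -> compact_set N.
Proof.
  intros [p0 hp0] hcl hbox F hF hcov.
  (* Centres outside N also need a member of the family attached to them; any will do. *)
  destruct (hcov p0 hp0) as [U0 [hU0 _]].
  assert (H : forall t : R * (R * unit), exists dU : posreal * (plane -> Prop), F (snd dU) /\
     forall q : plane, Rabs (fst q - fst t) < fst dU -> Rabs (snd q - fst (snd t)) < fst dU -> N q -> snd dU q).
  { intros [x [y u]]. destruct (classic (N (x, y))) as [h|h].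
    - destruct (hcov _ h) as [U [hU hUp]]. assert (hl := hF U hU (x, y) hUp). apply locally_plane in hl.
      destruct hl as [e [he He]]. exists (mkposreal e he, U). split; [exact hU|]. intros q q1 q2 _. now apply He.
    - assert (hl := hcl _ h). apply locally_plane in hl. destruct hl as [e [he He]].
      exists (mkposreal e he, U0). split; auto. intros q q1 q2 hq. exfalso. apply (He q); auto. }
  set (dU := fun t => proj1_sig (constructive_indefinite_description _ (H t))).
  assert (HdU : forall t, F (snd (dU t)) /\
     forall q : plane, Rabs (fst q - fst t) < fst (dU t) -> Rabs (snd q - fst (snd t)) < fst (dU t) -> N q -> snd (dU t) q).
  { intros t. exact (proj2_sig (constructive_indefinite_description _ (H t))). }
  apply NNPP. intros hno.
  apply (compactness_list 2 (- B, (- B, tt)) (B, (B, tt)) (fun t => fst (dU t))). intros [l hl]. apply hno.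
  exists (map (fun t => snd (dU t)) l). split.
  - intros U hU. apply in_map_iff in hU. destruct hU as [t [<- _]]. apply HdU.
  - intros q hq. destruct (hbox q hq) as [b1 b2].
    destruct (hl (fst q, (snd q, tt))) as [t [ht [_ hc]]].
    { split; [exact b1|split; [exact b2|exact I]]. }
    exists (snd (dU t)). split; [apply in_map_iff; now exists t|].
    destruct t as [x [y u]]. destruct hc as [c1 [c2 _]]. now apply HdU.
Qed.

(** Iterated derivatives stay in a class closed under differentiation, so no formula for them is
    needed. The class is closed only near x, hence the local comparison with the n-th derivative. *)
Lemma smooth_of_derivative_closed (P : (R -> R) -> Prop) (x r : R) : 0 < r ->
  (forall f, P f -> exists g, P g /\ forall y, Rabs (y - x) < r -> is_derive f y (g y)) ->
  forall f, P f -> smooth_at f x.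
Proof.
  intros hr HP.
  assert (K : forall n f, P f -> exists g, P g /\ forall y, Rabs (y - x) < r -> Derive_n f n y = g y).
  { induction n as [|n IH]; intros f hf; [exists f; auto|].
    destruct (IH f hf) as [g [hg Hg]]. destruct (HP g hg) as [h [hh Hh]]. exists h. split; auto.
    intros y hy. simpl. rewrite (Derive_ext_loc _ g); [now apply is_derive_unique, Hh|].
    apply locally_R. exists (r - Rabs (y - x)). split; [lra|]. intros z hz. apply Hg.
    replace (z - x) with ((z - y) + (y - x)) by ring. eapply Rle_lt_trans; [apply Rabs_triang|lra]. }
  intros f hf. apply locally_R. exists r. split; auto. intros y hy [|n]; [exact I|].
  destruct (K n f hf) as [g [hg Hg]]. destruct (HP g hg) as [h [_ Hh]].
  apply (ex_derive_ext_loc g).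
  - apply locally_R. exists (r - Rabs (y - x)). split; [lra|]. intros z hz. symmetry. apply Hg.
    replace (z - x) with ((z - y) + (y - x)) by ring. eapply Rle_lt_trans; [apply Rabs_triang|lra].
  - exists (h y). now apply Hh.
Qed.

(** A derivative-closed algebra containing the function whose graph is the half-circle; the inverse
    root is added because differentiation produces it. *)
Inductive root_expr (r : R) : (R -> R) -> Prop :=
| re_const c : root_expr r (fun _ => c)
| re_var : root_expr r (fun x => x)
| re_root : root_expr r (fun x => sqrt (r ^ 2 - x ^ 2))
| re_inv : root_expr r (fun x => / sqrt (r ^ 2 - x ^ 2))
| re_plus f g : root_expr r f -> root_expr r g -> root_expr r (fun x => f x + g x)
| re_mult f g : root_expr r f -> root_expr r g -> root_expr r (fun x => f x * g x).

Lemma root_expr_derive r f : root_expr r f ->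
  exists g, root_expr r g /\ forall y, Rabs y < r -> is_derive f y (g y).
Proof.
  assert (hp : forall y, Rabs y < r -> 0 < r ^ 2 - y ^ 2).
  { intros y hy. rewrite <- (pow2_abs y). generalize (Rabs_pos y). simpl. nra. }
  induction 1 as [c| | | |f g _ [f' [hf Hf]] _ [g' [hg Hg]]|f g hf0 [f' [hf Hf]] hg0 [g' [hg Hg]]].
  - exists (fun _ => 0). split; [constructor|]. intros y _. apply (is_derive_const c).
  - exists (fun _ => 1). split; [constructor|]. intros y _. apply (is_derive_id y).
  - exists (fun x => -1 * (x * / sqrt (r ^ 2 - x ^ 2))). split; [repeat constructor|]. intros y hy.
    assert (h := hp y hy). auto_derive; [simpl in *; lra|].
    change (r * (r * 1) + - (y * (y * 1))) with (r ^ 2 - y ^ 2). field. apply Rgt_not_eq, sqrt_lt_R0. exact h.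
  - exists (fun x => x * (/ sqrt (r ^ 2 - x ^ 2) * (/ sqrt (r ^ 2 - x ^ 2) * / sqrt (r ^ 2 - x ^ 2)))).
    split; [repeat constructor|]. intros y hy.
    assert (h := hp y hy). assert (h' := sqrt_lt_R0 _ h). auto_derive.
    + simpl in *. split; [lra|split; [apply Rgt_not_eq; exact h'|exact I]].
    + change (r * (r * 1) + - (y * (y * 1))) with (r ^ 2 - y ^ 2). field. apply Rgt_not_eq. exact h'.
  - exists (fun x => f' x + g' x). split; [now constructor|]. intros y hy.
    exact (is_derive_plus _ _ _ _ _ (Hf y hy) (Hg y hy)).
  - exists (fun x => f' x * g x + f x * g' x). split; [repeat constructor; auto|]. intros y hy.
    exact (is_derive_mult f g y _ _ (Hf y hy) (Hg y hy) Rmult_comm).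
Qed.

Lemma smooth_root r c x : Rabs x < r -> smooth_at (fun x => c * sqrt (r ^ 2 - x ^ 2)) x.
Proof.
  intros hx. apply (smooth_of_derivative_closed (root_expr r) x (r - Rabs x)); [lra| |repeat constructor].
  intros f hf. destruct (root_expr_derive r f hf) as [g [hg Hg]]. exists g. split; auto. intros y hy. apply Hg.
  replace y with ((y - x) + x) by ring. eapply Rle_lt_trans; [apply Rabs_triang|lra].
Qed.

Definition QQ (p : plane) : R := fst p ^ 2 + snd p ^ 2.
Definition disc (r : R) (p : plane) : Prop := QQ p <= r ^ 2.

Lemma QQ_eps p e : 0 < e -> exists d, 0 < d /\ forall q, Rabs (fst q - fst p) < d -> Rabs (snd q - snd p) < d ->
  Rabs (QQ q - QQ p) < e.
Proof.
  intros he. destruct p as [x y]. simpl.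
  set (M := 2 * Rabs x + 2 * Rabs y + 2).
  assert (hx := Rabs_pos x). assert (hy := Rabs_pos y). assert (hM : 0 < M) by (unfold M; lra).
  exists (Rmin 1 (e / M)). split; [apply Rmin_glb_lt; [lra|now apply Rdiv_lt_0_compat]|].
  intros [u v]; simpl. intros h1 h2. set (d := Rmin 1 (e / M)) in *.
  assert (d1 : d <= 1) by apply Rmin_l. assert (d2 : d <= e / M) by apply Rmin_r.
  assert (hdM : d * M <= e).
  { apply Rle_trans with (e / M * M); [apply Rmult_le_compat_r; lra|right; field; lra]. }
  unfold QQ; simpl fst; simpl snd.
  replace (u ^ 2 + v ^ 2 - (x ^ 2 + y ^ 2)) with ((u - x) * ((u - x) + 2 * x) + (v - y) * ((v - y) + 2 * y)) by ring.
  eapply Rle_lt_trans; [apply Rabs_triang|]. rewrite !Rabs_mult.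
  assert (A1 : Rabs (u - x + 2 * x) <= 1 + 2 * Rabs x).
  { eapply Rle_trans; [apply Rabs_triang|]. rewrite Rabs_mult, (Rabs_pos_eq 2); lra. }
  assert (A2 : Rabs (v - y + 2 * y) <= 1 + 2 * Rabs y).
  { eapply Rle_trans; [apply Rabs_triang|]. rewrite Rabs_mult, (Rabs_pos_eq 2); lra. }
  assert (B1 : Rabs (u - x) * Rabs (u - x + 2 * x) <= Rabs (u - x) * (1 + 2 * Rabs x)).
  { apply Rmult_le_compat_l; [apply Rabs_pos|auto]. }
  assert (B2 : Rabs (v - y) * Rabs (v - y + 2 * y) <= Rabs (v - y) * (1 + 2 * Rabs y)).
  { apply Rmult_le_compat_l; [apply Rabs_pos|auto]. }
  assert (B3 : Rabs (u - x) * (1 + 2 * Rabs x) < d * (1 + 2 * Rabs x)) by (apply Rmult_lt_compat_r; lra).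
  assert (B4 : Rabs (v - y) * (1 + 2 * Rabs y) < d * (1 + 2 * Rabs y)) by (apply Rmult_lt_compat_r; lra).
  unfold M in hdM. lra.
Qed.

Lemma disc_interior r p : QQ p < r ^ 2 -> locally p (disc r).
Proof.
  intros h. destruct (QQ_eps p (r ^ 2 - QQ p) ltac:(lra)) as [d [hd Hd]]. apply locally_plane. exists d.
  split; auto. intros q h1 h2. specialize (Hd q h1 h2). apply Rabs_def2 in Hd. unfold disc. lra.
Qed.

Lemma disc_closed r p : ~ disc r p -> locally p (fun q => ~ disc r q).
Proof.
  intros h. unfold disc in h. destruct (QQ_eps p (QQ p - r ^ 2) ltac:(lra)) as [d [hd Hd]]. apply locally_plane. exists d.
  split; auto. intros q h1 h2. specialize (Hd q h1 h2). apply Rabs_def2 in Hd. unfold disc. lra.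
Qed.

Lemma disc_coord r p : 0 <= r -> disc r p -> Rabs (fst p) <= r /\ Rabs (snd p) <= r.
Proof.
  intros hr h. unfold disc, QQ in h. generalize (pow2_ge_0 (fst p)) (pow2_ge_0 (snd p)). intros.
  rewrite <- (Rabs_pos_eq r hr). split; apply Rsqr_le_abs_0; rewrite !Rsqr_pow2; lra.
Qed.

Lemma disc_smooth_boundary r p : 0 < r -> QQ p = r ^ 2 -> smooth_boundary_at (disc r) p.
Proof.
  intros hr hp.
  assert (K : forall b : bool, snd (flip b p) <> 0 -> smooth_boundary_at (disc r) p).
  { intros b hv. set (u := fst (flip b p)) in *. set (v := snd (flip b p)) in *.
    assert (huv : u ^ 2 + v ^ 2 = r ^ 2). { rewrite <- hp. unfold u, v, QQ. destruct b; simpl; ring. }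
    (* The sign of the nonzero coordinate: it selects the half-circle and also the side of it on
       which the disc lies. *)
    set (sg := v / Rabs v). assert (pv := Rabs_pos_lt _ hv).
    assert (sg2 : sg * sg = 1). { unfold sg. replace (v / Rabs v * (v / Rabs v)) with (v ^ 2 / Rabs v ^ 2) by (field; lra).
      rewrite pow2_abs. field. auto. }
    assert (sgv : sg * v = Rabs v). { unfold sg. replace (v / Rabs v * v) with (v ^ 2 / Rabs v) by (field; lra).
      rewrite <- pow2_abs. field. lra. }
    assert (v2 : 0 < v ^ 2) by (rewrite <- pow2_abs; now apply pow_lt).
    assert (hu : Rabs u < r). { rewrite <- (Rabs_pos_eq r) by lra. apply Rsqr_lt_abs_0. rewrite !Rsqr_pow2. lra. }
    exists b, (fun x => sg * sqrt (r ^ 2 - x ^ 2)), sg. split; [|split; [|split]].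
    - intros e. rewrite e in sg2. lra.
    - now apply smooth_root.
    - fold u v. replace (r ^ 2 - u ^ 2) with (v ^ 2) by lra. rewrite <- pow2_abs, sqrt_pow2 by apply Rabs_pos.
      rewrite <- sgv, <- Rmult_assoc, sg2. ring.
    - assert (hm : 0 < Rmin (r - Rabs u) (Rabs v)) by (apply Rmin_glb_lt; lra).
      assert (m1 := Rmin_l (r - Rabs u) (Rabs v)). assert (m2 := Rmin_r (r - Rabs u) (Rabs v)).
      apply locally_plane. exists (Rmin (r - Rabs u) (Rabs v)). split; auto. intros q q1 q2.
      assert (q' : Rabs (fst (flip b q) - u) < Rmin (r - Rabs u) (Rabs v) /\ Rabs (snd (flip b q) - v) < Rmin (r - Rabs u) (Rabs v)).
      { unfold u, v. destruct b; simpl; auto. }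
      assert (EQ : disc r q <-> fst (flip b q) ^ 2 + snd (flip b q) ^ 2 <= r ^ 2).
      { unfold disc, QQ. destruct b; simpl; split; lra. }
      rewrite EQ. destruct q' as [w1 w2]. set (x := fst (flip b q)) in *. set (y := snd (flip b q)) in *.
      assert (hx : Rabs x < r).
      { replace x with ((x - u) + u) by ring. eapply Rle_lt_trans; [apply Rabs_triang|lra]. }
      assert (hx2 : 0 < r ^ 2 - x ^ 2). { rewrite <- (pow2_abs x). generalize (Rabs_pos x). simpl. nra. }
      assert (asg : Rabs sg = 1). { unfold sg, Rdiv. rewrite Rabs_mult, Rabs_inv, Rabs_Rabsolu. field. lra. }
      assert (hy : 0 < sg * y).
      { replace (sg * y) with (sg * (y - v) + sg * v) by ring. rewrite sgv.
        generalize (Rle_abs (- (sg * (y - v)))). rewrite Rabs_Ropp, Rabs_mult, asg. lra. }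
      assert (y2 : y ^ 2 = (sg * y) ^ 2). { replace ((sg * y) ^ 2) with (sg * sg * y ^ 2) by ring. rewrite sg2. ring. }
      replace (sg * (y - sg * sqrt (r ^ 2 - x ^ 2))) with (sg * y - sg * sg * sqrt (r ^ 2 - x ^ 2)) by ring.
      rewrite sg2, Rmult_1_l. split; intros h.
      + assert (sg * y <= sqrt (r ^ 2 - x ^ 2)); [|lra]. rewrite <- (sqrt_pow2 (sg * y)) by lra. apply sqrt_le_1_alt. lra.
      + assert (h' : sg * y <= sqrt (r ^ 2 - x ^ 2)) by lra. rewrite y2.
        assert ((sg * y) ^ 2 <= sqrt (r ^ 2 - x ^ 2) ^ 2) by (apply pow_incr; lra).
        rewrite pow2_sqrt in H by lra. lra. }
  destruct (Req_dec (snd p) 0) as [e|e]; [|now apply (K false)].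
  apply (K true). simpl. intros e'. unfold QQ in hp. rewrite e, e' in hp. assert (0 < r ^ 2) by now apply pow_lt.
  simpl in *. lra.
Qed.

Lemma disc_smooth_domain r : 0 < r -> smooth_domain (disc r).
Proof.
  intros hr. split.
  - apply (closed_bounded_compact _ r).
    + exists origin. unfold disc, QQ, origin; simpl. nra.
    + apply disc_closed.
    + intros p hp. destruct (disc_coord r p ltac:(lra) hp). split; now apply Rabs_le_between.
  - intros p hp. destruct hp as [h|h]; [left; now apply disc_interior|right; now apply disc_smooth_boundary].
Qed.

Lemma disc_bd r p : 0 < r <= 1 -> bd (disc r) p <-> QQ p = r ^ 2.
Proof.
  intros hr. split.
  - intros [[h|h] hn]; auto. exfalso. now apply hn, disc_interior.
  - intros h. split; [right; exact h|]. intros hl. apply locally_plane in hl. destruct hl as [d [hd Hd]].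
    destruct (disc_coord r p ltac:(lra) (or_intror h)) as [a1 a2].
    set (t := d / 2). assert (ht : 0 < t) by (unfold t; lra).
    assert (A : disc r (fst p * (1 + t), snd p * (1 + t))).
    { apply Hd; simpl.
      - replace (fst p * (1 + t) - fst p) with (fst p * t) by ring. rewrite Rabs_mult, (Rabs_pos_eq t) by lra.
        unfold t in *. nra.
      - replace (snd p * (1 + t) - snd p) with (snd p * t) by ring. rewrite Rabs_mult, (Rabs_pos_eq t) by lra.
        unfold t in *. nra. }
    unfold disc, QQ in A, h. simpl fst in A; simpl snd in A.
    replace ((fst p * (1 + t)) ^ 2 + (snd p * (1 + t)) ^ 2) with ((fst p ^ 2 + snd p ^ 2) * (1 + t) ^ 2) in A by ring.
    rewrite h in A. assert (0 < r ^ 2) by (apply pow_lt; lra). assert (1 < (1 + t) ^ 2) by (simpl; nra). nra.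
Qed.

(** * Crossing of the circle and invariant sets in the disc *)

Section Disc.
Variables (lam r : R) (Phi : plane -> R -> plane).
Hypothesis hr : 0 < r <= 1.
Hypothesis hrr : forall x, Rabs x <= 2 * r -> 1 / 6 <= rr lam x.
Hypothesis hPhi0 : forall p, Phi p 0 = p.
Hypothesis hPhi : forall p t, solves_at (Xc lam (1 + 1)) (Phi p) t.

Lemma disc_box p : disc r p -> in_box 1 p.
Proof.
  intros h. destruct (disc_coord r p ltac:(lra) h) as [a b].
  apply Rabs_le_between in a. apply Rabs_le_between in b. split; lra.
Qed.

(** The derivative of x^2 + y^2 along the field is -(2/3) x GG. As GG > 0 near the circle, the sign
    of x alone separates entry from exit. *)
Definition GG (p : plane) : R := 3 * rr lam (fst p) * fst p ^ 2 + snd p ^ 2.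

Lemma QQ_derive u t : solves_at (Xp lam) u t ->
  is_derive (fun s => QQ (u s)) t (- (2 / 3) * fst (u t) * GG (u t)).
Proof.
  intros [d1 d2]. unfold QQ.
  assert (e : forall (f : R -> R) l, is_derive f t l -> is_derive (fun s => f s ^ 2) t (2 * f t * l)).
  { intros f l h. auto_derive; [side_derive|]. derive_rw h. ring. }
  replace (- (2 / 3) * fst (u t) * GG (u t)) with
    (2 * fst (u t) * fst (Xp lam (u t)) + 2 * snd (u t) * snd (Xp lam (u t))).
  - exact (is_derive_plus _ _ _ _ _ (e _ _ d1) (e _ _ d2)).
  - unfold GG, rr, Xp. destruct (u t) as [x y]; simpl. field.
Qed.

Lemma near_circle p : QQ p = r ^ 2 -> exists e, 0 < e /\ forall t, Rabs t < e ->
  inner 1 (Phi p t) /\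
  is_derive (fun t => fst (Phi p t)) t (- AA lam (fst (Phi p t)) (snd (Phi p t))) /\
  0 < AA lam (fst (Phi p t)) (snd (Phi p t)) /\
  is_derive (fun t => QQ (Phi p t)) t (- (2 / 3) * fst (Phi p t) * GG (Phi p t)) /\ 0 < GG (Phi p t).
Proof.
  intros hp. assert (hd : disc r p) by (right; auto).
  destruct (Phi_near lam 1 (disc r) Phi disc_box hPhi0 hPhi p hd) as [e1 [he1 H1]].
  (* A move of less than r/2 in each coordinate keeps |x| <= 2 r and cannot reach the origin from
     the circle. *)
  destruct (Phi_eps lam 1 Phi hPhi p 0 (r / 2) ltac:(lra)) as [e2 [he2 H2]].
  exists (Rmin e1 e2). split; [now apply Rmin_glb_lt|]. intros t ht.
  assert (ht1 := Rlt_le_trans _ _ _ ht (Rmin_l _ _)). assert (ht2 := Rlt_le_trans _ _ _ ht (Rmin_r _ _)).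
  assert (hin := H1 t ht1). destruct (H2 t) as [a1 a2]; [now rewrite Rminus_0_r|]. rewrite hPhi0 in a1, a2.
  destruct (disc_coord r p ltac:(lra) hd) as [b1 b2].
  assert (hs := Phi_solves lam 1 Phi hPhi p t hin).
  set (x := fst (Phi p t)) in *. set (y := snd (Phi p t)) in *.
  assert (hx : Rabs x <= 2 * r).
  { replace x with ((x - fst p) + fst p) by ring. eapply Rle_trans; [apply Rabs_triang|lra]. }
  assert (hR := hrr x hx).
  assert (nz : 0 < x ^ 2 + y ^ 2).
  { destruct (Req_dec x 0) as [ex|ex]; [|generalize (pow2_ge_0 y); assert (0 < x ^ 2) by (rewrite <- pow2_abs; apply pow_lt, Rabs_pos_lt; auto); lra].
    destruct (Req_dec y 0) as [ey|ey]; [|generalize (pow2_ge_0 x); assert (0 < y ^ 2) by (rewrite <- pow2_abs; apply pow_lt, Rabs_pos_lt; auto); lra].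
    exfalso. rewrite ex, Rminus_0_l, Rabs_Ropp in a1. rewrite ey, Rminus_0_l, Rabs_Ropp in a2.
    unfold QQ in hp. rewrite <- (pow2_abs (fst p)), <- (pow2_abs (snd p)) in hp.
    assert (Rabs (fst p) ^ 2 <= (r / 2) ^ 2) by (apply pow_incr; split; [apply Rabs_pos|lra]).
    assert (Rabs (snd p) ^ 2 <= (r / 2) ^ 2) by (apply pow_incr; split; [apply Rabs_pos|lra]).
    assert (0 < r ^ 2) by (apply pow_lt; lra). replace ((r / 2) ^ 2) with (r ^ 2 / 4) in * by field. lra. }
  split; [exact hin|split; [|split; [|split]]].
  - destruct hs as [d1 _]. rewrite Xp_fst in d1. exact d1.
  - unfold AA. generalize (pow2_ge_0 x) (pow2_ge_0 y). nra.
  - now apply QQ_derive.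
  - unfold GG. fold x y. generalize (pow2_ge_0 x) (pow2_ge_0 y). nra.
Qed.

Lemma disc_nplus_of p : QQ p = r ^ 2 -> 0 <= fst p -> nplus (Xp lam) (disc r) p.
Proof.
  intros hp hx. split; [now apply disc_bd|]. destruct (near_circle p hp) as [e [he H]].
  exists e. split; auto. intros s q hs hf.
  assert (hin : forall t, Rabs t < e -> inner 1 (Phi p t)) by (intros t ht; now apply H).
  assert (hse : Rabs s < e) by (rewrite Rabs_left; lra).
  rewrite (Phi_flow_eq lam 1 Phi hPhi0 hPhi p s q (inner_path 1 Phi p e s hin hse) hf).
  assert (xp : forall t, - e < t < 0 -> 0 < fst (Phi p t)).
  { intros t ht. assert (h : - fst (Phi p t) < - fst (Phi p 0)).
    { apply (deriv_pos_lt (fun t => - fst (Phi p t)) (fun t => - - AA lam (fst (Phi p t)) (snd (Phi p t)))); [lra|].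
      intros z hz. destruct (H z) as [_ [d1 [d2 _]]]; [apply Rabs_def1; lra|]. split; [exact (is_derive_opp _ _ _ d1)|lra]. }
    rewrite hPhi0 in h. lra. }
  (* When x = 0 at time 0 the derivative of QQ vanishes there. Strictness is therefore taken from
     [s, s/2] and only monotonicity from [s/2, 0]. *)
  assert (A1 : - QQ (Phi p s) < - QQ (Phi p (s / 2))).
  { apply (deriv_pos_lt (fun t => - QQ (Phi p t)) (fun t => - (- (2 / 3) * fst (Phi p t) * GG (Phi p t)))); [lra|].
    intros z hz. destruct (H z) as [_ [_ [_ [d1 d2]]]]; [apply Rabs_def1; lra|]. split; [exact (is_derive_opp _ _ _ d1)|].
    assert (0 < fst (Phi p z) * GG (Phi p z)) by (apply Rmult_lt_0_compat; auto; apply xp; lra). lra. }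
  assert (A2 : - QQ (Phi p (s / 2)) <= - QQ (Phi p 0)).
  { apply (deriv_nonneg_le (fun t => - QQ (Phi p t)) (fun t => - (- (2 / 3) * fst (Phi p t) * GG (Phi p t)))); [lra|].
    intros z hz. destruct (H z) as [_ [_ [_ [d1 d2]]]]; [apply Rabs_def1; lra|]. split; [exact (is_derive_opp _ _ _ d1)|].
    assert (0 <= fst (Phi p z) * GG (Phi p z)); [|lra]. apply Rmult_le_pos; [|lra].
    destruct (proj2 hz) as [h|h]; [left; apply xp; lra|rewrite h, hPhi0; auto]. }
  rewrite hPhi0, hp in A2. unfold disc. lra.
Qed.

Lemma disc_nminus_of p : QQ p = r ^ 2 -> fst p <= 0 -> nminus (Xp lam) (disc r) p.
Proof.
  intros hp hx. split; [now apply disc_bd|]. destruct (near_circle p hp) as [e [he H]].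
  exists e. split; auto. intros s q hs hf.
  assert (hin : forall t, Rabs t < e -> inner 1 (Phi p t)) by (intros t ht; now apply H).
  assert (hse : Rabs s < e) by (rewrite Rabs_pos_eq; lra).
  rewrite (Phi_flow_eq lam 1 Phi hPhi0 hPhi p s q (inner_path 1 Phi p e s hin hse) hf).
  assert (xn : forall t, 0 < t < e -> fst (Phi p t) < 0).
  { intros t ht. assert (h : - fst (Phi p 0) < - fst (Phi p t)).
    { apply (deriv_pos_lt (fun t => - fst (Phi p t)) (fun t => - - AA lam (fst (Phi p t)) (snd (Phi p t)))); [lra|].
      intros z hz. destruct (H z) as [_ [d1 [d2 _]]]; [apply Rabs_def1; lra|]. split; [exact (is_derive_opp _ _ _ d1)|lra]. }
    rewrite hPhi0 in h. lra. }
  assert (A1 : QQ (Phi p (s / 2)) < QQ (Phi p s)).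
  { apply (deriv_pos_lt (fun t => QQ (Phi p t)) (fun t => - (2 / 3) * fst (Phi p t) * GG (Phi p t))); [lra|].
    intros z hz. destruct (H z) as [_ [_ [_ [d1 d2]]]]; [apply Rabs_def1; lra|]. split; [exact d1|].
    assert (0 < - fst (Phi p z) * GG (Phi p z)); [|lra]. apply Rmult_lt_0_compat; auto. generalize (xn z ltac:(lra)). lra. }
  assert (A2 : QQ (Phi p 0) <= QQ (Phi p (s / 2))).
  { apply (deriv_nonneg_le (fun t => QQ (Phi p t)) (fun t => - (2 / 3) * fst (Phi p t) * GG (Phi p t))); [lra|].
    intros z hz. destruct (H z) as [_ [_ [_ [d1 d2]]]]; [apply Rabs_def1; lra|]. split; [exact d1|].
    assert (0 <= - fst (Phi p z) * GG (Phi p z)); [|lra]. apply Rmult_le_pos; [|lra].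
    destruct (proj1 hz) as [h|h]; [generalize (xn z ltac:(lra)); lra|rewrite <- h, hPhi0; lra]. }
  rewrite hPhi0, hp in A2. unfold disc. lra.
Qed.

Lemma disc_not_nplus p : QQ p = r ^ 2 -> fst p < 0 -> ~ nplus (Xp lam) (disc r) p.
Proof.
  intros hp hx. destruct (near_circle p hp) as [e [he H]].
  destruct (H 0) as [_ [_ [_ [d1 d2]]]]; [rewrite Rabs_R0; auto|].
  destruct (deriv_pos_local _ _ _ d1) as [e' [he' [_ K]]].
  { rewrite hPhi0 in *. assert (0 < - fst p * GG p) by (apply Rmult_lt_0_compat; lra). lra. }
  apply (not_nplus_of_backward lam 1 (disc r) Phi disc_box hPhi0 hPhi p e'); auto; [right; auto|].
  intros t ht. specialize (K t ltac:(lra)). rewrite hPhi0, hp in K. left. exact K.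
Qed.

Lemma disc_not_nminus p : QQ p = r ^ 2 -> 0 < fst p -> ~ nminus (Xp lam) (disc r) p.
Proof.
  intros hp hx. destruct (near_circle p hp) as [e [he H]].
  destruct (H 0) as [_ [_ [_ [d1 d2]]]]; [rewrite Rabs_R0; auto|].
  destruct (deriv_neg_local _ _ _ d1) as [e' [he' [K _]]].
  { rewrite hPhi0 in *. assert (0 < fst p * GG p) by (apply Rmult_lt_0_compat; lra). lra. }
  apply (not_nminus_of_forward lam 1 (disc r) Phi disc_box hPhi0 hPhi p e'); auto; [right; auto|].
  intros t ht. specialize (K t ltac:(lra)). rewrite hPhi0, hp in K. left. exact K.
Qed.

Lemma disc_nplus_nminus p : nplus (Xp lam) (disc r) p /\ nminus (Xp lam) (disc r) p <-> QQ p = r ^ 2 /\ fst p = 0.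
Proof.
  split.
  - intros [h1 h2]. assert (hp : QQ p = r ^ 2) by (apply disc_bd; auto; apply h1). split; auto.
    destruct (Rtotal_order (fst p) 0) as [h|[h|h]]; auto; exfalso.
    + now apply (disc_not_nplus p).
    + now apply (disc_not_nminus p).
  - intros [hp hx]. split; [apply disc_nplus_of|apply disc_nminus_of]; auto; lra.
Qed.

(** A boundary curve with velocity X satisfies the equation of the flow at its base point, so the
    derivative of QQ there is both 0 and -(2/3) x GG. Conversely, at x = 0 the point is in both n^+
    and n^-, which excludes either sign of [cross]. *)
Lemma disc_tau p : tau (Xp lam) (disc r) p <-> QQ p = r ^ 2 /\ fst p = 0.
Proof.
  split.
  - intros [hb [c [[hc0 [hs1 [hs2 hloc]]] hv]]].
    assert (hp : QQ p = r ^ 2) by (now apply disc_bd). split; auto.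
    destruct (smooth_C11 _ _ hs1) as [r1 [hr1 [D1 _]]]. destruct (smooth_C11 _ _ hs2) as [r2 [hr2 [D2 _]]].
    assert (d1 := D1 0 ltac:(rewrite Rminus_diag, Rabs_R0; lra)). assert (d2 := D2 0 ltac:(rewrite Rminus_diag, Rabs_R0; lra)).
    unfold velocity0 in hv.
    assert (hsv : solves_at (Xp lam) c 0).
    { split; rewrite hc0, <- hv; simpl; auto. }
    assert (dq := QQ_derive c 0 hsv).
    assert (dq' : is_derive (fun s => QQ (c s)) 0 0).
    { apply (is_derive_ext_loc (fun _ => r ^ 2)); [|apply (is_derive_const (r ^ 2))].
      apply locally_R in hloc. destruct hloc as [e [he He]]. apply locally_R. exists e. split; auto.
      intros y hy. symmetry. apply disc_bd; auto. }
    apply is_derive_unique in dq. apply is_derive_unique in dq'. rewrite dq in dq'. rewrite hc0 in dq'.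
    destruct (near_circle p hp) as [e [he H]]. destruct (H 0) as [_ [_ [_ [_ g]]]]; [rewrite Rabs_R0; auto|].
    rewrite hPhi0 in g. destruct (Req_dec (fst p) 0) as [h|h]; auto. exfalso.
    assert (fst p * GG p <> 0) by (apply Rmult_integral_contrapositive_currified; lra). lra.
  - intros [hp hx]. assert (hb : bd (disc r) p) by (now apply disc_bd).
    destruct (local_boundary (disc r) p (disc_smooth_domain r (proj1 hr)) hb) as [al [be [dal [dbe [rho [hle [ht _]]]]]]].
    apply ht. fold (cross lam dal dbe p).
    assert (hrho := le_rho _ _ _ _ _ _ _ hle). assert (h0 := le_0 _ _ _ _ _ _ _ hle).
    assert (z1 : Rabs (fst p - fst p) < rho) by (rewrite Rminus_diag, Rabs_R0; auto).
    assert (z2 : Rabs (snd p - snd p) < rho) by (rewrite Rminus_diag, Rabs_R0; auto).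
    destruct (proj2 (disc_nplus_nminus p) (conj hp hx)) as [n1 n2].
    destruct (Rtotal_order (cross lam dal dbe p) 0) as [h|[h|h]]; auto; exfalso.
    + now apply (nplus_of_cross lam 1 (disc r) Phi disc_box hPhi0 hPhi p al be dal dbe rho hle p z1 z2 h0 h).
    + now apply (nminus_of_cross lam 1 (disc r) Phi disc_box hPhi0 hPhi p al be dal dbe rho hle p z1 z2 h0 h).
Qed.

Lemma disc_drift v a b m : a <= b -> 0 <= m ->
  (forall s, a <= s <= b -> solves_at (Xp lam) v s /\ disc r (v s) /\ m <= fst (v s) ^ 2) ->
  fst (v b) + m / 6 * b <= fst (v a) + m / 6 * a.
Proof.
  intros hab hm H. assert (h : - (fst (v a) + m / 6 * a) <= - (fst (v b) + m / 6 * b)); [|lra].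
  apply (deriv_nonneg_le (fun s => - (fst (v s) + m / 6 * s)) (fun s => - (fst (Xp lam (v s)) + m / 6)) a b hab).
  intros s hs. destruct (H s hs) as [[d1 _] [hd hms]]. split.
  - apply (is_derive_opp (fun s => fst (v s) + m / 6 * s)).
    apply (is_derive_plus (fun s => fst (v s)) (fun s => m / 6 * s)); auto. auto_derive; auto; ring.
  - rewrite Xp_fst. destruct (disc_coord r (v s) ltac:(lra) hd) as [h1 _].
    assert (hR := hrr (fst (v s)) ltac:(lra)). unfold AA. generalize (pow2_ge_0 (snd (v s))) (pow2_ge_0 (fst (v s))). nra.
Qed.

(** In the disc x' <= - x^2 / 6. From x < 0 the orbit therefore drifts out of the disc forward in
    time, from x > 0 backward, and from the punctured y-axis it moves at once into x < 0. Only the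
    origin is left. *)
Lemma disc_maximal_invariant : maximal_invariant_in (Xp lam) (disc r) (fun p => p = origin).
Proof.
  split; [|split].
  - intros p ->. unfold disc, QQ, origin; simpl. nra.
  - intros p -> t. exists origin. split; auto. apply const_flow, Xp_origin.
  - intros S hS hinv.
    assert (path : forall p t v, S p -> v 0 = p -> (forall s, Rmin 0 t <= s <= Rmax 0 t -> solves_at (Xp lam) v s) ->
      forall s, Rmin 0 t <= s <= Rmax 0 t -> S (v s)).
    { intros p t v hp v0 hv s hs. destruct (hinv p hp s) as [q [hf hq]].
      rewrite <- (flow_unique_along lam v p s q hf v0); auto. intros z hz. apply hv.
      revert hs hz. unfold Rmin, Rmax. repeat destruct Rle_dec; lra. }
    assert (neg : forall p, S p -> ~ fst p < 0).
    { intros p hp hx. set (m := fst p ^ 2). assert (hm : 0 < m) by (unfold m; simpl; nra).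
      (* At speed m/6 the time 12 r / m covers 2 r, the width of the disc; the extra unit makes the
         excess strict. *)
      set (T := 12 * r / m + 1). assert (hT : 0 <= 12 * r / m) by (apply Rdiv_le_0_compat; lra).
      destruct (hinv p hp T) as [q [[v [v0 [vT hv]]] hq]]. assert (hpath := path p T v hp v0 hv).
      rewrite Rmin_left, Rmax_right in * by (unfold T; lra).
      assert (mono : forall s, 0 <= s <= T -> fst (v s) <= fst p).
      { intros s hs. assert (A := disc_drift v 0 s 0 (proj1 hs) (Rle_refl 0)). rewrite v0 in A.
        assert (A' : fst (v s) + 0 / 6 * s <= fst p + 0 / 6 * 0).
        { apply A. intros z hz. split; [apply hv; lra|split; [apply hS, hpath; lra|apply pow2_ge_0]]. } lra. }
      assert (A := disc_drift v 0 T m ltac:(unfold T; lra) ltac:(lra)). rewrite v0 in A.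
      assert (A' : fst (v T) + m / 6 * T <= fst p + m / 6 * 0).
      { apply A. intros z hz. split; [apply hv; lra|split; [apply hS, hpath; lra|]].
        generalize (mono z hz). unfold m. simpl. nra. }
      replace (m / 6 * T) with (2 * r + m / 6) in A' by (unfold T; field; lra).
      destruct (disc_coord r (v T) ltac:(lra)) as [h1 _]; [apply hS, hpath; unfold T; lra|].
      destruct (disc_coord r p ltac:(lra) (hS p hp)) as [h2 _].
      apply Rabs_le_between in h1. apply Rabs_le_between in h2. lra. }
    assert (pos : forall p, S p -> ~ 0 < fst p).
    { intros p hp hx. set (m := fst p ^ 2). assert (hm : 0 < m) by (unfold m; simpl; nra).
      set (T := 12 * r / m + 1). assert (hT : 0 <= 12 * r / m) by (apply Rdiv_le_0_compat; lra).
      destruct (hinv p hp (- T)) as [q [[v [v0 [vT hv]]] hq]]. assert (hpath := path p (- T) v hp v0 hv).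
      rewrite Rmin_right, Rmax_left in * by (unfold T; lra).
      assert (mono : forall s, - T <= s <= 0 -> fst p <= fst (v s)).
      { intros s hs. assert (A := disc_drift v s 0 0 (proj2 hs) (Rle_refl 0)). rewrite v0 in A.
        assert (A' : fst p + 0 / 6 * 0 <= fst (v s) + 0 / 6 * s).
        { apply A. intros z hz. split; [apply hv; lra|split; [apply hS, hpath; lra|apply pow2_ge_0]]. } lra. }
      assert (A := disc_drift v (- T) 0 m ltac:(unfold T; lra) ltac:(lra)). rewrite v0 in A.
      assert (A' : fst p + m / 6 * 0 <= fst (v (- T)) + m / 6 * - T).
      { apply A. intros z hz. split; [apply hv; lra|split; [apply hS, hpath; lra|]].
        generalize (mono z hz). unfold m. simpl. nra. }
      replace (m / 6 * - T) with (- (2 * r + m / 6)) in A' by (unfold T; field; lra).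
      destruct (disc_coord r (v (- T)) ltac:(lra)) as [h1 _]; [apply hS, hpath; unfold T; lra|].
      destruct (disc_coord r p ltac:(lra) (hS p hp)) as [h2 _].
      apply Rabs_le_between in h1. apply Rabs_le_between in h2. lra. }
    intros p hp. assert (x0 : fst p = 0) by (generalize (neg p hp) (pos p hp); lra).
    destruct (Req_dec (snd p) 0) as [y0|y0].
    + rewrite (surjective_pairing p), x0, y0. reflexivity.
    (* On the y-axis x' = - y^2 < 0, so the orbit enters the half-plane already excluded. *)
    + exfalso. destruct (hinv p hp 1) as [q [[v [v0 [vT hv]]] hq]]. assert (hpath := path p 1 v hp v0 hv).
      rewrite Rmin_left, Rmax_right in * by lra.
      destruct (hv 0 ltac:(lra)) as [d1 _]. rewrite v0, Xp_fst, x0 in d1. unfold AA in d1.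
      assert (hy : 0 < snd p ^ 2) by (rewrite <- pow2_abs; apply pow_lt, Rabs_pos_lt; auto).
      destruct (deriv_neg_local _ _ _ d1) as [e [he [K _]]]; [simpl in *; lra|]. rewrite v0, x0 in K.
      set (s := Rmin e 1 / 2). assert (hm : 0 < Rmin e 1) by (apply Rmin_glb_lt; lra).
      assert (m1 := Rmin_l e 1). assert (m2 := Rmin_r e 1).
      apply (neg (v s)); [apply hpath|apply K]; unfold s; lra.
Qed.

Lemma disc_isolating_block : isolating_block (Xp lam) (fun p => p = origin) (disc r).
Proof.
  split; [|split; [|split]].
  - apply disc_smooth_domain, hr.
  - apply disc_maximal_invariant.
  - intros p. now rewrite disc_nplus_nminus, disc_tau.
  (* The tangency set is the pair (0, r), (0, -r), whose points are 2 r apart; the box of size r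
     isolates each of them. *)
  - intros p hp. apply disc_tau in hp. destruct hp as [hp hx]. apply locally_plane. exists r. split; [lra|].
    intros q _ h2 hq. apply disc_tau in hq. destruct hq as [hq hqx].
    rewrite (surjective_pairing p), (surjective_pairing q), hx, hqx. f_equal.
    unfold QQ in hp, hq. rewrite hx in hp. rewrite hqx in hq.
    assert (E : (snd q - snd p) * (snd q + snd p) = 0) by (simpl in *; lra).
    apply Rmult_integral in E. destruct E as [E|E]; [lra|]. exfalso.
    replace (snd q - snd p) with (- (2 * snd p)) in h2 by lra. rewrite Rabs_Ropp, Rabs_mult, (Rabs_pos_eq 2) in h2 by lra.
    assert (A : r <= Rabs (snd p)).
    { rewrite <- (Rabs_pos_eq r) by lra. apply Rsqr_le_abs_0. rewrite !Rsqr_pow2. simpl in *; lra. }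
    lra.
Qed.
End Disc.

Theorem mainTheorem8 (lam : R) (hlam : lam <> 0) :
  (exists N : plane -> Prop,
      isolating_block (Xp lam) (fun p => p = origin) N) /\
  forall N : plane -> Prop,
    isolating_block (Xp lam) (fun p => p = origin) N ->
    exists g : plane -> plane,
      is_block_map (Xp lam) N (4 / 3) g /\
      forall a : R, (forall n : nat, a <> INR n) -> 4 / 3 < a ->
        ~ class_at_aplus (Xp lam) N a g.
Proof.
  split.
  (* For |x| <= 2 r this gives |lam x| <= 1/6, hence [rr] >= 1/3 - 1/6. *)
  - set (r := 1 / (12 * (Rabs lam + 1))). assert (pl := Rabs_pos lam).
    assert (hr0 : 0 < r) by (apply Rdiv_lt_0_compat; lra).
    assert (hrl : 12 * (Rabs lam + 1) * r = 1) by (unfold r; field; lra).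
    destruct (complete_flow_exists lam (1 + 1) ltac:(lra)) as [Phi [hPhi0 hPhi]].
    exists (disc r). apply (disc_isolating_block lam r Phi); auto.
    + split; nra.
    + intros x hx. unfold rr. assert (Rabs (lam * x) <= Rabs lam * (2 * r)).
      { rewrite Rabs_mult. apply Rmult_le_compat_l; auto. }
      generalize (Rle_abs (lam * x)). nra.
  - intros N hN. destruct (block_map_of_isolating_block lam N hlam hN) as [g [h1 h2]].
    exists g. split; [exact h1|]. intros a _ ha. now apply h2.
Qed.
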